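(* Let $\mathbb{H}_{0,h}$, $\mathbf{Q}_h$, $A_h$, $|||\cdot|||$ and $\widehat{\gamma}$ be as defined in the context. There exist a constant $C>0$ and a constant $C_J>0$, the latter depending on $\nu$, $\kappa$, the discrete inf-sup constant $\widehat{\gamma}$ and the domain $\Omega$, such that for each $(\boldsymbol{\sigma}_h,\boldsymbol{u}_h)\in\mathbb{H}_{0,h}\times\mathbf{Q}_h$ there exists $(\boldsymbol{\tau}_h,\boldsymbol{v}_h)\in\mathbb{H}_{0,h}\times\mathbf{Q}_h$ with $$|||(\boldsymbol{\tau}_h,\boldsymbol{v}_h)|||\le C\,|||(\boldsymbol{\sigma}_h,\boldsymbol{u}_h)|||\qquad\text{and}\qquad |||(\boldsymbol{\sigma}_h,\boldsymbol{u}_h)|||^2\le C_J\,A_h\bigl((\boldsymbol{\sigma}_h,\boldsymbol{u}_h),(\boldsymbol{\tau}_h,\boldsymbol{v}_h)\bigr).$$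
   Context: Let $\Omega\subset\mathbb{R}^2$ be a bounded polygonal (Lipschitz) domain and $\nu,\kappa>0$ constants. $\|\cdot\|_{0,D}$ is the $L^2(D)$ norm. For a tensor $\boldsymbol{\tau}$, $\boldsymbol{\tau}^{\mathtt{d}}:=\boldsymbol{\tau}-\frac12\mathrm{tr}(\boldsymbol{\tau})\mathbb{I}$, '':'' is the Frobenius product, $\mathbf{div}$ is the row-wise divergence. $\mathbb{H}=\mathbb{H}(\mathbf{div};\Omega)$ is the space of $2\times2$ tensor fields in $L^2$ with $\mathbf{div}\,\boldsymbol{\tau}\in L^2(\Omega)^2$, with norm $\|\boldsymbol{\tau}\|_{\mathbf{div},\Omega}^2=\|\boldsymbol{\tau}\|_{0,\Omega}^2+\|\mathbf{div}\,\boldsymbol{\tau}\|_{0,\Omega}^2$; $\mathbf{Q}=L^2(\Omega)^2$; $|||(\boldsymbol{\tau},\boldsymbol{v})|||^2:=\|\boldsymbol{\tau}\|_{\mathbf{div},\Omega}^2+\|\boldsymbol{v}\|_{0,\Omega}^2$. Meshes: $\{\mathcal{T}_h\}_{h>0}$ is a family of decompositions of $\Omega$ into non-overlapping polygons $E$ (diameter $h_E$) for which there are constants $\hat c,\eta>0$, independent of $h$, such that every edge $e\subset\partial E$ has length $h_e\ge \hat c\,h_E$ and every $E$ is star-shaped with respect to a ball of radius $\eta h_E$. Spaces: fix an integer $k\ge0$; $P_j$ denotes polynomials of degree $\le j$, with $P_{-1}=\{0\}$. For $E\in\mathcal{T}_h$, $\mathbf{W}_h^E$ is the set of $\boldsymbol{\tau}=(\tau_1,\tau_2)\in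 H(\mathrm{div};E)\cap H(\mathrm{rot};E)$ with $\boldsymbol{\tau}\cdot\boldsymbol{n}|_e\in P_k(e)$ for every edge $e\subset\partial E$, $\mathrm{div}\,\boldsymbol{\tau}\in P_k(E)$, $\mathrm{rot}\,\boldsymbol{\tau}:=\partial_{x_1}\tau_2-\partial_{x_2}\tau_1\in P_{k-1}(E)$. $\mathbb{H}_h^E$ is the set of tensor fields on $E$ both of whose rows lie in $\mathbf{W}_h^E$; $\mathbb{H}_h:=\{\boldsymbol{\tau}_h\in\mathbb{H}:\boldsymbol{\tau}_h|_E\in\mathbb{H}_h^E\ \forall E\in\mathcal{T}_h\}$; $\mathbb{H}_{0,h}:=\{\boldsymbol{\tau}_h\in\mathbb{H}_h:\int_\Omega\mathrm{tr}(\boldsymbol{\tau}_h)=0\}$; $\mathbf{Q}_h:=\{\boldsymbol{v}\in\mathbf{Q}:\boldsymbol{v}|_E\in P_k(E)^2\ \forall E\in\mathcal{T}_h\}$. Forms: $\Pi_h^E$ is the $L^2(E)^{2\times2}$-orthogonal projector onto $P_k(E)^{2\times2}$. $S^E$ is a symmetric positive definite bilinear form with $\frac{c_0}{\nu}\|\boldsymbol{\tau}_h\|_{0,E}^2\le S^E(\boldsymbol{\tau}_h,\boldsymbol{\tau}_h)\le\frac{c_1}{\nu}\|\boldsymbol{\tau}_h\|_{0,E}^2$ for all $\boldsymbol{\tau}_h\in\mathbb{H}_h^E$, where $c_0,c_1>0$ are fixed constants depending only on the mesh assumptions. With $a^E(\boldsymbol{\sigma},\boldsymbol{\tau}):=\frac1\nu\int_E\boldsymbol{\sigma}^{\mathtt{d}}:\boldsymbol{\tau}^{\mathtt{d}}$,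 set $a_h(\boldsymbol{\sigma}_h,\boldsymbol{\tau}_h):=\sum_{E\in\mathcal{T}_h}\bigl[a^E(\Pi_h^E\boldsymbol{\sigma}_h,\Pi_h^E\boldsymbol{\tau}_h)+S^E(\boldsymbol{\sigma}_h-\Pi_h^E\boldsymbol{\sigma}_h,\boldsymbol{\tau}_h-\Pi_h^E\boldsymbol{\tau}_h)\bigr]$. Also $b(\boldsymbol{\tau},\boldsymbol{v}):=\int_\Omega\mathbf{div}\,\boldsymbol{\tau}\cdot\boldsymbol{v}$, $d(\boldsymbol{v},\boldsymbol{w}):=\int_\Omega\kappa\,\boldsymbol{v}\cdot\boldsymbol{w}$, and $$A_h((\boldsymbol{\sigma}_h,\boldsymbol{u}_h),(\boldsymbol{\tau}_h,\boldsymbol{v}_h)):=a_h(\boldsymbol{\sigma}_h,\boldsymbol{\tau}_h)+b(\boldsymbol{\tau}_h,\boldsymbol{u}_h)+b(\boldsymbol{\sigma}_h,\boldsymbol{v}_h)-d(\boldsymbol{u}_h,\boldsymbol{v}_h).$$ Known discrete inf-sup condition: there is $\widehat{\gamma}>0$, independent of $h$, with $\sup_{0\ne\boldsymbol{\tau}_h\in\mathbb{H}_{0,h}}\frac{b(\boldsymbol{\tau}_h,\boldsymbol{q}_h)}{\|\boldsymbol{\tau}_h\|_{\mathbf{div},\Omega}}\ge\widehat{\gamma}\|\boldsymbol{q}_h\|_{0,\Omega}$ for all $\boldsymbol{q}_h\in\mathbf{Q}_h$. *)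

(* Defs.v *)
From HB Require Import structures.
From mathcomp Require Import all_boot all_order all_algebra.
From mathcomp Require Import all_classical all_reals all_analysis.
Set Implicit Arguments.
Unset Strict Implicit.
Unset Printing Implicit Defensive.
Import Order.TTheory GRing.Theory Num.Theory.
Import numFieldNormedType.Exports.
Local Open Scope classical_set_scope.
Local Open Scope ring_scope.

(* Fields are functions on the whole plane; elements of L^2(D) are represented
   by functions, of which only the restriction to D matters, up to null sets. *)

Section Plane.
Context {R : realType}.
Notation pt := (R * R)%type.

Definition leb2 : {measure set (measurableTypeR R * measurableTypeR R) -> \bar R}
  := (lebesgue_measure \x lebesgue_measure)%E.

(* The library norm on R * R is the max norm, so the Euclidean distance is
   introduced separately; both induce the same topology. *)
Definition edist (x y : pt) : R :=
  Num.sqrt ((x.1 - y.1) ^+ 2 + (x.2 - y.2) ^+ 2).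

Definition diam (D : set pt) : R :=
  sup [set r | exists x y, [/\ D x, D y & r = edist x y]].

Definition lerp (a b : pt) (t : R) : pt := a + t *: (b - a).
Definition seg (a b : pt) : set pt := [set lerp a b t | t in `[0, 1]].
Definition frontier (D : set pt) : set pt := closure D `\` D°.

Definition star_shaped_ball (D : set pt) (r : R) : Prop :=
  exists c : pt,
    [set y | edist y c < r] `<=` D /\
    (forall x y, D x -> edist y c < r -> seg x y `<=` D).

(* Near x, and in coordinates rotated by the matrix of rows (c, s), (-s, c),
   D is the part of the plane above the graph of a Lipschitz function. *)
Definition lipschitz_boundary (D : set pt) : Prop :=
  forall x, frontier D x ->
    exists (c s r L : R) (g : R -> R),
      [/\ c ^+ 2 + s ^+ 2 = 1, 0 < r, L.-lipschitz g &
          forall y, edist y x < r ->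
            (D y <-> g (c * y.1 + s * y.2) < c * y.2 - s * y.1)].

Definition polygonal_domain (D : set pt) : Prop :=
  [/\ open D, bounded_set D, connected D, D !=set0 &
      lipschitz_boundary D /\
      exists s : seq (pt * pt),
        frontier D = [set x | exists2 e, e \in s & seg e.1 e.2 x]].

Definition dx1 (f : pt -> R) : pt -> R := fun x => 'D_((1, 0) : pt) f x.
Definition dx2 (f : pt -> R) : pt -> R := fun x => 'D_((0, 1) : pt) f x.

Fixpoint Cn (n : nat) (f : pt -> R) : Prop :=
  match n with
  | 0 => continuous f
  | m.+1 => (forall x, derivable f x (1, 0) /\ derivable f x (0, 1)) /\
            Cn m (dx1 f) /\ Cn m (dx2 f)
  end.

Definition test_fun (D : set pt) (phi : pt -> R) : Prop :=
  (forall n, Cn n phi) /\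
  (let K := closure [set x | phi x != 0] in compact K /\ K `<=` D).

Definition L2 (D : set pt) (f : pt -> R) : Prop := f \_ D \in Lfun leb2 2%:E.

Definition L2v (D : set pt) (v : pt -> 'rV[R]_2) : Prop :=
  forall j, L2 D (fun x => v x 0 j).

Definition L2m (D : set pt) (tau : pt -> 'M[R]_2) : Prop :=
  forall i j, L2 D (fun x => tau x i j).

Definition dotv (a b : 'rV[R]_2) : R := \sum_j a 0 j * b 0 j.
Definition frob (a b : 'M[R]_2) : R := \sum_i \sum_j a i j * b i j.
Definition dev (a : 'M[R]_2) : 'M[R]_2 := a - (\tr a / 2)%:M.

Definition normv (D : set pt) (v : pt -> 'rV[R]_2) : R :=
  Num.sqrt (\int[leb2]_(x in D) dotv (v x) (v x)).
Definition normm (D : set pt) (tau : pt -> 'M[R]_2) : R :=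
  Num.sqrt (\int[leb2]_(x in D) frob (tau x) (tau x)).

Definition grad (phi : pt -> R) (x : pt) : 'rV[R]_2 :=
  \row_j (if j == 0 then dx1 phi x else dx2 phi x).

Definition is_weak_div (D : set pt) (tau : pt -> 'rV[R]_2) (g : pt -> R) :=
  forall phi, test_fun D phi ->
    \int[leb2]_(x in D) dotv (tau x) (grad phi x)
      = - \int[leb2]_(x in D) (g x * phi x).

(* rot tau = d_1 tau_2 - d_2 tau_1 *)
Definition is_weak_rot (D : set pt) (tau : pt -> 'rV[R]_2) (g : pt -> R) :=
  forall phi, test_fun D phi ->
    \int[leb2]_(x in D) (tau x 0 1 * dx1 phi x - tau x 0 0 * dx2 phi x)
      = - \int[leb2]_(x in D) (g x * phi x).

Definition Hdiv (D : set pt) (tau : pt -> 'rV[R]_2) : Prop :=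
  L2v D tau /\ exists g, L2 D g /\ is_weak_div D tau g.
Definition Hrot (D : set pt) (tau : pt -> 'rV[R]_2) : Prop :=
  L2v D tau /\ exists g, L2 D g /\ is_weak_rot D tau g.

(* An arbitrary representative of the weak divergence (resp. rotational),
   which is unique up to null sets; 0 when it does not exist in L^2. *)
Definition wdiv (D : set pt) (tau : pt -> 'rV[R]_2) : pt -> R :=
  xget (fun=> 0) [set g | L2 D g /\ is_weak_div D tau g].
Definition wrot (D : set pt) (tau : pt -> 'rV[R]_2) : pt -> R :=
  xget (fun=> 0) [set g | L2 D g /\ is_weak_rot D tau g].

Definition mrow (tau : pt -> 'M[R]_2) (i : 'I_2) : pt -> 'rV[R]_2 :=
  fun x => row i (tau x).

Definition HHdiv (D : set pt) (tau : pt -> 'M[R]_2) : Prop :=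
  forall i, Hdiv D (mrow tau i).

Definition mdiv (D : set pt) (tau : pt -> 'M[R]_2) : pt -> 'rV[R]_2 :=
  fun x => \row_i wdiv D (mrow tau i) x.

Definition norm_div (D : set pt) (tau : pt -> 'M[R]_2) : R :=
  Num.sqrt (normm D tau ^+ 2 + normv D (mdiv D tau) ^+ 2).

Definition norm3 (D : set pt) (tau : pt -> 'M[R]_2) (v : pt -> 'rV[R]_2) : R :=
  Num.sqrt (norm_div D tau ^+ 2 + normv D v ^+ 2).

(* As with [size] of univariate polynomials, [m] is 1 + the degree bound, so
   that P_k is [poly2 k.+1], P_(k-1) is [poly2 k] and P_(-1) is [poly2 0]. *)
Definition poly2 (m : nat) (p : pt -> R) : Prop :=
  exists c : nat -> nat -> R, forall x,
    p x = \sum_(a < m) \sum_(b < m | (a + b < m)%N) c a b * x.1 ^+ a * x.2 ^+ b.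

Definition in_poly (D : set pt) (m : nat) (f : pt -> R) : Prop :=
  exists2 p, poly2 m p & {ae leb2, forall x, D x -> f x = p x}.

Definition poly2m (m : nat) (p : pt -> 'M[R]_2) : Prop :=
  forall i j, poly2 m (fun x => p x i j).

(* The L^2(D)-orthogonal projection onto P_k(D)^(2x2). *)
Definition proj (D : set pt) (k : nat) (tau : pt -> 'M[R]_2) : pt -> 'M[R]_2 :=
  xget (fun=> 0) [set p | poly2m k.+1 p /\
    forall q, poly2m k.+1 q ->
      \int[leb2]_(x in D) frob (tau x - p x) (q x) = 0].

Record polygon := Polygon {
  pset : set pt;
  nvert : nat;
  vert : 'I_nvert -> pt }.

Definition edge_src (E : polygon) (i : 'I_(nvert E)) : pt := vert i.
Definition edge_dst (E : polygon) (i : 'I_(nvert E)) : pt := vert (ordS i).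
Definition edge (E : polygon) (i : 'I_(nvert E)) : set pt :=
  seg (edge_src i) (edge_dst i).
Definition edge_len (E : polygon) (i : 'I_(nvert E)) : R :=
  edist (edge_src i) (edge_dst i).

(* [pset E] is the open region enclosed by the closed polygonal line through the
   vertices. That line is simple because the half-open edges are pairwise
   disjoint. Flat angles (hanging nodes) are allowed. *)
Definition is_polygon (E : polygon) : Prop :=
  [/\ (2 < nvert E)%N,
      [/\ open (pset E), bounded_set (pset E), connected (pset E)
        & pset E !=set0],
      trivIset setT (fun i : 'I_(nvert E) =>
        [set lerp (edge_src i) (edge_dst i) t | t in `[0, 1[]) &
      frontier (pset E) = \bigcup_(i : 'I_(nvert E)) edge i].

Record mesh := Mesh { ncell : nat; cell : 'I_ncell -> polygon }.

Definition regular_mesh (Omega : set pt) (chat eta : R) (T : mesh) : Prop :=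
  [/\ forall i : 'I_(ncell T), is_polygon (cell i) /\ pset (cell i) `<=` Omega,
      trivIset setT (fun i : 'I_(ncell T) => pset (cell i)),
      closure Omega = \bigcup_(i : 'I_(ncell T)) closure (pset (cell i)),
      forall (i : 'I_(ncell T)) (e : 'I_(nvert (cell i))),
        chat * diam (pset (cell i)) <= edge_len e &
      forall i : 'I_(ncell T),
        star_shaped_ball (pset (cell i)) (eta * diam (pset (cell i)))].

(* The normal trace of tau in H(div; E) is the functional on the traces of
   smooth functions given by Green's formula. Its restriction to the edge e
   is tested by functions vanishing on the rest of the boundary; it has to be a
   polynomial of degree <= k in the parameter t of e = { lerp a b t }. *)
Definition normal_trace_poly (k : nat) (E : polygon) (tau : pt -> 'rV[R]_2)
    (e : 'I_(nvert E)) : Prop :=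
  exists2 q : {poly R}, (size q <= k.+1)%N &
    forall phi, test_fun setT phi ->
      (forall x, frontier (pset E) x -> ~ edge e x -> phi x = 0) ->
      \int[leb2]_(x in pset E)
          (dotv (tau x) (grad phi x) + wdiv (pset E) tau x * phi x)
      = edge_len e * \int[lebesgue_measure]_(t in `[0, 1])
                        (q.[t] * phi (lerp (edge_src e) (edge_dst e) t)).

Definition WhE (k : nat) (E : polygon) (tau : pt -> 'rV[R]_2) : Prop :=
  [/\ Hdiv (pset E) tau, Hrot (pset E) tau,
      forall e : 'I_(nvert E), normal_trace_poly k tau e,
      in_poly (pset E) k.+1 (wdiv (pset E) tau) &
      in_poly (pset E) k (wrot (pset E) tau)].

Definition HhE (k : nat) (E : polygon) (tau : pt -> 'M[R]_2) : Prop :=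
  forall i, WhE k E (mrow tau i).

Definition Hh (Omega : set pt) (k : nat) (T : mesh) (tau : pt -> 'M[R]_2) :=
  HHdiv Omega tau /\ forall i : 'I_(ncell T), HhE k (cell i) tau.

Definition H0h (Omega : set pt) (k : nat) (T : mesh) (tau : pt -> 'M[R]_2) :=
  Hh Omega k T tau /\ \int[leb2]_(x in Omega) \tr (tau x) = 0.

Definition Qh (Omega : set pt) (k : nat) (T : mesh) (v : pt -> 'rV[R]_2) :=
  L2v Omega v /\
  forall (i : 'I_(ncell T)) j, in_poly (pset (cell i)) k.+1 (fun x => v x 0 j).

Definition tform := (pt -> 'M[R]_2) -> (pt -> 'M[R]_2) -> R.

Definition aE (nu : R) (D : set pt) (sigma tau : pt -> 'M[R]_2) : R :=
  nu^-1 * \int[leb2]_(x in D) frob (dev (sigma x)) (dev (tau x)).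

(* Linearity in the second argument follows by symmetry. *)
Definition stabilization (nu c0 c1 : R) (k : nat) (E : polygon) (S : tform) :=
  let V := HhE k E in
  [/\ forall a sigma tau rho, V sigma -> V tau -> V rho ->
        S (a *: sigma + tau) rho = a * S sigma rho + S tau rho,
      forall sigma tau, V sigma -> V tau -> S sigma tau = S tau sigma,
      forall tau, V tau -> 0 < normm (pset E) tau -> 0 < S tau tau &
      forall tau, V tau ->
        c0 / nu * normm (pset E) tau ^+ 2 <= S tau tau
        /\ S tau tau <= c1 / nu * normm (pset E) tau ^+ 2].

Definition a_h (nu : R) (k : nat) (T : mesh) (S : 'I_(ncell T) -> tform)
    (sigma tau : pt -> 'M[R]_2) : R :=
  \sum_(i < ncell T)
    (let D := pset (cell i) in
     aE nu D (proj D k sigma) (proj D k tau)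
     + S i (sigma - proj D k sigma) (tau - proj D k tau)).

Definition b_form (Omega : set pt) (tau : pt -> 'M[R]_2) (v : pt -> 'rV[R]_2) : R :=
  \int[leb2]_(x in Omega) dotv (mdiv Omega tau x) (v x).

Definition d_form (kappa : R) (Omega : set pt) (v w : pt -> 'rV[R]_2) : R :=
  \int[leb2]_(x in Omega) (kappa * dotv (v x) (w x)).

Definition A_h (nu kappa : R) (Omega : set pt) (k : nat) (T : mesh)
    (S : 'I_(ncell T) -> tform)
    (sigma : pt -> 'M[R]_2) (u : pt -> 'rV[R]_2)
    (tau : pt -> 'M[R]_2) (v : pt -> 'rV[R]_2) : R :=
  a_h nu k S sigma tau + b_form Omega tau u + b_form Omega sigma v
  - d_form kappa Omega u v.

Definition discrete_inf_sup (gammahat : R) (Omega : set pt) (k : nat) (T : mesh) :=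
  forall q, Qh Omega k T q ->
    ((gammahat * normv Omega q)%:E <=
     ereal_sup [set (b_form Omega tau q / norm_div Omega tau)%:E |
                tau in [set tau | H0h Omega k T tau /\
                                  0 < norm_div Omega tau]%R])%E.

End Plane.

Arguments polygon R : clear implicits.
Arguments mesh R : clear implicits.
Arguments tform R : clear implicits.

(* Main.v *)
(* The test pair is tau = sigma and v = kappa^-1 div sigma - u, for which A_h dominates
   a_h(sigma, sigma) + |div sigma|^2 + |u|^2.
   Two facts remain.

   (1) |sigma|^2 <= C (|dev sigma|^2 + |div sigma|^2) when tr sigma has mean zero. Here
   p = tr sigma / 2 has the weak gradient div sigma - div (dev sigma), so this is the inequality
   of Necas. Testing with gradients of test functions and projecting p on the closure of the
   Laplacians of test functions gives p = w + h with w controlled by the data and h weakly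
   harmonic. Convolving h with the Laplacian of a regularised logarithm (Weyl) shows that h is
   smooth, with gradient at x bounded by the L^2 norm of the data on a ball of radius
   comparable to the distance from x to the boundary. Hence dist * grad h is in L^2, and a
   Hardy-Poincare inequality, obtained by pushing mass along the graph direction of the
   boundary charts and chaining squares in the interior, bounds h up to a constant.

   (2) a_h(sigma, sigma) >= c |dev sigma|^2, cell by cell, for which sigma - Pi sigma must
   lie in the virtual element space: polynomials must have polynomial normal traces in the
   sense of Green's formula tested with functions g that vanish on the other edges. Since
   the cell is star-shaped with respect to a ball, it coincides near an inner point of an
   edge with one side of the line carrying it. Truncating g near its zero set leaves
   functions that vanish near the rest of the boundary, for which the formula reduces to a
   half-plane; the truncation is removed because grad g = 0 a.e. where g = 0. *)
Require Import Defs.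
From HB Require Import structures.
From mathcomp Require Import all_boot all_order all_algebra.
From mathcomp Require Import all_classical all_reals all_analysis.
From mathcomp Require Import measurable_realfun ring lra.
Import Order.TTheory GRing.Theory Num.Theory.
Import numFieldNormedType.Exports.
Local Open Scope classical_set_scope.
Local Open Scope ring_scope.

(** * Integration in the plane *)

(** Two classes of test functions coexist. [test_fun] belongs to the definitions; [tst] consists of
    the compactly supported functions of the class [sm], whose smoothness and symmetric second
    derivatives are obtained by induction on an expression. Test functions that have to be built are
    of the second kind; of a given one, C^1 regularity is what is exploited. The weight dist^2 is
    dictated by Weyl's bound: |grad h(x)|^2 is at most a multiple of r^-4 times an integral over a
    box of area 4 r^2, and averaging over x recovers a factor r^2. Hardy's inequality carries
    exactly this weight, with constants that do not degenerate at the boundary. Charts and edges are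
    oblique, but no rotation of Lebesgue measure occurs: inequalities are proved on the lines of one
    direction and summed by Fubini and translation invariance, and half-planes are cut by horizontal
    or vertical lines. Oscillations are measured about a constant c fixed in advance, so that
    estimates can be chained from set to set; c is chosen on the base square only, and the zero mean
    of tr sigma finally removes it. *)

Definition mu1 {R : realType} : set (measurableTypeR R) -> \bar R :=
  @lebesgue_measure R.
HB.instance Definition _ (R : realType) := SigmaFiniteMeasure.on (@mu1 R).
Definition mu2 {R : realType} :
  set (measurableTypeR R * measurableTypeR R) -> \bar R := @leb2 R.
HB.instance Definition _ (R : realType) := Measure.on (@mu2 R).

(** Squares of an exhaustion of the line exhaust the plane. The instance is wanted because [mu2]
    itself becomes a factor of product measures: with [mu1] when the plane is sliced by lines, with
    [mu2] when double integrals over the plane are exchanged. *)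
Lemma mu2_sigma_finite {R : realType} : sigma_finite setT (@mu2 R).
Proof.
have /sigma_finiteP[F [TF ndF Foo]] := sigma_finiteT (@mu1 R).
exists (fun n => F n `*` F n).
 rewrite -setXTT TF predeqE => -[x y]; split.
    move=> [/= [n _ Fnx] [k _ Gky]]; exists (maxn n k) => //; split.
    - by move: x Fnx; exact/subsetPset/ndF/leq_maxl.
    - by move: y Gky; exact/subsetPset/ndF/leq_maxr.
  by move=> [n _ []/= ? ?]; split; exists n.
move=> k; have [? ?] := Foo k.
split; first exact: measurableX.
by rewrite /mu2 /leb2 /= product_measure1E// lte_mul_pinfty// ge0_fin_numE.
Qed.
HB.instance Definition _ (R : realType) :=
  Measure_isSigmaFinite.Build _ _ _ (@mu2 R) mu2_sigma_finite.

Definition meas {R : realType} (f : R * R -> R) : Prop :=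
  @measurable_fun _ _ (measurableTypeR R * measurableTypeR R)%type _ setT f.
Definition mble {R : realType} (A : set (R * R)) : Prop :=
  @measurable _ (measurableTypeR R * measurableTypeR R)%type A.
Definition itg {R : realType} (f : R * R -> R) : Prop :=
  (@mu2 R).-integrable setT (EFin \o f).
Definition Int {R : realType} (f : R * R -> R) : R := \int[@mu2 R]_x f x.
Definition sqi {R : realType} (f : R * R -> R) : Prop :=
  meas f /\ itg (fun x => f x ^+ 2).
Definition box {R : realType} (a : R * R) (r : R) : set (R * R) :=
  [set y | `|y - a| < r].

Instance mu2_ae_filter {R : realType} : Filter (almost_everywhere (@mu2 R)).
Proof. exact: ae_filter_ringOfSetsType. Qed.

Section Measure.
Set Implicit Arguments.
Unset Strict Implicit.
Context {R : realType}.
Notation pt := (R * R)%type.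
Notation T1 := (measurableTypeR R).
Notation T2 := (T1 * T1)%type.
Implicit Types (f g h : pt -> R) (A B D : set pt) (a x y : pt).

Lemma ltr_norm_pair (u : pt) (r : R) : (`|u| < r) = (`|u.1| < r) && (`|u.2| < r).
Proof. by rewrite prod_normE gt_max. Qed.

Lemma ler_norm_pair (u : pt) (r : R) : (`|u| <= r) = (`|u.1| <= r) && (`|u.2| <= r).
Proof. by rewrite prod_normE ge_max. Qed.

Lemma box_setX a r :
  box a r = `]a.1 - r, a.1 + r[%classic `*` `]a.2 - r, a.2 + r[%classic.
Proof.
apply/seteqP; split => [x|x []] /=.
  rewrite /box /= ltr_norm_pair /= !ltr_norml => /andP[/andP[h1 h2] /andP[h3 h4]].
  by rewrite !in_itv /=; split; apply/andP; split; lra.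
rewrite !in_itv /= => /andP[h1 h2] /andP[h3 h4].
by rewrite /box /= ltr_norm_pair /= !ltr_norml; do 2 (apply/andP; split); lra.
Qed.

Lemma mble_box a r : mble (box a r).
Proof. by rewrite box_setX; apply: measurableX; exact: measurable_itv. Qed.

Lemma open_box a r : open (box a r).
Proof.
rewrite openE => x; rewrite /box /= => xr.
apply/nbhs_ballP; exists (r - `|x - a|) => /=; first by rewrite subr_gt0.
move=> y; rewrite -ball_normE /= => xy.
rewrite (_ : y - a = (x - a) - (x - y)); last by rewrite opprB [RHS]addrC subrKA.
by rewrite (le_lt_trans (ler_normB _ _))// -ltrBrDl.
Qed.

Lemma openP_box A : open A <-> forall x, A x -> exists2 r, 0 < r & box x r `<=` A.
Proof.
split=> [|h].
  rewrite openE => oA x /oA /nbhs_ballP[r /= r0 xr]; exists r => // y.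
  by rewrite /box /= distrC => xy; apply: xr; rewrite -ball_normE.
rewrite openE => x /h[r r0 xr]; apply/nbhs_ballP; exists r => //= y.
by rewrite -ball_normE /= distrC; exact: xr.
Qed.

(** Measurability refers to the product sigma-algebra, so second countability has to enter: an open
    set is a countable union of boxes with rational centres. *)
Lemma mble_open A : open A -> mble A.
Proof.
move/openP_box => oA.
pose F (n : nat) : set pt :=
  \bigcup_(q in [set q : rat * rat |
      box (ratr q.1, ratr q.2) (n.+1%:R^-1) `<=` A])
    box (ratr q.1, ratr q.2) (n.+1%:R^-1).
have -> : A = \bigcup_n F n.
  apply/seteqP; split => [x Ax|x [n _ [q qA]] /qA//].
  have [r r0 xr] := oA _ Ax.
  (* With e < r / 2, a rational centre within e of x gives a box that contains x and still lies in
     [box x r]. *)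
  have [n [e [eE e0 er]]] : exists n : nat, exists e : R,
      [/\ e = n.+1%:R^-1, 0 < e & e < r / 2].
    have /ltr_add_invr[n] : 0 < r / 2 by rewrite divr_gt0.
    by rewrite add0r => nr; exists n, (n.+1%:R^-1); rewrite nr invr_gt0 ltr0n.
  have ex (t : R) : exists q : rat, `|t - ratr q| < e.
    have [||z []] := @dense_rat R `]t - e, t + e[%classic.
    - by exists t; rewrite /= in_itv /=; apply/andP; split; lra.
    - exact: interval_open.
    rewrite /= in_itv /= => /andP[h1 h2] [q _ qz]; exists q.
    by rewrite qz ltr_norml; apply/andP; split; lra.
  have [q1 h1] := ex x.1; have [q2 h2] := ex x.2.
  exists n => //; exists (q1, q2) => /=; rewrite -eE; last by rewrite /box /= ltr_norm_pair h1.
  move=> y yq; apply: xr; move: yq; rewrite /box /= !ltr_norm_pair /=.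
  rewrite !ltr_norml => /andP[/andP[? ?] /andP[? ?]].
  move: h1 h2; rewrite !ltr_norml => /andP[? ?] /andP[? ?].
  by do 2 (apply/andP; split); lra.
apply: bigcupT_measurable => n; rewrite /F bigcup_mkcond.
apply: countable_bigcupT_measurable; first exact: countableP.
by move=> q; case: ifP => // _; exact: mble_box.
Qed.

(** The functions produced by Weyl's lemma are regular inside D only, whence continuity at the
    points of D instead of continuity on the plane. *)
Lemma meas_open_restrict D f : open D -> (forall x, D x -> {for x, continuous f}) ->
  meas (f \_ D).
Proof.
move=> oD cf; apply: (@measurable_restrictT _ _ T2 _ D f (mble_open oD)).1.
apply: (measurability _ (RGenOpens.measurableE R)).
move=> _ [_ [a [b ->] <-]]; apply: mble_open; apply/openP_box => x [Dx fx].
have : nbhs (f x) `]a, b[%classic by apply: open_nbhs_nbhs; split => //; exact: interval_open.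
move=> /(cf x Dx) /nbhs_ballP[r /= r0 xr].
have [s s0 xs] := (openP_box D).1 oD x Dx.
exists (Num.min r s) => [|y]; first by rewrite lt_min r0.
rewrite /box /= lt_min => /andP[yr ys]; split; first exact: xs.
by apply: xr; rewrite -ball_normE /= distrC.
Qed.

Lemma meas_continuous f : continuous f -> meas f.
Proof.
move=> cf; have <- : f \_ setT = f by apply/funext => x; rewrite patchE in_setT.
by apply: meas_open_restrict => [|x _]; [exact: openT|exact: cf].
Qed.

Lemma measD f g : meas f -> meas g -> meas (fun x => f x + g x).
Proof. exact: measurable_funD. Qed.

Lemma measN f : meas f -> meas (fun x => - f x).
Proof. by move=> mf; apply: measurableT_comp. Qed.

Lemma measB f g : meas f -> meas g -> meas (fun x => f x - g x).
Proof. exact: measurable_funB. Qed.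

Lemma measM f g : meas f -> meas g -> meas (fun x => f x * g x).
Proof. exact: measurable_funM. Qed.

Lemma meas_cst (c : R) : meas (fun=> c).
Proof. exact: measurable_cst. Qed.

Lemma measZ (c : R) f : meas f -> meas (fun x => c * f x).
Proof. exact: measM (meas_cst c). Qed.

Lemma measX n f : meas f -> meas (fun x => f x ^+ n).
Proof. exact: measurable_funX. Qed.

Lemma meas_norm f : meas f -> meas (fun x => `|f x|).
Proof. by move=> mf; apply: (@measurableT_comp _ _ _ _ _ _ (@Num.norm _ R)). Qed.

Lemma meas_indic A : mble A -> meas (\1_A).
Proof. by move=> mA; apply: measurable_indic. Qed.

Lemma meas_patch A f : mble A -> meas f -> meas (f \_ A).
Proof.
move=> mA mf; apply: (@measurable_restrictT _ _ T2 _ A f mA).1.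
exact: measurable_funTS.
Qed.

Lemma itg_meas f : itg f -> meas f.
Proof. by move=> /integrableP[/measurable_EFinP]. Qed.

Lemma itgD f g : itg f -> itg g -> itg (fun x => f x + g x).
Proof. by move=> fi gi; have := integrableD measurableT fi gi. Qed.

Lemma itgZ (c : R) f : itg f -> itg (fun x => c * f x).
Proof. by move=> fi; have := integrableZl measurableT c fi. Qed.

Lemma itgN f : itg f -> itg (fun x => - f x).
Proof. by move=> fi; have := integrableN fi. Qed.

Lemma itgB f g : itg f -> itg g -> itg (fun x => f x - g x).
Proof. by move=> fi gi; apply: itgD => //; exact: itgN. Qed.

Lemma itg0 : itg (fun=> 0 : R).
Proof. exact: integrable0. Qed.

Lemma itg_le f g : meas f -> itg g -> (forall x, `|f x| <= g x) -> itg f.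
Proof.
move=> mf ig fg; apply: (le_integrable _ _ _ ig) => //.
  exact/measurable_EFinP.
by move=> x _; rewrite !abse_EFin lee_fin (le_trans (fg x))// ler_norm.
Qed.

Lemma itg_norm f : itg f -> itg (fun x => `|f x|).
Proof. by move=> /integrable_abse. Qed.

Lemma itg_indic A : mble A -> (mu2 A < +oo)%E -> itg (\1_A).
Proof.
move=> mA Afin; apply/integrableP; split; first by apply/measurable_EFinP; exact: meas_indic.
under eq_integral do rewrite /= ger0_norm ?indicE//.
by have := integral_indic mu2 measurableT mA; rewrite setIT => ->.
Qed.

Lemma mu2_box a (r : R) : 0 <= r -> mu2 (box a r) = (4 * r ^+ 2)%:E.
Proof.
move=> r0; rewrite box_setX /mu2 /leb2 /= product_measure1E; [|exact: measurable_itv..].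
rewrite [X in (X * _)%E](@lebesgue_measure_itv R `]a.1 - r, a.1 + r[) [X in (_ * X)%E](@lebesgue_measure_itv R `]a.2 - r, a.2 + r[) /= !lte_fin.
have [->|/negPf rn] := eqVneq r 0.
  by rewrite !subr0 !addr0 !ltxx mul0e; congr EFin; ring.
have {}r0 : 0 < r by rewrite lt_def rn.
rewrite !ifT; [|lra|lra].
by rewrite -!EFinD -EFinM; congr EFin; ring.
Qed.

Lemma mu2_box_lty a r : (mu2 (box a r) < +oo)%E.
Proof.
have [r0|r0] := leP 0 r; first by rewrite mu2_box// ltry.
rewrite (_ : box a r = set0) ?measure0//; apply/seteqP; split => // x.
by rewrite /box /= => /(le_lt_trans (normr_ge0 _)) /(lt_trans r0); rewrite ltxx.
Qed.

Lemma itg_bounded f a (r C : R) : meas f -> (forall x, `|f x| <= C) ->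
  (forall x, ~ box a r x -> f x = 0) -> itg f.
Proof.
move=> mf fC f0; apply: (@itg_le _ (fun x => C * \1_(box a r) x)) => //.
  by apply: itgZ; apply: itg_indic; [exact: mble_box|exact: mu2_box_lty].
move=> x; rewrite indicE; have [xr|xr] := boolP (x \in box a r).
  by rewrite mulr1.
by rewrite f0 ?normr0 ?mulr0// => /mem_set; exact/negP.
Qed.

Lemma IntD f g : itg f -> itg g -> Int (fun x => f x + g x) = Int f + Int g.
Proof. by move=> fi gi; apply: RintegralD. Qed.

Lemma IntZ (c : R) f : itg f -> Int (fun x => c * f x) = c * Int f.
Proof. by move=> fi; apply: RintegralZl. Qed.

Lemma IntN f : itg f -> Int (fun x => - f x) = - Int f.
Proof.
by move=> fi; rewrite -mulN1r -IntZ//; congr Int; apply/funext => x; rewrite mulN1r.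
Qed.

Lemma IntB f g : itg f -> itg g -> Int (fun x => f x - g x) = Int f - Int g.
Proof. by move=> fi gi; rewrite IntD ?IntN//; exact: itgN. Qed.

Lemma Int0 : Int (fun=> 0 : R) = 0.
Proof. by have := IntZ 0 itg0; rewrite !mul0r. Qed.

Lemma Int_ge0 f : (forall x, 0 <= f x) -> 0 <= Int f.
Proof. by move=> f0; apply: Rintegral_ge0. Qed.

Lemma Int_le f g : itg f -> itg g -> (forall x, f x <= g x) -> Int f <= Int g.
Proof. by move=> fi gi fg; apply: le_Rintegral. Qed.

Lemma Int_norm f : itg f -> `|Int f| <= Int (fun x => `|f x|).
Proof. by move=> fi; apply: le_normr_Rintegral. Qed.

Lemma Int_EFin f : itg f -> (\int[mu2]_x (f x)%:E)%E = (Int f)%:E.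
Proof. by move=> fi; rewrite /Int /Rintegral fineK// integrable_fin_num. Qed.

Lemma itg_leP f (C : R) : meas f -> (forall x, 0 <= f x) ->
  (\int[mu2]_x (f x)%:E <= C%:E)%E -> itg f /\ Int f <= C.
Proof.
move=> mf f0 fC; have fi : itg f.
  apply/integrableP; split; first exact/measurable_EFinP.
  rewrite (le_lt_trans _ (ltry C))//; under eq_integral do rewrite /= ger0_norm//.
  exact: fC.
by split => //; move: fC; rewrite Int_EFin.
Qed.

Lemma eq_Int_ae f g : meas f -> meas g -> {ae (@mu2 R), forall x, f x = g x} ->
  Int f = Int g.
Proof.
move=> mf mg fg; congr fine; apply: ae_eq_integral => //;
  [exact/measurable_EFinP|exact/measurable_EFinP|].
by apply: filterS fg => x /= ->.
Qed.

Lemma itg_ae f g : meas f -> itg g -> {ae (@mu2 R), forall x, f x = g x} -> itg f.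
Proof.
move=> mf gi fg; apply/integrableP; split; first exact/measurable_EFinP.
have /integrableP[mg] := gi; apply: le_lt_trans; rewrite le_eqVlt; apply/orP; left.
apply/eqP/ae_eq_integral => //; [exact/measurableT_comp/measurable_EFinP|
  exact/measurableT_comp|].
by apply: filterS fg => x /= ->.
Qed.

Lemma sqi_mul f g : sqi f -> sqi g -> itg (fun x => f x * g x).
Proof.
move=> [mf fi] [mg gi]; apply: itg_le (itgD fi gi) _; first exact: measM.
by move=> x; rewrite ler_norml; apply/andP; split; nra.
Qed.

Lemma sqiD f g : sqi f -> sqi g -> sqi (fun x => f x + g x).
Proof.
move=> sf sg; split; first exact: measD sf.1 sg.1.
apply: itg_le (itgZ 2 (itgD sf.2 sg.2)) _; first by apply: measX; exact: measD sf.1 sg.1.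
by move=> x; rewrite ger0_norm ?sqr_ge0//; have := sqr_ge0 (f x - g x); rewrite !expr2; lra.
Qed.

Lemma sqi_bounded_mul f g (C : R) : sqi f -> meas g -> (forall x, `|g x| <= C) ->
  sqi (fun x => g x * f x).
Proof.
move=> sf mg gC; split; first exact: measM mg sf.1.
apply: itg_le (itgZ (C ^+ 2) sf.2) _; first by apply: measX; exact: measM mg sf.1.
move=> x; rewrite ger0_norm ?sqr_ge0// exprMn ler_wpM2r ?sqr_ge0//.
by rewrite -[leLHS]ger0_norm ?sqr_ge0// normrX lerXn2r ?nnegrE// (le_trans _ (gC x)).
Qed.

Lemma sqiZ (c : R) f : sqi f -> sqi (fun x => c * f x).
Proof. by move=> sf; apply: (@sqi_bounded_mul f (fun=> c) `|c| sf) => //; exact: meas_cst. Qed.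

Lemma sqiN f : sqi f -> sqi (fun x => - f x).
Proof.
move=> /(sqiZ (-1)); rewrite (_ : (fun x => -1 * f x) = (fun x => - f x))//.
by apply/funext => x; rewrite mulN1r.
Qed.

Lemma sqiB f g : sqi f -> sqi g -> sqi (fun x => f x - g x).
Proof. by move=> sf sg; apply: sqiD => //; exact: sqiN. Qed.

Lemma sqi_norm f : sqi f -> sqi (fun x => `|f x|).
Proof.
move=> sf; split; first exact: meas_norm sf.1.
rewrite (_ : (fun x => `|f x| ^+ 2) = (fun x => f x ^+ 2)); first exact: sf.2.
by apply/funext => x; rewrite real_normK ?num_real.
Qed.

Lemma sqi_patch A f : mble A -> sqi f -> sqi (f \_ A).
Proof.
move=> mA sf; split; first exact: meas_patch sf.1.
apply: itg_le sf.2 _; first by apply: measX; exact: meas_patch sf.1.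
move=> x; rewrite ger0_norm ?sqr_ge0// patchE.
by case: ifP => // _; rewrite expr0n /= sqr_ge0.
Qed.

(** The discriminant of a nonnegative quadratic, read off at its minimum - b / c. When c = 0 the
    function of t is affine, and its value at - (a + 1) / b would be negative unless b = 0. It
    serves for Cauchy-Schwarz and for the near-orthogonality of minimising sequences. *)
Lemma sqr_le_of_quadratic (a b c : R) : 0 <= c ->
  (forall t : R, 0 <= a + 2 * t * b + t ^+ 2 * c) -> b ^+ 2 <= a * c.
Proof.
move=> c0 h; have [c00|cp] := eqVneq c 0.
  have h0 := h 0; have hp := h (- (a + 1) / b).
  have [->|bn] := eqVneq b 0; first by rewrite c00 mulr0 expr0n.
  move: hp; rewrite c00 !mulr0 addr0 (_ : 2 * (- (a + 1) / b) * b = - 2 * (a + 1)); last first.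
    by field.
  by move: h0; rewrite c00; lra.
have {}cp : 0 < c by rewrite lt_def cp.
have := h (- b / c); rewrite (_ : _ + _ = (a * c - b ^+ 2) / c); last by field; lra.
by rewrite pmulr_lge0 ?invr_gt0// subr_ge0.
Qed.

Lemma Int_CS f g : sqi f -> sqi g ->
  Int (fun x => f x * g x) ^+ 2 <= Int (fun x => f x ^+ 2) * Int (fun x => g x ^+ 2).
Proof.
move=> sf sg; apply: sqr_le_of_quadratic; first by apply: Int_ge0 => x; exact: sqr_ge0.
move=> t; have i1 := sqi_mul sf sg; have := Int_ge0 (f := fun x => (f x + t * g x) ^+ 2).
rewrite (_ : (fun x => (f x + t * g x) ^+ 2) =
  (fun x => (f x ^+ 2 + (2 * t) * (f x * g x)) + t ^+ 2 * g x ^+ 2)); last first.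
  by apply/funext => x; ring.
rewrite IntD; [|exact: itgD sf.2 (itgZ _ i1)|exact: itgZ sg.2].
rewrite IntD; [|exact: sf.2|exact: itgZ].
rewrite IntZ// IntZ; last exact: sg.2.
by apply=> x; exact: sqr_ge0.
Qed.

End Measure.

(** * Integration by parts in the plane *)

Definition vanish {R : realType} (B : R) (u : R * R -> R) : Prop :=
  forall x, B <= `|x| -> u x = 0.

(** The regularity that integration by parts consumes: continuous partial derivatives, without
    differentiability in the sense of Frechet. It is what can be extracted from [test_fun]. *)
Definition c1 {R : realType} (u : R * R -> R) : Prop :=
  [/\ continuous u, (forall x, derivable u x (1, 0)), continuous (dx1 u),
      (forall x, derivable u x (0, 1)) & continuous (dx2 u)].

Section Calculus.
Set Implicit Arguments.
Unset Strict Implicit.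
Context {R : realType}.
Notation pt := (R * R)%type.
Notation T1 := (measurableTypeR R).
Notation T2 := (T1 * T1)%type.
Implicit Types (f g u v : pt -> R) (A D : set pt) (a x y : pt).

Lemma measurable_shift2 a : measurable_fun setT (fun x : T2 => (x : pt) + a : T2).
Proof.
apply/measurable_fun_pairP; split.
- by apply: measurable_funD => //; exact: measurable_fst.
- by apply: measurable_funD => //; exact: measurable_snd.
Qed.

(** Lebesgue measure is determined by its values on half-open intervals, and its pushforward by a
    translation has the same ones. *)
Lemma mu1_shift (t : R) (A : set T1) : measurable A ->
  mu1 ((fun x : R => x + t) @^-1` A) = mu1 A.
Proof.
move=> mA.
have mf : measurable_fun setT (fun x : T1 => (x : R) + t : T1).
  by apply: measurable_funD => //; exact: measurable_id.
pose m' := pushforward (@mu1 R) (fun x : T1 => (x : R) + t : T1).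
have h := @lebesgue_measure_unique R m' _ A mA.
rewrite /mu1 h// => X [[p q] _ <-] /=.
rewrite /m' /pushforward /mu1 -[X in X = _]/(lebesgue_measure `]p, q]%classic).
rewrite (_ : _ @^-1` _ = `]p - t, q - t]%classic); last first.
  apply/seteqP; split => z /=; rewrite !in_itv /= => /andP[? ?]; apply/andP; split; lra.
rewrite !lebesgue_measure_itv /= !lte_fin ltrBlDr subrK.
by case: ifP => // _; rewrite -!EFinB; congr EFin; lra.
Qed.

Lemma mu2_shift a A : mble A -> mu2 ((fun x : pt => x + a) @^-1` A) = mu2 A.
Proof.
move=> mA.
pose m' := pushforward (@mu2 R) (fun x : T2 => (x : pt) + a : T2).
have h := @product_measure_unique _ _ T1 T1 R (@mu1 R) (@mu1 R) m'.
rewrite [RHS](h (measurable_shift2 a) _ A mA)// => X Y mX mY.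
change (mu2 ((fun x : pt => x + a) @^-1` (X `*` Y)) = (mu1 X * mu1 Y)%E).
rewrite (_ : (fun x : pt => x + a) @^-1` _ = ((fun x : R => x + a.1) @^-1` X) `*` ((fun x : R => x + a.2) @^-1` Y)) //.
have mp (t : R) : measurable_fun setT (fun x : T1 => (x : R) + t : T1).
  by apply: measurable_funD => //; exact: measurable_id.
rewrite /mu2 /leb2 /= product_measure1E; last 2 first.
- by rewrite -[_ @^-1` _]setTI; apply: mp.
- by rewrite -[_ @^-1` _]setTI; apply: mp.
by congr (_ * _)%E; exact: mu1_shift.
Qed.

Lemma ge0_integral_shift (f : T2 -> \bar R) a : measurable_fun setT f ->
  (forall x, 0 <= f x)%E ->
  (\int[mu2]_x f (x + a)%R = \int[mu2]_x f x)%E.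
Proof.
move=> mf f0.
have := @ge0_integral_pushforward _ _ _ _ R _ (measurable_shift2 a) mu2 setT f
  measurableT mf (fun y _ => f0 y).
rewrite preimage_setT => <-.
apply: eq_measure_integral => [|m A mA _]; first exact: measurable_shift2.
exact: mu2_shift.
Qed.

Lemma meas_shift f a : meas f -> meas (fun x => f (x + a)).
Proof. by move=> mf; apply: measurableT_comp => //; exact: measurable_shift2. Qed.

Lemma itg_shift f a : itg f -> itg (fun x => f (x + a)).
Proof.
move=> fi; have mf := itg_meas fi; apply/integrableP; split.
  by apply/measurable_EFinP; exact: meas_shift.
have := @ge0_integral_shift (fun x => `|(f x)%:E|%E) a; rewrite /= => -> //.
- by have /integrableP[] := fi.
- by apply/measurable_EFinP; exact: meas_norm.
Qed.

Lemma Int_shift f a : itg f -> Int (fun x => f (x + a)) = Int f.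
Proof.
have H g : (forall x, 0 <= g x) -> itg g -> Int (fun x => g (x + a)) = Int g.
  move=> g0 gi; apply: EFin_inj; rewrite -!Int_EFin//; last exact: itg_shift.
  have := @ge0_integral_shift (EFin \o g) a; apply.
  - by apply/measurable_EFinP; exact: itg_meas.
  - by move=> x; rewrite lee_fin.
move=> fi; have ai := itg_norm fi; have pi := itgD ai fi.
have p0 x : 0 <= `|f x| + f x by have := ler_norm (- f x); rewrite normrN; lra.
(* The change of variables is available for nonnegative integrands, and f is the difference of the
   nonnegative functions [|f| + f] and [|f|]. *)
have E (g : pt -> R) : g = (fun x => (`|g x| + g x) - `|g x|).
  by apply/funext => x; rewrite addrC addKr.
rewrite [in RHS](E f) [in LHS](E (fun x => f (x + a))) !IntB//; [|exact: (itg_shift a pi)|exact: (itg_shift a ai)].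
by rewrite (H _ p0 pi) (H (fun x => `|f x|)).
Qed.

Lemma lipschitz_cont (V W : normedModType R) (f : V -> W) (L : R) :
  (forall x y : V, `|f x - f y| <= L * `|x - y|) -> continuous f.
Proof.
move=> h x; apply/cvgrPdist_lt => e e0; apply/nbhs_ballP.
exists (e / (`|L| + 1)) => /=; first by rewrite divr_gt0.
move=> y; rewrite -ball_normE /= ltr_pdivlMr// => xy.
apply: le_lt_trans xy; rewrite (le_trans (h x y))// mulrC ler_wpM2l//.
by rewrite (le_trans (ler_norm _))// lerDl.
Qed.

Lemma vanish_le (B C : R) u : B <= C -> vanish B u -> vanish C u.
Proof. by move=> BC uB x /(le_trans BC) /uB. Qed.

Lemma box0P (B : R) x : box 0 B x <-> `|x| < B.
Proof. by rewrite /box /= subr0. Qed.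

Lemma compact_sqbox (B : R) : compact [set x : pt | `|x| <= B].
Proof.
rewrite (_ : [set _ | _] = `[- B, B]%classic `*` `[- B, B]%classic); last first.
  apply/seteqP; split => x /=; rewrite ler_norm_pair !ler_norml !in_itv /=.
    by move=> /andP[].
  by move=> [-> ->].
by apply: compact_setX; exact: segment_compact.
Qed.

Lemma continuous_compact_bounded A f : compact A -> continuous f ->
  exists2 C, 0 <= C & forall x, A x -> `|f x| <= C.
Proof.
move=> cA cf; have : compact (f @` A).
  by apply: continuous_compact => //; exact: continuous_subspaceT.
move=> /compact_bounded [M [_ hM]]; exists (`|M| + 1); first by rewrite addr_ge0.
move=> x Ax; apply: hM; last by exists x.
by rewrite (le_lt_trans (ler_norm _))// ltrDl.
Qed.

Lemma vanish_bounded (B : R) f : continuous f -> vanish B f ->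
  exists2 C, 0 <= C & forall x, `|f x| <= C.
Proof.
move=> cf fB; have [C C0 hC] := continuous_compact_bounded (compact_sqbox (B := B)) cf.
exists C => // x; have [xB|/ltW xB] := leP `|x| B; first exact: hC.
by rewrite fB// normr0.
Qed.

Lemma vanish_itg (B : R) f : continuous f -> vanish B f -> itg f.
Proof.
move=> cf fB; have [C _ fC] := vanish_bounded cf fB.
apply: (@itg_bounded R f 0 B C) => //; first exact: meas_continuous.
by move=> x /box0P /negP; rewrite -leNgt; exact: fB.
Qed.

Lemma vanishM (B : R) f g : vanish B f -> vanish B (fun x => f x * g x).
Proof. by move=> fB x /fB ->; rewrite mul0r. Qed.

Lemma vanish_sqi (B : R) f : continuous f -> vanish B f -> sqi f.
Proof.
move=> cf fB; split; first exact: meas_continuous.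
apply: (@vanish_itg B); first by move=> x; apply: cvgM; exact: cf.
by move=> x /fB ->; rewrite expr0n.
Qed.

Lemma derive_zero_near f x (v : pt) : (\forall y \near x, f y = 0) -> 'D_v f x = 0.
Proof.
move=> fx; rewrite (near_eq_derive v (g := cst 0)) ?derive_cst//.
Qed.

Lemma vanish_derive (B : R) u (v : pt) : vanish B u -> vanish (B + 1) ('D_v u).
Proof.
move=> uB x xB; apply: derive_zero_near.
apply/nbhs_ballP; exists 1 => //= y; rewrite -ball_normE /= => xy; apply: uB.
have := ler_normD (x - y) y; rewrite subrK; lra.
Qed.

Lemma derivable_slice1 u (t s : R) : derivable u (t, s) (1, 0) ->
  is_derive t 1 (fun r => u (r, s)) (dx1 u (t, s)).
Proof.
move=> du; have E (h : R) : u (h *: (1, 0) + (t, s)) = u (h *: 1 + t, s).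
  have -> : h *: ((1, 0) : pt) + (t, s) = (h * 1 + t, h * 0 + s) by [].
  by rewrite mulr0 add0r.
split; first by move: du; rewrite /derivable /=; under eq_fun do rewrite E.
by rewrite /dx1 /derive; apply: (congr1 (fun g : R -> R => lim (g h @[h --> 0^']))); apply/funext => h /=; rewrite E.
Qed.

Lemma derivable_slice2 u (t s : R) : derivable u (t, s) (0, 1) ->
  is_derive s 1 (fun r => u (t, r)) (dx2 u (t, s)).
Proof.
move=> du; have E (h : R) : u (h *: (0, 1) + (t, s)) = u (t, h *: 1 + s).
  have -> : h *: ((0, 1) : pt) + (t, s) = (h * 0 + t, h * 1 + s) by [].
  by rewrite mulr0 add0r.
split; first by move: du; rewrite /derivable /=; under eq_fun do rewrite E.
by rewrite /dx2 /derive; apply: (congr1 (fun g : R -> R => lim (g h @[h --> 0^']))); apply/funext => h /=; rewrite E.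
Qed.

Lemma is_derive_FTC2 (F f : R -> R) (p q : R) : p <= q ->
  (forall t, p <= t <= q -> is_derive t 1 F (f t)) ->
  {within `[p, q], continuous f} ->
  (\int[mu1]_(t in `[p, q]) (f t)%:E = (F q - F p)%:E)%E.
Proof.
rewrite le_eqVlt => /predU1P[<-{q} _ _|pq dF cf].
  by rewrite set_itv1 /mu1 integral_set1 subrr.
have cF t : p <= t <= q -> {for t, continuous F}.
  by move=> /dF [/derivable1_diffP/differentiable_continuous].
rewrite /mu1 (@continuous_FTC2 R f F)//.
- split.
  + by move=> t; rewrite in_itv /= => /andP[? ?]; have [] := dF t; rewrite ?ltW.
  + by apply: cvg_at_right_filter; apply: cF; rewrite lexx ltW.
  + by apply: cvg_at_left_filter; apply: cF; rewrite lexx ltW.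
- move=> t; rewrite in_itv /= => /andP[? ?]; rewrite derive1E.
  by apply: (@derive_val _ _ _ t 1 F (f t) (dF t _)); rewrite !ltW.
Qed.

Lemma continuous_slice1 f (s : R) : continuous f -> continuous (fun r : R => f (r, s)).
Proof.
move=> cf t; apply: (@continuous_comp _ _ _ (fun r : R => (r, s)) f); last exact: cf.
apply: (lipschitz_cont (L := 1)) => x y; rewrite mul1r prod_normE /= subrr normr0.
by rewrite ge_max lexx normr_ge0.
Qed.

Lemma continuous_slice2 f (t : R) : continuous f -> continuous (fun r : R => f (t, r)).
Proof.
move=> cf s; apply: (@continuous_comp _ _ _ (fun r : R => (t, r)) f); last exact: cf.
apply: (lipschitz_cont (L := 1)) => x y; rewrite mul1r prod_normE /= subrr normr0.
by rewrite ge_max lexx normr_ge0.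
Qed.

Lemma slice1_FTC u (s p q : R) : p <= q ->
  (forall x, derivable u x (1, 0)) -> continuous (dx1 u) ->
  (\int[mu1]_(t in `[p, q]) (dx1 u (t, s))%:E = (u (q, s) - u (p, s))%:E)%E.
Proof.
move=> pq du cu; apply: (is_derive_FTC2 (F := fun r => u (r, s))) => //.
- by move=> t _; exact: derivable_slice1.
- by apply: continuous_subspaceT; exact: continuous_slice1.
Qed.

Lemma slice2_FTC u (t p q : R) : p <= q ->
  (forall x, derivable u x (0, 1)) -> continuous (dx2 u) ->
  (\int[mu1]_(s in `[p, q]) (dx2 u (t, s))%:E = (u (t, q) - u (t, p))%:E)%E.
Proof.
move=> pq du cu; apply: (is_derive_FTC2 (F := fun r => u (t, r))) => //.
- by move=> s _; exact: derivable_slice2.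
- by apply: continuous_subspaceT; exact: continuous_slice2.
Qed.

Lemma Int_fubini1 f : itg f ->
  ((Int f)%:E = \int[mu1]_s \int[mu1]_t (f (t, s))%:E)%E.
Proof.
move=> fi; rewrite -(Int_EFin fi).
by rewrite -[LHS](@integral21_prod_meas1 _ _ T1 T1 R (@mu1 R) (@mu1 R) (EFin \o f)).
Qed.

Lemma Int_fubini2 f : itg f ->
  ((Int f)%:E = \int[mu1]_t \int[mu1]_s (f (t, s))%:E)%E.
Proof.
move=> fi; rewrite -(Int_EFin fi).
by rewrite -[LHS](@integral12_prod_meas1 _ _ T1 T1 R (@mu1 R) (@mu1 R) (EFin \o f)).
Qed.

Lemma integral_itv_support (f : R -> R) (p q : R) :
  (forall t, ~~ (p <= t <= q) -> f t = 0) ->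
  (\int[mu1]_t (f t)%:E = \int[mu1]_(t in `[p, q]) (f t)%:E)%E.
Proof.
move=> f0; rewrite [RHS]integral_mkcond; apply: eq_integral => t _.
rewrite patchE; case: ifPn => //; rewrite notin_setE /= in_itv /= => /negP /f0 ->.
by [].
Qed.

Lemma Int_dx1 (B : R) u : (forall x, derivable u x (1, 0)) -> continuous (dx1 u) ->
  vanish B u -> Int (dx1 u) = 0.
Proof.
move=> du cu uB; have vB := vanish_derive (1, 0) uB.
apply: EFin_inj; rewrite Int_fubini1; last exact: vanish_itg cu vB.
(* The sign of B is unrestricted; when B + 1 is negative the derivative vanishes identically. *)
apply: integral0_eq => s _; have [B0|B0] := leP 0 (B + 1).
  rewrite (integral_itv_support (p := - (B + 1)) (q := B + 1)).
    rewrite slice1_FTC//; last by lra.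
    rewrite !uB ?subrr//; rewrite prod_normE /= le_max ?normrN; apply/orP; left.
      by rewrite ger0_norm//; lra.
    by rewrite ger0_norm//; lra.
  move=> t; rewrite -ler_norml -ltNge => /ltW tB; apply: vB.
  by rewrite prod_normE /= le_max tB.
apply: integral0_eq => t _; congr EFin; apply: vB.
by rewrite (le_trans (ltW B0)).
Qed.

Lemma Int_dx2 (B : R) u : (forall x, derivable u x (0, 1)) -> continuous (dx2 u) ->
  vanish B u -> Int (dx2 u) = 0.
Proof.
move=> du cu uB; have vB := vanish_derive (0, 1) uB.
apply: EFin_inj; rewrite Int_fubini2; last exact: vanish_itg cu vB.
apply: integral0_eq => s _; have [B0|B0] := leP 0 (B + 1).
  rewrite (integral_itv_support (p := - (B + 1)) (q := B + 1)).
    rewrite slice2_FTC//; last by lra.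
    rewrite !uB ?subrr//; rewrite prod_normE /= le_max ?normrN; apply/orP; right.
      by rewrite ger0_norm//; lra.
    by rewrite ger0_norm//; lra.
  move=> t; rewrite -ler_norml -ltNge => /ltW tB; apply: vB.
  by rewrite prod_normE /= le_max tB orbT.
apply: integral0_eq => t _; congr EFin; apply: vB.
by rewrite (le_trans (ltW B0)).
Qed.

Lemma dx1M u v x : derivable u x (1, 0) -> derivable v x (1, 0) ->
  dx1 (fun y => u y * v y) x = dx1 u x * v x + u x * dx1 v x.
Proof.
move=> du dv; rewrite /dx1.
have -> : 'D_(1, 0) (fun y => u y * v y) x = u x * 'D_(1, 0) v x + v x * 'D_(1, 0) u x.
  exact: deriveM du dv.
by rewrite addrC mulrC.
Qed.

Lemma dx2M u v x : derivable u x (0, 1) -> derivable v x (0, 1) ->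
  dx2 (fun y => u y * v y) x = dx2 u x * v x + u x * dx2 v x.
Proof.
move=> du dv; rewrite /dx2.
have -> : 'D_(0, 1) (fun y => u y * v y) x = u x * 'D_(0, 1) v x + v x * 'D_(0, 1) u x.
  exact: deriveM du dv.
by rewrite addrC mulrC.
Qed.

Lemma c1M u v : c1 u -> c1 v -> c1 (fun x => u x * v x).
Proof.
move=> [cu du1 cu1 du2 cu2] [cv dv1 cv1 dv2 cv2]; split.
- by move=> x; apply: cvgM; [exact: cu|exact: cv].
- by move=> x; apply: derivableM.
- rewrite (_ : dx1 _ = (fun x => dx1 u x * v x + u x * dx1 v x)).
    by move=> x; apply: cvgD; apply: cvgM;
      [exact: cu1|exact: cv|exact: cu|exact: cv1].
  by apply/funext => x; exact: dx1M.
- by move=> x; apply: derivableM.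
- rewrite (_ : dx2 _ = (fun x => dx2 u x * v x + u x * dx2 v x)).
    by move=> x; apply: cvgD; apply: cvgM;
      [exact: cu2|exact: cv|exact: cu|exact: cv2].
  by apply/funext => x; exact: dx2M.
Qed.

Lemma Int_parts1 (B : R) u v : c1 u -> c1 v -> vanish B v ->
  Int (fun x => dx1 u x * v x) = - Int (fun x => u x * dx1 v x).
Proof.
move=> cu cv vB; have [cuv duv cuv1 _ _] := c1M cu cv.
have uvB : vanish B (fun x => u x * v x) by move=> x /vB ->; rewrite mulr0.
have := Int_dx1 duv cuv1 uvB.
have [cu0 du1 cu1 _ _] := cu; have [cv0 dv1 cv1 _ _] := cv.
rewrite (_ : dx1 _ = (fun x => dx1 u x * v x + u x * dx1 v x)); last first.
  by apply/funext => x; exact: dx1M.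
rewrite IntD => [/eqP||]; first by rewrite addr_eq0 => /eqP.
- apply: (@vanish_itg B); last by move=> x /vB ->; rewrite mulr0.
  by move=> x; apply: cvgM; [exact: cu1|exact: cv0].
- apply: (@vanish_itg (B + 1)); last first.
    by move=> x xB; rewrite /dx1 (vanish_derive (1, 0) vB)// mulr0.
  by move=> x; apply: cvgM; [exact: cu0|exact: cv1].
Qed.

Lemma Int_parts2 (B : R) u v : c1 u -> c1 v -> vanish B v ->
  Int (fun x => dx2 u x * v x) = - Int (fun x => u x * dx2 v x).
Proof.
move=> cu cv vB; have [cuv _ _ duv cuv1] := c1M cu cv.
have uvB : vanish B (fun x => u x * v x) by move=> x /vB ->; rewrite mulr0.
have := Int_dx2 duv cuv1 uvB.
have [cu0 _ _ du1 cu1] := cu; have [cv0 _ _ dv1 cv1] := cv.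
rewrite (_ : dx2 _ = (fun x => dx2 u x * v x + u x * dx2 v x)); last first.
  by apply/funext => x; exact: dx2M.
rewrite IntD => [/eqP||]; first by rewrite addr_eq0 => /eqP.
- apply: (@vanish_itg B); last by move=> x /vB ->; rewrite mulr0.
  by move=> x; apply: cvgM; [exact: cu1|exact: cv0].
- apply: (@vanish_itg (B + 1)); last first.
    by move=> x xB; rewrite /dx2 (vanish_derive (0, 1) vB)// mulr0.
  by move=> x; apply: cvgM; [exact: cu0|exact: cv1].
Qed.

End Calculus.

(** * Smooth functions and test functions *)

(** The power of 1 / t is a parameter because the family is then closed under differentiation: the
    derivative of a member is a combination of two others. The member n = 0 is the classical flat
    function exp(-1/t). *)
Definition flat {R : realType} (n : nat) (t : R) : R :=
  if 0 < t then t^-1 ^+ n * expR (- t^-1) else 0.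

(* A class of explicit C^oo functions on the plane, closed under d/dx1, d/dx2. *)
Inductive sm {R : realType} : (R * R -> R) -> Prop :=
| sm_cst (c : R) : sm (fun=> c)
| sm_fst : sm (fun x => x.1)
| sm_snd : sm (fun x => x.2)
| sm_add f g : sm f -> sm g -> sm (fun x => f x + g x)
| sm_mul f g : sm f -> sm g -> sm (fun x => f x * g x)
| sm_inv f : (forall x, f x != 0) -> sm f -> sm (fun x => (f x)^-1)
| sm_ln f : (forall x, 0 < f x) -> sm f -> sm (fun x => ln (f x))
| sm_flat n f : sm f -> sm (fun x => flat n (f x)).
Arguments sm_add {R f g} _ _.
Arguments sm_mul {R f g} _ _.
Arguments sm_inv {R f} _ _.
Arguments sm_ln {R f} _ _.
Arguments sm_flat {R} n {f} _.

Section Smooth.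
Set Implicit Arguments.
Unset Strict Implicit.
Context {R : realType}.
Notation pt := (R * R)%type.
Implicit Types (f g u v : pt -> R) (A D : set pt) (a x y : pt).

Lemma flat_ge0 n (t : R) : 0 <= flat n t.
Proof.
rewrite /flat; case: ifP => // t0.
by rewrite mulr_ge0 ?expR_ge0// exprn_ge0// invr_ge0 ltW.
Qed.

(** The exponential of 1 / t dominates the term of order n + 2 of its series. The quadratic rate
    makes the difference quotient at 0 tend to 0. *)
Lemma flat_le n : exists2 C : R, 0 <= C & forall t : R, `|flat n t| <= C * t ^+ 2.
Proof.
exists n.+2`!%:R => [|t]; first exact: ler0n.
rewrite ger0_norm ?flat_ge0// /flat; case: ifP => [t0|_]; last first.
  by rewrite mulr_ge0 ?sqr_ge0.
have := @expR_ge1Dxn R t^-1 n.+1; rewrite invr_ge0 => /(_ (ltW t0)) h.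
rewrite expRN ler_pdivrMr ?expR_gt0//.
apply: (@le_trans _ _ (n.+2`!%:R * t ^+ 2 * (t^-1 ^+ n.+2 / n.+2`!%:R))); last first.
  by apply: ler_wpM2l; [rewrite mulr_ge0 ?sqr_ge0|rewrite (le_trans _ h)// lerDr].
have N0 : n.+2`!%:R != 0 :> R by rewrite pnatr_eq0 gtn_eqF ?fact_gt0.
move: N0; set N := n.+2`!%:R => N0.
rewrite (_ : N * t ^+ 2 * (t^-1 ^+ n.+2 / N) = t^-1 ^+ n.+2 * t ^+ 2); last by field.
by rewrite -[n.+2]addn2 exprD -mulrA -exprMn mulVf ?gt_eqF// expr1n mulr1.
Qed.

Lemma is_derive_inv (t : R) : t != 0 -> is_derive t 1 (@GRing.inv R) (- t ^- 2).
Proof.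
move=> t0; apply: is_derive_eq (@is_deriveV R id t 1 1 t0 (is_derive_id t 1)) _.
by rewrite [_ *: 1]mulr1.
Qed.

Lemma is_derive_invN2 (t : R) : t != 0 ->
  is_derive t 1 (fun s : R => - s ^- 2) (2 * t ^- 3).
Proof.
move=> t0; have h2 := is_deriveN (is_deriveX 2 (is_derive_inv t0)).
rewrite (_ : (fun s : R => _) = - (@GRing.inv R) ^+ 2); last first.
  by apply/funext => s; rewrite opprfctE exprfctE exprVn.
apply: is_derive_eq h2 _; rewrite [_ *: _]mulrC /= expr1.
by rewrite mulNr opprK -!exprVn; ring.
Qed.

Lemma is_derive_flat n (t : R) :
  is_derive t 1 (flat n) (flat n.+2 t - n%:R * flat n.+1 t).
Proof.
have [t0|t0|->] := ltgtP t 0.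
- rewrite {2 3}/flat ltNge (ltW t0) /= mulr0 subrr.
  apply: (@near_eq_is_derive _ _ _ (cst 0) (flat n)) => //.
  apply/nbhs_ballP; exists (- t); first by rewrite /= oppr_gt0.
  move=> s; rewrite -ball_normE /= ltr_norml => /andP[s1 s2].
  by rewrite /flat ltNge (_ : s <= 0)//; lra.
- have d1 : is_derive t 1 (fun s : R => s^-1 ^+ n * expR (- s^-1))
     (t^-1 ^+ n.+2 * expR (- t^-1) - n%:R * (t^-1 ^+ n.+1 * expR (- t^-1))).
    have dV : is_derive t 1 (fun s : R => s^-1) (- t ^- 2).
      by apply: is_derive_inv; rewrite gt_eqF.
    have dX := @is_deriveX R R (fun s : R => s^-1) n t 1 _ dV.
    have dE := @is_derive1_comp R expR (fun s => - s^-1) t _ _ (is_derive_expR _) (is_deriveN dV).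
    rewrite (_ : (fun s : R => _) =
      ((fun s : R => s^-1) ^+ n) * (expR \o (fun s : R => - s^-1))); last first.
      by apply/funext => s; rewrite /= mulrfctE exprfctE.
    apply: is_derive_eq (is_deriveM dX dE) _ => /=; rewrite exprfctE.
    rewrite opprK -!exprVn ![_ *: _]mulrC; case: (n) => [|m] /=.
      by rewrite expr0; ring.
    by rewrite !exprS; ring.
  rewrite {2 3}/flat t0; apply: (@near_eq_is_derive _ _ _ (fun s : R => s^-1 ^+ n * expR (- s^-1)) (flat n)) => //.
  apply/nbhs_ballP; exists t => // s; rewrite -ball_normE /= ltr_norml => /andP[s1 s2].
  by rewrite /flat (_ : 0 < s)//; lra.
- rewrite {2 3}/flat ltxx mulr0 subrr; have [C C0 hC] := flat_le n.
  have h : (h^-1 *: (flat n (h *: 1 + 0) - flat n 0) : R) @[h --> 0^'] --> (0 : R).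
    apply/cvgr0Pnorm_le => e e0; near=> h.
    have hn0 : h != 0 by near: h; exact: nbhs_dnbhs_neq.
    rewrite addr0 {2}/flat ltxx subr0 normrZ normfV ler_pdivrMl ?normr_gt0//.
    have hC1 : `|h| < e / (C + 1).
      by near: h; apply: dnbhs0_lt; rewrite divr_gt0// ltr_wpDl.
    rewrite [h *: 1]mulr1 (le_trans (hC h))// -real_normK ?num_real// expr2 mulrCA ler_wpM2l//.
    move: hC1; rewrite ltr_pdivlMr ?ltr_wpDl// => /ltW; apply: le_trans.
    by rewrite mulrC ler_wpM2l// lerDl.
  by split; [apply/cvg_ex; exists 0|exact: cvg_lim h].
Unshelve. all: by end_near. Qed.

Lemma derive_comp1 (F : R -> R) (F' : R) f x (v : pt) : differentiable f x ->
  is_derive (f x) 1 F F' ->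
  differentiable (fun y => F (f y)) x /\ 'D_v (fun y => F (f y)) x = F' * 'D_v f x.
Proof.
move=> df [/derivable1_diffP dF F'E].
split; first exact: differentiable_comp df dF.
rewrite deriveE; last exact: differentiable_comp df dF.
rewrite (diff_comp df dF) /= diff1E//= derive1E F'E -deriveE//.
by rewrite [_ *: _]mulrC.
Qed.

Lemma differentiable_fst x : differentiable (fun y : pt => y.1) x.
Proof.
exact: (@linear_differentiable R (R^o * R^o)%type R^o (@fst R^o R^o) x (fun y => cvg_fst)).
Qed.

Lemma differentiable_snd x : differentiable (fun y : pt => y.2) x.
Proof.
exact: (@linear_differentiable R (R^o * R^o)%type R^o (@snd R^o R^o) x (fun y => cvg_snd)).
Qed.

Lemma derive_fst x (v : pt) : 'D_v (fun y : pt => y.1) x = v.1.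
Proof.
rewrite deriveE; last exact: differentiable_fst.
have := @diff_lin R (R^o * R^o)%type R^o (@fst R^o R^o) x (fun y => cvg_fst).
by move=> ->.
Qed.

Lemma derive_snd x (v : pt) : 'D_v (fun y : pt => y.2) x = v.2.
Proof.
rewrite deriveE; last exact: differentiable_snd.
have := @diff_lin R (R^o * R^o)%type R^o (@snd R^o R^o) x (fun y => cvg_snd).
by move=> ->.
Qed.

(** Induction on the expression. The three claims go together because every rule of differentiation
    asks for differentiability of the parts. The chain rule [com] covers the unary constructors: the
    derivative of F at g has to be again an expression of the class. *)
Lemma sm_differentiable_dx f : sm f ->
  [/\ forall x, differentiable f x, sm (dx1 f) & sm (dx2 f)].
Proof.
have com (F : R -> R) (g G : pt -> R) : (forall x, differentiable g x) -> sm G ->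
    sm (dx1 g) -> sm (dx2 g) -> (forall x, is_derive (g x) 1 F (G x)) ->
    [/\ forall x, differentiable (fun y => F (g y)) x, sm (dx1 (fun y => F (g y)))
       & sm (dx2 (fun y => F (g y)))].
  move=> dg sG s1 s2 dF; split.
  - by move=> x; have [] := derive_comp1 0 (dg x) (dF x).
  - rewrite (_ : dx1 _ = (fun x => G x * dx1 g x)); first exact: sm_mul.
    by apply/funext => x; have [] := derive_comp1 (1, 0) (dg x) (dF x).
  - rewrite (_ : dx2 _ = (fun x => G x * dx2 g x)); first exact: sm_mul.
    by apply/funext => x; have [] := derive_comp1 (0, 1) (dg x) (dF x).
elim=> {f} [c| | |f g sf [df f1 f2] sg [dg g1 g2]|f g sf [df f1 f2] sg [dg g1 g2]
  |f f0 sf [df f1 f2]|f f0 sf [df f1 f2]|n f sf [df f1 f2]].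
- split => //; [rewrite (_ : dx1 _ = fun=> 0)|rewrite (_ : dx2 _ = fun=> 0)];
    try exact: sm_cst; by apply/funext => x; rewrite /dx1 /dx2 derive_cst.
- split; [exact: differentiable_fst|rewrite (_ : dx1 _ = fun=> 1)
    |rewrite (_ : dx2 _ = fun=> 0)];
    try exact: sm_cst; by apply/funext => x; rewrite /dx1 /dx2 derive_fst.
- split; [exact: differentiable_snd|rewrite (_ : dx1 _ = fun=> 0)
    |rewrite (_ : dx2 _ = fun=> 1)];
    try exact: sm_cst; by apply/funext => x; rewrite /dx1 /dx2 derive_snd.
- split; first by move=> x; exact: differentiableD.
  + rewrite (_ : dx1 _ = (fun x => dx1 f x + dx1 g x)); first exact: sm_add.
    by apply/funext => x; apply: deriveD; apply: diff_derivable.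
  + rewrite (_ : dx2 _ = (fun x => dx2 f x + dx2 g x)); first exact: sm_add.
    by apply/funext => x; apply: deriveD; apply: diff_derivable.
- split; first by move=> x; exact: differentiableM.
  + rewrite (_ : dx1 _ = (fun x => dx1 f x * g x + f x * dx1 g x)).
      by apply: sm_add; apply: sm_mul.
    by apply/funext => x; apply: dx1M; apply: diff_derivable.
  + rewrite (_ : dx2 _ = (fun x => dx2 f x * g x + f x * dx2 g x)).
      by apply: sm_add; apply: sm_mul.
    by apply/funext => x; apply: dx2M; apply: diff_derivable.
- apply: (com _ f (fun x => -1 * ((f x)^-1 * (f x)^-1))) => //.
    by apply: sm_mul; [exact: sm_cst|apply: sm_mul; apply: sm_inv].
  move=> x; apply: is_derive_eq (is_derive_inv (f0 x)) _.
  by rewrite mulN1r -exprVn expr2.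
- apply: (com _ f (fun x => (f x)^-1)) => //.
    by apply: sm_inv => // x; rewrite gt_eqF.
  by move=> x; exact: is_derive1_ln.
- apply: (com _ f (fun x => flat n.+2 (f x) + - n%:R * flat n.+1 (f x))) => //.
    by apply: sm_add; [|apply: sm_mul; [exact: sm_cst|]]; exact: sm_flat.
  by move=> x; rewrite mulNr; exact: is_derive_flat.
Qed.

Lemma sm_dx1 f : sm f -> sm (dx1 f).
Proof. by move=> /sm_differentiable_dx[]. Qed.

Lemma sm_dx2 f : sm f -> sm (dx2 f).
Proof. by move=> /sm_differentiable_dx[]. Qed.

Lemma sm_differentiable f x : sm f -> differentiable f x.
Proof. by move=> /sm_differentiable_dx[]. Qed.

Lemma sm_derivable f x (v : pt) : sm f -> derivable f x v.
Proof. by move=> sf; apply: diff_derivable; exact: sm_differentiable. Qed.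

Lemma sm_continuous f : sm f -> continuous f.
Proof. by move=> sf x; apply: differentiable_continuous; exact: sm_differentiable. Qed.

Lemma sm_c1 f : sm f -> c1 f.
Proof.
move=> sf; split; [exact: sm_continuous|by move=> x; exact: sm_derivable| |
  by move=> x; exact: sm_derivable|].
- exact/sm_continuous/sm_dx1.
- exact/sm_continuous/sm_dx2.
Qed.

Lemma sm_Cn n f : sm f -> Cn n f.
Proof.
elim: n f => [|n IHn] f sf /=; first exact: sm_continuous.
split; first by move=> x; split; exact: sm_derivable.
by split; apply: IHn; [exact: sm_dx1|exact: sm_dx2].
Qed.

Lemma sm_opp f : sm f -> sm (fun x => - f x).
Proof.
move=> sf; rewrite (_ : (fun x => - f x) = (fun x => -1 * f x)).
  by apply: sm_mul => //; exact: sm_cst.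
by apply/funext => x; rewrite mulN1r.
Qed.

Lemma sm_sub f g : sm f -> sm g -> sm (fun x => f x - g x).
Proof. by move=> sf sg; apply: sm_add => //; exact: sm_opp. Qed.

Lemma sm_comp2 f g h : sm f -> sm g -> sm h -> sm (fun x => f (g x, h x)).
Proof.
move=> sf sg sh; elim: sf => //=.
- by move=> c; exact: sm_cst.
- by move=> f1 f2 _ ? _ ?; exact: sm_add.
- by move=> f1 f2 _ ? _ ?; exact: sm_mul.
- by move=> f1 f0 _ s1; apply: sm_inv.
- by move=> f1 f0 _ s1; apply: sm_ln.
- by move=> n f1 _ s1; apply: sm_flat.
Qed.

Lemma sm_affine f (c : R) a : sm f -> sm (fun x => f (c *: (x - a))).
Proof.
move=> sf; rewrite (_ : (fun x => _) = (fun x : pt => f (c * (x.1 - a.1), c * (x.2 - a.2))))//.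
by apply: sm_comp2 => //; (apply: sm_mul; [exact: sm_cst|apply: sm_sub]);
  try exact: sm_cst; [exact: sm_fst|exact: sm_snd].
Qed.

Lemma derive_sm f x (v : pt) : sm f -> 'D_v f x = v.1 * dx1 f x + v.2 * dx2 f x.
Proof.
move=> sf; have df := sm_differentiable x sf; rewrite /dx1 /dx2 !deriveE//.
rewrite {1}(_ : v = v.1 *: ((1, 0) : pt) + v.2 *: ((0, 1) : pt)).
  by rewrite linearD !linearZ.
case: v => v1 v2; have -> : v1 *: ((1, 0) : pt) + v2 *: ((0, 1) : pt) =
  (v1 * 1 + v2 * 0, v1 * 0 + v2 * 1) by [].
by rewrite !mulr1 !mulr0 addr0 add0r.
Qed.

Lemma derive_affine f (c : R) a x (v : pt) : sm f ->
  'D_v (fun y => f (c *: (y - a))) x = c * 'D_v f (c *: (x - a)).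
Proof.
move=> sf; transitivity ('D_(c *: v) f (c *: (x - a))); last first.
  by rewrite !derive_sm//= mulrDr !mulrA.
apply: (congr1 (fun g : R -> R => lim (g h @[h --> 0^']))); apply/funext => h /=.
have -> : c *: (h *: v + x - a) = h *: (c *: v) + c *: (x - a); last by [].
by rewrite -addrA scalerDr !scalerA mulrC.
Qed.

(** Schwarz's theorem without second-order analysis: for F(g) both mixed derivatives equal F''(g)
    g_1 g_2 + F'(g) g_12, and sums and products behave alike, so symmetry propagates through the
    expression. *)
Lemma dx12_sm f : sm f -> dx1 (dx2 f) = dx2 (dx1 f).
Proof.
have com (F F' F'' : R -> R) (g : pt -> R) : sm g ->
    (forall x, is_derive (g x) 1 F (F' (g x))) ->
    (forall x, is_derive (g x) 1 F' (F'' (g x))) ->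
    dx1 (dx2 g) = dx2 (dx1 g) ->
    dx1 (dx2 (fun y => F (g y))) = dx2 (dx1 (fun y => F (g y))).
  move=> sg dF dF' E.
  have d1 x : dx1 (fun y => F (g y)) x = F' (g x) * dx1 g x.
    by have [] := derive_comp1 (1, 0) (sm_differentiable x sg) (dF x).
  have d2 x : dx2 (fun y => F (g y)) x = F' (g x) * dx2 g x.
    by have [] := derive_comp1 (0, 1) (sm_differentiable x sg) (dF x).
  have h11 x : differentiable (fun y => F' (g y)) x.
    exact: (derive_comp1 0 (sm_differentiable x sg) (dF' x)).1.
  rewrite (funext d1) (funext d2); apply/funext => x.
  rewrite dx1M ?dx2M; [|exact: diff_derivable|exact/sm_derivable/sm_dx1|
    exact: diff_derivable|exact/sm_derivable/sm_dx2].
  have -> : dx1 (fun y => F' (g y)) x = F'' (g x) * dx1 g x.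
    by have [] := derive_comp1 (1, 0) (sm_differentiable x sg) (dF' x).
  have -> : dx2 (fun y => F' (g y)) x = F'' (g x) * dx2 g x.
    by have [] := derive_comp1 (0, 1) (sm_differentiable x sg) (dF' x).
  by rewrite E; ring.
have D1 g h : sm g -> sm h -> dx1 (fun y => g y + h y) = (fun y => dx1 g y + dx1 h y).
  by move=> sg sh; apply/funext => x; apply: deriveD; exact: sm_derivable.
have D2 g h : sm g -> sm h -> dx2 (fun y => g y + h y) = (fun y => dx2 g y + dx2 h y).
  by move=> sg sh; apply/funext => x; apply: deriveD; exact: sm_derivable.
have M1 g h : sm g -> sm h -> dx1 (fun y => g y * h y) = (fun y => dx1 g y * h y + g y * dx1 h y).
  by move=> sg sh; apply/funext => x; apply: dx1M; exact: sm_derivable.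
have M2 g h : sm g -> sm h -> dx2 (fun y => g y * h y) = (fun y => dx2 g y * h y + g y * dx2 h y).
  by move=> sg sh; apply/funext => x; apply: dx2M; exact: sm_derivable.
have dc (c : R) : dx1 (fun=> c) = (fun=> 0) /\ dx2 (fun=> c) = (fun=> 0).
  by split; apply/funext => x; rewrite /dx1 /dx2 derive_cst.
elim=> {f} [c| | |f g sf IHf sg IHg|f g sf IHf sg IHg|f f0 sf IHf|f f0 sf IHf|n f sf IHf].
- by rewrite (dc c).1 (dc c).2 (dc 0).1 (dc 0).2.
- rewrite (_ : dx1 (fun x : pt => x.1) = fun=> 1).
    rewrite (_ : dx2 (fun x : pt => x.1) = fun=> 0); first by rewrite (dc 0).1 (dc 1).2.
    by apply/funext => x; rewrite /dx2 derive_fst.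
  by apply/funext => x; rewrite /dx1 derive_fst.
- rewrite (_ : dx1 (fun x : pt => x.2) = fun=> 0).
    rewrite (_ : dx2 (fun x : pt => x.2) = fun=> 1); first by rewrite (dc 1).1 (dc 0).2.
    by apply/funext => x; rewrite /dx2 derive_snd.
  by apply/funext => x; rewrite /dx1 derive_snd.
- rewrite (D2 _ _ sf sg) (D1 _ _ (sm_dx2 sf) (sm_dx2 sg)).
  by rewrite (D1 _ _ sf sg) (D2 _ _ (sm_dx1 sf) (sm_dx1 sg)) IHf IHg.
- rewrite (M2 _ _ sf sg) (D1 _ _ (sm_mul (sm_dx2 sf) sg) (sm_mul sf (sm_dx2 sg))).
  rewrite (M1 _ _ (sm_dx2 sf) sg) (M1 _ _ sf (sm_dx2 sg)).
  rewrite (M1 _ _ sf sg) (D2 _ _ (sm_mul (sm_dx1 sf) sg) (sm_mul sf (sm_dx1 sg))).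
  rewrite (M2 _ _ (sm_dx1 sf) sg) (M2 _ _ sf (sm_dx1 sg)) IHf IHg.
  apply/funext => x; move: (f x) (g x) (dx1 f x) (dx2 f x) (dx1 g x) (dx2 g x).
  by move: (dx2 (dx1 f) x) (dx2 (dx1 g) x) => *; ring.
- apply: (com (@GRing.inv R) (fun t => - t ^- 2) (fun t => 2 * t ^- 3) f sf _ _ IHf).
  + by move=> x; exact: is_derive_inv.
  + by move=> x; exact: is_derive_invN2.
- apply: (com (@ln R) (@GRing.inv R) (fun t => - t ^- 2) f sf _ _ IHf).
  + by move=> x; exact: is_derive1_ln.
  + by move=> x; apply: is_derive_inv; rewrite gt_eqF.
- apply: (com (flat n) (fun t => flat n.+2 t - n%:R * flat n.+1 t)
    (fun t => (flat n.+4 t - n.+2%:R * flat n.+3 t) -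
       n%:R * (flat n.+3 t - n.+1%:R * flat n.+2 t)) f sf _ _ IHf).
  + by move=> x; exact: is_derive_flat.
  + move=> x; have h1 := is_derive_flat n.+2 (f x); have h2 := is_derive_flat n.+1 (f x).
    exact: (is_deriveB h1 (is_deriveZ n%:R h2)).
Qed.

End Smooth.

(** * Test functions and the fundamental lemma of the calculus of variations *)

Definition step {R : realType} (t : R) : R := flat 0 t / (flat 0 t + flat 0 (1 - t)).

(** K is any compact set outside which phi vanishes, not the closed support, so that sums and
    derivatives need no computation of supports. [tst_test_fun] links the class to the test
    functions of the definitions. *)
Definition tst {R : realType} (D : set (R * R)) (phi : R * R -> R) : Prop :=
  sm phi /\ exists K, [/\ compact K, K `<=` D & forall x, ~ K x -> phi x = 0].

Section TestFunctions.
Set Implicit Arguments.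
Unset Strict Implicit.
Context {R : realType}.
Notation pt := (R * R)%type.
Notation T1 := (measurableTypeR R).
Notation T2 := (T1 * T1)%type.
Implicit Types (f g h phi : pt -> R) (A D K : set pt) (a x y : pt).

Lemma flat_gt0 n (t : R) : 0 < t -> 0 < flat n t.
Proof. by move=> t0; rewrite /flat t0 mulr_gt0 ?expR_gt0// exprn_gt0 ?invr_gt0. Qed.

Lemma flat_le0 n (t : R) : t <= 0 -> flat n t = 0.
Proof. by rewrite leNgt /flat => /negbTE ->. Qed.

Lemma step_den_gt0 (t : R) : 0 < flat 0 t + flat 0 (1 - t).
Proof.
have [t0|t0] := ltP 0 t; first by rewrite ltr_pwDl ?flat_ge0 ?flat_gt0.
by rewrite ltr_wpDl ?flat_ge0 ?flat_gt0//; lra.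
Qed.

Lemma step_le0 (t : R) : t <= 0 -> step t = 0.
Proof. by move=> t0; rewrite /step flat_le0// mul0r. Qed.

Lemma step_ge1 (t : R) : 1 <= t -> step t = 1.
Proof.
move=> t1; rewrite /step (@flat_le0 0 (1 - t)) ?subr_le0// addr0 divff// gt_eqF//.
by rewrite flat_gt0// (lt_le_trans _ t1).
Qed.

Lemma step_ge0 (t : R) : 0 <= step t.
Proof. by rewrite /step divr_ge0 ?flat_ge0// ltW ?step_den_gt0. Qed.

Lemma step_le1 (t : R) : step t <= 1.
Proof. by rewrite /step ler_pdivrMr ?step_den_gt0// mul1r lerDl flat_ge0. Qed.

Lemma sm_step f : sm f -> sm (fun x => step (f x)).
Proof.
move=> sf; apply: sm_mul; first exact: sm_flat.
apply: sm_inv => [x|]; first by rewrite gt_eqF ?step_den_gt0.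
by apply: sm_add; apply: sm_flat => //; apply: sm_sub => //; exact: sm_cst.
Qed.

Lemma tst_sm D phi : tst D phi -> sm phi. Proof. by case. Qed.

Lemma tst_vanish D phi : tst D phi -> exists B, vanish B phi.
Proof.
move=> [_ [K [/compact_bounded[M [_ hM]] _ K0]]].
exists (`|M| + 2) => x xM; apply: K0 => Kx.
have /= := hM (`|M| + 1) _ x Kx; have : M < `|M| + 1.
  by rewrite (le_lt_trans (ler_norm _))// ltrDl.
by move=> /[swap] /[apply]; lra.
Qed.

Lemma tst_derive D phi (v : pt) : tst D phi -> sm ('D_v phi) -> tst D ('D_v phi).
Proof.
move=> [s [K [cK KD K0]]] sD; split => //.
exists K; split => // x nKx; apply: derive_zero_near.
have oK : open (~` K) by apply: closed_openC; apply: compact_closed => //; exact: norm_hausdorff.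
by move: oK; rewrite openE => /(_ x nKx); apply: filterS => y; exact: K0.
Qed.

Lemma tst_dx1 D phi : tst D phi -> tst D (dx1 phi).
Proof. by move=> tp; apply: tst_derive => //; exact/sm_dx1/(tst_sm tp). Qed.

Lemma tst_dx2 D phi : tst D phi -> tst D (dx2 phi).
Proof. by move=> tp; apply: tst_derive => //; exact/sm_dx2/(tst_sm tp). Qed.

Lemma tst_add D f g : tst D f -> tst D g -> tst D (fun x => f x + g x).
Proof.
move=> [sf [K [cK KD K0]]] [sg [L [cL LD L0]]]; split; first exact: sm_add.
exists (K `|` L); split; [exact: compactU| by move=> x [/KD|/LD]|].
by move=> x KL; rewrite K0 ?L0 ?addr0// => h; apply: KL; [right|left].
Qed.

Lemma tst_scale D (c : R) f : tst D f -> tst D (fun x => c * f x).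
Proof.
move=> [sf [K [cK KD K0]]]; split; first by apply: sm_mul => //; exact: sm_cst.
by exists K; split => // x /K0 ->; rewrite mulr0.
Qed.

Lemma tst_test_fun D phi : tst D phi -> test_fun D phi.
Proof.
move=> [sp [K [cK KD K0]]]; split; first by move=> n; exact: sm_Cn.
have sK : closure [set x | phi x != 0] `<=` K.
  have /closure_id -> : closed K by apply: compact_closed => //; exact: norm_hausdorff.
  apply: closureS => x /= nz; apply: contrapT => /K0 h; by rewrite h eqxx in nz.
split; last exact: subset_trans KD.
by apply: subclosed_compact cK sK; exact: closed_closure.
Qed.

Lemma compact_cbox a (r : R) : compact [set x : pt | `|x - a| <= r].
Proof.
rewrite (_ : [set _ | _] = `[a.1 - r, a.1 + r]%classic `*` `[a.2 - r, a.2 + r]%classic).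
  by apply: compact_setX; exact: segment_compact.
apply/seteqP; split => x /=; rewrite ler_norm_pair !ler_norml !in_itv /=.
  by move=> /andP[/andP[? ?] /andP[? ?]]; split; apply/andP; split; lra.
by move=> [/andP[? ?] /andP[? ?]]; do 2 (apply/andP; split); lra.
Qed.

Lemma Int_dominated (F : nat -> pt -> R) f g : (forall n, meas (F n)) -> meas f -> itg g ->
  (forall n x, `|F n x| <= g x) -> (forall x, F n x @[n --> \oo] --> f x) ->
  itg f /\ Int (F n) @[n --> \oo] --> Int f.
Proof.
move=> mF mf ig Fg Ff; have iF n : itg (F n) by exact: itg_le (mF n) ig (Fg n).
have cF : {ae (@mu2 R), forall x, setT x -> (F n x)%:E @[n --> \oo] --> (f x)%:E}.
  by apply: aeW => x _; apply: cvg_EFin; [exact: nearW|exact: Ff].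
have bF : {ae (@mu2 R), forall x n, setT x -> (`|(F n x)%:E| <= (g x)%:E)%E}.
  by apply: aeW => x n _; rewrite lee_fin.
have [fi _ cv] := @dominated_convergence _ _ _ mu2 setT measurableT
  (fun n x => (F n x)%:E) (fun x => (f x)%:E) (fun x => (g x)%:E)
  (fun n => (measurable_EFinP _ _).2 (mF n)) ((measurable_EFinP _ _).2 mf) cF ig bF.
split => //; rewrite Int_EFin// in cv.
rewrite (_ : (fun n => Int (F n)) = fine \o (fun n => \int[mu2]_x (F n x)%:E)%E).
  exact: fine_cvg cv.
by apply/funext => n /=; rewrite Int_EFin.
Qed.

(** Smooth functions with values in [0, 1] that tend pointwise to the indicator of ]p, q[: the
    factor n squeezes the transition layers towards the endpoints, and [step] vanishes on the
    negative side. *)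
Let plateau (n : nat) (p q t : R) := step (n%:R * (t - p)) * step (n%:R * (q - t)).

Let plateau01 n p q t : 0 <= plateau n p q t <= 1.
Proof. by rewrite mulr_ge0 ?step_ge0//= mulr_ile1 ?step_ge0 ?step_le1. Qed.

Let plateau_out n p q t : ~~ (p < t < q) -> plateau n p q t = 0.
Proof.
rewrite negb_and -!leNgt => /orP[tp|qt].
  by rewrite /plateau step_le0 ?mul0r// mulr_ge0_le0// subr_le0.
by rewrite /plateau mulrC step_le0 ?mul0r// mulr_ge0_le0// subr_le0.
Qed.

Let plateau_cvg p q t : plateau n p q t @[n --> \oo] --> (\1_`]p, q[%classic t : R).
Proof.
rewrite indicE; have [|tpq] := boolP (t \in `]p, q[%classic).
  rewrite inE /= in_itv /= => /andP[pt tq]; apply: cvg_near_cst.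
  have [m hm] : exists m : nat, 1 <= m%:R * (t - p) /\ 1 <= m%:R * (q - t).
    have d0 : 0 < Num.min (t - p) (q - t) by rewrite lt_min !subr_gt0 pt.
    exists (Num.bound (Num.min (t - p) (q - t))^-1).
    have mi : 0 <= (Num.min (t - p) (q - t))^-1 by rewrite invr_ge0 ltW.
    have /ltW := archi_boundP mi; rewrite -[X in X <= _]mul1r ler_pdivrMr// => hm.
    by split; apply: le_trans hm _; rewrite ler_wpM2l// ge_min lexx ?orbT.
  exists m => // n /= mn; rewrite /plateau !step_ge1 ?mulr1//.
    by rewrite (le_trans hm.2)// ler_wpM2r ?ler_nat// subr_ge0 ltW.
  by rewrite (le_trans hm.1)// ler_wpM2r ?ler_nat// subr_ge0 ltW.
apply: cvg_near_cst; apply: nearW => n; apply: plateau_out.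
by apply: contra tpq => h; rewrite inE /= in_itv.
Qed.

Lemma itg_mul_bounded f g a (r C : R) : sqi g -> meas f -> (forall x, `|f x| <= C) ->
  (forall x, ~ box a r x -> f x = 0) -> itg (fun x => g x * f x).
Proof.
move=> sg mf fC f0; apply: sqi_mul => //; split => //.
apply: (@itg_bounded R (fun x => f x ^+ 2) a r (C ^+ 2)); first exact: measX.
  by move=> x; rewrite normrX lerXn2r ?nnegrE// (le_trans _ (fC x)).
by move=> x /f0 ->; rewrite expr0n.
Qed.

Let rect (p q s t : R) : set pt := `]p, q[%classic `*` `]s, t[%classic.

Let mrect p q s t : mble (rect p q s t).
Proof. by apply: measurableX; exact: measurable_itv. Qed.

Let Int_rect D g a (r : R) p q s t : sqi g ->
  (forall phi, tst D phi -> Int (fun x => g x * phi x) = 0) ->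
  [set x : pt | `|x - a| <= r] `<=` D -> rect p q s t `<=` box a r ->
  Int (fun x => g x * \1_(rect p q s t) x) = 0.
Proof.
move=> sg h rD sub; have ms := mrect p q s t.
pose F n x := plateau n p q x.1 * plateau n s t x.2.
have Fout n x : ~ rect p q s t x -> F n x = 0.
  move=> nx; rewrite /F; have [/plateau_out ->|] := boolP (~~ (p < x.1 < q)); first by rewrite mul0r.
  rewrite negbK => h1; rewrite mulrC plateau_out ?mul0r//; apply/negP => h2; apply: nx.
  by split; rewrite /= in_itv.
have F01 n x : 0 <= F n x <= 1.
  have /andP[? ?] := plateau01 n p q x.1; have /andP[? ?] := plateau01 n s t x.2.
  by rewrite mulr_ge0//= mulr_ile1.
have smP n (p' q' : R) f : sm f -> sm (fun x => plateau n p' q' (f x)).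
  by move=> sf; apply: sm_mul; apply: sm_step; apply: sm_mul; try exact: sm_cst;
    apply: sm_sub => //; exact: sm_cst.
have smF n : sm (F n) by apply: sm_mul; apply: smP; [exact: sm_fst|exact: sm_snd].
have tF n : tst D (F n).
  split => //; exists [set x | `|x - a| <= r]; split => //; first exact: compact_cbox.
  by move=> x xr; apply: Fout => /sub /ltW.
have ib : itg (fun x => `|g x * \1_(box a r) x|).
  apply: itg_norm; apply: (@itg_mul_bounded _ _ a r 1) => //.
  - by apply: meas_indic; exact: mble_box.
  - by move=> x; rewrite indicE; case: (_ \in _); rewrite ?normr1 ?normr0.
  - by move=> x xr; rewrite indicE memNset.
have iF n : itg (fun x => g x * F n x).
  apply: (@itg_mul_bounded (F n) g a r 1 sg (meas_continuous (sm_continuous (smF n)))).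
    by move=> x; have /andP[? ?] := F01 n x; rewrite ger0_norm.
  by move=> x xr; apply: Fout => /sub.
have bF n x : `|g x * F n x| <= `|g x * \1_(box a r) x|.
  rewrite (normrM (g x) (F n x)) (normrM (g x) (\1_(box a r) x)) ler_wpM2l// indicE.
  have [xr|xr] := boolP (x \in box a r).
    by rewrite normr1; have /andP[? ?] := F01 n x; rewrite ger0_norm.
  by rewrite Fout ?normr0// => /sub /mem_set; exact/negP.
have cF x : g x * F n x @[n --> \oo] --> g x * \1_(rect p q s t) x.
  apply: cvgM; first exact: cvg_cst.
  have -> : \1_(rect p q s t) x = (\1_`]p, q[%classic x.1 * \1_`]s, t[%classic x.2 : R).
    by rewrite !indicE -natrM mulnb; congr ((nat_of_bool _)%:R); apply/idP/andP;
      rewrite !inE => -[].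
  by apply: cvgM; exact: plateau_cvg.
have [_ cv] := Int_dominated (fun n => itg_meas (iF n)) (measM sg.1 (meas_indic ms)) ib bF cF.
apply/esym; apply: (cvg_unique _ _ cv) => //.
rewrite (_ : (fun n => _) = fun=> 0); first exact: cvg_cst.
by apply/funext => n /=; rewrite h.
Qed.

(** The sets over whose preimage h integrates to zero form a Dynkin system, complements being
    covered by the vanishing total integral; a generating class closed under intersection is
    therefore enough. The map p will be a coordinate or the identity, which allows one side of a
    rectangle to be generalised at a time. *)
Lemma zero_integral_dynkin d (T : measurableType d) (G : set (set T)) (p : T2 -> T) h :
  measurable_fun setT p -> d.-measurable = <<s G>> -> setI_closed G -> itg h -> Int h = 0 ->
  (forall S, G S -> (\int[mu2]_(x in p @^-1` S) (h x)%:E = 0)%E) ->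
  forall S, measurable S -> (\int[mu2]_(x in p @^-1` S) (h x)%:E = 0)%E.
Proof.
move=> mp GE GI hi h0 hG S mS.
have mpre (A : set T) : measurable A -> measurable (p @^-1` A).
  by move=> mA; rewrite -[_ @^-1` _]setTI; exact: mp.
have hT : (\int[mu2]_x (h x)%:E = 0)%E by rewrite Int_EFin// h0.
have hS (A : set T2) : measurable A -> mu2.-integrable A (EFin \o h).
  by move=> mA; apply: (integrableS measurableT mA _ hi).
pose P (A : set T) := (\int[mu2]_(x in p @^-1` A) (h x)%:E = 0)%E.
apply: (@dynkin_induction d T G P GE GI) => //.
- rewrite /P => A mA hA; rewrite -preimage_setC.
  have := @integral_setU_EFin _ _ _ mu2 (p @^-1` A) (~` (p @^-1` A)) h
    (mpre _ mA) (measurableC (mpre _ mA)).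
  rewrite setUv hT hA add0e => <- //.
  + exact: itg_meas.
  + by apply/disj_setPLR; rewrite setCK.
- rewrite /P => F mF tF hF; rewrite preimage_bigcup integral_bigcup.
  + by rewrite eseries0// => i _ _; exact: hF.
  + move=> i j _ _ [x [Fi Fj]]; apply: tF => //; by exists (p x).
  + by move=> k; apply: mpre.
  + by apply: hS; apply: bigcupT_measurable => k; exact: mpre.
- by rewrite -GE.
Qed.

Lemma itg_patch A h : mble A -> itg h -> itg (h \_ A).
Proof.
move=> mA hi; apply: itg_le (itg_norm hi) _; first exact: meas_patch (itg_meas hi).
by move=> x; rewrite patchE; case: ifP => // _; rewrite normr0.
Qed.

Lemma Int_patch A h : mble A -> itg h ->
  ((Int (h \_ A))%:E = \int[mu2]_(x in A) (h x)%:E)%E.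
Proof.
move=> mA hi; rewrite -Int_EFin; last exact: itg_patch.
rewrite [RHS]integral_mkcond; apply: eq_integral => x _.
by rewrite !patchE; case: ifP.
Qed.

Lemma patch_indic A h : h \_ A = (fun x => h x * \1_A x).
Proof.
by apply/funext => x; rewrite patchE indicE; case: ifP; rewrite ?mulr1 ?mulr0.
Qed.

Lemma patch_patch A D h : (h \_ A) \_ D = h \_ (A `&` D).
Proof. by apply/funext => x; rewrite !patchE in_setI; do 2 case: (_ \in _). Qed.

Lemma zero_of_zero_integrals h : itg h ->
  (forall A, mble A -> (\int[mu2]_(x in A) (h x)%:E = 0)%E) ->
  {ae (@mu2 R), forall x, h x = 0}.
Proof.
move=> hi hA; have mh := itg_meas hi.
pose P : set T2 := [set x | 0 <= h x].
have mP : mble P.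
  have -> : P = setT `&` h @^-1` `[0, +oo[%classic.
    by rewrite setTI; apply/seteqP; split => x /=; rewrite in_itv /= andbT.
  by apply: mh => //; exact: measurable_itv.
have : (\int[mu2]_x `|(h x)%:E| = 0)%E.
  have i1 : itg (h \_ P) by exact: itg_patch.
  have i2 : itg (h \_ (~` P)) by apply: itg_patch => //; exact: measurableC.
  have E : Int (h \_ P) - Int (h \_ (~` P)) = 0.
    apply: EFin_inj; rewrite EFinB !Int_patch//; last exact: measurableC.
    by rewrite !hA ?sube0//; exact: measurableC.
  rewrite -IntB// in E; rewrite -[RHS]/(0%:E) -E -Int_EFin; last exact: itgB.
  apply: eq_integral => x _ /=; rewrite !patchE; congr EFin.
  have [xP|xP] := boolP (x \in P).
    rewrite ifF ?subr0; last by apply/negbTE; rewrite notin_setE /= => /(_ (set_mem xP)).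
    by rewrite ger0_norm//; exact: set_mem xP.
  rewrite ifT ?sub0r; last by apply/mem_set => /mem_set; exact/negP.
  by rewrite ltr0_norm// ltNge; apply/negP => /mem_set; exact/negP.
move/ae_eq_integral_abs => /(_ measurableT) [].
  exact/measurable_EFinP.
by move=> N [mN N0 sN]; exists N; split => //; apply: subset_trans sN => x /= nx /(_ I) [].
Qed.

Let Int_box D g a (r : R) : sqi g ->
  (forall phi, tst D phi -> Int (fun x => g x * phi x) = 0) ->
  [set x : pt | `|x - a| <= r] `<=` D ->
  {ae (@mu2 R), forall x, box a r x -> g x = 0}.
Proof.
move=> sg hg rD.
pose I1 : set R := `]a.1 - r, a.1 + r[%classic.
pose I2 : set R := `]a.2 - r, a.2 + r[%classic.
have ibnd A : mble A -> A `<=` box a r -> itg (g \_ A).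
  move=> mA Ab; rewrite patch_indic; apply: (@itg_mul_bounded _ _ a r 1) => //.
  - exact: meas_indic.
  - by move=> x; rewrite indicE; case: (_ \in _); rewrite ?normr1 ?normr0.
  - by move=> x xr; rewrite indicE memNset// => /Ab.
have H0 p q s t : rect p q s t `<=` box a r -> Int (g \_ (rect p q s t)) = 0.
  by move=> sub; rewrite patch_indic; exact: (Int_rect sg hg rD sub).
have boxE : box a r = I1 `*` I2 by rewrite box_setX.
have mI (i : interval R) : measurable ([set` i] : set T1) by exact: measurable_itv.
(* Open intervals become arbitrary measurable sets one side at a time, here the first. Restricting g
   to a fixed rectangle keeps the integrand integrable. *)
have step1 (p q s t : R) : rect p q s t `<=` box a r -> forall A : set T1, measurable A ->
    Int (g \_ ((`]p, q[%classic `&` A) `*` `]s, t[%classic)) = 0.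
  move=> sub A mA; have mr := mrect p q s t; have hi := ibnd _ mr sub.
  have := @zero_integral_dynkin _ T1 (@RGenOInfty.G R) fst (g \_ (rect p q s t)).
  move=> /(_ measurable_fst (RGenOInfty.measurableE R) _ hi (H0 _ _ _ _ sub) _ A mA) h.
  have {h} := h _ _.
  rewrite -Int_patch//; last by rewrite -[_ @^-1` _]setTI; apply: measurable_fst.
  rewrite patch_patch (_ : _ `&` _ = (`]p, q[%classic `&` A) `*` `]s, t[%classic).
    move=> h; apply: EFin_inj; apply: h.
    - move=> _ _ [x ->] [y ->]; exists (Num.max x y); apply/seteqP; split => z /=;
        rewrite !in_itv /= !andbT gt_max; first by move=> [-> ->].
      by move=> /andP[].
    - move=> _ [x ->]; rewrite -Int_patch//; last first.
        by rewrite -[_ @^-1` _]setTI; apply: measurable_fst.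
      congr EFin; rewrite patch_patch (_ : _ `&` _ = rect (Num.max x p) q s t).
        apply: H0 => z [] /= ; rewrite in_itv /= gt_max => /andP[/andP[_ h1] h2] h3.
        by apply: sub; split => //=; rewrite in_itv /= h1.
      apply/seteqP; split => z; rewrite /rect /= !in_itv /= andbT gt_max.
        by move=> [[/andP[-> ->] ->] ->].
      by move=> [/andP[/andP[-> ->] ->] ->].
  by apply/seteqP; split => z [[? ?] ?].
(* The second side, the first one being arbitrary by now. *)
have step2 (A B : set T1) : measurable A -> measurable B ->
    Int (g \_ ((I1 `&` A) `*` (I2 `&` B))) = 0.
  move=> mA mB; have mr : mble ((I1 `&` A) `*` I2).
    by apply: measurableX; [exact: (measurableI _ _ (mI _) mA)|exact: mI].
  have sub : (I1 `&` A) `*` I2 `<=` box a r by rewrite boxE => z [[? _] ?].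
  have hi := ibnd _ mr sub; have hi0 : Int (g \_ ((I1 `&` A) `*` I2)) = 0.
    by apply: step1 => //; rewrite boxE.
  have := @zero_integral_dynkin _ T1 (@RGenOInfty.G R) snd _ measurable_snd
    (RGenOInfty.measurableE R) _ hi hi0 _ B mB.
  rewrite -Int_patch//; last by rewrite -[_ @^-1` _]setTI; apply: measurable_snd.
  rewrite patch_patch (_ : _ `&` _ = (I1 `&` A) `*` (I2 `&` B)).
    move=> h; apply: EFin_inj; apply: h.
    - move=> _ _ [x ->] [y ->]; exists (Num.max x y); apply/seteqP; split => z /=;
        rewrite !in_itv /= !andbT gt_max; first by move=> [-> ->].
      by move=> /andP[].
    - move=> _ [x ->]; rewrite -Int_patch//; last first.
        by rewrite -[_ @^-1` _]setTI; apply: measurable_snd.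
      congr EFin; rewrite patch_patch (_ : _ `&` _ = (I1 `&` A) `*` `]Num.max x (a.2 - r), a.2 + r[%classic).
        apply: step1 => // z [] /= h3; rewrite in_itv /= gt_max => /andP[/andP[_ h1] h2].
        by rewrite boxE; split => //=; rewrite /I2 /= in_itv /= h1.
      apply/seteqP; split => z; rewrite /I2 /= !in_itv /= andbT gt_max.
        by move=> [[? /andP[-> ->]] ->].
      by move=> [? /andP[/andP[-> ->] ->]].
  by apply/seteqP; split => z /=; tauto.
have hi := ibnd _ (mble_box a r) (@subset_refl _ _).
have hi0 : Int (g \_ (box a r)) = 0 by rewrite boxE; apply: H0; rewrite boxE.
(* Last pass: measurable rectangles generate the product sigma-algebra. *)
have := @zero_integral_dynkin _ T2 [set A `*` B | A in measurable & B in measurable] id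
  (g \_ (box a r)) (@measurable_id _ _ _) (measurable_prod_measurableType _ _) _ hi hi0.
move=> h; have {h} hz := zero_of_zero_integrals hi (fun A mA => h _ _ A mA).
have : {ae (@mu2 R), forall x, (g \_ (box a r)) x = 0}.
  apply: hz.
  - move=> _ _ [A1 mA1 [B1 mB1 <-]] [A2 mA2 [B2 mB2 <-]].
    exists (A1 `&` A2); first exact: measurableI.
    by exists (B1 `&` B2); [exact: measurableI|rewrite setXI].
  - move=> _ [A mA [B mB <-]]; rewrite -Int_patch//; last exact: measurableX.
    rewrite patch_patch boxE -setXI; congr EFin; exact: step2.
by apply: filterS => x /= + xr; rewrite patchE mem_set.
Qed.

Lemma fundamental_lemma D g : open D -> sqi g ->
  (forall phi, tst D phi -> Int (fun x => g x * phi x) = 0) ->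
  {ae (@mu2 R), forall x, D x -> g x = 0}.
Proof.
move=> /openP_box oD sg hg.
pose Q (n : nat) (q : rat * rat) :=
  [set x : pt | `|x - (ratr q.1, ratr q.2)| <= n.+1%:R^-1] `<=` D.
(* Rational boxes are numbered through [unpickle], so that [ae_foralln] can gather countably many
   null sets; a number that codes no box inside D imposes nothing. *)
pose P (k : nat) x : Prop := forall (n : nat) (q : rat * rat),
  unpickle k = Some (n, q) -> Q n q -> box (ratr q.1, ratr q.2) n.+1%:R^-1 x -> g x = 0.
have hP k : {ae (@mu2 R), forall x, P k x}.
  rewrite /P; case: (unpickle k : option (nat * (rat * rat))) => [[n q]|]; last first.
    by apply: aeW => x ? ?.
  have [qD|nqD] := pselect (Q n q); last first.
    by apply: aeW => x ? ? [<- <-].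
  by apply: filterS (Int_box sg hg qD) => x h ? ? [<- <-].
have := ae_foralln hP; apply: filterS => x hx Dx.
have [r r0 xr] := oD _ Dx.
have [n [e [eE e0 er]]] : exists n : nat, exists e : R,
    [/\ e = n.+1%:R^-1, 0 < e & e < r / 2].
  have /ltr_add_invr[n] : 0 < r / 2 by rewrite divr_gt0.
  by rewrite add0r => nr; exists n, (n.+1%:R^-1); rewrite nr invr_gt0 ltr0n.
have ex (t : R) : exists q : rat, `|t - ratr q| < e.
  have [||z []] := @dense_rat R `]t - e, t + e[%classic.
  - by exists t; rewrite /= in_itv /=; apply/andP; split; lra.
  - exact: interval_open.
  rewrite /= in_itv /= => /andP[h1 h2] [q _ qz]; exists q.
  by rewrite qz ltr_norml; apply/andP; split; lra.
have [q1 h1] := ex x.1; have [q2 h2] := ex x.2.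
apply: (hx (pickle (n, (q1, q2))) n (q1, q2)); first by rewrite pickleK.
  move=> y /=; rewrite -eE => yq; apply: xr; move: yq; rewrite /box /= ltr_norm_pair ler_norm_pair /=.
  rewrite !ler_norml !ltr_norml => /andP[/andP[? ?] /andP[? ?]].
  move: h1 h2; rewrite !ltr_norml => /andP[? ?] /andP[? ?].
  by do 2 (apply/andP; split); lra.
by rewrite -eE /box /= ltr_norm_pair h1.
Qed.

End TestFunctions.

(** * Completeness of L^2 and orthogonal projection *)

Section Projection.
Set Implicit Arguments.
Unset Strict Implicit.
Context {R : realType}.
Notation pt := (R * R)%type.
Notation T1 := (measurableTypeR R).
Notation T2 := (T1 * T1)%type.
Implicit Types (f g h p v w : pt -> R) (x : pt).

(** A weighted Cauchy-Schwarz inequality: the weights 4^-k, k >= n, add up to less than 2 / 4^n. In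
    the induction (x + y)^2 <= 2 x^2 + 2 y^2 costs a factor 2, while passing from n + 1 to n gains a
    factor 4. *)
Lemma telescope_sqr (a : nat -> R) (n m : nat) :
  (a (n + m)%N - a n) ^+ 2 <=
    2 / 4 ^+ n * \sum_(n <= k < n + m) 4 ^+ k * (a k.+1 - a k) ^+ 2.
Proof.
elim: m n => [|m IHm] n; first by rewrite addn0 subrr expr0n big_geq// mulr0.
rewrite big_ltn; last by rewrite -[X in (X < _)%N]addn0 ltn_add2l.
have := IHm n.+1; rewrite addSnnS; set s := \sum_(_ <= _ < _) _; set b := a (n + m.+1)%N => h.
have s0 : 0 <= s by apply: sumr_ge0 => k _; rewrite mulr_ge0 ?sqr_ge0 ?exprn_ge0.
have p4 : 0 < 4 ^+ n :> R by rewrite exprn_gt0.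
have {p4} p4 : 4 ^+ n != 0 :> R by rewrite gt_eqF.
have q0 : 0 <= s / 4 ^+ n by rewrite divr_ge0// exprn_ge0.
move: h; rewrite (_ : 2 / 4 ^+ n.+1 * s = s / 4 ^+ n / 2); last by rewrite exprS; field.
rewrite (_ : 2 / 4 ^+ n * _ = 2 * (a n.+1 - a n) ^+ 2 + 2 * (s / 4 ^+ n)); last by field.
move: q0; move: (s / _) => q q0; have := sqr_ge0 (b - a n.+1 - (a n.+1 - a n)).
by move: (a n) (a n.+1) => a0 a1; rewrite !expr2 => h1 h2; lra.
Qed.

Lemma sqr_ltr_norm (x e : R) : 0 < e -> x ^+ 2 < e ^+ 2 -> `|x| < e.
Proof.
move=> e0; rewrite -[x ^+ 2]real_normK ?num_real// => h.
by rewrite -(@ltr_pXn2r _ 2) ?nnegrE// ltW.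
Qed.

(** Beppo Levi for a series with geometric integrals. The sum is turned into a real function by
    [fine], which alters it on a null set; this is why the partial sums are dominated almost
    everywhere only. *)
Lemma ae_finite_series (u : nat -> pt -> R) (C : R) :
  (forall k, itg (u k)) -> (forall k x, 0 <= u k x) ->
  (forall k, Int (u k) <= C / 2 ^+ k) ->
  exists s, [/\ itg s, (forall x, 0 <= s x), Int s <= 2 * C &
    {ae (@mu2 R), forall x n, \sum_(0 <= k < n) u k x <= s x}].
Proof.
move=> ui u0 uC.
pose S x := (\sum_(0 <= k <oo) (u k x)%:E)%E.
have mu k : measurable_fun setT (EFin \o u k : T2 -> _).
  by apply/measurable_EFinP; exact: itg_meas.
have mS : measurable_fun setT (S : T2 -> _).
  apply: ge0_emeasurable_sum; [by move=> k x _ _; rewrite lee_fin|by move=> k _; exact: mu].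
have S0 x : (0 <= S x)%E by apply: nneseries_ge0 => k _ _; rewrite lee_fin.
have IS : (\int[mu2]_x S x <= (2 * C)%:E)%E.
  rewrite integral_nneseries//; last by move=> k x _; rewrite lee_fin.
  apply: lime_le.
    by apply: is_cvg_nneseries => k _ _; apply: integral_ge0 => x _; rewrite lee_fin.
  apply: nearW => n; rewrite (eq_bigr (fun k => (Int (u k))%:E)); last first.
    by move=> k _; rewrite Int_EFin.
  rewrite sumEFin lee_fin (@le_trans _ _ (\sum_(0 <= k < n) C / 2 ^+ k))//.
    by apply: ler_sum.
  have C0 : 0 <= C by have := uC 0%N; rewrite expr0 divr1; apply: le_trans; exact: Int_ge0.
  have E : \sum_(0 <= k < n) C / 2 ^+ k = 2 * C - 2 * C / 2 ^+ n.
    elim: n => [|n IHn]; first by rewrite big_nil expr0 divr1 subrr.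
    rewrite big_nat_recr//= IHn exprS invfM.
    by have : 2 ^+ n != 0 :> R by []; move=> ?; field.
  by rewrite E gerBl divr_ge0 ?mulr_ge0// exprn_ge0.
have aeS : {ae (@mu2 R), forall x, S x \is a fin_num}.
  have : mu2.-integrable setT (S : T2 -> _).
    apply/integrableP; split => //.
    under eq_integral do rewrite gee0_abs//.
    by rewrite (le_lt_trans IS)// ltry.
  by move/integrable_ae => /(_ measurableT); apply: filterS => x /(_ I).
have ms : meas (fun x => fine (S x)) by apply: measurableT_comp.
have s0 x : 0 <= fine (S x) by exact: fine_ge0.
have [si Is] : itg (fun x => fine (S x)) /\ Int (fun x => fine (S x)) <= 2 * C.
  apply: itg_leP => //; apply: le_trans IS.
  apply: ge0_le_integral => //; first by move=> x _; rewrite lee_fin.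
    exact/measurable_EFinP.
  move=> x _; have := S0 x; case: (S x) => //= r; by rewrite leey.
exists (fun x => fine (S x)); split => //.
apply: filterS aeS => x Sx n; rewrite -lee_fin fineK// -sumEFin.
apply: nneseries_lim_ge => k _ _; by rewrite lee_fin.
Qed.

(** Riesz-Fischer with rates: the decay 8^-n of the increments pays for the weights 4^k of
    [telescope_sqr] and leaves the summable 2^-k. The pointwise limit is set to 0 on the exceptional
    set N, which keeps it measurable. *)
Lemma sqi_complete (f : nat -> pt -> R) (C : R) : (forall n, sqi (f n)) ->
  (forall n, Int (fun x => (f n.+1 x - f n x) ^+ 2) <= C / 8 ^+ n) ->
  exists h, sqi h /\ exists K, forall n, Int (fun x => (h x - f n x) ^+ 2) <= K / 4 ^+ n.
Proof.
move=> sf fC.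
pose u k x := 4 ^+ k * (f k.+1 x - f k x) ^+ 2.
have sd k : sqi (fun x => f k.+1 x - f k x) by exact: sqiB.
have u0 k x : 0 <= u k x by rewrite mulr_ge0 ?sqr_ge0 ?exprn_ge0.
have ui k : itg (u k) by apply: itgZ; exact: (sd k).2.
have uC k : Int (u k) <= C / 2 ^+ k.
  rewrite /u IntZ; last exact: (sd k).2.
  apply: le_trans (ler_wpM2l _ (fC k)) _; first exact: exprn_ge0.
  rewrite (_ : 8 = 4 * 2 :> R); last by ring.
  by rewrite exprMn mulrCA invfM !mulrA mulfK ?expf_neq0// mulrC.
have [s [si s0 Is aes]] := ae_finite_series ui u0 uC.
have key x : (forall n, \sum_(0 <= k < n) u k x <= s x) ->
    forall n m, (f (n + m)%N x - f n x) ^+ 2 <= 2 / 4 ^+ n * s x.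
  move=> hs n m; apply: le_trans (telescope_sqr (fun k => f k x) n m) _.
  apply: ler_wpM2l; first by rewrite divr_ge0// exprn_ge0.
  apply: le_trans (hs (n + m)%N); rewrite [leRHS](big_cat_nat (n := n)) ?leq_addr//=.
  by rewrite lerDr sumr_ge0.
have ae2 : {ae (@mu2 R), forall x, cvgn (f ^~ x) /\
    forall n m, (f (n + m)%N x - f n x) ^+ 2 <= 2 / 4 ^+ n * s x}.
  apply: filterS aes => x /key hx; split => //.
  apply/cauchy_cvgP; apply: cauchy_exP => e e0.
  have [N hN] : exists N, 2 / 4 ^+ N * s x < e ^+ 2.
    have h : (2 * s x) * (4^-1 ^+ n) @[n --> \oo] --> (2 * s x) * 0.
      by apply: cvgM; [exact: cvg_cst|apply: cvg_expr; rewrite ger0_norm ?invr_ge0// invf_lt1// ltr1n].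
    rewrite mulr0 in h; have e2 : 0 < e ^+ 2 by rewrite exprn_gt0.
    have /cvgrPdist_lt /(_ _ e2)[N _ /(_ N (leqnn N))] := h.
    rewrite /= sub0r normrN => /(le_lt_trans (ler_norm _)) hN; exists N.
    by rewrite mulrAC -exprVn.
  exists (f N x); exists N => // m /= Nm; rewrite -ball_normE /= distrC.
  have := hx N (m - N)%N; rewrite subnKC// => /le_lt_trans /(_ hN).
  exact: sqr_ltr_norm.
have [N [mN N0 hN]] := ae2.
have Nin x : ~ N x -> cvgn (f ^~ x) /\
    forall n m, (f (n + m)%N x - f n x) ^+ 2 <= 2 / 4 ^+ n * s x.
  by move=> nx; apply: contrapT => /hN.
pose h := (fun x => limn (f ^~ x)) \_ (~` N).
have mh : meas h.
  apply: (@measurable_fun_cvg _ T2 R setT (fun n => f n \_ (~` N))) => //.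
    by move=> n; apply: meas_patch (sf n).1; exact: measurableC.
  move=> x _; rewrite /h patchE; case: ifPn => [|] xN.
    rewrite (_ : (fun n => _) = f ^~ x); last by apply/funext => n; rewrite patchE xN.
    by have [] := Nin x _ => //; move: xN; rewrite inE.
  rewrite (_ : (fun n => _) = fun=> point); first exact: cvg_cst.
  by apply/funext => n; rewrite patchE (negbTE xN).
have hle n x : ~ N x -> (h x - f n x) ^+ 2 <= 2 / 4 ^+ n * s x.
  move=> nx; have [cx hx] := Nin x nx; rewrite /h patchE mem_set//.
  have lx : (f m x - f n x) ^+ 2 @[m --> \oo] --> (limn (f ^~ x) - f n x) ^+ 2.
    by apply: cvgM; apply: cvgB => //; exact: cvg_cst.
  apply: (ler_cvg_to lx (cvg_cst (2 / 4 ^+ n * s x))); exists n => // m /= nm.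
  by have := hx n (m - n)%N; rewrite subnKC.
have hn n : itg (fun x => (h x - f n x) ^+ 2) /\
    Int (fun x => (h x - f n x) ^+ 2) <= (4 * C) / 4 ^+ n.
  have mhn : meas (fun x => (h x - f n x) ^+ 2) by apply: measX; exact: measB (sf n).1.
  have ip : itg ((fun x => (h x - f n x) ^+ 2) \_ (~` N)).
    apply: itg_le (itgZ (2 / 4 ^+ n) si) _.
      by apply: meas_patch => //; exact: measurableC.
    move=> x; rewrite patchE; case: ifPn => [|_]; last first.
      by rewrite normr0 mulr_ge0// divr_ge0// exprn_ge0.
    by rewrite inE => nx; rewrite ger0_norm ?sqr_ge0//; exact: hle.
  have ae3 : {ae (@mu2 R), forall x, (h x - f n x) ^+ 2 =
      ((fun x => (h x - f n x) ^+ 2) \_ (~` N)) x}.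
    exists N; split => // x /= nE; apply: contrapT => nx; apply: nE.
    by rewrite patchE mem_set.
  split; first exact: itg_ae ip ae3.
  rewrite (eq_Int_ae mhn (itg_meas ip) ae3).
  apply: (@le_trans _ _ (Int (fun x => 2 / 4 ^+ n * s x))).
    apply: Int_le => //; first exact: itgZ.
    move=> x; rewrite patchE; case: ifPn => [|_]; last first.
      by rewrite mulr_ge0// divr_ge0// exprn_ge0.
    by rewrite inE; exact: hle.
  rewrite IntZ// mulrAC ler_wpM2r ?invr_ge0 ?exprn_ge0//.
  by apply: le_trans (ler_wpM2l _ Is) _ => //; rewrite mulrA; lra.
exists h; split.
  have sh : sqi (fun x => h x - f 0%N x) by split; [exact: measB (sf _).1|exact: (hn _).1].
  rewrite (_ : h = fun x => (h x - f 0%N x) + f 0%N x); first exact: sqiD.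
  by apply/funext => x; rewrite subrK.
by exists (4 * C) => n; exact: (hn n).2.
Qed.

Lemma cvg_geometric0 (K : R) : K / 4 ^+ n @[n --> \oo] --> (0 : R).
Proof.
rewrite -(mulr0 K); apply: cvgM; first exact: cvg_cst.
rewrite (_ : (fun n => (4 ^+ n)^-1) = (fun n => 4^-1 ^+ n)); last first.
  by apply/funext => n; rewrite exprVn.
by apply: cvg_expr; rewrite ger0_norm ?invr_ge0// invf_lt1// ltr1n.
Qed.

Lemma sqr_cvg0 (a b : nat -> R) : (forall n, a n ^+ 2 <= b n) ->
  b n @[n --> \oo] --> (0 : R) -> a n @[n --> \oo] --> (0 : R).
Proof.
move=> ab b0; apply/cvgr0Pnorm_lt => e e0.
have e2 : 0 < e ^+ 2 by rewrite exprn_gt0.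
have /cvgr0Pnorm_lt /(_ _ e2)[N _ hN] := b0; exists N => // n /= Nn.
have := le_lt_trans (ab n) (le_lt_trans (ler_norm _) (hN n Nn)).
exact: sqr_ltr_norm.
Qed.

(* Minimise |p - v|^2 over V; V need not be closed, so the minimiser w lies in
   its closure, and v_n --> w along a fast minimising sequence. *)
Lemma orthogonal_projection (V : set (pt -> R)) p (K : R) : sqi p -> 0 <= K ->
  V (fun=> 0) -> (forall v, V v -> sqi v) ->
  (forall v w, V v -> V w -> V (fun x => v x + w x)) ->
  (forall (c : R) v, V v -> V (fun x => c * v x)) ->
  (forall v, V v -> Int (fun x => p x * v x) ^+ 2 <= K * Int (fun x => v x ^+ 2)) ->
  exists w, [/\ sqi w, Int (fun x => w x ^+ 2) <= K &
    forall v, V v -> Int (fun x => (p x - w x) * v x) = 0].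
Proof.
move=> sp K0 V0 sV VD VZ pK.
pose E v := Int (fun x => (p x - v x) ^+ 2).
have E0 v : 0 <= E v by apply: Int_ge0 => x; exact: sqr_ge0.
pose m := inf [set E v | v in V].
have hm : has_inf [set E v | v in V].
  by split; [exists (E (fun=> 0)), (fun=> 0)|exists 0 => _ [v _ <-]].
have mE v : V v -> m <= E v by move=> Vv; apply: ge_inf; [exact: hm.2|exists v].
(* Four times [eps n] is 8^-n, the rate that [sqi_complete] asks for. *)
pose eps n : R := (4 * 8 ^+ n)^-1.
have eps0 n : 0 < eps n by rewrite invr_gt0 mulr_gt0// exprn_gt0.
have /choice[v hv] : forall n, exists v : pt -> R, V v /\ E v < m + eps n.
  move=> n.
  have [_ [v Vv <-] vm] := inf_adherent (eps0 n) hm.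
  by exists v; split.
have sv n := sV _ (hv n).1.
have V_E v1 v2 (t : R) : V v1 -> V v2 ->
    E (fun x => v1 x + t * v2 x) =
    E v1 + 2 * t * - Int (fun x => (p x - v1 x) * v2 x) + t ^+ 2 * Int (fun x => v2 x ^+ 2).
  move=> V1 V2; have s1 := sqiB sp (sV _ V1); have s2 := sV _ V2.
  rewrite /E (_ : (fun x => (p x - (v1 x + t * v2 x)) ^+ 2) =
    (fun x => ((p x - v1 x) ^+ 2 + (- (2 * t)) * ((p x - v1 x) * v2 x)) + t ^+ 2 * v2 x ^+ 2)).
    rewrite IntD; [|exact: itgD s1.2 (itgZ _ (sqi_mul s1 s2))|exact: itgZ s2.2].
    rewrite IntD; [|exact: s1.2|exact: itgZ (sqi_mul s1 s2)].
    rewrite IntZ; last exact: sqi_mul.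
    by rewrite IntZ; [ring|exact: sqi_mul].
  by apply/funext => x; ring.
(* Along the line v_n + t u the squared distance to p cannot drop by more than [eps n]; a quadratic
   polynomial in t bounded below in this way has a small linear coefficient. *)
have ortho n u : V u -> Int (fun x => (p x - v n x) * u x) ^+ 2 <= eps n * Int (fun x => u x ^+ 2).
  move=> Vu; rewrite -sqrrN; apply: sqr_le_of_quadratic; first by apply: Int_ge0 => x; exact: sqr_ge0.
  move=> t; have := mE _ (VD _ _ (hv n).1 (VZ t _ Vu)); rewrite V_E//; last exact: (hv n).1.
  by have := (hv n).2; lra.
(* Parallelogram law: the midpoint of v_n and v_(n+1) lies in V, so its squared distance to p is at
   least m, and |v_(n+1) - v_n|^2 <= 2 (eps_n + eps_(n+1)). *)
have dv n : Int (fun x => (v n.+1 x - v n x) ^+ 2) <= 1 / 8 ^+ n.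
  have Vd : V (fun x => v n.+1 x + (-1) * v n x) by apply: VD; [exact: (hv _).1|exact/VZ/(hv _).1].
  have Vm : V (fun x => v n x + 2^-1 * (v n.+1 x + (-1) * v n x)).
    by apply: VD; [exact: (hv _).1|exact: VZ].
  have h1 := mE _ Vm; rewrite V_E// in h1; last exact: (hv n).1.
  have h2 : E (v n.+1) = E (fun x => v n x + 1 * (v n.+1 x + (-1) * v n x)).
    by congr E; apply/funext => x; ring.
  rewrite V_E// in h2; last exact: (hv n).1.
  rewrite (_ : (fun x => (v n.+1 x - v n x) ^+ 2) = (fun x => (v n.+1 x + -1 * v n x) ^+ 2)); last first.
    by apply/funext => x; rewrite mulN1r.
  have h3 := (hv n).2; have h4 := (hv n.+1).2; move: h1 h2 h3 h4.
  have e8 : eps n.+1 <= eps n.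
    by rewrite lef_pV2 ?posrE ?mulr_gt0 ?exprn_gt0// ler_pM2l// exprS ler_peMl ?exprn_ge0// ler1n.
  have -> : 1 / 8 ^+ n = 4 * eps n.
    by rewrite /eps invfM mulrA divff// mul1r.
  move: (Int (fun x => (v n.+1 x + _) ^+ 2)) (Int _) (E (v n)) (E (v n.+1)) => q b e1 e2.
  by move=> h1 h2 h3 h4; lra.
have [w [sw [C hw]]] := sqi_complete sv dv.
have sd n : sqi (fun x => w x - v n x) by exact: sqiB.
have eps_cvg c : eps n * c @[n --> \oo] --> (0 : R).
  rewrite -(mul0r c); apply: cvgM; last exact: cvg_cst.
  apply: (@squeeze_cvgr _ _ _ _ (fun=> 0) (fun n => 1 / 4 ^+ n)).
  - apply: nearW => n; rewrite ltW//= mul1r lef_pV2 ?posrE ?mulr_gt0 ?exprn_gt0//.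
    rewrite (@le_trans _ _ (8 ^+ n))//; first by rewrite lerXn2r ?nnegrE// ler_nat.
    by rewrite ler_peMl ?exprn_ge0// ler1n.
  - exact: cvg_cst.
  - exact: cvg_geometric0.
have wv u : sqi u -> Int (fun x => (w x - v n x) * u x) @[n --> \oo] --> (0 : R).
  move=> su; apply: (@sqr_cvg0 _ (fun n => C / 4 ^+ n * Int (fun x => u x ^+ 2))).
    move=> n; apply: le_trans (Int_CS (sd n) su) _.
    by rewrite ler_wpM2r// Int_ge0// => x; exact: sqr_ge0.
  rewrite -(mul0r (Int (fun x => u x ^+ 2))); apply: cvgM; last exact: cvg_cst.
  exact: cvg_geometric0.
have orth u : V u -> Int (fun x => (p x - w x) * u x) = 0.
  move=> Vu; have su := sV _ Vu.
  have h1 := wv u su.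
  have h2 : Int (fun x => (p x - v n x) * u x) @[n --> \oo] --> (0 : R).
    by apply: (@sqr_cvg0 _ (fun n => eps n * Int (fun x => u x ^+ 2))) => // n; exact: ortho.
  have h3 : Int (fun x => (p x - v n x) * u x) - Int (fun x => (w x - v n x) * u x) @[n --> \oo] --> (0 : R).
    by rewrite -(subr0 (0 : R)); apply: cvgB.
  move: h3; rewrite (_ : (fun n => _) = fun=> Int (fun x => (p x - w x) * u x)).
    by move=> /(cvg_lim (@norm_hausdorff _ _)) <-; rewrite lim_cst//; exact: norm_hausdorff.
  apply/funext => n /=; rewrite -IntB; [|exact: sqi_mul (sqiB sp (sv n)) su|exact: sqi_mul].
  by congr Int; apply/funext => x; ring.
exists w; split => //.
set a := Int (fun x => w x ^+ 2); have a0 : 0 <= a by apply: Int_ge0 => x; exact: sqr_ge0.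
(* The bound on |w|^2 is read off from the v_n, because w need not lie in V. By orthogonality b_n is
   the pairing of p with v_n, whence b_n^2 <= K c_n, and both b_n and c_n tend to |w|^2. *)
pose b n := Int (fun x => w x * v n x); pose c n := Int (fun x => v n x ^+ 2).
have bK n : b n ^+ 2 <= K * c n.
  rewrite (_ : b n = Int (fun x => p x * v n x)); first exact: pK (hv n).1.
  have := orth _ (hv n).1.
  rewrite (_ : (fun x => _) = (fun x => p x * v n x - w x * v n x)); last first.
    by apply/funext => x; rewrite mulrBl.
  rewrite IntB; [|exact: sqi_mul sp (sv n)|exact: sqi_mul sw (sv n)].
  by move=> /eqP; rewrite subr_eq0 => /eqP ->.
have bE n : b n = a - Int (fun x => (w x - v n x) * w x).
  rewrite /a /b -IntB; [|exact: sw.2|exact: sqi_mul].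
  by congr Int; apply/funext => x; ring.
have cE n : c n = Int (fun x => (w x - v n x) ^+ 2) + (2 * b n - a).
  rewrite /a /b /c -IntZ; last exact: sqi_mul.
  rewrite -IntB; [|exact: itgZ (sqi_mul sw (sv n))|exact: sw.2].
  rewrite -IntD; [|exact: (sd n).2|apply: itgB; [exact: itgZ (sqi_mul sw (sv n))|exact: sw.2]].
  by congr Int; apply/funext => x; ring.
have cb : b n @[n --> \oo] --> a.
  rewrite (funext bE); have := cvgB (cvg_cst a) (wv w sw); rewrite subr0; exact.
have cc : c n @[n --> \oo] --> a.
  rewrite (funext cE).
  rewrite [X in _ --> X](_ : a = 0 + (2 * a - a)); last by ring.
  apply: cvgD; last by apply: cvgB; [apply: cvgM => //; exact: cvg_cst|exact: cvg_cst].
  apply: (@squeeze_cvgr _ _ _ _ (fun=> 0) (fun n => C / 4 ^+ n)).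
  - by apply: nearW => n; rewrite hw Int_ge0// => x; exact: sqr_ge0.
  - exact: cvg_cst.
  - exact: cvg_geometric0.
have : a ^+ 2 <= K * a.
  have cb2 : b n * b n @[n --> \oo] --> a * a by exact: cvgM.
  have cc2 : K * c n @[n --> \oo] --> K * a by apply: cvgM => //; exact: cvg_cst.
  by rewrite expr2; apply: (ler_cvg_to cb2 cc2); apply: nearW => n; rewrite -expr2.
have [->|an0] := eqVneq a 0; first by [].
by rewrite expr2 ler_pM2r// lt_def an0.
Qed.

End Projection.

(** * Weyl's lemma *)

(** Without its normalising factor, this is an average of h around x at scale 1 / c. The factor is
    left out because it is c^2 for the kernel and c^3 for its derivatives. *)
Definition smear {R : realType} (h psi : R * R -> R) (c : R) (x : R * R) : R :=
  Int (fun y => h y * psi (c *: (y - x))).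

Section Weyl.
Set Implicit Arguments.
Unset Strict Implicit.
Context {R : realType}.
Notation pt := (R * R)%type.
Implicit Types (f g h phi psi : pt -> R) (A D K : set pt) (a e x y : pt).

Lemma cont_at_norm (V W : normedModType R) (f : V -> W) (x : V) :
  (forall eps : R, 0 < eps -> exists2 d : R, 0 < d &
     forall y : V, `|y - x| < d -> `|f y - f x| < eps) -> {for x, continuous f}.
Proof.
move=> h; apply/cvgrPdist_lt => eps /h[d d0 hd].
apply/nbhs_ballP; exists d => // y; rewrite -ball_normE /= distrC => /hd.
by rewrite distrC.
Qed.

Lemma is_derive_line f x e (t : R) : derivable f (x + t *: e) e ->
  is_derive t 1 (fun s => f (x + s *: e)) ('D_e f (x + t *: e)).
Proof.
move=> du; have E (h : R) : f (h *: e + (x + t *: e)) = f (x + (h *: 1 + t) *: e).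
  by rewrite addrCA [h *: 1]mulr1 scalerDl.
split; first by move: du; rewrite /derivable /=; under eq_fun do rewrite E.
by rewrite /derive; apply: (congr1 (fun g : R -> R => lim (g h @[h --> 0^']))); apply/funext => h /=; rewrite E.
Qed.

Lemma sm_MVT f x e : sm f -> exists2 t : R, 0 <= t <= 1 &
  f (x + e) - f x = e.1 * dx1 f (x + t *: e) + e.2 * dx2 f (x + t *: e).
Proof.
move=> sf; have df (t : R) := is_derive_line (sm_derivable sf : derivable f (x + t *: e) e).
have [|t] := @MVT_segment R (fun s => f (x + s *: e)) _ 0 1 ler01 (fun t _ => df t).
  apply: continuous_subspaceT => t; apply: differentiable_continuous.
  by apply/derivable1_diffP; have [] := df t.
rewrite in_itv /= => t01; rewrite scale1r scale0r addr0 subr0 mulr1 => E.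
by exists t => //; rewrite E derive_sm.
Qed.

Lemma ler_dot2 (a b c d C E : R) : `|a| <= E -> `|b| <= E -> `|c| <= C -> `|d| <= C ->
  `|a * c + b * d| <= 2 * C * E.
Proof.
move=> aE bE cC dC; rewrite (le_trans (ler_normD _ _))// (normrM a) (normrM b).
rewrite (_ : 2 * C * E = E * C + E * C); last by ring.
by apply: lerD; apply: ler_pM.
Qed.

Lemma ler_dotn (a b c d E : R) : `|a| <= E -> `|b| <= E ->
  `|a * c + b * d| <= (`|c| + `|d|) * E.
Proof.
move=> aE bE; rewrite (le_trans (ler_normD _ _))// (normrM a) (normrM b).
by rewrite mulrDl !(mulrC _ E); apply: lerD; apply: ler_wpM2r.
Qed.

Lemma ler_norm_fst e : `|e.1| <= `|e|.
Proof. by have := lexx `|e|; rewrite {1}ler_norm_pair => /andP[]. Qed.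

Lemma ler_norm_snd e : `|e.2| <= `|e|.
Proof. by have := lexx `|e|; rewrite {1}ler_norm_pair => /andP[]. Qed.

Lemma sm_lipschitz (B : R) f : sm f -> vanish B f ->
  exists2 C, 0 <= C & forall x e, `|f (x + e) - f x| <= C * `|e|.
Proof.
move=> sf vf.
have [C1 C10 h1] := vanish_bounded (sm_continuous (sm_dx1 sf)) (vanish_derive (1, 0) vf).
have [C2 C20 h2] := vanish_bounded (sm_continuous (sm_dx2 sf)) (vanish_derive (0, 1) vf).
exists (2 * (C1 + C2)); first by rewrite mulr_ge0// addr_ge0.
move=> x e; have [t _ ->] := sm_MVT x e sf.
apply: ler_dot2; [exact: ler_norm_fst|exact: ler_norm_snd| |].
  by apply: le_trans (h1 _) _; rewrite lerDl.
by apply: le_trans (h2 _) _; rewrite lerDr.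
Qed.

Lemma sm_taylor (B : R) f : sm f -> vanish B f ->
  exists2 C, 0 <= C & forall x e,
    `|f (x + e) - f x - (e.1 * dx1 f x + e.2 * dx2 f x)| <= C * `|e| ^+ 2.
Proof.
move=> sf vf.
have [C1 C10 h1] := sm_lipschitz (sm_dx1 sf) (vanish_derive (1, 0) vf).
have [C2 C20 h2] := sm_lipschitz (sm_dx2 sf) (vanish_derive (0, 1) vf).
exists (2 * (C1 + C2)); first by rewrite mulr_ge0// addr_ge0.
move=> x e; have [t /andP[t0 t1] ->] := sm_MVT x e sf.
rewrite opprD addrACA -!mulrBr expr2 mulrA -(mulrA 2).
have te : `|t *: e| <= `|e| by rewrite normrZ ger0_norm// ler_piMl.
apply: ler_dot2; [exact: ler_norm_fst|exact: ler_norm_snd| |].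
  apply: le_trans (h1 _ _) _; apply: ler_pM => //.
  by rewrite lerDl.
apply: le_trans (h2 _ _) _; apply: ler_pM => //.
by rewrite lerDr.
Qed.

Lemma vanish_affine (B c : R) psi x : 0 < c -> vanish B psi ->
  forall y, ~ box x (`|B| / c) y -> psi (c *: (y - x)) = 0.
Proof.
move=> c0 vp y /negP; rewrite -leNgt => h; apply: vp.
rewrite normrZ gtr0_norm// (le_trans (ler_norm B))//.
by rewrite mulrC -ler_pdivrMr.
Qed.

Lemma smear_itg (B c : R) h psi x : sqi h -> continuous psi -> vanish B psi -> 0 < c ->
  itg (fun y => h y * psi (c *: (y - x))).
Proof.
move=> sh sp vp c0; have [C _ hC] := vanish_bounded sp vp.
apply: (@itg_mul_bounded _ _ _ x (`|B| / c) C) => //; last exact: vanish_affine.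
apply: meas_continuous => y; apply: continuous_comp; last exact: sp.
by apply: cvgZr; apply: cvgB => //; exact: cvg_cst.
Qed.

(** Taylor's formula for psi is integrated against h; the sign is + because x enters psi (c (y - x))
    negatively. A quadratic remainder yields continuity and derivatives at once, although h is
    merely square integrable. *)
Lemma smear_taylor (B c : R) h psi x : sqi h -> sm psi -> vanish B psi -> 0 < c ->
  exists2 C, 0 <= C & forall e, `|e| <= 1 ->
    `|smear h psi c (x + e) - smear h psi c x +
       c * (e.1 * smear h (dx1 psi) c x + e.2 * smear h (dx2 psi) c x)| <= C * `|e| ^+ 2.
Proof.
move=> sh sp vp c0; have [C C0 hC] := sm_taylor sp vp.
(* B + 1 covers the support of the derivatives of psi, and the last 1 the displacement e. *)
pose r := (`|B| + 1) / c + 1.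
have cp := sm_continuous sp.
have cp1 := sm_continuous (sm_dx1 sp); have vp1 := vanish_derive (1, 0) vp.
have cp2 := sm_continuous (sm_dx2 sp); have vp2 := vanish_derive (0, 1) vp.
have mb : mble (box x r) by exact: mble_box.
have ib : itg (fun y => `|h y| * \1_(box x r) y).
  apply: (@itg_mul_bounded _ _ _ x r 1) => //; [exact: sqi_norm|exact: meas_indic| |].
  - by move=> y; rewrite indicE normr_nat lern1 leq_b1.
  - by move=> y xy; rewrite indicE memNset.
exists (C * c ^+ 2 * Int (fun y => `|h y| * \1_(box x r) y)).
  apply: mulr_ge0; first by rewrite mulr_ge0// exprn_ge0// ltW.
  by apply: Int_ge0 => y; rewrite mulr_ge0// indicE.
move=> e e1; have i0 := smear_itg (x + e) sh cp vp c0; have i1 := smear_itg x sh cp vp c0.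
have i2 := smear_itg x sh cp1 vp1 c0; have i3 := smear_itg x sh cp2 vp2 c0.
pose rem y := psi (c *: (y - (x + e))) - psi (c *: (y - x)) +
   c * (e.1 * dx1 psi (c *: (y - x)) + e.2 * dx2 psi (c *: (y - x))).
have E : smear h psi c (x + e) - smear h psi c x +
       c * (e.1 * smear h (dx1 psi) c x + e.2 * smear h (dx2 psi) c x) =
       Int (fun y => h y * rem y) /\ itg (fun y => h y * rem y).
  rewrite (_ : (fun y => h y * rem y) = (fun y =>
     (h y * psi (c *: (y - (x + e))) - h y * psi (c *: (y - x))) +
     c * (e.1 * (h y * dx1 psi (c *: (y - x))) + e.2 * (h y * dx2 psi (c *: (y - x)))))).
    split; last by apply: itgD; [exact: itgB|apply/itgZ/itgD; exact: itgZ].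
    rewrite IntD; [|exact: itgB|by apply/itgZ/itgD; exact: itgZ].
    rewrite (IntB i0 i1) (IntZ c); last by apply: itgD; exact: itgZ.
    by rewrite IntD ?(IntZ _ i2) ?(IntZ _ i3)//; exact: itgZ.
  by apply/funext => y; rewrite /rem; ring.
have [-> irem] := E.
have rb y : `|rem y| <= C * c ^+ 2 * `|e| ^+ 2.
  have := hC (c *: (y - x)) (- (c *: e)).
  rewrite -scalerBr opprD addrA -addrA -opprD -[y - x - e]addrA -opprD.
  rewrite normrN normrZ gtr0_norm// exprMn mulrA.
  congr (`|_| <= _); rewrite /rem; congr (_ + _).
  rewrite /=; move: (dx1 _ _) (dx2 _ _) => u v; rewrite [c *: e.1]mulrC [c *: e.2]mulrC; ring.
have r0 y : ~ box x r y -> rem y = 0.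
  move=> yr; have yr0 : forall s, s <= r -> ~ box x s y.
    by move=> s sr h1; apply: yr; exact: lt_le_trans h1 sr.
  have b1 : `| `|B| + 1 | / c = r - 1 by rewrite ger0_norm ?addr_ge0// /r addrK.
  have vB : vanish (`|B| + 1) psi by apply: vanish_le vp; rewrite (le_trans (ler_norm B))// lerDl.
  have vB1 : vanish (`|B| + 1) (dx1 psi) by apply: vanish_le vp1; rewrite lerD2r ler_norm.
  have vB2 : vanish (`|B| + 1) (dx2 psi) by apply: vanish_le vp2; rewrite lerD2r ler_norm.
  have bx : ~ box x (`| `|B| + 1 | / c) y by apply: yr0; rewrite b1 gerBl.
  rewrite /rem (vanish_affine c0 vB1 bx) (vanish_affine c0 vB2 bx) (vanish_affine c0 vB bx).
  rewrite (vanish_affine c0 vB (x := x + e) (y := y)); first by rewrite !mulr0 addr0 mulr0 subrr addr0.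
  rewrite b1 /box /= => h1; apply: yr; rewrite /box /=.
  rewrite (_ : y - x = (y - (x + e)) + e); last by rewrite opprD addrA subrK.
  apply: le_lt_trans (ler_normD _ _) _; have -> : r = (r - 1) + 1 by rewrite subrK.
  exact: ltr_leD.
apply: le_trans (Int_norm irem) _.
apply: le_trans (Int_le (g := fun y => C * c ^+ 2 * `|e| ^+ 2 * (`|h y| * \1_(box x r) y)) _ _ _) _.
- exact: itg_norm.
- exact: itgZ.
- move=> y; rewrite normrM; have [yr|yr] := pselect (box x r y).
    by rewrite indicE mem_set// mulr1 mulrC ler_wpM2r.
  by rewrite r0// normr0 mulr0 indicE memNset// !mulr0.
- by rewrite IntZ// mulrAC.
Qed.

Lemma smear_continuous (B c : R) h psi : sqi h -> sm psi -> vanish B psi -> 0 < c ->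
  continuous (smear h psi c).
Proof.
move=> sh sp vp c0 x; have [C C0 hC] := smear_taylor x sh sp vp c0.
set a := smear h (dx1 psi) c x in hC; set b := smear h (dx2 psi) c x in hC.
pose M := C + c * (`|a| + `|b|) + 1.
have M0 : 0 < M by rewrite ltr_pwDr// addr_ge0// mulr_ge0// ?addr_ge0// ltW.
apply: (@cont_at_norm pt R) => eps eps0; exists (Num.min 1 (eps / M)).
  by rewrite lt_min ltr01 divr_gt0.
move=> y; rewrite lt_min => /andP[xy1 xy2].
have := hC (y - x) (ltW xy1); rewrite [x + _]addrC subrK.
set e := y - x in xy1 xy2 *; set u := smear h psi c y - smear h psi c x => h1.
rewrite -/u.
have h2 : `|c * (e.1 * a + e.2 * b)| <= c * (`|a| + `|b|) * `|e|.
  rewrite (normrM c) (gtr0_norm c0) -mulrA ler_wpM2l ?(ltW c0)//.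
  by apply: ler_dotn; [exact: ler_norm_fst|exact: ler_norm_snd].
have h3 : C * `|e| ^+ 2 <= C * `|e| by rewrite expr2 ler_wpM2l// ler_piMl// ltW.
have h4 : `|e| * M < eps by rewrite -ltr_pdivlMr.
have := ler_normB (u + c * (e.1 * a + e.2 * b)) (c * (e.1 * a + e.2 * b)).
rewrite addrK => h5; move: h4; rewrite /M.
apply: le_lt_trans; apply: le_trans h5 _; apply: le_trans (lerD (le_trans h1 h3) h2) _.
by rewrite -mulrDl mulrC ler_wpM2l// lerDl.
Qed.

Lemma is_derive_quadratic (F : R -> R) (t d C : R) :
  (forall s, `|s| <= 1 -> `|F (t + s) - F t - s * d| <= C * s ^+ 2) -> is_derive t 1 F d.
Proof.
move=> hF; pose q (s : R) := s^-1 *: (F (s *: 1 + t) - F t).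
have qd : q s @[s --> 0^'] --> d.
  apply/cvgrPdist_lt => eps eps0; near=> s.
  have s0 : s != 0 by near: s; exact: nbhs_dnbhs_neq.
  have s1 : `|s| < Num.min 1 (eps / (`|C| + 1)).
    near: s; apply: dnbhs0_lt; rewrite lt_min ltr01 divr_gt0// ltr_pwDr//.
  move: s1; rewrite lt_min => /andP[s1 s2].
  have := hF s (ltW s1); rewrite distrC /q [s *: 1]mulr1 (addrC s) => h.
  have -> : s^-1 *: (F (t + s) - F t) = s^-1 * (F (t + s) - F t) by [].
  have -> : d - s^-1 * (F (t + s) - F t) = s^-1 * (s * d - (F (t + s) - F t)).
    by rewrite [RHS]mulrBr mulKf.
  rewrite normrM normfV ltr_pdivrMl ?normr_gt0//; move: h.
  rewrite -(real_normK (num_real s)); move: s2; rewrite ltr_pdivlMr ?ltr_pwDr//.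
  have := ler_norm C; have : 0 < `|s| by rewrite normr_gt0.
  by move: (`|s|) (`|C|) (`|s * d - _|) => S C' U *; nra.
split; first by apply/cvg_ex; exists d; exact: qd.
by apply: (cvg_lim (@norm_hausdorff _ _)); exact: qd.
Unshelve. all: by end_near. Qed.

Lemma smear_is_derive (B c : R) h psi x e (t : R) :
  sqi h -> sm psi -> vanish B psi -> 0 < c -> `|e| <= 1 ->
  is_derive t 1 (fun s => smear h psi c (x + s *: e))
    (- c * (e.1 * smear h (dx1 psi) c (x + t *: e) + e.2 * smear h (dx2 psi) c (x + t *: e))).
Proof.
move=> sh sp vp c0 e1; have [C C0 hC] := smear_taylor (x + t *: e) sh sp vp c0.
apply: (@is_derive_quadratic _ _ _ C) => s s1.
have se : `|s *: e| <= `|s| by rewrite normrZ ler_piMr.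
have := hC (s *: e) (le_trans se s1).
rewrite scalerDl addrA /= => h1.
have -> (a b : R) : s * (- c * (e.1 * a + e.2 * b)) = - (c * ((s * e.1) * a + (s * e.2) * b)) by ring.
rewrite opprK; apply: le_trans h1 _; apply: ler_wpM2l => //.
by rewrite -(real_normK (num_real s)) lerXn2r ?nnegrE.
Qed.

End Weyl.

(** * A kernel from the regularised logarithm *)

Definition lap {R : realType} (f : R * R -> R) (x : R * R) : R :=
  dx1 (dx1 f) x + dx2 (dx2 f) x.

(* A smooth function equal to ln |x|^2 for |x| >= 1: up to a constant, a
   regularised fundamental solution of the Laplacian. *)
Definition logmod {R : realType} (x : R * R) : R :=
  let q := x.1 * x.1 + x.2 * x.2 in
  ln (step (4 / 3 * q - 1 / 3) * q + (1 - step (4 / 3 * q - 1 / 3))).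

Section Kernel.
Set Implicit Arguments.
Unset Strict Implicit.
Context {R : realType}.
Notation pt := (R * R)%type.
Implicit Types (f g h phi psi : pt -> R) (A D K : set pt) (a e x y : pt).

Let sq (x : pt) : R := x.1 * x.1 + x.2 * x.2.

Lemma sm_sq : sm sq.
Proof. by apply: sm_add; apply: sm_mul; constructor. Qed.

Lemma sq_norm x : 1 < `|x| -> 1 < sq x.
Proof.
rewrite ltNge ler_norm_pair negb_and -!ltNge /sq -!expr2.
rewrite -(real_normK (num_real x.1)) -(real_normK (num_real x.2)).
move: (normr_ge0 x.1) (normr_ge0 x.2); move: `|x.1| `|x.2| => a b a0 b0.
by case/orP => h; nra.
Qed.

(** A convex combination of q and 1 in which q has weight 0 as long as q <= 1/4; the step starts
    there and is complete at q = 1. *)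
Lemma logmod_arg_gt0 (q : R) : 0 < step (4 / 3 * q - 1 / 3) * q + (1 - step (4 / 3 * q - 1 / 3)).
Proof.
have [q4|q4] := leP q (1 / 4).
  by rewrite step_le0 ?mul0r ?subr0 ?add0r//; lra.
have := step_ge0 (4 / 3 * q - 1 / 3); have := step_le1 (4 / 3 * q - 1 / 3).
by move: (step _) => k k1 k0; nra.
Qed.

Lemma sm_logmod : sm (@logmod R).
Proof.
apply: sm_ln => [x|]; first exact: logmod_arg_gt0.
have ss : sm (fun x => step (4 / 3 * sq x - 1 / 3)).
  apply/sm_step/sm_sub; last exact: sm_cst.
  by apply: sm_mul; [exact: sm_cst|exact: sm_sq].
apply: sm_add; first by apply: sm_mul; [exact: ss|exact: sm_sq].
by apply: sm_sub; [exact: sm_cst|exact: ss].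
Qed.

Lemma logmodE x : 1 <= sq x -> logmod x = ln (sq x).
Proof.
move=> q1; rewrite /logmod step_ge1 -/(sq x); first by rewrite mul1r subrr addr0.
by move: q1; rewrite /sq; lra.
Qed.

Lemma open_sq_gt1 : open [set x | 1 < sq x].
Proof.
rewrite (_ : [set _ | _] = sq @^-1` [set t | 1 < t]) //.
apply: open_comp; last exact: open_gt.
by move=> x _; exact: sm_continuous sm_sq x.
Qed.

Lemma near_sq_gt1 x : 1 < sq x -> \forall y \near x, 1 < sq y.
Proof. by move=> x1; move: open_sq_gt1; rewrite openE => /(_ x x1). Qed.

Lemma derive_sq x (v : pt) : 'D_v sq x = 2 * (x.1 * v.1 + x.2 * v.2).
Proof.
have d1 w := derive_fst x w; have d2 w := derive_snd x w.
have sf : sm (fun y : pt => y.1 * y.1) by apply: sm_mul; constructor.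
have ss : sm (fun y : pt => y.2 * y.2) by apply: sm_mul; constructor.
have df w : derivable (fun y : pt => y.1) x w by apply: sm_derivable; constructor.
have ds w : derivable (fun y : pt => y.2) x w by apply: sm_derivable; constructor.
rewrite derive_sm; last exact: sm_sq.
rewrite /dx1 /dx2 !deriveD; try exact: sm_derivable.
rewrite !deriveM// !d1 !d2 /= /GRing.scale /=; ring.
Qed.

Lemma derive_logmod x (v : pt) : 1 < sq x ->
  'D_v logmod x = (sq x)^-1 * (2 * (x.1 * v.1 + x.2 * v.2)).
Proof.
move=> x1; have s0 : 0 < sq x by exact: lt_trans x1.
rewrite (near_eq_derive (g := fun y => ln (sq y))).
  by rewrite (derive_comp1 _ (sm_differentiable x sm_sq) (is_derive1_ln s0)).2 derive_sq.
by apply: filterS (near_sq_gt1 x1) => y /ltW; exact: logmodE.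
Qed.

Lemma derive2_logmod x (v : pt) : 1 < sq x ->
  'D_v ('D_v logmod) x =
    2 * (v.1 ^+ 2 + v.2 ^+ 2) / sq x - 4 * (x.1 * v.1 + x.2 * v.2) ^+ 2 / sq x ^+ 2.
Proof.
move=> x1; have s0 : sq x != 0 by rewrite gt_eqF// (lt_trans _ x1).
pose l (y : pt) := 2 * (y.1 * v.1 + y.2 * v.2).
have sl : sm l.
  by apply: sm_mul; [constructor|apply: sm_add; apply: sm_mul; constructor].
have [di Di] := derive_comp1 v (sm_differentiable x sm_sq) (is_derive_inv s0).
rewrite (near_eq_derive (g := fun y => (sq y)^-1 * l y)); last first.
  by apply: filterS (near_sq_gt1 x1) => y; exact: derive_logmod.
rewrite deriveM; [|exact: diff_derivable|exact: sm_derivable].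
have -> : 'D_v l x = 2 * (v.1 ^+ 2 + v.2 ^+ 2).
  rewrite /l (_ : (fun y : pt => _) = (fun y : pt => (2 * v.1) *: y.1 + (2 * v.2) *: y.2)).
    have df w : derivable (fun y : pt => y.1) x w by apply: sm_derivable; constructor.
    have ds w : derivable (fun y : pt => y.2) x w by apply: sm_derivable; constructor.
    rewrite deriveD; [|exact: derivableZ|exact: derivableZ].
    by rewrite !deriveZ// derive_fst derive_snd /GRing.scale /=; ring.
  by apply/funext => y; rewrite /GRing.scale /=; ring.
rewrite Di derive_sq /GRing.scale /= /l; field; exact: s0.
Qed.

Lemma lap_logmod x : 1 < sq x -> lap logmod x = 0.
Proof.
move=> x1; have s0 : sq x != 0 by rewrite gt_eqF// (lt_trans _ x1).
apply: (etrans (congr2 +%R (derive2_logmod (1, 0) x1) (derive2_logmod (0, 1) x1))).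
rewrite /=; move: s0; rewrite /sq.
by move: (x.1) (x.2) => a b s0; field; exact: s0.
Qed.

Lemma vanish_lap_logmod : vanish 2 (lap (@logmod R)).
Proof.
by move=> x x2; apply/lap_logmod/sq_norm; apply: lt_le_trans x2; rewrite ltr1n.
Qed.

Lemma vanish_derive_lap_logmod (v : pt) : vanish 2 ('D_v (lap (@logmod R))).
Proof.
move=> x x2; apply: derive_zero_near.
have /near_sq_gt1 : 1 < sq x by apply: sq_norm; apply: lt_le_trans x2; rewrite ltr1n.
by apply: filterS => y; exact: lap_logmod.
Qed.

Lemma sm_lap f : sm f -> sm (lap f).
Proof. by move=> sf; apply: sm_add; [exact/sm_dx1/sm_dx1|exact/sm_dx2/sm_dx2]. Qed.

Lemma dx1_affine f (c : R) a : sm f ->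
  dx1 (fun y => f (c *: (y - a))) = (fun y => c * dx1 f (c *: (y - a))).
Proof. by move=> sf; apply/funext => y; exact: derive_affine. Qed.

Lemma dx2_affine f (c : R) a : sm f ->
  dx2 (fun y => f (c *: (y - a))) = (fun y => c * dx2 f (c *: (y - a))).
Proof. by move=> sf; apply/funext => y; exact: derive_affine. Qed.

Lemma dx1_add f g : sm f -> sm g -> dx1 (fun y => f y + g y) = (fun y => dx1 f y + dx1 g y).
Proof. by move=> sf sg; apply/funext => y; rewrite /dx1 deriveD//; exact: sm_derivable. Qed.

Lemma dx2_add f g : sm f -> sm g -> dx2 (fun y => f y + g y) = (fun y => dx2 f y + dx2 g y).
Proof. by move=> sf sg; apply/funext => y; rewrite /dx2 deriveD//; exact: sm_derivable. Qed.

Lemma dx1_scale f (c : R) : sm f -> dx1 (fun y => c * f y) = (fun y => c * dx1 f y).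
Proof. by move=> sf; apply/funext => y; rewrite /dx1 deriveZ//; exact: sm_derivable. Qed.

Lemma dx2_scale f (c : R) : sm f -> dx2 (fun y => c * f y) = (fun y => c * dx2 f y).
Proof. by move=> sf; apply/funext => y; rewrite /dx2 deriveZ//; exact: sm_derivable. Qed.

Lemma dx1_cst (c : R) : dx1 (fun=> c : R) = (fun=> 0 : R).
Proof. by apply/funext => y; rewrite /dx1 derive_cst. Qed.

Lemma dx2_cst (c : R) : dx2 (fun=> c : R) = (fun=> 0 : R).
Proof. by apply/funext => y; rewrite /dx2 derive_cst. Qed.

Lemma lap_affine f (c : R) a : sm f ->
  lap (fun y => f (c *: (y - a))) = (fun y => c ^+ 2 * lap f (c *: (y - a))).
Proof.
move=> sf; have s1 := sm_dx1 sf; have s2 := sm_dx2 sf.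
have E1 := etrans (congr1 dx1 (dx1_affine c a sf)) (dx1_scale c (sm_affine c a s1)).
have E2 := etrans (congr1 dx2 (dx2_affine c a sf)) (dx2_scale c (sm_affine c a s2)).
apply/funext => y.
have F1 := congr1 (fun g => c * g y) (dx1_affine c a s1).
have F2 := congr1 (fun g => c * g y) (dx2_affine c a s2).
have G1 := etrans (congr1 (fun g => g y) E1) F1; have G2 := etrans (congr1 (fun g => g y) E2) F2.
apply: (etrans (congr2 +%R G1 G2)).
rewrite /lap; move: (dx1 (dx1 f) _) (dx2 (dx2 f) _) => u v; ring.
Qed.

Lemma lap_add f g : sm f -> sm g -> lap (fun y => f y + g y) = (fun y => lap f y + lap g y).
Proof.
move=> sf sg.
have E1 := etrans (congr1 dx1 (dx1_add sf sg)) (dx1_add (sm_dx1 sf) (sm_dx1 sg)).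
have E2 := etrans (congr1 dx2 (dx2_add sf sg)) (dx2_add (sm_dx2 sf) (sm_dx2 sg)).
apply/funext => y.
apply: (etrans (congr2 +%R (congr1 (fun g => g y) E1) (congr1 (fun g => g y) E2))).
exact: addrACA.
Qed.

Lemma lap_scale f (c : R) : sm f -> lap (fun y => c * f y) = (fun y => c * lap f y).
Proof.
move=> sf.
have E1 := etrans (congr1 dx1 (dx1_scale c sf)) (dx1_scale c (sm_dx1 sf)).
have E2 := etrans (congr1 dx2 (dx2_scale c sf)) (dx2_scale c (sm_dx2 sf)).
apply/funext => y.
apply: (etrans (congr2 +%R (congr1 (fun g => g y) E1) (congr1 (fun g => g y) E2))).
exact/esym/mulrDr.
Qed.

Lemma lap_cst (c : R) : lap (fun=> c : R) = (fun=> 0 : R).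
Proof. by apply/funext => y; rewrite /lap !dx1_cst !dx2_cst addr0. Qed.

Lemma lap_dx1 f : sm f -> lap (dx1 f) = dx1 (lap f).
Proof.
move=> sf; have s1 := sm_dx1 sf; have s2 := sm_dx2 sf.
apply: (etrans _ (esym (dx1_add (sm_dx1 s1) (sm_dx2 s2)))); apply/funext => y.
apply: (congr1 (fun g : pt -> R => dx1 (dx1 (dx1 f)) y + g y)).
exact: (etrans (congr1 dx2 (esym (dx12_sm sf))) (esym (dx12_sm s2))).
Qed.

Lemma lap_dx2 f : sm f -> lap (dx2 f) = dx2 (lap f).
Proof.
move=> sf; have s1 := sm_dx1 sf; have s2 := sm_dx2 sf.
apply: (etrans _ (esym (dx2_add (sm_dx1 s1) (sm_dx2 s2)))); apply/funext => y.
apply: (congr1 (fun g : pt -> R => g y + dx2 (dx2 (dx2 f)) y)).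
exact: (etrans (congr1 dx1 (dx12_sm sf)) (dx12_sm s1)).
Qed.

Lemma tst_lap D phi : tst D phi -> tst D (lap phi).
Proof. by move=> t; apply: tst_add; [exact/tst_dx1/tst_dx1|exact/tst_dx2/tst_dx2]. Qed.

Lemma Int_lap D phi : tst D phi -> Int (lap phi) = 0.
Proof.
move=> t; have [B vB] := tst_vanish t; have sp := tst_sm t.
have s1 := sm_dx1 sp; have s2 := sm_dx2 sp.
have v1 := vanish_derive (1, 0) vB; have v2 := vanish_derive (0, 1) vB.
have I1 := Int_dx1 (fun x => sm_derivable s1) (sm_continuous (sm_dx1 s1)) v1.
have I2 := Int_dx2 (fun x => sm_derivable s2) (sm_continuous (sm_dx2 s2)) v2.
have i1 := vanish_itg (sm_continuous (sm_dx1 s1)) (vanish_derive (1, 0) v1).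
have i2 := vanish_itg (sm_continuous (sm_dx2 s2)) (vanish_derive (0, 1) v2).
exact (etrans (IntD i1 i2) (etrans (congr2 +%R I1 I2) (addr0 0))).
Qed.

Lemma lap_logmod_even x : lap logmod (- x) = lap logmod x.
Proof.
have E : (fun y : pt => logmod (-1 *: (y - 0))) = @logmod R.
  by apply/funext => y; rewrite subr0 scaleN1r /logmod /= !mulrNN.
have := congr1 (fun f => lap f x) E.
by rewrite lap_affine; [rewrite sqrrN expr1n mul1r subr0 scaleN1r|exact: sm_logmod].
Qed.

(** Away from x both logarithms are ln |y - x|^2 up to the constants 2 ln c and 2 ln c'; the last
    term cancels their difference and leaves a function of compact support. *)
Definition logdiff (c c' : R) x : pt -> R :=
  fun y => (logmod (c *: (y - x)) + (-1) * logmod (c' *: (y - x))) + (2 * ln c' - 2 * ln c).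

Lemma logdiff_tst (c c' : R) x D : 0 < c -> 0 < c' ->
  [set y | `|y - x| <= 2 / c] `<=` D -> [set y | `|y - x| <= 2 / c'] `<=` D ->
  tst D (logdiff c c' x).
Proof.
move=> c0 c'0 cD c'D; split.
  apply: sm_add; last exact: sm_cst.
  apply: sm_add; first by apply: sm_affine; exact: sm_logmod.
  by apply: sm_mul; [exact: sm_cst|apply: sm_affine; exact: sm_logmod].
exists ([set y | `|y - x| <= 2 / c] `|` [set y | `|y - x| <= 2 / c']); split.
- by apply: compactU; exact: compact_cbox.
- by move=> y [/cD|/c'D].
have key (r : R) y : 0 < r -> ~ `|y - x| <= 2 / r ->
    logmod (r *: (y - x)) = 2 * ln r + ln (sq (y - x)).
  move=> r0 /negP; rewrite -ltNge ltr_pdivrMr// => h.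
  have h1 : 1 < sq (r *: (y - x)).
    by apply: sq_norm; rewrite normrZ gtr0_norm// mulrC (lt_trans _ h)// ltr1n.
  rewrite logmodE ?ltW//; have E : sq (r *: (y - x)) = r ^+ 2 * sq (y - x).
    by rewrite /sq /= /GRing.scale /=; ring.
  have s0 : 0 < sq (y - x).
    by move: h1; rewrite E => /(lt_trans ltr01); rewrite pmulr_rgt0// exprn_gt0.
  by rewrite E lnM ?posrE ?exprn_gt0// lnXn// mulr_natl.
move=> y /not_orP[h h']; rewrite /logdiff !key//.
by move: (ln c) (ln c') (ln _) => *; ring.
Qed.

Lemma lap_logdiff (c c' : R) x : lap (logdiff c c' x) =
  fun y => c ^+ 2 * lap logmod (c *: (y - x)) - c' ^+ 2 * lap logmod (c' *: (y - x)).
Proof.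
have sl := sm_logmod.
have sa (r : R) : sm (fun y => logmod (r *: (y - x))) by exact: sm_affine.
have sm1 : sm (fun y => -1 * logmod (c' *: (y - x))) by apply: sm_mul; [exact: sm_cst|exact: sa].
apply: (etrans (lap_add (sm_add (sa c) sm1) (sm_cst (2 * ln c' - 2 * ln c)))).
apply/funext => y; rewrite (congr1 (fun g => g y) (lap_cst _)) addr0.
rewrite (congr1 (fun g => g y) (lap_add (sa c) sm1)) (congr1 (fun g => g y) (lap_scale (-1) (sa c'))).
have A1 := congr1 (fun g : pt -> R => g y) (lap_affine c x sl).
have A2 := congr1 (fun g : pt -> R => g y) (lap_affine c' x sl).
have A3 := congr2 (fun u v : R => u + -1 * v) A1 A2.
apply: (etrans A3); rewrite /=; move: (lap _ _) (lap _ _) => u v; ring.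
Qed.

End Kernel.

Section KernelMass.
Set Implicit Arguments.
Unset Strict Implicit.
Context {R : realType}.
Notation pt := (R * R)%type.
Implicit Types (f g h u phi psi : pt -> R) (A D K : set pt) (a e x y : pt).

Lemma mble_cbox a (r : R) : mble [set x : pt | `|x - a| <= r].
Proof.
have : mble (~` [set x : pt | `|x - a| <= r]).
  apply: mble_open; apply: closed_openC; apply: compact_closed; last exact: compact_cbox.
  exact: norm_hausdorff.
by move/measurableC; rewrite setCK.
Qed.

Lemma le_integral_itv (G : R -> R) (B m : R) : 0 <= B -> 0 <= m -> continuous G ->
  (forall s, `|s| <= B -> m <= G s) ->
  ((2 * B * m)%R%:E <= \int[mu1]_(s in `[(- B)%R, B]) (G s)%:E)%E.
Proof.
move=> B0 m0 cG mG.
apply: (@le_trans _ _ (\int[mu1]_(s in `[(- B)%R, B]) m%:E)%E).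
  rewrite integral_cst//= /mu1 lebesgue_measure_itv /= lte_fin.
  case: ifPn => [_|]; first by rewrite -EFinB -EFinM lee_fin; nra.
  by rewrite -leNgt mule0 lee_fin => h; nra.
apply: ge0_le_integral => //=.
- apply/measurable_EFinP; apply: measurable_funTS; exact: continuous_measurable_fun.
- by move=> s; rewrite in_itv /= -ler_norml => /mG; rewrite lee_fin.
Qed.

Lemma itg_patch_cbox f (B : R) : continuous f -> itg (f \_ [set x : pt | `|x| <= B]).
Proof.
move=> cf; have [C C0 hC] := continuous_compact_bounded (@compact_sqbox R B) cf.
have mQ : mble [set x : pt | `|x| <= B].
  by rewrite (_ : [set _ | _] = [set x : pt | `|x - 0| <= B]); [exact: mble_cbox|apply/seteqP; split => x /=; rewrite subr0].
apply: (@itg_bounded _ _ 0 (B + 1) C); first by apply: meas_patch => //; exact: meas_continuous.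
  by move=> x; rewrite patchE; case: ifPn => [|_]; [rewrite inE; exact: hC|rewrite normr0].
move=> x /box0P xB; rewrite patchE; case: ifPn => //; rewrite inE /= => xB'.
by exfalso; apply: xB; apply: le_lt_trans xB' _; rewrite ltrDl.
Qed.

(** The flux of a derivative through two opposite sides of a square, bounded from below; it will
    show that the kernel has positive mass. *)
Lemma Int_dx1_square u (B m : R) : 0 <= B -> 0 <= m -> continuous u ->
  (forall x, derivable u x (1, 0)) -> continuous (dx1 u) ->
  (forall s, `|s| <= B -> m <= u (B, s) - u (- B, s)) ->
  2 * B * m <= Int (dx1 u \_ [set x : pt | `|x| <= B]).
Proof.
move=> B0 m0 cu du cd hm; rewrite -lee_fin (Int_fubini1 (itg_patch_cbox B cd)).
have E (s : R) : (\int[mu1]_t ((dx1 u \_ [set x : pt | `|x| <= B]) (t, s))%:E =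
    (if `|s| <= B then u (B, s) - u (- B, s) else 0)%:E)%E.
  case: ifPn => [sB|sB]; last first.
    apply: integral0_eq => t _; rewrite patchE memNset//= ler_norm_pair /=.
    by rewrite (negbTE sB) andbF.
  rewrite (integral_itv_support (p := - B) (q := B)).
    rewrite -(slice1_FTC _ _ du cd); last by lra.
    apply: eq_integral => t; rewrite inE /= in_itv /= -ler_norml => tB.
    by rewrite patchE mem_set//= ler_norm_pair /= tB.
  move=> t; rewrite -ler_norml => tB; rewrite patchE memNset//= ler_norm_pair /=.
  by rewrite (negbTE tB).
under eq_integral do rewrite E.
rewrite (integral_itv_support (p := - B) (q := B)); last first.
  by move=> s; rewrite -ler_norml => /negbTE ->.
apply: le_trans (le_integral_itv B0 m0 (G := fun s => u (B, s) - u (- B, s)) _ hm) _.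
  by move=> s; apply: cvgB; exact: continuous_slice2.
rewrite le_eqVlt; apply/orP; left; apply/eqP/eq_integral => s.
by rewrite inE /= in_itv /= -ler_norml => ->.
Qed.

Lemma Int_dx2_square u (B m : R) : 0 <= B -> 0 <= m -> continuous u ->
  (forall x, derivable u x (0, 1)) -> continuous (dx2 u) ->
  (forall s, `|s| <= B -> m <= u (s, B) - u (s, - B)) ->
  2 * B * m <= Int (dx2 u \_ [set x : pt | `|x| <= B]).
Proof.
move=> B0 m0 cu du cd hm; rewrite -lee_fin (Int_fubini2 (itg_patch_cbox B cd)).
have E (t : R) : (\int[mu1]_s ((dx2 u \_ [set x : pt | `|x| <= B]) (t, s))%:E =
    (if `|t| <= B then u (t, B) - u (t, - B) else 0)%:E)%E.
  case: ifPn => [tB|tB]; last first.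
    apply: integral0_eq => s _; rewrite patchE memNset//= ler_norm_pair /=.
    by rewrite (negbTE tB).
  rewrite (integral_itv_support (p := - B) (q := B)).
    rewrite -(slice2_FTC _ _ du cd); last by lra.
    apply: eq_integral => s; rewrite inE /= in_itv /= -ler_norml => sB.
    by rewrite patchE mem_set//= ler_norm_pair /= tB.
  move=> s; rewrite -ler_norml => sB; rewrite patchE memNset//= ler_norm_pair /=.
  by rewrite (negbTE sB) andbF.
under eq_integral do rewrite E.
rewrite (integral_itv_support (p := - B) (q := B)); last first.
  by move=> s; rewrite -ler_norml => /negbTE ->.
apply: le_trans (le_integral_itv B0 m0 (G := fun s => u (s, B) - u (s, - B)) _ hm) _.
  by move=> s; apply: cvgB; exact: continuous_slice1.
rewrite le_eqVlt; apply/orP; left; apply/eqP/eq_integral => s.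
by rewrite inE /= in_itv /= -ler_norml => ->.
Qed.

Lemma patch_add_zero f g A : (forall x, ~ A x -> f x + g x = 0) ->
  (fun x => f x + g x) = fun x => (f \_ A) x + (g \_ A) x.
Proof.
move=> vf; apply/funext => x; rewrite /patch; case: ifPn => [//|].
by rewrite notin_setE => /vf ->; rewrite addr0.
Qed.

(** The Laplacian lives in the square of half-side 2, on whose sides the function is ln |x|^2. The
    exact mass would be 4 pi; for positivity, each pair of opposite sides has a flux density 8 / (4
    + s^2), which is at least 1 for |s| <= 2. *)
Lemma Int_lap_logmod_gt0 : 0 < Int (lap (@logmod R)).
Proof.
have sl := @sm_logmod R; have s1 := sm_dx1 sl; have s2 := sm_dx2 sl.
have E := @patch_add_zero (dx1 (dx1 (@logmod R))) (dx2 (dx2 (@logmod R))) [set x : pt | `|x| <= 2] _.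
have /E{}E : forall x : pt, ~ `|x| <= 2 -> dx1 (dx1 (@logmod R)) x + dx2 (dx2 (@logmod R)) x = 0.
  by move=> x /negP; rewrite -ltNge => /ltW; exact: vanish_lap_logmod.
change (0 < Int (fun x => dx1 (dx1 (@logmod R)) x + dx2 (dx2 (@logmod R)) x)).
have i1 := itg_patch_cbox 2 (sm_continuous (sm_dx1 s1)).
have i2 := itg_patch_cbox 2 (sm_continuous (sm_dx2 s2)).
rewrite E (IntD i1 i2).
have sq2 (s : R) : `|s| <= 2 -> 1 <= 8 / (4 + s ^+ 2).
  move=> s2'; rewrite ler_pdivlMr; last by rewrite ltr_pwDl// sqr_ge0.
  by rewrite -(real_normK (num_real s)); have := normr_ge0 s; nra.
have h1 : 2 * 2 * 1 <= Int (dx1 (dx1 (@logmod R)) \_ [set x : pt | `|x| <= 2]).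
  apply: (Int_dx1_square _ _ (sm_continuous s1) (fun x => sm_derivable s1) (sm_continuous (sm_dx1 s1))) => //.
  move=> s s2'; have d0 : 4 + s * s != 0 by rewrite gt_eqF// ltr_pwDl// -expr2 sqr_ge0.
  have e1 : 1 < 2 * 2 + s * s by nra.
  have e2 : 1 < (- 2) * (- 2) + s * s by nra.
  have D1 : dx1 (@logmod R) (2, s) = 4 / (4 + s * s).
    apply: (etrans (derive_logmod (x := (2, s)) (1, 0) e1)) => /=.
    by rewrite (_ : 2 * 2 = 4 :> R); [field|ring].
  have D2 : dx1 (@logmod R) (- 2, s) = - (4 / (4 + s * s)).
    apply: (etrans (derive_logmod (x := (- 2, s)) (1, 0) e2)) => /=.
    by rewrite (_ : -2 * -2 = 4 :> R); [field|ring].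
  rewrite D1 D2 opprK; apply: le_trans (sq2 _ s2') _; rewrite expr2 -mulrDl.
  by rewrite (_ : 4 + 4 = 8 :> R)//; ring.
have h2 : 2 * 2 * 1 <= Int (dx2 (dx2 (@logmod R)) \_ [set x : pt | `|x| <= 2]).
  apply: (Int_dx2_square _ _ (sm_continuous s2) (fun x => sm_derivable s2) (sm_continuous (sm_dx2 s2))) => //.
  move=> s s2'; have d0 : 4 + s * s != 0 by rewrite gt_eqF// ltr_pwDl// -expr2 sqr_ge0.
  have e1 : 1 < s * s + 2 * 2 by nra.
  have e2 : 1 < s * s + (- 2) * (- 2) by nra.
  have D1 : dx2 (@logmod R) (s, 2) = 4 / (4 + s * s).
    apply: (etrans (derive_logmod (x := (s, 2)) (0, 1) e1)) => /=.
    by rewrite addrC (_ : 2 * 2 = 4 :> R); [field|ring].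
  have D2 : dx2 (@logmod R) (s, - 2) = - (4 / (4 + s * s)).
    apply: (etrans (derive_logmod (x := (s, - 2)) (0, 1) e2)) => /=.
    by rewrite addrC (_ : -2 * -2 = 4 :> R); [field|ring].
  rewrite D1 D2 opprK; apply: le_trans (sq2 _ s2') _; rewrite expr2 -mulrDl.
  by rewrite (_ : 4 + 4 = 8 :> R)//; ring.
by apply: lt_le_trans (lerD h1 h2); rewrite mulr1 -mulr2n mulrn_wgt0// mulr_gt0.
Qed.

(** Two rescalings of the kernel differ by the Laplacian of a test function, so a weakly harmonic
    function has the same weighted average at all admissible scales: this is the mean value property
    in the form used below. *)
Lemma weyl_kernel : exists eta : pt -> R,
  [/\ sm eta, vanish 2 eta /\ vanish 2 (dx1 eta) /\ vanish 2 (dx2 eta),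
      forall x, eta (- x) = eta x, 0 < Int eta &
      forall D (c c' : R) x, 0 < c -> 0 < c' ->
        [set y | `|y - x| <= 2 / c] `<=` D -> [set y | `|y - x| <= 2 / c'] `<=` D ->
        exists phi, tst D phi /\
          lap phi = fun y => c ^+ 2 * eta (c *: (y - x)) + (- c' ^+ 2) * eta (c' *: (y - x))].
Proof.
exists (lap (@logmod R)); split.
- exact: sm_lap sm_logmod.
- by split; [|split]; [exact: vanish_lap_logmod|exact: vanish_derive_lap_logmod..].
- exact: lap_logmod_even.
- exact: Int_lap_logmod_gt0.
- move=> D c c' x c0 c'0 cD c'D; exists (logdiff c c' x); split; first exact: logdiff_tst.
  by rewrite lap_logdiff; apply/funext => y; rewrite mulNr.
Qed.

End KernelMass.

Section WeylLemma.
Set Implicit Arguments.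
Unset Strict Implicit.
Context {R : realType}.
Notation pt := (R * R)%type.
Notation T1 := (measurableTypeR R).
Notation T2 := (T1 * T1)%type.
Implicit Types (f g h u phi psi eta : pt -> R) (A D K : set pt) (a e x y : pt).

(** A majorant of product form supplies joint integrability, hence Fubini. *)
Lemma Int_swap (F : pt * pt -> R) f g :
  measurable_fun setT (F : T2 * T2 -> R) -> itg f -> itg g ->
  (forall x y, `|F (x, y)| <= f x * g y) ->
  Int (fun x => Int (fun y => F (x, y))) = Int (fun y => Int (fun x => F (x, y))).
Proof.
move=> mF fi gi bF.
have mEF : measurable_fun setT (EFin \o F : T2 * T2 -> \bar R) by exact/measurable_EFinP.
have iy x : itg (fun y => F (x, y)).
  apply: itg_le (itgZ (f x) gi) (bF x).
  exact: (measurableT_comp mF (measurable_pair1 _)).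
have ix y : itg (fun x => F (x, y)).
  apply: itg_le (itgZ (g y) fi) _; last by move=> x; rewrite mulrC.
  exact: (measurableT_comp mF (measurable_pair2 _)).
have iF : (@mu2 R \x @mu2 R)%E.-integrable setT (EFin \o F : T2 * T2 -> \bar R).
  apply/(integrable12ltyP _ _ mEF).
  apply: (@le_lt_trans _ _ (\int[mu2]_x (Int g * f x)%:E)%E).
    apply: ge0_le_integral => //=.
    - by move=> x _; exact: integral_ge0.
    - have := @measurable_fun_fubini_tonelli_F _ _ T2 T2 R (@mu2 R) (abse \o (EFin \o F)).
      by apply; [exact: measurableT_comp|move=> ?; exact: abse_ge0].
    - by apply/measurable_EFinP; exact: (itg_meas (itgZ _ fi)).
    - move=> x _; rewrite mulrC -(IntZ _ gi) -(Int_EFin (itgZ _ gi)).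
      apply: ge0_le_integral => //=.
      + by apply/measurable_EFinP; exact: itg_meas (itg_norm (iy x)).
      + by apply/measurable_EFinP; exact: (itg_meas (itgZ _ gi)).
      + by move=> y _; rewrite lee_fin.
  by rewrite (Int_EFin (itgZ _ fi)) ltry.
have := etrans (integral12_prod_meas1 iF) (esym (integral21_prod_meas1 iF)).
rewrite /fubini_F /fubini_G => E.
have -> : Int (fun x => Int (fun y => F (x, y))) =
    fine (\int[mu2]_x \int[mu2]_y (F (x, y))%:E)%E.
  by congr fine; apply: eq_integral => x _; rewrite (Int_EFin (iy x)).
by rewrite E; congr fine; apply: eq_integral => y _; rewrite (Int_EFin (ix y)).
Qed.

Lemma cont_near (V W : normedModType R) (f g : V -> W) (x : V) (d : R) : 0 < d ->
  (forall y : V, `|y - x| < d -> g y = f y) ->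
  {for x, continuous f} -> {for x, continuous g}.
Proof.
move=> d0 E cf; have Ex : g x = f x by apply: E; rewrite subrr normr0.
suff : g @ x --> g x by [].
rewrite Ex; apply: cvg_trans cf; apply: near_eq_cvg; apply/nbhs_ballP; exists d => // y.
by rewrite -ball_normE /= distrC => /E ->.
Qed.

Lemma is_derive_near (f g : R -> R) (t d l : R) : 0 < d ->
  (forall s, `|s - t| < d -> g s = f s) -> is_derive t 1 f l -> is_derive t 1 g l.
Proof.
move=> d0 E [df Df].
have fg : \forall s \near t, f s = g s.
  by apply/nbhs_ballP; exists d => // y; rewrite -ball_normE /= distrC => /E.
by apply: (near_eq_is_derive fg); split.
Qed.

(** c is an inverse length: the kernel at scale c lives in the box of radius 2 / c, which has to fit
    into D. *)
Let adm D x (c : R) := 0 < c /\ [set y | `|y - x| <= 2 / c] `<=` D.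

Lemma adm_near D x y (c : R) : adm D x c -> `|y - x| < c^-1 -> adm D y (2 * c).
Proof.
move=> [c0 cD] yx; split; first by rewrite mulr_gt0.
move=> z /= zy; apply: cD => /=; have -> : z - x = (z - y) + (y - x) by rewrite addrA subrK.
apply: le_trans (ler_normD _ _) _; have -> : 2 / c = c^-1 + c^-1 by rewrite mulr_natl mulr2n.
by apply: lerD; [move: zy; rewrite invfM mulrA divff ?mul1r|exact: ltW].
Qed.

Lemma open_adm D : open D -> forall x, exists c : R, D x -> adm D x c.
Proof.
move=> /openP_box oD x; have [Dx|nDx] := pselect (D x); last by exists 0.
have [r r0 xr] := oD _ Dx; exists (4 / r) => _; split; first by rewrite divr_gt0.
move=> y /= yx; apply: xr; rewrite /box /=; apply: le_lt_trans yx _.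
by rewrite invf_div mulrA ltr_pdivrMr//; lra.
Qed.

(** The exponent n will be 2 for the kernel and 3 for its first derivatives, since differentiating
    eta (c (y - x)) produces one more factor c. *)
Definition scale_invariant D h psi n := forall x (c c' : R), adm D x c -> adm D x c' ->
  c ^+ n * smear h psi c x = c' ^+ n * smear h psi c' x.

(** Harmonicity is tested with phi, [dx1 phi] and [dx2 phi], where the Laplacian of phi is the
    difference of the kernels at two scales; the Laplacian commutes with derivatives. *)
Lemma kernel_scale_invariant D h eta :
  sqi h -> (forall phi, tst D phi -> Int (fun x => h x * lap phi x) = 0) ->
  sm eta -> vanish 2 eta -> vanish 2 (dx1 eta) -> vanish 2 (dx2 eta) ->
  (forall D' (c c' : R) x, 0 < c -> 0 < c' ->
    [set y | `|y - x| <= 2 / c] `<=` D' -> [set y | `|y - x| <= 2 / c'] `<=` D' ->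
    exists phi, tst D' phi /\
      lap phi = fun y => c ^+ 2 * eta (c *: (y - x)) + (- c' ^+ 2) * eta (c' *: (y - x))) ->
  [/\ scale_invariant D h eta 2, scale_invariant D h (dx1 eta) 3 & scale_invariant D h (dx2 eta) 3].
Proof.
move=> sh harm se ve v1 v2 ker.
have key psi (p q c c' : R) x : sm psi -> vanish 2 psi -> 0 < c -> 0 < c' ->
    Int (fun y => h y * (p * psi (c *: (y - x)) + (- q) * psi (c' *: (y - x)))) = 0 ->
    p * smear h psi c x = q * smear h psi c' x.
  move=> sp vp c0 c'0; have i1 := smear_itg x sh (sm_continuous sp) vp c0.
  have i2 := smear_itg x sh (sm_continuous sp) vp c'0.
  rewrite (_ : (fun y => _) = (fun y => p * (h y * psi (c *: (y - x))) + (- q) * (h y * psi (c' *: (y - x))))).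
    rewrite (IntD (itgZ p i1) (itgZ (- q) i2)) (IntZ p i1) (IntZ (- q) i2) mulNr => /eqP.
    by rewrite subr_eq0 => /eqP.
  by apply/funext => y; rewrite mulrDr !(mulrCA (h y)).
split=> x c c' [c0 cD] [c'0 c'D]; have [phi [tphi E]] := ker D c c' x c0 c'0 cD c'D.
- by apply: key => //; rewrite -[RHS](harm _ tphi) E.
- have sa (r : R) : sm (fun y => eta (r *: (y - x))) by exact: sm_affine.
  have sz (p r : R) : sm (fun y => p * eta (r *: (y - x))) by apply: sm_mul; [exact: sm_cst|exact: sa].
  apply: key => //; first exact: sm_dx1.
  rewrite -[RHS](harm _ (tst_dx1 tphi)); congr Int; apply/funext => y; congr (_ * _).
  have E1 := etrans (lap_dx1 (tst_sm tphi)) (congr1 dx1 E).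
  have E2 := etrans E1 (dx1_add (sz _ _) (sz _ _)).
  have E3 := congr1 (fun g : pt -> R => g y) E2.
  have F1 r p := etrans (congr1 (fun g : pt -> R => g y) (dx1_scale p (sa r)))
     (congr1 (fun g : pt -> R => p * g y) (dx1_affine r x se)).
  apply: (etrans _ (esym E3)); apply: (etrans _ (esym (congr2 +%R (F1 _ _) (F1 _ _)))) => /=.
  by move: (dx1 eta _) (dx1 eta _) => *; ring.
- have sa (r : R) : sm (fun y => eta (r *: (y - x))) by exact: sm_affine.
  have sz (p r : R) : sm (fun y => p * eta (r *: (y - x))) by apply: sm_mul; [exact: sm_cst|exact: sa].
  apply: key => //; first exact: sm_dx2.
  rewrite -[RHS](harm _ (tst_dx2 tphi)); congr Int; apply/funext => y; congr (_ * _).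
  have E1 := etrans (lap_dx2 (tst_sm tphi)) (congr1 dx2 E).
  have E2 := etrans E1 (dx2_add (sz _ _) (sz _ _)).
  have E3 := congr1 (fun g : pt -> R => g y) E2.
  have F1 r p := etrans (congr1 (fun g : pt -> R => g y) (dx2_scale p (sa r)))
     (congr1 (fun g : pt -> R => p * g y) (dx2_affine r x se)).
  apply: (etrans _ (esym E3)); apply: (etrans _ (esym (congr2 +%R (F1 _ _) (F1 _ _)))) => /=.
  by move: (dx2 eta _) (dx2 eta _) => *; ring.
Qed.

(** The masses at scales c and 1 differ by the integral of a Laplacian, which is 0; this takes the
    place of a change of variables by a dilation. *)
Lemma Int_kernel eta (c : R) y : sm eta -> vanish 2 eta -> (forall x, eta (- x) = eta x) ->
  (forall D' (c c' : R) x, 0 < c -> 0 < c' ->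
    [set y | `|y - x| <= 2 / c] `<=` D' -> [set y | `|y - x| <= 2 / c'] `<=` D' ->
    exists phi, tst D' phi /\
      lap phi = fun y => c ^+ 2 * eta (c *: (y - x)) + (- c' ^+ 2) * eta (c' *: (y - x))) ->
  0 < c ->
  itg (fun x => eta (c *: (y - x))) /\ c ^+ 2 * Int (fun x => eta (c *: (y - x))) = Int eta.
Proof.
move=> se ve even ker c0.
have ev (r : R) : (fun x => eta (r *: (y - x))) = (fun x => eta (r *: (x - y))).
  by apply/funext => x; rewrite -even -scalerN opprB.
have ie : itg eta by exact: vanish_itg (sm_continuous se) ve.
have i1 (r : R) : 0 < r -> itg (fun x => eta (r *: (x - y))).
  move=> r0; apply: (@vanish_itg R (`|y| + 2 / r)).
    by apply: sm_continuous; exact: sm_affine.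
  move=> x xB; apply: ve; rewrite normrZ gtr0_norm// mulrC -ler_pdivrMr//.
  rewrite -(lerD2l `|y|); apply: le_trans xB _.
  by rewrite -{1}(subrK y x) addrC; exact: ler_normD.
rewrite ev; split; first exact: i1.
have [phi [tphi E]] := ker setT c 1 y c0 ltr01 (fun _ _ => I) (fun _ _ => I).
have := Int_lap tphi; rewrite E (IntD (itgZ _ (i1 _ c0)) (itgZ _ (i1 _ ltr01))).
rewrite (IntZ _ (i1 _ c0)) (IntZ _ (i1 _ ltr01)) expr1n mulN1r => /eqP.
rewrite subr_eq0 => /eqP ->.
under [X in Int X]eq_fun do rewrite scale1r.
exact: (Int_shift (- y) ie).
Qed.

Lemma mollify_estimate eta phi (B : R) : sm eta -> vanish 2 eta -> (forall x, eta (- x) = eta x) ->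
  (forall D' (c c' : R) x, 0 < c -> 0 < c' ->
    [set y | `|y - x| <= 2 / c] `<=` D' -> [set y | `|y - x| <= 2 / c'] `<=` D' ->
    exists phi, tst D' phi /\
      lap phi = fun y => c ^+ 2 * eta (c *: (y - x)) + (- c' ^+ 2) * eta (c' *: (y - x))) ->
  sm phi -> vanish B phi ->
  exists2 C, 0 <= C & forall (c : R) y, 0 < c ->
    `|c ^+ 2 * Int (fun x => eta (c *: (y - x)) * phi x) - Int eta * phi y| <= C / c.
Proof.
move=> se ve even ker sp vp.
have [M M0 hM] := vanish_bounded (sm_continuous se) ve.
have [L L0 hL] := sm_lipschitz sp vp.
(* M bounds the kernel and L (2 / c) the oscillation of phi on its support, a box of area 4 (2 /
   c)^2; with the prefactor c^2 the product is 32 M L / c. *)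
exists (32 * M * L); first by rewrite !mulr_ge0.
move=> c y c0; have [ie Ie] := Int_kernel y se ve even ker c0.
have iep : itg (fun x => eta (c *: (y - x)) * phi x).
  rewrite (_ : (fun x => _) = (fun x => phi x * eta (- (c *: (x - y))))).
    rewrite (_ : (fun x => _) = (fun x => phi x * eta (c *: (x - y)))).
      apply: (@smear_itg _ 2) => //; [exact: vanish_sqi (sm_continuous sp) vp|exact: sm_continuous].
    by apply/funext => x; rewrite even.
  by apply/funext => x; rewrite mulrC -scalerN opprB.
rewrite -Ie -mulrA -mulrBr normrM ger0_norm ?sqr_ge0//.
have -> : Int (fun x => eta (c *: (y - x)) * phi x) - Int (fun x => eta (c *: (y - x))) * phi y =
  Int (fun x => eta (c *: (y - x)) * phi x - phi y * eta (c *: (y - x))).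
  by rewrite (IntB iep (itgZ _ ie)) (IntZ _ ie) (mulrC (phi y)).
have ib : itg (fun x => (M * (L * (2 / c))) * \1_(box y (2 / c)) x).
  by apply: itgZ; apply: itg_indic; [exact: mble_box|exact: mu2_box_lty].
apply: (@le_trans _ _ (c ^+ 2 * Int (fun x => (M * (L * (2 / c))) * \1_(box y (2 / c)) x))).
  apply: ler_wpM2l; first exact: sqr_ge0.
  have idf := itgB iep (itgZ (phi y) ie).
  apply: le_trans (Int_norm idf) _; apply: Int_le ib _; first exact: itg_norm.
  move=> x; rewrite (mulrC (phi y)) -mulrBr (normrM (eta _)).
  have [xy|xy] := pselect (box y (2 / c) x); last first.
    rewrite ve ?normr0 ?mul0r//; first by rewrite !mulr_ge0 ?invr_ge0// ltW.
    rewrite normrZ gtr0_norm// mulrC -ler_pdivrMr// distrC leNgt; exact/negP.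
  rewrite indicE mem_set// mulr1; apply: ler_pM => //.
  have := hL y (x - y); rewrite [y + _]addrC subrK => /le_trans; apply.
  by apply: ler_wpM2l => //; exact: ltW.
have r0 : 0 <= 2 / c by rewrite divr_ge0// ltW.
have iE : Int (\1_(box y (2 / c))) = 4 * (2 / c) ^+ 2.
  apply: EFin_inj; rewrite -Int_EFin; last by apply: itg_indic; [exact: mble_box|exact: mu2_box_lty].
  by rewrite (integral_indic mu2 measurableT (mble_box _ _)) setIT; exact: mu2_box.
rewrite IntZ; last by apply: itg_indic; [exact: mble_box|exact: mu2_box_lty].
rewrite iE; have cn : c != 0 by rewrite gt_eqF.
rewrite [leLHS](_ : _ = 32 * M * L / c)//; field; exact: cn.
Qed.

End WeylLemma.

Section WeylTheorem.
Set Implicit Arguments.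
Unset Strict Implicit.
Context {R : realType}.
Notation pt := (R * R)%type.
Notation T1 := (measurableTypeR R).
Notation T2 := (T1 * T1)%type.
Implicit Types (f g h u phi psi eta : pt -> R) (A D K : set pt) (a e x y : pt).

(** By scale invariance the left-hand side can be computed at any scale c >= c0. Exchanging the
    integrals moves the kernel onto the smooth phi, where it acts as an approximate identity with an
    error of order 1 / c. *)
Lemma smear_limit eta h phi D (c0 : R) : sm eta -> vanish 2 eta ->
  (forall x, eta (- x) = eta x) ->
  (forall D' (c c' : R) x, 0 < c -> 0 < c' ->
    [set y | `|y - x| <= 2 / c] `<=` D' -> [set y | `|y - x| <= 2 / c'] `<=` D' ->
    exists phi, tst D' phi /\
      lap phi = fun y => c ^+ 2 * eta (c *: (y - x)) + (- c' ^+ 2) * eta (c' *: (y - x))) ->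
  sqi h -> tst D phi -> 0 < c0 ->
  (forall x (c : R), D x -> c0 <= c -> c0 ^+ 2 * smear h eta c0 x = c ^+ 2 * smear h eta c x) ->
  Int (fun x => c0 ^+ 2 * smear h eta c0 x * phi x) = Int eta * Int (fun x => h x * phi x).
Proof.
move=> se ve even ker sh tphi c00 hD; have sp := tst_sm tphi; have [B vB] := tst_vanish tphi.
have [C C0 hC] := mollify_estimate se ve even ker sp vB.
have [M M0 hM] := vanish_bounded (sm_continuous se) ve.
(* The support of phi enlarged by the width of the widest kernel, the one at scale c0. *)
pose r := `|B| + 2 / c0.
have r0 : 0 <= r by rewrite addr_ge0// divr_ge0// ltW.
have ihb : itg (fun y => `|h y| * \1_(box 0 (r + 1)) y).
  apply: (@itg_mul_bounded _ _ _ 0 (r + 1) 1) => //; [exact: sqi_norm|apply: meas_indic; exact: mble_box| |].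
  - by move=> y; rewrite indicE normr_nat lern1 leq_b1.
  - by move=> y xy; rewrite indicE memNset.
set S := Int (fun y => `|h y| * \1_(box 0 (r + 1)) y) in ihb *.
have S0 : 0 <= S by apply: Int_ge0 => y; rewrite mulr_ge0// indicE.
have iph : itg (fun x => h x * phi x).
  exact: sqi_mul sh (vanish_sqi (sm_continuous sp) vB).
have est (c : R) : c0 <= c ->
    `|Int (fun x => c0 ^+ 2 * smear h eta c0 x * phi x) - Int eta * Int (fun x => h x * phi x)|
      <= C / c * S.
  move=> cc; have c1 : 0 < c by exact: lt_le_trans cc.
  have far x y : phi x != 0 -> eta (c *: (y - x)) != 0 -> box 0 (r + 1) y.
    move=> px ey; have xB : `|x| < B by rewrite ltNge; apply/negP => /vB /eqP; rewrite (negbTE px).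
    have yx : `|c *: (y - x)| < 2 by rewrite ltNge; apply/negP => /ve /eqP; rewrite (negbTE ey).
    rewrite box0P; have -> : y = (y - x) + x by rewrite subrK.
    apply: le_lt_trans (ler_normD _ _) _; rewrite /r.
    have h1 : `|y - x| < 2 / c0.
      rewrite ltr_pdivlMr//; apply: le_lt_trans yx; rewrite normrZ gtr0_norm// mulrC.
      by rewrite ler_wpM2r.
    by have := ler_norm B; move: `|y - x| `|x| (2 / c0) `|B| h1 xB => *; lra.
  pose F (z : pt * pt) := h z.2 * eta (c *: (z.2 - z.1)) * phi z.1.
  have mF : measurable_fun setT (F : T2 * T2 -> R).
    have m1 : measurable_fun setT (fun z : T2 * T2 => h z.2) by exact: (measurableT_comp sh.1 measurable_snd).
    have m3 : measurable_fun setT (fun z : T2 * T2 => phi z.1).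
      exact: (measurableT_comp (meas_continuous (sm_continuous sp)) measurable_fst).
    have m2 : measurable_fun setT (fun z : T2 * T2 => eta (c *: ((z.2 : pt) - z.1))).
      have p1 : measurable_fun setT (fun z : T2 * T2 => c * (z.2.1 - z.1.1)).
        apply: measurable_funM; first exact: measurable_cst.
        by apply: measurable_funB; [exact: (measurableT_comp measurable_fst measurable_snd)|
                                    exact: (measurableT_comp measurable_fst measurable_fst)].
      have p2 : measurable_fun setT (fun z : T2 * T2 => c * (z.2.2 - z.1.2)).
        apply: measurable_funM; first exact: measurable_cst.
        by apply: measurable_funB; [exact: (measurableT_comp measurable_snd measurable_snd)|
                                    exact: (measurableT_comp measurable_snd measurable_fst)].
      exact: (measurableT_comp (meas_continuous (sm_continuous se)) (measurable_fun_pair p1 p2)).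
    by apply: measurable_funM m3; exact: measurable_funM.
  have Fle x y : `|F (x, y)| <= `|phi x| * (M * (`|h y| * \1_(box 0 (r + 1)) y)).
    rewrite /F /=; have [->|p0] := eqVneq (phi x) 0; first by rewrite mulr0 normr0 mul0r.
    have [->|e0] := eqVneq (eta (c *: (y - x))) 0.
      by rewrite mulr0 mul0r normr0 !mulr_ge0// indicE.
    rewrite indicE mem_set; last exact: far p0 e0.
    rewrite mulr1 (normrM (h y * _)) (normrM (h y)) mulrC ler_wpM2l// mulrC ler_wpM2r//.
  have SW := Int_swap mF (itg_norm (vanish_itg (sm_continuous sp) vB)) (itgZ M ihb) Fle.
  have E1 : Int (fun x => c0 ^+ 2 * smear h eta c0 x * phi x) =
      Int (fun y => h y * (c ^+ 2 * Int (fun x => eta (c *: (y - x)) * phi x))).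
    have {}SW : Int (fun x => smear h eta c x * phi x) =
        Int (fun y => h y * Int (fun x => eta (c *: (y - x)) * phi x)).
      rewrite -[LHS](_ : Int (fun x => Int (fun y => F (x, y))) = _).
        rewrite SW; congr Int; apply/funext => y.
        rewrite -IntZ.
          by congr Int; apply/funext => x; rewrite /F /= mulrA.
        rewrite (_ : (fun x => _) = (fun x => phi x * eta (c *: (x - y)))).
          apply: (@smear_itg _ 2) => //; [exact: vanish_sqi (sm_continuous sp) vB|exact: sm_continuous].
        by apply/funext => x; rewrite mulrC -even -scalerN opprB.
      congr Int; apply/funext => x; rewrite mulrC /smear -IntZ.
        by congr Int; apply/funext => y; rewrite /F /= mulrC.
      by apply: (@smear_itg _ 2) => //; exact: sm_continuous.
    have [i1 i2] : itg (fun x => smear h eta c x * phi x) /\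
       itg (fun y => h y * Int (fun x => eta (c *: (y - x)) * phi x)).
      split.
        apply: (@vanish_itg _ B); last by move=> x /vB ->; rewrite mulr0.
        by move=> x; apply: cvgM; [exact: (smear_continuous sh se ve c1)|exact: sm_continuous].
      rewrite (_ : (fun y => _) = (fun y => h y * smear phi eta c y)).
        apply: (sqi_mul sh); apply: (@vanish_sqi _ (r + 1)).
          by apply: (smear_continuous _ se ve c1); exact: vanish_sqi (sm_continuous sp) vB.
        move=> y yr; rewrite /smear (_ : (fun x => _) = fun=> 0) ?Int0//; apply/funext => x.
        have [->|p0] := eqVneq (phi x) 0; first by rewrite mul0r.
        have [->|e0] := eqVneq (eta (c *: (x - y))) 0; first by rewrite mulr0.
        have /(far _ _ p0) : eta (c *: (y - x)) != 0 by rewrite -even -scalerN opprB.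
        by move=> /box0P; rewrite ltNge yr.
      apply/funext => y; congr (_ * Int _); apply/funext => x.
      by rewrite mulrC -even -scalerN opprB.
    transitivity (c ^+ 2 * Int (fun x => smear h eta c x * phi x)).
      rewrite -(IntZ _ i1); congr Int; apply/funext => x.
      have [->|p0] := eqVneq (phi x) 0; first by rewrite !mulr0.
      have Dx : D x by have [_ [K [_ KD K0]]] := tphi; apply: KD; apply: contrapT => /K0 /eqP; rewrite (negbTE p0).
      by rewrite (hD x c Dx cc) mulrA.
    rewrite SW -(IntZ _ i2); congr Int; apply/funext => y; by rewrite mulrCA.
  have ipz : itg (fun y => h y * (c ^+ 2 * Int (fun x => eta (c *: (y - x)) * phi x))).
    rewrite (_ : (fun y => _) = (fun y => h y * (c ^+ 2 * smear phi eta c y))).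
      apply: (sqi_mul sh); apply: sqiZ; apply: (@vanish_sqi _ (r + 1)).
        by apply: (smear_continuous _ se ve c1); exact: vanish_sqi (sm_continuous sp) vB.
      move=> y yr; rewrite /smear (_ : (fun x => _) = fun=> 0) ?Int0//; apply/funext => x.
      have [->|p0] := eqVneq (phi x) 0; first by rewrite mul0r.
      have [->|e0] := eqVneq (eta (c *: (x - y))) 0; first by rewrite mulr0.
      have /(far _ _ p0) : eta (c *: (y - x)) != 0 by rewrite -even -scalerN opprB.
      by move=> /box0P; rewrite ltNge yr.
    apply/funext => y; congr (_ * (_ * Int _)); apply/funext => x.
    by rewrite mulrC -even -scalerN opprB.
  rewrite E1 -(IntZ _ iph) -(IntB ipz (itgZ _ iph)).
  apply: le_trans (Int_norm (itgB ipz (itgZ _ iph))) _.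
  rewrite /S -(IntZ _ ihb); apply: Int_le; [exact: itg_norm (itgB ipz (itgZ _ iph))|exact: itgZ|].
  move=> y; rewrite [Int eta * _]mulrCA -mulrBr (normrM (h y)).
  have [yb|yb] := pselect (box 0 (r + 1) y).
    by rewrite indicE mem_set// mulr1 [leRHS]mulrC; apply: ler_wpM2l; [exact: normr_ge0|exact: hC].
  rewrite (_ : phi y = 0); last first.
    apply: vB; rewrite leNgt; apply/negP => yB; apply: yb; apply/box0P.
    by apply: lt_le_trans yB _; rewrite /r -addrA (le_trans (ler_norm B))// lerDl addr_ge0// divr_ge0// ltW.
  rewrite (_ : Int _ = 0) ?mulr0 ?subrr ?normr0 ?mulr0 ?indicE ?memNset ?mulr0//.
  rewrite (_ : (fun x => _) = fun=> 0) ?Int0//; apply/funext => x.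
  have [->|p0] := eqVneq (phi x) 0; first by rewrite mulr0.
  have [->|e0] := eqVneq (eta (c *: (y - x))) 0; first by rewrite mul0r.
  by exfalso; apply: yb; exact: far p0 e0.
apply/eqP; rewrite -subr_eq0 -normr_le0 leNgt; apply/negP => d0.
set d := `|_| in est d0.
have CS0 : 0 <= C * S by exact: mulr_ge0.
(* A scale so large that C S / c < d, contradicting the estimate. *)
have := est (c0 + (C * S + 1) / d); have q0 : 0 < (C * S + 1) / d by rewrite divr_gt0// ltr_pwDr.
rewrite lerDl ltW// => /(_ isT); rewrite mulrAC ler_pdivlMr ?addr_gt0// mulrDr [d * (_ / _)]mulrC divfK ?gt_eqF//.
by have : 0 < d * c0 by [exact: mulr_gt0]; lra.
Qed.

End WeylTheorem.

Section WeylRegularity.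
Set Implicit Arguments.
Unset Strict Implicit.
Context {R : realType}.
Notation pt := (R * R)%type.
Implicit Types (f g h u phi psi eta gam H : pt -> R) (A D K : set pt) (a e x y : pt).

Let adm D x (c : R) := 0 < c /\ [set y | `|y - x| <= 2 / c] `<=` D.

Lemma smear_ae_eq eta h D H : sm eta -> vanish 2 eta ->
  (forall x, eta (- x) = eta x) -> 0 < Int eta ->
  (forall D' (c c' : R) x, 0 < c -> 0 < c' ->
    [set y | `|y - x| <= 2 / c] `<=` D' -> [set y | `|y - x| <= 2 / c'] `<=` D' ->
    exists phi, tst D' phi /\
      lap phi = fun y => c ^+ 2 * eta (c *: (y - x)) + (- c' ^+ 2) * eta (c' *: (y - x))) ->
  open D -> sqi h -> scale_invariant D h eta 2 ->
  (forall x (c : R), adm D x c -> H x = (Int eta)^-1 * (c ^+ 2 * smear h eta c x)) ->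
  {ae (@mu2 R), forall x, D x -> H x = h x}.
Proof.
move=> se ve even I0 ker oD sh inv HE.
pose c (n : nat) : R := n.+1%:R.
have c0 n : 0 < c n by rewrite ltr0n.
(* Bounded open sets that exhaust D and on each of which the single scale n + 1 is admissible; the
   radius 3 / c in place of 2 / c leaves the room 1 / c that makes E n open. *)
pose E n := [set y : pt | exists2 x, `|y - x| < (c n)^-1 & [set z | `|z - x| <= 3 / c n] `<=` D] `&` box 0 (c n).
have admE n y : E n y -> adm D y (c n).
  move=> [[x yx xD] _]; split => // z /= zy; apply: xD => /=.
  have -> : z - x = (z - y) + (y - x) by rewrite addrA subrK.
  apply: le_trans (ler_normD _ _) _; have -> : 3 / c n = 2 / c n + (c n)^-1.
    by move: (c n)^-1 => v; ring.
  by apply: lerD => //; exact: ltW.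
have oE n : open (E n).
  apply: openI; last exact: open_box.
  apply/openP_box => y [x yx xD]; exists ((c n)^-1 - `|y - x|); first by rewrite subr_gt0.
  move=> z zy; exists x => //; have -> : z - x = (z - y) + (y - x) by rewrite addrA subrK.
  by apply: le_lt_trans (ler_normD _ _) _; rewrite -ltrBrDr.
have coverE x : D x -> exists n, E n x.
  move=> Dx; have /openP_box /(_ _ Dx)[r r0 xr] := oD.
  have [n nr] : exists n, Num.max `|x| (3 / r) < c n.
    by exists (Num.truncn (Num.max `|x| (3 / r))); exact: truncnS_gt.
  move: nr; rewrite gt_max => /andP[nx nr]; exists n; split; last exact/box0P.
  exists x; first by rewrite subrr normr0 invr_gt0.
  move=> y /= yx; apply: xr; rewrite /box /=; apply: le_lt_trans yx _.
  by rewrite ltr_pdivrMr// mulrC -ltr_pdivrMr.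
pose u n x := (Int eta)^-1 * (c n ^+ 2 * smear h eta (c n) x).
have cu n : continuous (u n).
  move=> x; apply: cvgM; first exact: cvg_cst.
  by apply: cvgM; [exact: cvg_cst|exact: (smear_continuous sh se ve (c0 n))].
have ae n : {ae (@mu2 R), forall x, E n x -> u n x = h x}.
  have mE := mble_open (oE n).
  have su : sqi (u n \_ (E n)).
    have mu : meas (u n \_ (E n)) by apply: meas_patch mE _; exact: meas_continuous.
    have [C C1 hC] := continuous_compact_bounded (@compact_sqbox R (c n)) (cu n).
    split => //; apply: (@itg_bounded _ _ 0 (c n) (C ^+ 2)); first exact: measX.
      move=> x; rewrite patchE; case: ifPn => [|_]; last by rewrite expr0n normr0 sqr_ge0.
      rewrite inE => -[_ /box0P xc]; rewrite normrX lerXn2r ?nnegrE//; apply: hC; exact: ltW.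
    by move=> x xc; rewrite patchE memNset ?expr0n// => -[].
  have sg : sqi (fun x => (u n \_ (E n)) x - (h \_ (E n)) x).
    by apply: sqiB => //; exact: sqi_patch.
  suff hP : forall phi, tst (E n) phi -> Int (fun x => ((u n \_ (E n)) x - (h \_ (E n)) x) * phi x) = 0.
    have := fundamental_lemma (oE n) sg hP; apply: filterS => x hx Ex; apply/eqP; rewrite -subr_eq0; apply/eqP.
    by have := hx Ex; rewrite !patchE mem_set.
  move=> phi tphi; have [B vB] := tst_vanish tphi; have sp := vanish_sqi (sm_continuous (tst_sm tphi)) vB.
  have out x : ~ E n x -> phi x = 0.
    by have [_ [K [_ KE K0]]] := tphi; move=> nE; apply: K0 => /KE.
  transitivity (Int (fun x => u n x * phi x - h x * phi x)).
    congr Int; apply/funext => x; rewrite -mulrBl !patchE; case: ifPn => [//|].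
    by rewrite notin_setE => /out ->; rewrite !mulr0.
  have lim := smear_limit se ve even ker sh tphi (c0 n).
  have i1 : itg (fun x => c n ^+ 2 * smear h eta (c n) x * phi x).
    apply: (@vanish_itg _ B); last by move=> x /vB ->; rewrite mulr0.
    move=> x; apply: cvgM; last exact: (sm_continuous (tst_sm tphi)).
    by apply: cvgM; [exact: cvg_cst|exact: (smear_continuous sh se ve (c0 n))].
  have E1 : (fun x => u n x * phi x) = (fun x => (Int eta)^-1 * (c n ^+ 2 * smear h eta (c n) x * phi x)).
    by apply/funext => x; rewrite /u -!mulrA.
  have i2 : itg (fun x => u n x * phi x) by rewrite E1; exact: itgZ.
  rewrite (IntB i2 (sqi_mul sh sp)) E1 (IntZ _ i1) lim.
    by rewrite mulKf ?gt_eqF// subrr.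
  move=> x c' Ex cc'; apply: inv; first exact: admE.
  have [c00 cD] := admE _ _ Ex; split; first exact: lt_le_trans cc'.
  move=> y /= yx; apply: cD => /=; apply: le_trans yx _.
  by rewrite ler_pM2l// lef_pV2 ?posrE// (lt_le_trans _ cc').
have := ae_foralln ae; apply: filterS => x hx Dx; have [n En] := coverE x Dx.
by rewrite (HE x (c n)); [exact: hx|exact: admE].
Qed.

(** The rescaled kernel xi is itself a test function, so the hypothesis on the weak gradient of h
    applies to it. Cauchy-Schwarz on the box of area 4 r^2 and c = 2 / r turn (c^2 M (1 + 2 c))^2 4
    r^2 into 64 M^2 (r + 4)^2 / r^4. *)
Lemma smear_gradient_bound eta D h gam (M r : R) x :
  sm eta -> vanish 2 eta -> vanish 2 (dx1 eta) -> vanish 2 (dx2 eta) ->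
  (forall y, `|eta y| <= M) -> (forall y, `|dx1 eta y| <= M) -> (forall y, `|dx2 eta y| <= M) ->
  sqi gam -> (forall y, 0 <= gam y) ->
  (forall phi, tst D phi -> let J := Int (fun y => gam y * (`|phi y| + `|dx1 phi y| + `|dx2 phi y|)) in
    `|Int (fun y => h y * dx1 phi y)| <= J /\ `|Int (fun y => h y * dx2 phi y)| <= J) ->
  0 < r -> [set y | `|y - x| <= r] `<=` D ->
  let c := 2 / r in
  let G := Int (fun y => gam y ^+ 2 * \1_(box x r) y) in
  sqi h ->
  (c ^+ 3 * smear h (dx1 eta) c x) ^+ 2 <= 64 * M ^+ 2 * (r + 4) ^+ 2 / r ^+ 4 * G /\
  (c ^+ 3 * smear h (dx2 eta) c x) ^+ 2 <= 64 * M ^+ 2 * (r + 4) ^+ 2 / r ^+ 4 * G.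
Proof.
move=> se ve v1 v2 b0 b1 b2 sgam gam0 hJ r0 xrD c G sh.
have c0 : 0 < c by rewrite divr_gt0.
have c2r : 2 / c = r by rewrite /c invf_div mulrCA divff ?mulr1.
have rn : r != 0 by rewrite gt_eqF.
have M0 : 0 <= M by exact: le_trans (b0 0).
pose xi y := eta (c *: (y - x)).
have far psi y : vanish 2 psi -> ~ box x r y -> psi (c *: (y - x)) = 0.
  move=> vp yr; apply: (vanish_affine c0 vp); rewrite ger0_norm//.
  by rewrite c2r.
have txi : tst D xi.
  split; first exact: sm_affine.
  exists [set y | `|y - x| <= r]; split => //; first exact: compact_cbox.
  by move=> y yr; apply: far => // /ltW.
have D1 := dx1_affine c x se; have D2 := dx2_affine c x se.
have := hJ xi txi; set J := Int (fun y => gam y * _) => /= -[h1 h2].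
have mb := mble_box x r.
have s1 : sqi (\1_(box x r) : pt -> R).
  split; first exact: meas_indic.
  rewrite (_ : (fun y => _) = \1_(box x r)); first exact: (itg_indic mb (mu2_box_lty x r)).
  by apply/funext => y; rewrite indicE; case: (_ \in _); rewrite ?expr1n ?expr0n.
have igb : itg (fun y => gam y * \1_(box x r) y) by exact: sqi_mul.
have sgb : sqi (fun y => gam y * \1_(box x r) y).
  rewrite (_ : (fun y => _) = (fun y => \1_(box x r) y * gam y)).
    apply: (@sqi_bounded_mul _ _ _ 1) => //; first exact: meas_indic.
    by move=> y; rewrite indicE normr_nat lern1 leq_b1.
  by apply/funext => y; rewrite mulrC.
have bJ : J <= M * (1 + 2 * c) * Int (fun y => gam y * \1_(box x r) y).
  rewrite -(IntZ _ igb) /J.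
  have le0 y : gam y * (`|xi y| + `|dx1 xi y| + `|dx2 xi y|) <= M * (1 + 2 * c) * (gam y * \1_(box x r) y).
    rewrite (congr1 (fun g : pt -> R => g y) D1) (congr1 (fun g : pt -> R => g y) D2) /xi.
    have [yr|yr] := pselect (box x r y); last first.
      by rewrite !far// !mulr0 normr0 !addr0 mulr0 indicE memNset// !mulr0.
    rewrite indicE mem_set// mulr1 mulrC; apply: ler_wpM2r => //.
    rewrite (normrM c) (normrM c) gtr0_norm// mulrDr mulr1 -addrA; apply: lerD => //.
    rewrite (_ : M * (2 * c) = c * M + c * M); last by ring.
    by apply: lerD; apply: ler_wpM2l => //; exact: ltW.
  apply: (Int_le _ _ le0); last exact: itgZ.
  apply: (itg_le _ (itgZ (M * (1 + 2 * c)) igb)) => [|y]; last first.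
    have p0 : 0 <= gam y * (`|xi y| + `|dx1 xi y| + `|dx2 xi y|).
      by apply: mulr_ge0 => //; apply: addr_ge0 => //; exact: addr_ge0.
    rewrite (ger0_norm p0); exact: le0.
  apply: measM; first exact: sgam.1.
  have ct := sm_continuous (tst_sm txi); have ct1 := sm_continuous (sm_dx1 (tst_sm txi)).
  have ct2 := sm_continuous (sm_dx2 (tst_sm txi)).
  have mc (g : pt -> R) : continuous g -> meas (fun y => `|g y|) by move=> cg; exact: (meas_norm (meas_continuous cg)).
  exact: (measD (measD (mc _ ct) (mc _ ct1)) (mc _ ct2)).
set g1 := Int (fun y => gam y * _) in bJ.
have CSg : g1 ^+ 2 <= 4 * r ^+ 2 * G.
  have := Int_CS sgb s1.
  have -> : Int (fun y => gam y * \1_(box x r) y * \1_(box x r) y) = g1.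
    congr Int; apply/funext => y; rewrite -mulrA indicE.
    by case: (_ \in _); rewrite ?mulr1 ?mulr0.
  have -> : Int (fun y => (gam y * \1_(box x r) y) ^+ 2) = G.
    congr Int; apply/funext => y; rewrite exprMn indicE.
    by case: (_ \in _); rewrite ?expr1n ?expr0n.
  have -> : Int (fun y => \1_(box x r) y ^+ 2) = 4 * r ^+ 2.
    have -> : (fun y => (\1_(box x r) y) ^+ 2) = \1_(box x r) :> (pt -> R).
      by apply/funext => y; rewrite indicE; case: (_ \in _); rewrite ?expr1n ?expr0n.
    apply: EFin_inj; rewrite -(Int_EFin (itg_indic mb (mu2_box_lty x r))).
    rewrite (integral_indic mu2 measurableT mb) setIT; apply: mu2_box; exact: ltW.
  by rewrite mulrC.
have g10 : 0 <= g1 by apply: Int_ge0 => y; rewrite mulr_ge0// indicE.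
have fin (d : R) : `|c * d| <= J -> (c ^+ 3 * d) ^+ 2 <= 64 * M ^+ 2 * (r + 4) ^+ 2 / r ^+ 4 * G.
  move=> dJ; have {dJ}dJ := le_trans dJ bJ.
  have P0 : 0 <= M * (1 + 2 * c) * g1 by exact: le_trans dJ.
  have : (c * d) ^+ 2 <= (M * (1 + 2 * c)) ^+ 2 * (4 * r ^+ 2 * G).
    rewrite -(real_normK (num_real (c * d))).
    apply: (@le_trans _ _ ((M * (1 + 2 * c) * g1) ^+ 2)); first by rewrite lerXn2r ?nnegrE.
    by rewrite exprMn ler_wpM2l// sqr_ge0.
  move=> /(ler_wpM2l (exprn_ge0 4 (ltW c0))).
  have -> : c ^+ 4 * (c * d) ^+ 2 = (c ^+ 3 * d) ^+ 2 by ring.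
  move/le_trans; apply; rewrite le_eqVlt; apply/orP; left; apply/eqP; rewrite /c; field.
  exact: rn.
split; apply: fin.
  move: h1; congr (_ <= _); congr (`|_|); rewrite /smear -IntZ.
    congr Int; apply/funext => y; rewrite (congr1 (fun g : pt -> R => g y) D1); exact: mulrCA.
  by apply: (smear_itg _ sh (sm_continuous (sm_dx1 se)) v1).
move: h2; congr (_ <= _); congr (`|_|); rewrite /smear -IntZ.
  congr Int; apply/funext => y; rewrite (congr1 (fun g : pt -> R => g y) D2); exact: mulrCA.
by apply: (smear_itg _ sh (sm_continuous (sm_dx2 se)) v2).
Qed.

End WeylRegularity.

Section HarmonicPart.
Set Implicit Arguments.
Unset Strict Implicit.
Context {R : realType}.
Notation pt := (R * R)%type.
Implicit Types (f g h u phi psi eta gam H : pt -> R) (A D K : set pt) (a e x y : pt).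

Let gradient_constants (a b k s t M r G : R) : a = - k * s -> b = - k * t -> 0 <= G -> 0 < r ->
  s ^+ 2 <= 64 * M ^+ 2 * (r + 4) ^+ 2 / r ^+ 4 * G ->
  t ^+ 2 <= 64 * M ^+ 2 * (r + 4) ^+ 2 / r ^+ 4 * G ->
  a ^+ 2 + b ^+ 2 <= (128 * M ^+ 2 * k ^+ 2 + 1) * (r + 4) ^+ 2 / r ^+ 4 * G.
Proof.
move=> -> -> G0 r0 hs ht; rewrite !exprMn sqrrN -mulrDr.
apply: le_trans (ler_wpM2l (sqr_ge0 k) (lerD hs ht)) _.
have : 0 <= (r + 4) ^+ 2 / r ^+ 4 * G.
  by rewrite mulr_ge0// divr_ge0 ?sqr_ge0// exprn_ge0// ltW.
move: (r ^+ 4)^-1 (M ^+ 2) (k ^+ 2) ((r + 4) ^+ 2) => v m q w h.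
rewrite -subr_ge0; apply: le_trans h _; rewrite le_eqVlt; apply/orP; left; apply/eqP; ring.
Qed.

(** C depends on the kernel alone. The function gam dominates the weak gradient of h and will carry
    the data; the last clause bounds grad H locally by it, with the explicit power of the radius
    that the weighted energy has to absorb. *)
Theorem weyl : exists2 C : R, 0 < C & forall D h gam,
  open D -> sqi h -> sqi gam -> (forall y, 0 <= gam y) ->
  (forall phi, tst D phi -> Int (fun x => h x * lap phi x) = 0) ->
  (forall phi, tst D phi -> let J := Int (fun y => gam y * (`|phi y| + `|dx1 phi y| + `|dx2 phi y|)) in
    `|Int (fun y => h y * dx1 phi y)| <= J /\ `|Int (fun y => h y * dx2 phi y)| <= J) ->
  exists H H1 H2 : pt -> R, [/\ {ae (@mu2 R), forall x, D x -> H x = h x},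
    forall x, D x -> [/\ {for x, continuous H}, {for x, continuous H1} & {for x, continuous H2}],
    forall x e (t : R), `|e| <= 1 -> D (x + t *: e) ->
      is_derive t 1 (fun s => H (x + s *: e)) (e.1 * H1 (x + t *: e) + e.2 * H2 (x + t *: e)) &
    forall x (r : R), 0 < r -> [set y | `|y - x| <= r] `<=` D ->
      H1 x ^+ 2 + H2 x ^+ 2 <=
        C * (r + 4) ^+ 2 / r ^+ 4 * Int (fun y => gam y ^+ 2 * \1_(box x r) y)].
Proof.
have [eta [se [ve [v1 v2]] even I0 ker]] := @weyl_kernel R.
have [M0 M00 b0] := vanish_bounded (sm_continuous se) ve.
have [M1 M10 b1] := vanish_bounded (sm_continuous (sm_dx1 se)) v1.
have [M2 M20 b2] := vanish_bounded (sm_continuous (sm_dx2 se)) v2.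
pose M := M0 + M1 + M2; pose k := (Int eta)^-1.
have [M0M M1M M2M] : [/\ M0 <= M, M1 <= M & M2 <= M].
  by rewrite /M; split; move: M00 M10 M20; clear; lra.
have k0 : 0 < k by rewrite invr_gt0.
have Mp : 0 <= M by rewrite !addr_ge0.
exists (128 * M ^+ 2 * k ^+ 2 + 1).
  apply: ltr_pwDr => //; apply: mulr_ge0; last exact: sqr_ge0.
  by apply: mulr_ge0 => //; exact: sqr_ge0.
move=> D h gam oD sh sgam gam0 harm hJ.
have [U0 U1 U2] := kernel_scale_invariant sh harm se ve v1 v2 ker.
(* The chosen scale need not vary continuously with x. Scale invariance makes H independent of it in
   D, and around x the common scale [2 * cc x] is admissible, so that H is locally one fixed
   smear. *)
have /choice[cc hcc] := open_adm oD.
pose H x := k * (cc x ^+ 2 * smear h eta (cc x) x).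
(* The minus sign comes from differentiating in x, the third power from the factor c of the chain
   rule. *)
pose H1 x := - k * (cc x ^+ 3 * smear h (dx1 eta) (cc x) x).
pose H2 x := - k * (cc x ^+ 3 * smear h (dx2 eta) (cc x) x).
have Dadm x c : 0 < c -> [set y | `|y - x| <= 2 / c] `<=` D -> D x.
  by move=> c0; apply => /=; rewrite subrr normr0 divr_ge0// ltW.
have HE x c : 0 < c /\ [set y | `|y - x| <= 2 / c] `<=` D -> H x = k * (c ^+ 2 * smear h eta c x).
  move=> [c0 cD]; exact (congr1 (fun w => k * w) (U0 x _ _ (hcc x (Dadm x c c0 cD)) (conj c0 cD))).
have H1E x c : 0 < c /\ [set y | `|y - x| <= 2 / c] `<=` D -> H1 x = - k * (c ^+ 3 * smear h (dx1 eta) c x).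
  move=> [c0 cD]; exact (congr1 (fun w => - k * w) (U1 x _ _ (hcc x (Dadm x c c0 cD)) (conj c0 cD))).
have H2E x c : 0 < c /\ [set y | `|y - x| <= 2 / c] `<=` D -> H2 x = - k * (c ^+ 3 * smear h (dx2 eta) c x).
  move=> [c0 cD]; exact (congr1 (fun w => - k * w) (U2 x _ _ (hcc x (Dadm x c c0 cD)) (conj c0 cD))).
have cont psi (a : R) n c : sm psi -> vanish 2 psi -> 0 < c ->
    continuous (fun x => a * (c ^+ n * smear h psi c x)).
  move=> sp vp c0 x; apply: cvgM; first exact: cvg_cst.
  by apply: cvgM; [exact: cvg_cst|exact: (smear_continuous sh sp vp c0)].
exists H, H1, H2; split.
- exact: (smear_ae_eq se ve even I0 ker oD sh U0 HE).
- move=> x Dx; have ax := hcc x Dx; have [c0 cD] := ax.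
  have ci0 : 0 < (cc x)^-1 by rewrite invr_gt0.
  have c20 : 0 < 2 * cc x by rewrite mulr_gt0.
  split.
  - apply: (cont_near (f := fun y => k * ((2 * cc x) ^+ 2 * smear h eta (2 * cc x) y)) ci0).
      by move=> y yx; apply: HE; exact: adm_near ax yx.
    exact: (cont _ _ _ _ se ve c20).
  - apply: (cont_near (f := fun y => - k * ((2 * cc x) ^+ 3 * smear h (dx1 eta) (2 * cc x) y)) ci0).
      by move=> y yx; apply: H1E; exact: adm_near ax yx.
    exact: (cont _ _ _ _ (sm_dx1 se) v1 c20).
  - apply: (cont_near (f := fun y => - k * ((2 * cc x) ^+ 3 * smear h (dx2 eta) (2 * cc x) y)) ci0).
    by move=> y yx; apply: H2E; exact: adm_near ax yx.
  exact: (cont _ _ _ _ (sm_dx2 se) v2 c20).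
- move=> x e t e1 Dxt; have ax := hcc _ Dxt; set z := x + t *: e in ax Dxt *; have [c0 cD] := ax.
  have ci0 : 0 < (cc z)^-1 by rewrite invr_gt0.
  set c := 2 * cc z; have c20 : 0 < c by rewrite mulr_gt0.
  have E s : `|s - t| < (cc z)^-1 -> H (x + s *: e) = k * (c ^+ 2 * smear h eta c (x + s *: e)).
    move=> st; apply: HE; apply: (adm_near ax).
    rewrite /z opprD addrACA subrr add0r -scalerBl normrZ; apply: le_lt_trans st.
    by rewrite ler_piMr.
  apply: (is_derive_near ci0 E).
  have az : 0 < c /\ [set y | `|y - z| <= 2 / c] `<=` D.
    by apply: (adm_near ax); rewrite subrr normr0.
  rewrite (H1E _ _ az) (H2E _ _ az).
  have d := smear_is_derive x t sh se ve c20 e1.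
  have d2 : is_derive t 1 (fun s => (k * c ^+ 2) *: smear h eta c (x + s *: e))
      ((k * c ^+ 2) *: (- c * (e.1 * smear h (dx1 eta) c z + e.2 * smear h (dx2 eta) c z))).
    exact: is_deriveZ.
  have -> : (fun s => k * (c ^+ 2 * smear h eta c (x + s *: e))) =
            (fun s => (k * c ^+ 2) *: smear h eta c (x + s *: e)).
    by apply/funext => s; exact: mulrA.
  apply: is_derive_eq d2 _; move: (smear _ _ _ z) (smear _ _ _ z) => q p.
  have -> : (k * c ^+ 2) *: (- c * (e.1 * p + e.2 * q)) = (k * c ^+ 2) * (- c * (e.1 * p + e.2 * q)) by [].
  ring.
- move=> x r r0 xrD.
  have le1 y := le_trans (b0 y) M0M; have le2 y := le_trans (b1 y) M1M.
  have le3 y := le_trans (b2 y) M2M.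
  have [g1 g2] := smear_gradient_bound se ve v1 v2 le1 le2 le3 sgam gam0 hJ r0 xrD sh.
  have a2 : 0 < 2 / r /\ [set y | `|y - x| <= 2 / (2 / r)] `<=` D.
    split; first by rewrite divr_gt0.
    by rewrite invf_div mulrCA divff// mulr1.
  have G0 : 0 <= Int (fun y => gam y ^+ 2 * \1_(box x r) y).
    by apply: Int_ge0 => y; apply: mulr_ge0; [exact: sqr_ge0|rewrite indicE].
  exact (gradient_constants (H1E _ _ a2) (H2E _ _ a2) G0 r0 g1 g2).
Qed.

End HarmonicPart.

(** * Inequalities on lines and their transport to the plane *)

Section Slices.
Set Implicit Arguments.
Unset Strict Implicit.
Context {R : realType}.
Notation pt := (R * R)%type.
Notation T1 := (measurableTypeR R).
Notation T2 := (T1 * T1)%type.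
Implicit Types (f g Phi Psi : pt -> R) (e x y : pt).

Lemma measurable_line e : measurable_fun setT (fun z : T2 * T1 => ((z.1 : pt) + (z.2 : R) *: e : T2)).
Proof.
have m1 : measurable_fun setT (fun z : T2 * T1 => z.1.1 + z.2 * e.1).
  apply: measurable_funD; first exact: (measurableT_comp measurable_fst measurable_fst).
  by apply: measurable_funM; [exact: measurable_snd|exact: measurable_cst].
have m2 : measurable_fun setT (fun z : T2 * T1 => z.1.2 + z.2 * e.2).
  apply: measurable_funD; first exact: (measurableT_comp measurable_snd measurable_fst).
  by apply: measurable_funM; [exact: measurable_snd|exact: measurable_cst].
exact: (measurable_fun_pair m1 m2).
Qed.

Let chi (l1 l2 : R) (y : pt) : R := \1_([set t : R | 0 <= t < 1]) (l1 * y.1 + l2 * y.2).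

Let meas_chi (l1 l2 : R) : meas (chi l1 l2).
Proof.
have ml : meas (fun y : pt => l1 * y.1 + l2 * y.2).
  apply: measD; apply: measM; try exact: meas_cst; [exact: measurable_fst|exact: measurable_snd].
apply: (measurableT_comp _ ml); apply: measurable_indic.
rewrite (_ : [set t : R | 0 <= t < 1] = `[0, 1[%classic); first exact: measurable_itv.
by apply/seteqP; split => t /=; rewrite in_itv.
Qed.

(* Slicing the plane into lines of direction e, each weighted by the window
   0 <= l < 1, where l is a linear form with l(e) = 1. *)
Let line_slice Phi e (l1 l2 : R) : l1 * e.1 + l2 * e.2 = 1 -> meas Phi -> (forall x, 0 <= Phi x) ->
  (\int[mu2]_y (Phi y)%:E = \int[mu2]_y \int[mu1]_s (Phi (y + (s : R) *: e) * chi l1 l2 y)%:E)%E.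
Proof.
move=> le1 mP P0; have chi0 y : 0 <= chi l1 l2 y by rewrite /chi indicE.
have mc := meas_chi l1 l2.
pose F (z : T2 * T1) : \bar R := (Phi z.1 * chi l1 l2 ((z.1 : pt) + (z.2 : R) *: (- e)))%:E.
pose G (z : T2 * T1) : \bar R := (Phi ((z.1 : pt) + (z.2 : R) *: e) * chi l1 l2 z.1)%:E.
have mF : measurable_fun setT F.
  apply/measurable_EFinP; apply: measurable_funM; first exact: (measurableT_comp mP measurable_fst).
  exact: (measurableT_comp mc (measurable_line (- e))).
have mG : measurable_fun setT G.
  apply/measurable_EFinP; apply: measurable_funM; last exact: (measurableT_comp mc measurable_fst).
  exact: (measurableT_comp mP (measurable_line e)).
have F0 z : (0 <= F z)%E by rewrite lee_fin mulr_ge0.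
have G0 z : (0 <= G z)%E by rewrite lee_fin mulr_ge0.
have FT := etrans (esym (fubini_tonelli1 (m1 := @mu2 R) (m2 := @mu1 R) F mF F0)) (fubini_tonelli2 (m1 := @mu2 R) (m2 := @mu1 R) F mF F0).
have GT := etrans (esym (fubini_tonelli1 (m1 := @mu2 R) (m2 := @mu1 R) G mG G0)) (fubini_tonelli2 (m1 := @mu2 R) (m2 := @mu1 R) G mG G0).
apply: (@etrans _ _ (\int[mu2]_y fubini_F (@mu1 R) F y)%E).
  apply: eq_integral => y _; rewrite /fubini_F /F /=.
  have E s : chi l1 l2 ((y : pt) + (s : R) *: (- e)) = \1_(`]l1 * y.1 + l2 * y.2 - 1, l1 * y.1 + l2 * y.2]%classic) s.
    rewrite /chi !indicE /=; congr (nat_of_bool _)%:R; apply/idP/idP; rewrite !inE /= in_itv /=.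
      have -> : l1 * (y.1 + s * - e.1) + l2 * (y.2 + s * - e.2) = l1 * y.1 + l2 * y.2 - s * (l1 * e.1 + l2 * e.2) by ring.
      by rewrite le1 mulr1 => /andP[h1 h2]; apply/andP; split; lra.
    have -> : l1 * (y.1 + s * - e.1) + l2 * (y.2 + s * - e.2) = l1 * y.1 + l2 * y.2 - s * (l1 * e.1 + l2 * e.2) by ring.
    by rewrite le1 mulr1 => /andP[h1 h2]; apply/andP; split; lra.
  under eq_integral do rewrite E EFinM.
  rewrite ge0_integralZl//=; last 2 first.
  - by apply/measurable_EFinP; apply: measurable_indic; exact: measurable_itv.
  - by rewrite lee_fin.
  rewrite (integral_indic mu1 measurableT (measurable_itv _)) setIT.
  rewrite [X in (_ * X)%E](@lebesgue_measure_itv R `]l1 * y.1 + l2 * y.2 - 1, l1 * y.1 + l2 * y.2]) /= lte_fin.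
  by rewrite gtrBl ltr01 -EFinB subKr mule1.
apply: (etrans FT); apply: (etrans _ (esym GT)); apply: eq_integral => s _; rewrite /fubini_G.
rewrite -(@ge0_integral_shift R (fun y => F (y, s)) ((s : R) *: e)).
- apply: eq_integral => y _; rewrite /F /G /=; congr (_ * chi _ _ _)%:E.
  by rewrite scalerN addrK.
- exact: (measurableT_comp mF (measurable_pair2 _)).
- by move=> y; exact: F0.
Qed.

(** The direction of a boundary chart is oblique; comparing the integrals line by line spares a
    rotation of Lebesgue measure. The window of [line_slice] takes the value 0 or 1 on each line, so
    the comparison survives it. *)
Lemma line_fubini Phi Psi e (l1 l2 : R) : l1 * e.1 + l2 * e.2 = 1 ->
  meas Phi -> meas Psi -> (forall x, 0 <= Phi x) -> (forall x, 0 <= Psi x) ->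
  (forall y, (\int[mu1]_s (Phi (y + (s : R) *: e))%:E <= \int[mu1]_s (Psi (y + (s : R) *: e))%:E)%E) ->
  (\int[mu2]_y (Phi y)%:E <= \int[mu2]_y (Psi y)%:E)%E.
Proof.
move=> le1 mP mQ P0 Q0 h; rewrite (line_slice le1 mP P0) (line_slice le1 mQ Q0).
have chi0 y : 0 <= chi l1 l2 y by rewrite /chi indicE.
have mc := meas_chi l1 l2.
have mG (f : pt -> R) : meas f -> measurable_fun setT (fun z : T2 * T1 => (f ((z.1 : pt) + (z.2 : R) *: e) * chi l1 l2 z.1)%:E).
  move=> mf; apply/measurable_EFinP; apply: measurable_funM; last exact: (measurableT_comp mc measurable_fst).
  exact: (measurableT_comp mf (measurable_line e)).
apply: ge0_le_integral => //.
- by move=> y _; apply: integral_ge0 => s _; rewrite lee_fin mulr_ge0.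
- have := @measurable_fun_fubini_tonelli_F _ _ T2 T1 R (@mu1 R) _ (mG _ mP).
  by apply=> z; rewrite lee_fin mulr_ge0.
- have := @measurable_fun_fubini_tonelli_F _ _ T2 T1 R (@mu1 R) _ (mG _ mQ).
  by apply=> z; rewrite lee_fin mulr_ge0.
move=> y _; rewrite /chi indicE; case: (_ \in _) => /=.
  by under eq_integral do rewrite mulr1; under [leRHS]eq_integral do rewrite mulr1; exact: h.
by under eq_integral do rewrite mulr0; under [leRHS]eq_integral do rewrite mulr0.
Qed.

(** Two-sided continuity at each point of the closed interval, not continuity within it: the slices
    come from functions regular on an open set that contains the whole segment. *)
Definition cts (p q : R) (u : R -> R) := forall t, p <= t <= q -> {for t, continuous u}.

Implicit Types (p q : R) (u v : R -> R).

Lemma ctsM p q u v : cts p q u -> cts p q v -> cts p q (fun t => u t * v t).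
Proof. by move=> cu cv t pq; apply: cvgM; [exact: cu|exact: cv]. Qed.

Lemma ctsD p q u v : cts p q u -> cts p q v -> cts p q (fun t => u t + v t).
Proof. by move=> cu cv t pq; apply: cvgD; [exact: cu|exact: cv]. Qed.

Lemma cts_continuous p q (u : R -> R) : continuous u -> cts p q u.
Proof. by move=> cu t _; exact: cu. Qed.

Lemma cts_within p q u : cts p q u -> {within `[p, q], continuous u}.
Proof. by move=> cu; apply: continuous_in_subspaceT => t; rewrite inE /= in_itv /=; exact: cu. Qed.

Lemma cts_measurable p q u : cts p q u -> measurable_fun (`[p, q] : set T1) u.
Proof.
move=> /cts_within cu; apply: subspace_continuous_measurable_fun => //.
Qed.

Lemma ge0_integral_cts_le p q (F f g h : R -> R) : p <= q ->
  (forall t, p <= t <= q -> is_derive t 1 F (f t)) ->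
  cts p q f -> cts p q g -> cts p q h ->
  (forall t, p <= t <= q -> 0 <= g t) -> (forall t, p <= t <= q -> 0 <= h t) ->
  (forall t, p <= t <= q -> g t <= f t + h t) ->
  (\int[mu1]_(t in `[p, q]) (g t)%:E <= (F q - F p)%:E + \int[mu1]_(t in `[p, q]) (h t)%:E)%E.
Proof.
move=> pq dF cf cg ch g0 h0 gfh.
have ig (u : R -> R) : cts p q u -> (@mu1 R).-integrable `[p, q] (EFin \o u).
  by move=> cu; apply: continuous_compact_integrable; [exact: segment_compact|exact: cts_within].
have FTC := is_derive_FTC2 pq dF (cts_within cf).
rewrite -FTC -integralD//=; [|exact: ig|exact: ig].
apply: ge0_le_integral => //=.
- by apply/measurable_EFinP; exact: cts_measurable.
- by apply/measurable_EFinP; apply: measurable_funD; exact: cts_measurable.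
Qed.

Lemma is_derive_cts p q (F f : R -> R) : (forall t, p <= t <= q -> is_derive t (1 : R) F (f t)) -> cts p q F.
Proof.
move=> dF t /dF[df _]; apply: differentiable_continuous; exact/derivable1_diffP.
Qed.

(** Hardy's inequality: integrate the derivative of 2 (t - o) u^2 and use 0 <= (u + 2 (t - o) v)^2.
    The origin o of the weight is free; put at an endpoint, it kills the boundary term there. *)
Lemma slice_weight p q (o : R) (u v : R -> R) : p <= q ->
  (forall t, p <= t <= q -> is_derive t (1 : R) u (v t)) -> cts p q v ->
  (\int[mu1]_(t in `[p, q]) (u t ^+ 2)%:E <=
    (2 * (q - o) * u q ^+ 2 - 2 * (p - o) * u p ^+ 2)%:E +
    \int[mu1]_(t in `[p, q]) (4 * ((t - o) * v t) ^+ 2)%:E)%E.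
Proof.
move=> pq du cv; have cu := is_derive_cts du.
have cw : cts p q (fun t => t - o) by apply: cts_continuous => t; apply: cvgB; [exact: cvg_id|exact: cvg_cst].
have cc (k : R) : cts p q (fun=> k) by move=> t _; exact: cvg_cst.
apply: (@ge0_integral_cts_le _ _ (fun t => 2 * (t - o) * u t ^+ 2)
  (fun t => 2 * (u t * u t) + 4 * ((t - o) * (u t * v t)))) => //.
- move=> t tpq; have d := du t tpq.
  have w : is_derive t (1 : R) (fun t => 2 * (t - o)) 2.
    have -> : (fun t => 2 * (t - o)) = (fun t : R => 2 *: (t - o)) by [].
    by apply: is_derive_eq; rewrite subr0 /GRing.scale /= mulr1.
  have u2 := is_deriveM d d; have := is_deriveM w u2.
  rewrite (_ : (fun t => 2 * (t - o)) * (u * u) = (fun t => 2 * (t - o) * u t ^+ 2)).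
    move=> h; apply: is_derive_eq h _.
    by rewrite -[LHS]/(2 * (t - o) * (u t * v t + u t * v t) + (u t * u t) * 2); ring.
  by apply/funext => s; rewrite expr2.
- by apply: ctsD; apply: ctsM => //; apply: ctsM => //; apply: ctsM.
- by apply: ctsM.
- by apply: ctsM => //; apply: ctsM; apply: ctsM.
- by move=> t _; exact: sqr_ge0.
- by move=> t _; rewrite mulr_ge0// sqr_ge0.
move=> t _; have := sqr_ge0 (u t + 2 * ((t - o) * v t)); rewrite -subr_ge0.
set w := (t - o) * v t => h.
have -> : (t - o) * (u t * v t) = u t * w by rewrite /w mulrCA.
by rewrite -subr_ge0; apply: le_trans h _; rewrite le_eqVlt; apply/orP; left; apply/eqP; ring.
Qed.

(** A trace inequality: integrate the derivative of (q - t) u^2, whose value at q is 0, and complete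
    the square. *)
Lemma slice_point p q (u v : R -> R) : p <= q ->
  (forall t, p <= t <= q -> is_derive t (1 : R) u (v t)) -> cts p q v ->
  (((q - p) * u p ^+ 2)%:E <= \int[mu1]_(t in `[p, q]) (2 * u t ^+ 2 + ((q - p) * v t) ^+ 2)%:E)%E.
Proof.
move=> pq du cv; have cu := is_derive_cts du.
have cw : cts p q (fun t => q - t) by apply: cts_continuous => t; apply: cvgB; [exact: cvg_cst|exact: cvg_id].
have cc (k : R) : cts p q (fun=> k) by move=> t _; exact: cvg_cst.
have := @ge0_integral_cts_le p q (fun t => (q - t) * u t ^+ 2)
  (fun t => (- 1) * (u t * u t) + 2 * ((q - t) * (u t * v t))) (fun=> 0)
  (fun t => 2 * u t ^+ 2 + ((q - p) * v t) ^+ 2) pq.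
rewrite integral0 subrr mul0r sub0r EFinN -leeBlDl ?fin_numN// sub0e oppeK; apply.
- move=> t tpq; have d := du t tpq.
  have w : is_derive t (1 : R) (fun t => q - t) (- 1).
    have -> : (fun t => q - t) = (fun t : R => (- 1) *: (t - q)).
      by apply/funext => s; rewrite scaleN1r opprB.
    by apply: is_derive_eq; rewrite subr0 /GRing.scale /= mulr1.
  have u2 := is_deriveM d d; have := is_deriveM w u2.
  rewrite (_ : (fun t => q - t) * (u * u) = (fun t => (q - t) * u t ^+ 2)).
    move=> h; apply: is_derive_eq h _.
    by rewrite -[LHS]/((q - t) * (u t * v t + u t * v t) + (u t * u t) * (- 1)); ring.
  by apply/funext => s; rewrite expr2.
- by apply: ctsD; apply: ctsM => //; apply: ctsM => //; apply: ctsM.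
- exact: cc.
- by apply: ctsD; [apply: ctsM => //; exact: ctsM|apply: ctsM; exact: ctsM].
- by [].
- by move=> t _; rewrite addr_ge0 ?sqr_ge0// mulr_ge0// sqr_ge0.
move=> t /andP[pt tq]; have h1 := sqr_ge0 (u t + (q - t) * v t).
have h2 : ((q - t) * v t) ^+ 2 <= ((q - p) * v t) ^+ 2.
  by rewrite !exprMn ler_wpM2r ?sqr_ge0// lerXn2r ?nnegrE; lra.
have -> : -1 * (u t * u t) + 2 * ((q - t) * (u t * v t)) + (2 * u t ^+ 2 + ((q - p) * v t) ^+ 2) =
  (u t + (q - t) * v t) ^+ 2 + (((q - p) * v t) ^+ 2 - ((q - t) * v t) ^+ 2) by ring.
by rewrite addr_ge0// subr_ge0.
Qed.

(** Hardy's inequality on [p, a] leaves the boundary term 2 (a - o) u(a)^2, which the trace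
    inequality moves into the reference interval [a, b]. The term at p has a favourable sign because
    o <= p, so no constant degenerates as p tends to o: this is what the boundary requires. *)
Lemma slice_tent p (o a b k : R) (u v : R -> R) : o <= p -> p <= a -> a < b ->
  0 < k -> k * (b - a) = a - o ->
  (forall t, p <= t <= b -> is_derive t (1 : R) u (v t)) -> cts p b v ->
  (\int[mu1]_(t in `[p, a]) (u t ^+ 2)%:E <=
    \int[mu1]_(t in `[a, b]) (4 * k * u t ^+ 2)%:E +
    \int[mu1]_(t in `[p, b]) ((4 + 2 / k) * ((t - o) * v t) ^+ 2)%:E)%E.
Proof.
move=> op pa ab k0 kE du cv; have oa : o <= a by exact: le_trans pa.
have du1 t : p <= t <= a -> is_derive t (1 : R) u (v t).
  by move=> /andP[h1 h2]; apply: du; rewrite h1 (le_trans h2)// ltW.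
have du2 t : a <= t <= b -> is_derive t (1 : R) u (v t).
  by move=> /andP[h1 h2]; apply: du; rewrite h2 (le_trans pa).
have cv1 : cts p a v by move=> t /andP[h1 h2]; apply: cv; rewrite h1 (le_trans h2)// ltW.
have cv2 : cts a b v by move=> t /andP[h1 h2]; apply: cv; rewrite h2 (le_trans pa).
have cu2 := is_derive_cts du2.
have cc (p' q' k' : R) : cts p' q' (fun=> k') by move=> t _; exact: cvg_cst.
have cw (p' q' : R) : cts p' q' (fun t => t - o) by apply: cts_continuous => t; apply: cvgB; [exact: cvg_id|exact: cvg_cst].
have h1 := slice_weight o pa du1 cv1; have h2 := slice_point (ltW ab) du2 cv2.
pose X t : R := ((t - o) * v t) ^+ 2.
have X0 t : 0 <= X t by exact: sqr_ge0.
have mX (p' q' c : R) : cts p' q' v -> measurable_fun (`[p', q'] : set T1) (fun t => (c * X t)%:E).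
  move=> cv'; apply/measurable_EFinP; apply: cts_measurable; apply: ctsM => //.
  by apply: ctsM; exact: ctsM.
have mu_ : measurable_fun (`[a, b] : set T1) (fun t => (4 * k * u t ^+ 2)%:E).
  by apply/measurable_EFinP; apply: cts_measurable; apply: ctsM => //; exact: ctsM.
have k4 : 0 <= 4 * k by rewrite mulr_ge0// ltW.
have k2 : 0 <= 2 / k by rewrite divr_ge0// ltW.
have sub (p' q' c : R) : 0 <= c -> p <= p' -> q' <= b ->
    (\int[mu1]_(t in `[p', q']) (c * X t)%:E <= \int[mu1]_(t in `[p, b]) (c * X t)%:E)%E.
  move=> c0 pp' qb; apply: ge0_subset_integral => //.
  - exact: mX.
  - by move=> t _; rewrite lee_fin mulr_ge0.
  - by move=> t /=; rewrite !in_itv /= => /andP[h h']; rewrite (le_trans pp' h) (le_trans h' qb).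
have step1 : ((2 * (a - o) * u a ^+ 2)%:E <=
   \int[mu1]_(t in `[a, b]) (4 * k * u t ^+ 2)%:E + \int[mu1]_(t in `[p, b]) (2 / k * X t)%:E)%E.
  apply: (@le_trans _ _ (\int[mu1]_(t in `[a, b]) ((4 * k * u t ^+ 2)%:E + (2 / k * X t)%:E))%E); last first.
    rewrite ge0_integralD//=; [|by move=> t _; rewrite lee_fin mulr_ge0// sqr_ge0|
      by move=> t _; rewrite lee_fin mulr_ge0|exact: mX].
    by apply: leeD => //; exact: sub.
  have -> : 2 * (a - o) * u a ^+ 2 = (2 * k) * ((b - a) * u a ^+ 2) by rewrite -kE; ring.
  rewrite EFinM; apply: (@le_trans _ _ ((2 * k)%:E * \int[mu1]_(t in `[a, b]) (2 * u t ^+ 2 + ((b - a) * v t) ^+ 2)%:E)%E).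
    by apply: lee_wpmul2l => //; rewrite lee_fin mulr_ge0// ltW.
  have mm : measurable_fun (`[a, b] : set T1) (fun t => (2 * u t ^+ 2 + ((b - a) * v t) ^+ 2)%:E).
    apply/measurable_EFinP; apply: cts_measurable; apply: ctsD; first by apply: ctsM => //; exact: ctsM.
    by apply: ctsM; exact: ctsM.
  have m0 t : 0 <= 2 * u t ^+ 2 + ((b - a) * v t) ^+ 2 by rewrite addr_ge0 ?sqr_ge0// mulr_ge0// sqr_ge0.
  rewrite -ge0_integralZl//=; last 2 first.
  - by move=> t _; rewrite lee_fin.
  - by rewrite lee_fin mulr_ge0// ltW.
  apply: ge0_le_integral => //=.
  - by move=> t _; rewrite lee_fin mulr_ge0// mulr_ge0// ltW.
  - exact: measurable_funeM.
  - by apply: emeasurable_funD => //; exact: mX.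
  move=> t; rewrite in_itv /= => /andP[hat _]; rewrite lee_fin mulrDr mulrA (_ : 2 * k * 2 = 4 * k); last by ring.
  rewrite lerD2l /X !exprMn mulrA [leRHS]mulrA; apply: ler_wpM2r; first exact: sqr_ge0.
  have -> : 2 * k * (b - a) ^+ 2 = 2 / k * (k * (b - a)) ^+ 2 by field; rewrite gt_eqF.
  by rewrite kE ler_wpM2l// lerXn2r ?nnegrE ?subr_ge0// ?lerD2r// (le_trans oa).
apply: (le_trans h1); apply: (@le_trans _ _ ((2 * (a - o) * u a ^+ 2)%:E +
    \int[mu1]_(t in `[p, b]) (4 * X t)%:E)%E).
  apply: leeD; last by apply: sub => //; exact: ltW.
  rewrite lee_fin gerBl mulr_ge0 ?sqr_ge0//.
  by rewrite mulr_ge0// subr_ge0.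
apply: (le_trans (leeD step1 (lexx _))); rewrite -addeA leeD2l//.
rewrite -ge0_integralD//=; [|by move=> t _; rewrite lee_fin mulr_ge0|exact: mX|
      by move=> t _; rewrite lee_fin mulr_ge0|exact: mX].
apply: ge0_le_integral => //=.
- by move=> t _; rewrite -EFinD lee_fin addr_ge0// mulr_ge0.
- by apply: emeasurable_funD; exact: mX.
- exact: mX.
- by move=> t _; rewrite -EFinD lee_fin -mulrDl addrC.
Qed.

End Slices.

(** Extended-valued, because inside the Hardy inequality nothing says that H is square integrable up
    to the boundary; finiteness is part of the conclusion. *)
Definition eint {R : realType} (V : set (R * R)) (f : R * R -> R) : \bar R :=
  (\int[@mu2 R]_y ((f \_ V) y)%:E)%E.

Definition slab {R : realType} (S : set (R * R)) (d : R * R -> R) (p q : R) : set (R * R) :=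
  [set y | S y /\ p <= d y <= q].

Definition sqdev {R : realType} (H : R * R -> R) (c : R) (y : R * R) : R := (H y - c) ^+ 2.

Definition sqgrad {R : realType} (H1 H2 : R * R -> R) (y : R * R) : R := H1 y ^+ 2 + H2 y ^+ 2.

(** What Weyl's lemma delivers and what slicing consumes: derivatives along all lines, with
    continuous coefficients H1 and H2. *)
Definition c1data {R : realType} (D : set (R * R)) (H H1 H2 : R * R -> R) : Prop :=
  (forall x, D x -> [/\ {for x, continuous H}, {for x, continuous H1} & {for x, continuous H2}]) /\
  (forall x e (t : R), `|e| <= 1 -> D (x + t *: e) ->
     is_derive t 1 (fun s => H (x + s *: e)) (e.1 * H1 (x + t *: e) + e.2 * H2 (x + t *: e))).

Section Transport.
Set Implicit Arguments.
Unset Strict Implicit.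
Context {R : realType}.
Notation pt := (R * R)%type.
Notation T1 := (measurableTypeR R).
Implicit Types (f g H d : pt -> R) (D S V W : set pt) (e x y : pt).

Lemma eint_ge0 V f : (forall x, 0 <= f x) -> (0 <= eint V f)%E.
Proof.
move=> f0; apply: integral_ge0 => y _; rewrite lee_fin patchE.
by case: ifP.
Qed.

Lemma eint_le V W f g : meas (f \_ V) -> meas (g \_ W) -> (forall x, 0 <= f x) -> (forall x, 0 <= g x) ->
  (forall x, V x -> W x /\ f x <= g x) -> (eint V f <= eint W g)%E.
Proof.
move=> mf mg f0 g0 fg; apply: ge0_le_integral => //.
- by move=> y _; rewrite lee_fin patchE; case: ifP.
- exact/measurable_EFinP.
- exact/measurable_EFinP.
move=> y _; rewrite lee_fin !patchE; case: ifPn => [|_]; last by case: ifP.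
by rewrite inE => /fg[Wy h]; rewrite mem_set.
Qed.

Lemma patchZ V f (c : R) : (fun x => c * f x) \_ V = (fun x => c * (f \_ V) x).
Proof. by apply/funext => x; rewrite !patchE; case: ifP => // _; rewrite mulr0. Qed.

Lemma patchD V f g : (fun x => f x + g x) \_ V = (fun x => (f \_ V) x + (g \_ V) x).
Proof. by apply/funext => x; rewrite !patchE; case: ifP => // _; rewrite addr0. Qed.

Lemma eintZ V f (c : R) : 0 <= c -> meas (f \_ V) -> (forall x, 0 <= f x) ->
  eint V (fun x => c * f x) = (c%:E * eint V f)%E.
Proof.
move=> c0 mf f0; rewrite /eint patchZ; under eq_integral do rewrite EFinM.
rewrite ge0_integralZl//; first exact/measurable_EFinP.
by move=> y _; rewrite lee_fin patchE; case: ifP.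
Qed.

Lemma eintD V f g : meas (f \_ V) -> meas (g \_ V) -> (forall x, 0 <= f x) -> (forall x, 0 <= g x) ->
  eint V (fun x => f x + g x) = (eint V f + eint V g)%E.
Proof.
move=> mf mg f0 g0; rewrite /eint patchD; under eq_integral do rewrite EFinD.
by rewrite ge0_integralD//; try (by apply/measurable_EFinP); move=> y _; rewrite lee_fin patchE; case: ifP.
Qed.

Lemma eint_setU V W f : meas (f \_ V) -> meas (f \_ W) -> meas (f \_ (V `|` W)) -> (forall x, 0 <= f x) ->
  (eint (V `|` W) f <= eint V f + eint W f)%E.
Proof.
move=> mV mW mU f0; rewrite -ge0_integralD//; try (by apply/measurable_EFinP);
  try by (move=> y _; rewrite lee_fin patchE; case: ifP).
apply: ge0_le_integral => //.
- by move=> y _; rewrite lee_fin patchE; case: ifP.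
- exact/measurable_EFinP.
- by apply: emeasurable_funD; exact/measurable_EFinP.
move=> y _; rewrite -EFinD lee_fin !patchE; case: ifPn => [|_].
  rewrite inE => -[Vy|Wy]; rewrite ?(mem_set Vy) ?(mem_set Wy); case: ifP => _; rewrite ?addr0 ?add0r//.
    by rewrite lerDl.
  by rewrite lerDl.
by do 2 case: ifP => _; rewrite ?addr0 ?add0r// addr_ge0.
Qed.

Lemma meas_sub_open D V f : open D -> mble V -> V `<=` D -> (forall x, D x -> {for x, continuous f}) ->
  meas (f \_ V).
Proof.
move=> oD mV VD cf; have -> : f \_ V = (f \_ D) \_ V.
  apply/funext => x; rewrite !patchE; case: ifPn => //; rewrite inE => /VD Dx.
  by rewrite mem_set.
by apply: meas_patch => //; exact: meas_open_restrict.
Qed.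

Lemma meas_line f y e : meas f -> measurable_fun setT (fun s : T1 => f (y + (s : R) *: e)).
Proof.
move=> mf; have := measurableT_comp mf (measurable_line e) => h.
exact: (measurableT_comp h (measurable_pair1 y)).
Qed.

(** [slice_tent] on every line of direction e: S is a union of such lines and d a coordinate of unit
    speed along them, so that slabs become intervals. The extra factor 2 is that of (e . grad H)^2
    <= 2 |grad H|^2, as e has max norm at most 1. *)
Lemma push D H H1 H2 e (l1 l2 : R) S d (o p a b k c : R) : open D -> c1data D H H1 H2 ->
  `|e| <= 1 -> l1 * e.1 + l2 * e.2 = 1 -> mble S -> meas d ->
  (forall y (t : R), S (y + t *: e) <-> S y) -> (forall y (t : R), d (y + t *: e) = d y + t) ->
  o <= p -> p <= a -> a < b -> 0 < k -> k * (b - a) = a - o ->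
  slab S d p b `<=` D ->
  (eint (slab S d p a) (sqdev H c) <=
   (4 * k)%:E * eint (slab S d a b) (sqdev H c) +
   (2 * (4 + 2 / k))%:E * eint (slab S d p b)
      (fun y => ((d y - o) ^+ 2 * sqgrad H1 H2 y)%R))%E.
Proof.
move=> oD [cH dH] e1 le1 mS md Se de op pa ab k0 kE WD.
pose W := slab S d.
have mW p' q' : mble (W p' q').
  rewrite (_ : W p' q' = S `&` d @^-1` `[p', q']%classic).
    apply: measurableI => //; rewrite -[X in measurable X]setTI; apply: md => //; exact: measurable_itv.
  by apply/seteqP; split => y; rewrite /W /= in_itv.
have WD1 : W p a `<=` D by move=> y [Sy /andP[h1 h2]]; apply: WD; split => //; rewrite h1 (le_trans h2)// ltW.
have WD2 : W a b `<=` D by move=> y [Sy /andP[h1 h2]]; apply: WD; split => //; rewrite h2 (le_trans pa).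
have cu x : D x -> {for x, continuous (sqdev H c)}.
  by move=> /cH[cHx _ _]; apply: cvgM; apply: cvgB => //; exact: cvg_cst.
have cN x : D x -> {for x, continuous (sqgrad H1 H2)}.
  by move=> /cH[_ c1' c2']; apply: cvgD; apply: cvgM.
have mU V : mble V -> V `<=` D -> meas ((sqdev H c) \_ V).
  by move=> mV VD; exact: (meas_sub_open oD mV VD cu).
have mN : meas ((fun y => (d y - o) ^+ 2 * sqgrad H1 H2 y) \_ (W p b)).
  rewrite (_ : _ \_ _ = (fun y => (d y - o) ^+ 2 * ((sqgrad H1 H2) \_ (W p b)) y)).
    apply: measM; first by apply: measX; apply: measB => //; exact: meas_cst.
    exact: (meas_sub_open oD (mW _ _) WD cN).
  by apply/funext => y; rewrite !patchE; case: ifP => // _; rewrite mulr0.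
have k4 : 0 <= 4 * k by rewrite mulr_ge0// ltW.
have K0 : 0 <= 2 * (4 + 2 / k) by rewrite mulr_ge0// addr_ge0// divr_ge0// ltW.
have u0 y : 0 <= sqdev H c y by exact: sqr_ge0.
have N0 y : 0 <= (d y - o) ^+ 2 * sqgrad H1 H2 y by rewrite /sqgrad mulr_ge0 ?addr_ge0 ?sqr_ge0.
rewrite -(eintZ k4 (mU _ (mW a b) WD2) u0) -(eintZ K0 mN N0) /eint.
have mR1 := mU _ (mW p a) WD1; have mR2 := measZ (4 * k) (mU _ (mW a b) WD2).
have mR3 := measZ (2 * (4 + 2 / k)) mN.
rewrite !patchZ -ge0_integralD//; last 4 first.
- by move=> y _; rewrite lee_fin mulr_ge0// patchE; case: ifP.
- exact/measurable_EFinP.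
- by move=> y _; rewrite lee_fin mulr_ge0// patchE; case: ifP.
- exact/measurable_EFinP.
under [leRHS]eq_integral do rewrite -EFinD.
apply: (line_fubini le1) => //.
- exact: measD.
- by move=> y; rewrite patchE; case: ifP.
- by move=> y; rewrite addr_ge0// mulr_ge0// patchE; case: ifP.
move=> y; have [Sy|nSy] := pselect (S y); last first.
  rewrite integral0_eq; first by apply: integral_ge0 => s _; rewrite lee_fin addr_ge0// mulr_ge0// patchE; case: ifP.
  by move=> s _; rewrite patchE memNset// => -[/Se].
have mem p' q' s : W p' q' (y + s *: e) <-> p' - d y <= s <= q' - d y.
  have E := de y s; split => [[_ /andP[]]|/andP[h1 h2]].
    by rewrite E => h1 h2; apply/andP; split; lra.
  by split; [exact/Se|rewrite E; apply/andP; split; lra].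
have slice (f : pt -> R) p' q' : (\int[mu1]_s ((f \_ (W p' q')) (y + (s : R) *: e))%:E =
    \int[mu1]_(s in `[(p' - d y)%R, (q' - d y)%R]) (f (y + (s : R) *: e))%:E)%E.
  rewrite (integral_itv_support (p := p' - d y) (q := q' - d y)).
    apply: eq_integral => s; rewrite inE /= in_itv /= => h; rewrite patchE mem_set//.
    exact/mem.
  by move=> s h; rewrite patchE memNset// => /mem; exact/negP.
rewrite slice; have inD s : p - d y <= s <= b - d y -> D (y + s *: e) by move=> /mem /WD.
pose v s := e.1 * H1 (y + s *: e) + e.2 * H2 (y + s *: e).
have du s : p - d y <= s <= b - d y -> is_derive s (1 : R) (fun s => H (y + s *: e) - c) (v s).
  move=> /inD Ds; have h := dH y e s e1 Ds; have h2 := is_deriveB h (is_derive_cst c s 1).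
  by apply: is_derive_eq h2 _; rewrite subr0.
have cv : cts (p - d y) (b - d y) v.
  have cl : continuous (fun s : R => y + s *: e).
    by move=> s; apply: cvgD; [exact: cvg_cst|apply: cvgZl; exact: cvg_id].
  move=> s /inD /cH[_ c1' c2']; apply: cvgD; apply: cvgM; try exact: cvg_cst.
    by apply: continuous_comp; [exact: cl|exact: c1'].
  by apply: continuous_comp; [exact: cl|exact: c2'].
have ST := slice_tent (o := o - d y) (k := k) (p := p - d y) (a := a - d y) (b := b - d y).
apply: (le_trans (ST _ _ _ _ _ _ _ du cv)); rewrite ?lerD2r ?ltrD2r//.
  by rewrite !opprB !addrA !subrK.
under [leRHS]eq_integral do rewrite EFinD.
rewrite ge0_integralD//=; last 4 first.
- by move=> s _; rewrite lee_fin mulr_ge0// patchE; case: ifP.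
- apply/measurable_EFinP; exact: (meas_line y e mR2).
- by move=> s _; rewrite lee_fin mulr_ge0// patchE; case: ifP.
- apply/measurable_EFinP; exact: (meas_line y e mR3).
have E1 (f : pt -> R) (K : R) p' q' : (\int[mu1]_s (K * (f \_ (W p' q')) (y + (s : R) *: e))%R%:E =
    \int[mu1]_(s in `[(p' - d y)%R, (q' - d y)%R]) (K * f (y + (s : R) *: e))%R%:E)%E.
  by rewrite -(slice (fun z => K * f z)); apply: eq_integral => s _; rewrite patchZ.
rewrite !E1; apply: leeD => //; apply: ge0_le_integral => //=.
- by move=> s _; rewrite lee_fin mulr_ge0 ?sqr_ge0// addr_ge0// divr_ge0// ltW.
- apply/measurable_EFinP; apply: cts_measurable; apply: ctsM; first by move=> t _; exact: cvg_cst.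
  have cw : cts (p - d y) (b - d y) (fun t : R => (t - (o - d y)) * v t).
    by apply: ctsM cv => t _; apply: cvgB; [exact: cvg_id|exact: cvg_cst].
  exact: (ctsM cw cw).
- apply/measurable_EFinP; apply: (eq_measurable_fun (fun s : T1 => 2 * (4 + 2 / k) *
     ((fun y => (d y - o) ^+ 2 * sqgrad H1 H2 y) \_ (W p b)) (y + (s : R) *: e))).
    by move=> s; rewrite inE /= in_itv /= => h; rewrite patchE mem_set//; exact/mem.
  by apply: measurable_funTS; exact: (meas_line y e mR3).
move=> s _; rewrite lee_fin de exprMn /sqgrad.
have -> : s - (o - d y) = d y + s - o by ring.
have v2 : v s ^+ 2 <= 2 * (H1 (y + s *: e) ^+ 2 + H2 (y + s *: e) ^+ 2).
  move: e1; rewrite ler_norm_pair => /andP[ea eb]; rewrite /v.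
  have {}ea : e.1 ^+ 2 <= 1 by rewrite -(real_normK (num_real e.1)) expr_le1.
  have {}eb : e.2 ^+ 2 <= 1 by rewrite -(real_normK (num_real e.2)) expr_le1.
  move: (H1 _) (H2 _) (e.1) (e.2) ea eb => A B u w ea eb.
  have h1 := sqr_ge0 (u * A - w * B); have h2 := sqr_ge0 A; have h3 := sqr_ge0 B.
  have h4 : u ^+ 2 * A ^+ 2 <= A ^+ 2 by rewrite ler_piMl.
  have h5 : w ^+ 2 * B ^+ 2 <= B ^+ 2 by rewrite ler_piMl.
  rewrite -subr_ge0; have -> : 2 * (A ^+ 2 + B ^+ 2) - (u * A + w * B) ^+ 2 =
    (u * A - w * B) ^+ 2 + 2 * (A ^+ 2 - u ^+ 2 * A ^+ 2) + 2 * (B ^+ 2 - w ^+ 2 * B ^+ 2) by ring.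
  by rewrite !addr_ge0// mulr_ge0// subr_ge0.
move: v2 K0; move: (v s ^+ 2) (_ + H2 _ ^+ 2) ((_ - o) ^+ 2) (sqr_ge0 (d y + s - o)) (4 + _) => V N w w0 K v2 K0.
have {}K0 : 0 <= K by rewrite pmulr_rge0 in K0.
have -> : 2 * K * (w * N) = K * (w * (2 * N)) by ring.
by apply: ler_wpM2l => //; exact: ler_wpM2l.
Qed.

End Transport.

(** * A Hardy-Poincare inequality *)

(** The distance is in the max norm, for which the boxes are balls. As the infimum of the empty set
    is 0, the existence of a point outside D is a recurring hypothesis. *)
Definition bdist {R : realType} (D : set (R * R)) (x : R * R) : R :=
  inf [set `|z - x| | z in ~` D].

Definition energy {R : realType} (D : set (R * R)) (H1 H2 : R * R -> R) : \bar R :=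
  eint D (fun x => (bdist D x ^+ 2 * sqgrad H1 H2 x)%R).

(* V is controlled by Q when the oscillation of H on V about any constant is
   bounded by the weighted Dirichlet energy and the oscillation on Q. *)
Definition controls {R : realType} (D Q V : set (R * R)) : Prop :=
  exists2 C : R, 0 <= C & forall H H1 H2 (M c : R), c1data D H H1 H2 -> 0 < M ->
    (energy D H1 H2 <= M%:E)%E ->
    (eint V (sqdev H c) <= C%:E * (M%:E + eint Q (sqdev H c)))%E.

Section Squares.
Set Implicit Arguments.
Unset Strict Implicit.
Context {R : realType}.
Notation pt := (R * R)%type.
Implicit Types (f g H d : pt -> R) (D Q S V W : set pt) (e x y z : pt).

Lemma bdist_ge0 D x : 0 <= bdist D x.
Proof.
have [[z nz]|h] := pselect (exists z, ~ D z).
  by apply: lb_le_inf; [exists `|z - x|, z|move=> _ [w _ <-]].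
rewrite /bdist (_ : [set _ | _ in _] = set0) ?inf0//.
by rewrite -subset0 => _ [z nz <-]; apply: h; exists z.
Qed.

Lemma bdist_le D x z : ~ D z -> bdist D x <= `|z - x|.
Proof. by move=> nz; apply: ge_inf; [exists 0 => _ [w _ <-]|exists z]. Qed.

Lemma bdist_ge D x (r : R) : (exists z, ~ D z) -> (forall z, ~ D z -> r <= `|z - x|) -> r <= bdist D x.
Proof. by move=> [z nz] h; apply: lb_le_inf; [exists `|z - x|, z|move=> _ [w /h hw <-]]. Qed.

Lemma bdist_lip D x y : (exists z, ~ D z) -> bdist D x <= bdist D y + `|x - y|.
Proof.
move=> nD; rewrite -lerBlDr; apply: bdist_ge => // z nz; rewrite lerBlDr.
apply: le_trans (bdist_le x nz) _; rewrite (distrC x).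
by have := ler_normD (z - y) (y - x); rewrite addrA subrK.
Qed.

Lemma bdist_continuous D : (exists z, ~ D z) -> continuous (bdist D).
Proof.
move=> nD; apply: (@lipschitz_cont R pt R _ 1) => x y; rewrite mul1r ler_norml.
have h1 := bdist_lip x y nD; have h2 := bdist_lip y x nD; rewrite distrC in h2.
by apply/andP; split; lra.
Qed.

Lemma bdist_cbox D a (r s : R) x : (exists z, ~ D z) -> [set y | `|y - a| <= r + s] `<=` D ->
  `|x - a| <= r -> s <= bdist D x.
Proof.
move=> nD aD xa; apply: bdist_ge => // z nz; rewrite leNgt; apply/negP => zx; apply: nz.
apply: aD => /=; have := ler_normD (z - x) (x - a); rewrite addrA subrK => /le_trans; apply.
by rewrite addrC lerD// ltW.
Qed.

Lemma bdist_box D x y : (exists z, ~ D z) -> `|y - x| < bdist D x -> D y.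
Proof. by move=> nD h; apply: contrapT => ny; have := bdist_le x ny; rewrite leNgt h. Qed.

Lemma bdist_gt0 D x : open D -> (exists z, ~ D z) -> D x -> 0 < bdist D x.
Proof.
move=> /openP_box oD nD /oD[r r0 xr]; apply: lt_le_trans r0 _.
by apply: bdist_ge => // z nz; rewrite leNgt; apply/negP => zx; apply: nz; exact: xr.
Qed.

Lemma chain_control (C1 C2 M : R) (X Y Z : \bar R) : 0 <= C1 -> 0 <= C2 -> 0 < M -> (0 <= Z)%E ->
  (X <= C1%:E * (M%:E + Y))%E -> (Y <= C2%:E * (M%:E + Z))%E ->
  (X <= (C1 * (1 + C2))%:E * (M%:E + Z))%E.
Proof.
move=> C10 C20 M0 Z0 XY YZ; apply: (le_trans XY); rewrite EFinM -muleA.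
apply: lee_wpmul2l; first by rewrite lee_fin.
rewrite EFinD ge0_muleDl ?lee_fin// mul1e; apply: leeD => //.
by rewrite leeDl.
Qed.

Lemma mble_slab S d (p q : R) : mble S -> meas d -> mble (slab S d p q).
Proof.
move=> mS md; rewrite (_ : slab S d p q = S `&` d @^-1` `[p, q]%classic).
  apply: measurableI => //; rewrite -[X in measurable X]setTI; apply: md => //; exact: measurable_itv.
by apply/seteqP; split => y; rewrite /slab /= in_itv.
Qed.

Lemma sqdev_cont D H H1 H2 (c : R) x : c1data D H H1 H2 -> D x -> {for x, continuous (sqdev H c)}.
Proof. by move=> [cH _] /cH[cHx _ _]; apply: cvgM; apply: cvgB => //; exact: cvg_cst. Qed.

Lemma sqgrad_cont D H H1 H2 x : c1data D H H1 H2 -> D x -> {for x, continuous (sqgrad H1 H2)}.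
Proof. by move=> [cH _] /cH[_ c1' c2']; apply: cvgD; apply: cvgM. Qed.

Lemma sqdev_ge0 H (c : R) x : 0 <= sqdev H c x. Proof. exact: sqr_ge0. Qed.

Lemma sqgrad_ge0 f g x : 0 <= sqgrad f g x. Proof. by rewrite addr_ge0 ?sqr_ge0. Qed.

Lemma meas_energy D H H1 H2 : open D -> (exists z, ~ D z) -> c1data D H H1 H2 ->
  meas ((fun x => bdist D x ^+ 2 * sqgrad H1 H2 x) \_ D).
Proof.
move=> oD nD dat; apply: (meas_sub_open oD (mble_open oD)) => // x Dx.
apply: cvgM; last exact: sqgrad_cont dat Dx.
by apply: cvgM; exact: bdist_continuous.
Qed.

(** [push] at a distance r from the boundary, where a bounded weight on the gradient is dominated by
    the energy. The control spreads from the end [a, b] of the slab towards smaller values of d. *)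
Lemma grow (p a b r : R) : p <= a -> a < b -> 0 < r ->
  exists2 C : R, 0 <= C & forall D H H1 H2 e (l1 l2 : R) S d (M c : R), open D -> (exists z, ~ D z) ->
    c1data D H H1 H2 -> 0 < M -> (energy D H1 H2 <= M%:E)%E ->
    `|e| <= 1 -> l1 * e.1 + l2 * e.2 = 1 -> mble S -> meas d ->
    (forall y (t : R), S (y + t *: e) <-> S y) -> (forall y (t : R), d (y + t *: e) = d y + t) ->
    slab S d p b `<=` D -> (forall y, slab S d p b y -> r <= bdist D y) ->
    (eint (slab S d p b) (sqdev H c) <= C%:E * (M%:E + eint (slab S d a b) (sqdev H c)))%E.
Proof.
(* The origin of the weight is kept at distance 1 from the slab, which makes k positive even when p
   = a. *)
move=> pa ab r0; pose o := p - 1; pose k := (a - o) / (b - a).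
have oa : 0 < a - o by rewrite /o; lra.
have k0 : 0 < k by rewrite divr_gt0// subr_gt0.
have kE : k * (b - a) = a - o by rewrite divfK// subr_eq0 gt_eqF.
pose K := 2 * (4 + 2 / k); have K0 : 0 <= K by rewrite mulr_ge0// addr_ge0// divr_ge0// ltW.
pose B := ((b - o) / r) ^+ 2; have B0 : 0 <= B by exact: sqr_ge0.
exists (4 * k + 1 + K * B); first by rewrite addr_ge0 ?addr_ge0// mulr_ge0// ltW.
move=> D H H1 H2 e l1 l2 S d M c oD nD dat M0 en e1 le1 mS md Se de WD rW.
have op : o <= p by rewrite /o; lra.
have PS := push c oD dat e1 le1 mS md Se de op pa ab k0 kE WD.
have mW p' q' := mble_slab p' q' mS md.
have WD1 : slab S d p a `<=` D by move=> y [Sy /andP[h1 h2]]; apply: WD; split => //; rewrite h1 (le_trans h2)// ltW.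
have WD2 : slab S d a b `<=` D by move=> y [Sy /andP[h1 h2]]; apply: WD; split => //; rewrite h2 (le_trans pa).
have cu x := @sqdev_cont D H H1 H2 c x dat.
have mU V : mble V -> V `<=` D -> meas (sqdev H c \_ V) by move=> mV VD; exact: (meas_sub_open oD mV VD cu).
have split_ : slab S d p b = slab S d p a `|` slab S d a b.
  apply/seteqP; split => y.
    move=> [Sy /andP[h1 h2]]; have [h|h] := leP (d y) a; [left|right]; split => //; first by rewrite h1.
    by rewrite ltW.
  by move=> [[Sy /andP[h1 h2]]|[Sy /andP[h1 h2]]]; split => //; [rewrite h1 (le_trans h2)// ltW|rewrite h2 (le_trans pa)].
have u0 y := sqdev_ge0 H c y.
have U1 : (eint (slab S d p b) (sqdev H c) <= eint (slab S d p a) (sqdev H c) + eint (slab S d a b) (sqdev H c))%E.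
  rewrite {1}split_; apply: eint_setU => //; [exact: mU|exact: mU|].
  by rewrite -split_; exact: mU.
have EN : (eint (slab S d p b) (fun y => ((d y - o) ^+ 2 * sqgrad H1 H2 y)%R) <= B%:E * M%:E)%E.
  apply: (@le_trans _ _ (eint D (fun y => (B * (bdist D y ^+ 2 * sqgrad H1 H2 y))%R))).
    apply: eint_le.
    - rewrite (_ : _ \_ _ = (fun y => (d y - o) ^+ 2 * (sqgrad H1 H2 \_ (slab S d p b)) y)).
        apply: measM; first by apply: measX; apply: measB => //; exact: meas_cst.
        by apply: (meas_sub_open oD (mW _ _) WD) => x Dx; exact: sqgrad_cont dat Dx.
      by apply/funext => y; rewrite !patchE; case: ifP => // _; rewrite mulr0.
    - by rewrite patchZ; apply: measZ; exact: meas_energy dat.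
    - by move=> x; rewrite mulr_ge0 ?sqr_ge0 ?sqgrad_ge0.
    - by move=> x; apply: mulr_ge0 => //; apply: mulr_ge0; [exact: sqr_ge0|exact: sqgrad_ge0].
    move=> y Wy; split; first exact: WD.
    rewrite mulrA; apply: ler_wpM2r; first exact: sqgrad_ge0.
    have ry := rW y Wy; case: Wy => _ /andP[h1 h2].
    rewrite /B exprMn exprVn -mulrA; have rb : r ^+ 2 <= bdist D y ^+ 2 by rewrite lerXn2r ?nnegrE ?bdist_ge0// ltW.
    apply: (@le_trans _ _ ((b - o) ^+ 2)).
      by rewrite lerXn2r ?nnegrE; move: op h1 h2; rewrite ?subr_ge0; lra.
    rewrite ler_peMr ?sqr_ge0// mulrC ler_pdivlMr ?exprn_gt0//.
    by rewrite mul1r.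
  rewrite eintZ//; [|exact: meas_energy dat|by move=> x; rewrite mulr_ge0 ?sqr_ge0 ?sqgrad_ge0].
  by apply: lee_wpmul2l => //; rewrite lee_fin.
have Z0 : (0 <= eint (slab S d a b) (sqdev H c))%E by apply: eint_ge0 => y; exact: u0.
apply: (le_trans U1); apply: (le_trans (leeD (le_trans PS (leeD2l _ (lee_wpmul2l _ EN))) (lexx _))).
  by rewrite lee_fin.
move: Z0; set Z := eint _ _ => Z0.
have k4 : 0 <= 4 * k by rewrite mulr_ge0// ltW.
have KB : 0 <= K * B by exact: mulr_ge0.
rewrite muleA -EFinM addeAC -{2}(mul1e Z) -ge0_muleDl ?lee_fin// -EFinD.
have -> : ((4 * k + 1 + K * B)%:E * (M%:E + Z) = (4 * k + 1 + K * B)%:E * Z + (4 * k + 1 + K * B)%:E * M%:E)%E.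
  by rewrite addeC ge0_muleDr// lee_fin ltW.
apply: leeD.
  by apply: lee_wpmul2r => //; rewrite lee_fin lerDl.
by rewrite lee_fin; apply: ler_wpM2r; [exact: ltW|rewrite lerDr addr_ge0].
Qed.

Definition rect (p1 q1 p2 q2 : R) : set pt := [set y | p1 <= y.1 <= q1 /\ p2 <= y.2 <= q2].

Lemma cbox_rect y (r : R) : [set x : pt | `|x - y| <= r] = rect (y.1 - r) (y.1 + r) (y.2 - r) (y.2 + r).
Proof.
apply/seteqP; split => x; rewrite /rect /= ler_norm_pair !ler_norml /=.
  by move=> /andP[/andP[? ?] /andP[? ?]]; split; apply/andP; split; lra.
by move=> [/andP[? ?] /andP[? ?]]; do 2 (apply/andP; split); lra.
Qed.

Lemma sub_rect (p1 q1 p2 q2 p1' q1' p2' q2' : R) y : p1' <= p1 -> q1 <= q1' -> p2' <= p2 -> q2 <= q2' ->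
  rect p1 q1 p2 q2 y -> rect p1' q1' p2' q2' y.
Proof.
move=> h1 h2 h3 h4 [/andP[a1 a2] /andP[a3 a4]]; split.
  by rewrite (le_trans h1) ?(le_trans a2).
by rewrite (le_trans h3) ?(le_trans a4).
Qed.

(** The small square is enlarged side by side, to the left, to the right, downwards and upwards. The
    margin t keeps all intermediate rectangles at distance at least t from the complement. *)
Lemma square_control D x y (r s t : R) : open D -> (exists z, ~ D z) -> 0 < s -> 0 < t ->
  [set z | `|z - y| <= s] `<=` [set z | `|z - x| <= r] -> [set z | `|z - x| <= r + t] `<=` D ->
  controls D [set z | `|z - y| <= s] [set z | `|z - x| <= r].
Proof.
move=> oD nD s0 t0 yx xD.
have [h1 h2 h3 h4] : [/\ x.1 - r <= y.1 - s, y.1 + s <= x.1 + r, x.2 - r <= y.2 - s & y.2 + s <= x.2 + r].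
  move: yx; rewrite !cbox_rect => yx.
  have [] : rect (x.1 - r) (x.1 + r) (x.2 - r) (x.2 + r) (y.1 - s, y.2 - s).
    by apply: yx; split => /=; apply/andP; split; lra.
  have [] : rect (x.1 - r) (x.1 + r) (x.2 - r) (x.2 + r) (y.1 + s, y.2 + s).
    by apply: yx; split => /=; apply/andP; split; lra.
  by move=> /= /andP[? ?] /andP[? ?] /andP[? ?] /andP[? ?]; split; lra.
rewrite !cbox_rect; set p1 := x.1 - r in h1 *; set q1 := x.1 + r in h2 *.
set p2 := x.2 - r in h3 *; set q2 := x.2 + r in h4 *.
set a1 := y.1 - s in h1 *; set b1 := y.1 + s in h2 *; set a2 := y.2 - s in h3 *; set b2 := y.2 + s in h4 *.
have ab1 : a1 < b1 by rewrite /a1 /b1; lra.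
have ab2 : a2 < b2 by rewrite /a2 /b2; lra.
have subD z : rect p1 q1 p2 q2 z -> D z /\ t <= bdist D z.
  rewrite -cbox_rect => zx; split; first by apply: xD => /=; rewrite (le_trans zx)// lerDl ltW.
  exact: (bdist_cbox nD xD zx).
have [C1 C10 g1] := grow h1 ab1 t0.
(* [grow] extends towards smaller values, so extensions to the right and upwards use the reflected
   coordinates. *)
have n1 : - q1 <= - b1 by rewrite lerN2.
have n1' : - b1 < - p1 by rewrite ltrN2; apply: le_lt_trans h1 _.
have [C2 C20 g2] := grow n1 n1' t0.
have [C3 C30 g3] := grow h3 ab2 t0.
have n2 : - q2 <= - b2 by rewrite lerN2.
have n2' : - b2 < - p2 by rewrite ltrN2; apply: le_lt_trans h3 _.
have [C4 C40 g4] := grow n2 n2' t0.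
have ms1 (u v : R) : mble [set z : pt | u <= z.2 <= v].
  have := @mble_slab setT (fun z => z.2) u v measurableT measurable_snd.
  by congr mble; apply/seteqP; split => z; rewrite /slab /=; [case|split].
have ms2 (u v : R) : mble [set z : pt | u <= z.1 <= v].
  have := @mble_slab setT (fun z => z.1) u v measurableT measurable_fst.
  by congr mble; apply/seteqP; split => z; rewrite /slab /=; [case|split].
have m1 : meas (fun z : pt => z.1) by exact: measurable_fst.
have m2 : meas (fun z : pt => z.2) by exact: measurable_snd.
have mn1 : meas (fun z : pt => - z.1) by exact: measN.
have mn2 : meas (fun z : pt => - z.2) by exact: measN.
have norm1 (u v : R) : `|u| <= 1 -> `|v| <= 1 -> `|(u, v) : pt| <= 1 by move=> hu hv; rewrite ler_norm_pair hu.
have n11 : `|1 : R| <= 1 by rewrite normr1.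
have nm11 : `|-1 : R| <= 1 by rewrite normrN1.
have n00 : `|0 : R| <= 1 by rewrite normr0.
have slabE1 p q u v : slab [set z : pt | u <= z.2 <= v] (fun z => z.1) p q = rect p q u v.
  by apply/seteqP; split => z [].
have slabE2 p q u v : slab [set z : pt | u <= z.1 <= v] (fun z => z.2) p q = rect u v p q.
  by apply/seteqP; split => z [].
have slabE3 p q u v : slab [set z : pt | u <= z.2 <= v] (fun z => - z.1) (- q) (- p) = rect p q u v.
  by apply/seteqP; split => z []; rewrite /= ?lerN2 => h h'; split; rewrite //= ?lerN2 andbC.
have slabE4 p q u v : slab [set z : pt | u <= z.1 <= v] (fun z => - z.2) (- q) (- p) = rect u v p q.
  by apply/seteqP; split => z []; rewrite /= ?lerN2 => h h'; split; rewrite //= ?lerN2 andbC.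
exists (C4 * (1 + C3 * (1 + C2 * (1 + C1)))); first by rewrite !(mulr_ge0, addr_ge0).
move=> H H1 H2 M c dat M0 en.
have e0 V : (0 <= eint V (sqdev H c))%E by apply: eint_ge0 => z; exact: sqdev_ge0.
have s1 : (eint (rect p1 b1 a2 b2) (sqdev H c) <= C1%:E * (M%:E + eint (rect a1 b1 a2 b2) (sqdev H c)))%E.
  have := g1 D H H1 H2 (1, 0) 1 0 [set z : pt | a2 <= z.2 <= b2] (fun z => z.1) M c oD nD dat M0 en.
  rewrite !slabE1; apply => //.
  - exact: norm1.
  - by rewrite /= mulr1 mulr0 addr0.
  - by move=> z w /=; rewrite [w *: _]mulr0 addr0.
  - by move=> z w /=; rewrite [w *: _]mulr1.
  - by move=> z hz; apply: (subD z _).1; apply: sub_rect hz => //; (exact: ltW || exact: le_trans (ltW _) _).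
  - by move=> z hz; apply: (subD z _).2; apply: sub_rect hz => //; (exact: ltW || exact: le_trans (ltW _) _).
have s2 : (eint (rect p1 q1 a2 b2) (sqdev H c) <= C2%:E * (M%:E + eint (rect p1 b1 a2 b2) (sqdev H c)))%E.
  have := g2 D H H1 H2 (-1, 0) (-1) 0 [set z : pt | a2 <= z.2 <= b2] (fun z => - z.1) M c oD nD dat M0 en.
  rewrite !slabE3; apply => //.
  - exact: norm1.
  - by rewrite /= mulrNN mulr1 mulr0 addr0.
  - by move=> z w /=; rewrite [w *: _]mulr0 addr0.
  - by move=> z w /=; rewrite [w *: _]mulrN1 opprD opprK.
  - by move=> z hz; apply: (subD z _).1; apply: sub_rect hz => //; (exact: ltW || exact: le_trans (ltW _) _).
  - by move=> z hz; apply: (subD z _).2; apply: sub_rect hz => //; (exact: ltW || exact: le_trans (ltW _) _).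
have s3 : (eint (rect p1 q1 p2 b2) (sqdev H c) <= C3%:E * (M%:E + eint (rect p1 q1 a2 b2) (sqdev H c)))%E.
  have := g3 D H H1 H2 (0, 1) 0 1 [set z : pt | p1 <= z.1 <= q1] (fun z => z.2) M c oD nD dat M0 en.
  rewrite !slabE2; apply => //.
  - exact: norm1.
  - by rewrite /= mulr1 mulr0 add0r.
  - by move=> z w /=; rewrite [w *: _]mulr0 addr0.
  - by move=> z w /=; rewrite [w *: _]mulr1.
  - by move=> z hz; apply: (subD z _).1; apply: sub_rect hz => //; (exact: ltW || exact: le_trans (ltW _) _).
  - by move=> z hz; apply: (subD z _).2; apply: sub_rect hz => //; (exact: ltW || exact: le_trans (ltW _) _).
have s4 : (eint (rect p1 q1 p2 q2) (sqdev H c) <= C4%:E * (M%:E + eint (rect p1 q1 p2 b2) (sqdev H c)))%E.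
  have := g4 D H H1 H2 (0, -1) 0 (-1) [set z : pt | p1 <= z.1 <= q1] (fun z => - z.2) M c oD nD dat M0 en.
  rewrite !slabE4; apply => //.
  - exact: norm1.
  - by rewrite /= mulrNN mulr1 mulr0 add0r.
  - by move=> z w /=; rewrite [w *: _]mulr0 addr0.
  - by move=> z w /=; rewrite [w *: _]mulrN1 opprD opprK.
  - by move=> z h; exact: (subD z h).1.
  - by move=> z h; exact: (subD z h).2.
have ch1 := chain_control C20 C10 M0 (e0 _) s2 s1.
have ch2 := chain_control C30 (mulr_ge0 C20 (addr_ge0 ler01 C10)) M0 (e0 _) s3 ch1.
apply: (chain_control C40 _ M0 (e0 _) s4 ch2).
by rewrite !(mulr_ge0, addr_ge0).
Qed.

End Squares.

Section Boundary.
Set Implicit Arguments.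
Unset Strict Implicit.
Context {R : realType}.
Notation pt := (R * R)%type.
Notation T1 := (measurableTypeR R).
Notation T2 := (T1 * T1)%type.
Implicit Types (f H d : pt -> R) (D K Q S V W : set pt) (e x y z : pt).

Lemma eintE V f : eint V f = (\int[@mu2 R]_(y in V) (f y)%:E)%E.
Proof.
rewrite [RHS]integral_mkcond; apply: eq_integral => y _.
by rewrite !patchE; case: ifP.
Qed.

Lemma eint_bigcup_le (F : nat -> set pt) f (B : \bar R) : {homo F : n m / (n <= m)%N >-> n `<=` m} ->
  (forall n, mble (F n)) -> (forall n, meas (f \_ (F n))) -> (forall x, 0 <= f x) ->
  (forall n, (eint (F n) f <= B)%E) -> (eint (\bigcup_n F n) f <= B)%E.
Proof.
move=> ndF mF mf f0 FB.
have mFf n : measurable_fun (F n) (fun y : T2 => (f y)%:E).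
  by apply/measurable_EFinP; apply/(measurable_restrictT _ (mF n)); exact: mf.
have cF : (\int[@mu2 R]_(x in F i) (f x)%:E)%E @[i --> \oo] --> (\int[@mu2 R]_(x in \bigcup_i F i) (f x)%:E)%E.
  apply: (@ge0_nondecreasing_set_cvg_integral _ T2 R F (fun y => (f y)%:E) (@mu2 R)) => //.
    by move=> n m nm; apply/subsetPset; exact: ndF.
  by move=> i x _; rewrite lee_fin.
rewrite eintE; move/cvg_lim: (cF) => <- //.
apply: lime_le; first by apply/cvg_ex; eexists; exact: cF.
by apply: nearW => n; rewrite -eintE.
Qed.

Lemma edist_lt x y (r : R) : `|x - y| < r / 2 -> Defs.edist x y < r.
Proof.
move=> h; have r0 : 0 < r by have := le_lt_trans (normr_ge0 _) h; rewrite pmulr_lgt0.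
move: h; rewrite ltr_norm_pair /= => /andP[h1 h2].
rewrite /Defs.edist -[ltRHS](ger0_norm (ltW r0)) -sqrtr_sqr ltr_sqrt ?exprn_gt0//.
rewrite -(real_normK (num_real (x.1 - y.1))) -(real_normK (num_real (x.2 - y.2))).
move: (normr_ge0 (x.1 - y.1)) (normr_ge0 (x.2 - y.2)) h1 h2.
move: `|_| `|_| => a b a0 b0 h1 h2; nra.
Qed.

(** The height d above the graph satisfies d <= Lam bdist. From {p <= d <= T} the oscillation is
    pushed up into the compact slab {T <= d <= 2 T} with the weight d^2, at a cost independent of p,
    and p tends to 0. *)
Lemma boundary_control D x (c s r L : R) (g : R -> R) : open D -> (exists z, ~ D z) ->
  c ^+ 2 + s ^+ 2 = 1 -> 0 < r -> (forall t u : R, `|g t - g u| <= L * `|t - u|) -> 0 <= L ->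
  (forall y, Defs.edist y x < r -> (D y <-> g (c * y.1 + s * y.2) < c * y.2 - s * y.1)) ->
  closure D x -> ~ D x ->
  exists (t : R) (K : set pt), [/\ 0 < t, compact K, K `<=` D & controls D K (D `&` box x t)].
Proof.
move=> oD nD cs1 r0 gL L0 chart clx nDx.
pose xi y : R := c * y.1 + s * y.2; pose eta y : R := c * y.2 - s * y.1.
pose d y := eta y - g (xi y); pose Lam := 2 * (1 + L).
have Lam0 : 0 < Lam by rewrite mulr_gt0// ltr_pwDl.
have c1 : `|c| <= 1 by rewrite -(@expr_le1 _ 2)// real_normK ?num_real// -cs1 lerDl sqr_ge0.
have s1 : `|s| <= 1 by rewrite -(@expr_le1 _ 2)// real_normK ?num_real// -cs1 lerDr sqr_ge0.
have xiL y z : `|xi y - xi z| <= 2 * `|y - z|.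
  have -> : xi y - xi z = (y - z).1 * c + (y - z).2 * s by rewrite /xi /=; ring.
  apply: le_trans (ler_dotn _ _ (ler_norm_fst _) (ler_norm_snd _)) _.
  by apply: ler_wpM2r => //; lra.
have etaL y z : `|eta y - eta z| <= 2 * `|y - z|.
  have -> : eta y - eta z = (y - z).1 * (- s) + (y - z).2 * c by rewrite /eta /=; ring.
  apply: le_trans (ler_dotn _ _ (ler_norm_fst _) (ler_norm_snd _)) _.
  by apply: ler_wpM2r => //; rewrite normrN; lra.
have dL y z : `|d y - d z| <= Lam * `|y - z|.
  have -> : d y - d z = (eta y - eta z) - (g (xi y) - g (xi z)) by rewrite /d; ring.
  apply: le_trans (ler_normB _ _) _; rewrite /Lam mulrDr mulrDl mulr1; apply: lerD => //.
  apply: le_trans (gL _ _) _; rewrite [2 * L]mulrC -mulrA; exact: ler_wpM2l.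
have chart' y : `|y - x| < r / 2 -> (D y <-> 0 < d y).
  by move=> /edist_lt /chart h; rewrite /d subr_gt0.
have dx0 : d x = 0.
  apply/eqP; rewrite eq_le; apply/andP; split.
    rewrite leNgt; apply/negP => dx; apply: nDx; apply/chart' => //.
    by rewrite subrr normr0 divr_gt0.
  rewrite leNgt; apply/negP => dx.
  have [y [Dy]] : D `&` box x (Num.min (r / 2) (- d x / Lam)) !=set0.
    apply: clx; apply/open_nbhs_nbhs; split; first exact: open_box.
    by rewrite /box /= subrr normr0 lt_min !divr_gt0// oppr_gt0.
  rewrite /box /= lt_min => /andP[/chart' h1 h2]; have := h1.1 Dy.
  have := dL y x; rewrite ltr_pdivlMr// in h2; rewrite ler_norml => /andP[_ h3] h4; lra.
(* Sizes that keep the curved slab inside the chart: 2 T = r1 / 2 and (1 + L) d1 = r1 / 2, so height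
   and horizontal extent together stay within r1 < r / 2. *)
pose r1 := r / 4; have r10 : 0 < r1 by rewrite divr_gt0.
pose d1 := r1 / (2 * (1 + L)); have d10 : 0 < d1 by rewrite divr_gt0.
pose T := r1 / 4; have T0 : 0 < T by rewrite divr_gt0.
pose S : set pt := [set y | `|xi y - xi x| <= d1].
(* The graph direction: along e the coordinate xi is fixed and the height grows at unit speed. *)
pose e : pt := (- s, c).
have e1 : `|e| <= 1 by rewrite ler_norm_pair /= normrN s1.
have le1 : - s * e.1 + c * e.2 = 1 by rewrite -cs1 /e /=; ring.
have xie y t : xi (y + t *: e) = xi y.
  rewrite /xi /= -[t *: c]/(t * c) -[t *: - s]/(t * - s); ring.
have de y t : d (y + t *: e) = d y + t.
  rewrite /d xie; have -> : eta (y + t *: e) = eta y + t * (c ^+ 2 + s ^+ 2); last by rewrite cs1 mulr1; ring.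
  rewrite /eta /= -[t *: c]/(t * c) -[t *: - s]/(t * - s); ring.
have Se y t : S (y + t *: e) <-> S y by rewrite /S /= xie.
have cxi : continuous xi by apply: (@lipschitz_cont R pt R _ 2).
have cd : continuous d by apply: (@lipschitz_cont R pt R _ Lam).
have mS : mble S.
  have -> : S = slab setT (fun y => `|xi y - xi x|) 0 d1.
    by apply/seteqP; split => y; rewrite /S /slab /= normr_ge0; [split|case].
  apply: mble_slab; first exact: measurableT.
  by apply: meas_norm; apply: measB; [exact: meas_continuous|exact: meas_cst].
have md : meas d by exact: meas_continuous.
have near_x y : S y -> 0 <= d y <= 2 * T -> `|y - x| <= r1.
  move=> Sy /andP[h1 h2].
  have a1 : `|eta y - eta x| <= 2 * T + L * d1.
    have -> : eta y - eta x = d y + (g (xi y) - g (xi x)) by move: dx0; rewrite /d => /eqP; rewrite subr_eq0 => /eqP ->; ring.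
    apply: le_trans (ler_normD _ _) _; rewrite ger0_norm//; apply: lerD => //.
    by apply: le_trans (gL _ _) _; exact: ler_wpM2l.
  have key : 2 * T + L * d1 + d1 <= r1.
    have -> : 2 * T + L * d1 + d1 = r1 / 2 + r1 / 2; last by rewrite -splitr.
    by rewrite /T /d1; field; rewrite gt_eqF// ltr_pwDl.
  have bnd (a b : R) : `|a| <= 1 -> `|b| <= 1 -> `|a * (xi y - xi x) + b * (eta y - eta x)| <= r1.
    move=> ha hb; apply: le_trans key; apply: le_trans (ler_normD _ _) _; rewrite (normrM a) (normrM b) addrC.
    by apply: lerD; [apply: le_trans a1|apply: le_trans Sy]; rewrite ler_piMl.
  rewrite ler_norm_pair; apply/andP; split.
    have -> : (y - x).1 = c * (xi y - xi x) + (- s) * (eta y - eta x).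
      by rewrite -[LHS]mul1r -cs1 /xi /eta /=; ring.
    by apply: bnd; rewrite ?normrN.
  have -> : (y - x).2 = s * (xi y - xi x) + c * (eta y - eta x).
    by rewrite -[LHS]mul1r -cs1 /xi /eta /=; ring.
  exact: bnd.
have r12 : r1 < r / 2 by rewrite /r1; lra.
have slabD (p : R) y : 0 < p -> slab S d p (2 * T) y -> D y /\ d y <= Lam * bdist D y.
  move=> p0 [Sy /andP[h1 h2]]; have dy : 0 < d y by exact: lt_le_trans h1.
  have yx := near_x y Sy; rewrite (ltW dy) h2 in yx; have {}yx := yx isT.
  split; first by apply/chart' => //; exact: le_lt_trans r12.
  rewrite mulrC -ler_pdivrMr//; apply: bdist_ge => // z nz; rewrite leNgt; apply/negP => zy.
  apply: nz; apply/chart'.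
    have -> : z - x = (z - y) + (y - x) by rewrite addrA subrK.
    apply: le_lt_trans (ler_normD _ _) _.
    have : d y / Lam <= T.
      rewrite ler_pdivrMr//; apply: le_trans h2 _; rewrite mulrC ler_wpM2l//; first exact: ltW.
      by rewrite /Lam ler_peMr// lerDl.
    by move: zy yx; rewrite /T /r1; move: `|z - y| `|y - x| (d y / Lam) => a b u *; lra.
  rewrite ltr_pdivlMr// in zy; have := dL z y; rewrite ler_norml => /andP[h3 _].
  by move: zy h3; rewrite [_ * Lam]mulrC; move: (Lam * _) => u *; lra.
pose K := slab S d T (2 * T).
(* In this order: xi is 2-Lipschitz, so the box lies over S; the chart is valid; d is Lam-Lipschitz
   and vanishes at x, so d <= T. *)
pose t := Num.min (d1 / 2) (Num.min (r / 2) (T / Lam)).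
have t0 : 0 < t by rewrite !lt_min !divr_gt0.
have mW p q := @mble_slab R S d p q mS md.
exists t, K; split => //.
- apply: (subclosed_compact _ (@compact_cbox R x r1)); last first.
    move=> y [Sy /andP[h1 h2]]; apply: (near_x y Sy).
    by rewrite h2 (le_trans (ltW T0) h1).
  have -> : K = [set y | `|xi y - xi x| <= d1] `&` ([set y | T <= d y] `&` [set y | d y <= 2 * T]).
    apply/seteqP; split => y; first by move=> [h /andP[h1 h2]].
    by move=> [h [h1 h2]]; split => //; apply/andP.
  apply: closedI; last apply: closedI.
  - have cn : continuous (fun y => `|xi y - xi x|).
      by move=> y; apply: cvg_norm; apply: cvgB; [exact: cxi|exact: cvg_cst].
    exact: (closed_comp (fun y _ => cn y) (@closed_le R d1)).
  - exact: (closed_comp (fun y _ => cd y) (@closed_ge R T)).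
  - exact: (closed_comp (fun y _ => cd y) (@closed_le R (2 * T))).
- by move=> y /slabD; case.
(* With o = 0 and k = 1 the constants 4 k and 2 (4 + 2 / k) of [push] are 4 and 12; replacing d^2 by
   bdist^2 costs Lam^2. *)
exists (12 * Lam ^+ 2 + 4); first by rewrite addr_ge0// mulr_ge0// sqr_ge0.
move=> H H1 H2 M k dat M0 en.
have u0 y := sqdev_ge0 H k y.
have cu y := @sqdev_cont R D H H1 H2 k y dat.
have mU V : mble V -> V `<=` D -> meas (sqdev H k \_ V) by move=> mV VD; exact: (meas_sub_open oD mV VD cu).
have Z0 : (0 <= eint K (sqdev H k))%E by apply: eint_ge0 => y; exact: u0.
have est (p : R) : 0 < p -> p <= T ->
    (eint (slab S d p T) (sqdev H k) <= (12 * Lam ^+ 2 + 4)%:E * (M%:E + eint K (sqdev H k)))%E.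
  move=> p0 pT; have T2 : T < 2 * T by lra.
  have WD : slab S d p (2 * T) `<=` D by move=> y /(slabD _ _ p0)[].
  have kE : 1 * (2 * T - T) = T - 0 by ring.
  have PS := push k oD dat e1 le1 mS md Se de (ltW p0) pT T2 ltr01 kE WD.
  apply: (le_trans PS).
  have EN : (eint (slab S d p (2 * T)) (fun y => ((d y - 0) ^+ 2 * sqgrad H1 H2 y)%R) <= (Lam ^+ 2)%:E * M%:E)%E.
    apply: (@le_trans _ _ (eint D (fun y => (Lam ^+ 2 * (bdist D y ^+ 2 * sqgrad H1 H2 y))%R))).
      apply: eint_le.
      - rewrite (_ : _ \_ _ = (fun y => (d y - 0) ^+ 2 * (sqgrad H1 H2 \_ (slab S d p (2 * T))) y)).
          apply: measM; first by apply: measX; apply: measB => //; exact: meas_cst.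
          by apply: (meas_sub_open oD (mW _ _) WD) => y Dy; exact: sqgrad_cont dat Dy.
        by apply/funext => y; rewrite !patchE; case: ifP => // _; rewrite mulr0.
      - by rewrite patchZ; apply: measZ; exact: meas_energy dat.
      - by move=> y; apply: mulr_ge0; [exact: sqr_ge0|exact: sqgrad_ge0].
      - by move=> y; apply: mulr_ge0; [exact: sqr_ge0|apply: mulr_ge0; [exact: sqr_ge0|exact: sqgrad_ge0]].
      move=> y Wy; have [Dy h] := slabD p y p0 Wy; split => //.
      rewrite subr0 mulrA -exprMn; apply: ler_wpM2r; first exact: sqgrad_ge0.
      have dy : 0 <= d y by case: Wy => _ /andP[h1 _]; rewrite (le_trans _ h1)// ltW.
      by rewrite lerXn2r// nnegrE// (le_trans dy).
    rewrite eintZ ?sqr_ge0//; [|exact: meas_energy dat|by move=> y; apply: mulr_ge0; [exact: sqr_ge0|exact: sqgrad_ge0]].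
    by apply: lee_wpmul2l => //; rewrite lee_fin sqr_ge0.
  apply: (le_trans (leeD (lexx _) (lee_wpmul2l _ EN))); first by rewrite lee_fin; lra.
  rewrite mulr1 divr1 -!EFinM.
  have -> : ((12 * Lam ^+ 2 + 4)%:E * (M%:E + eint K (sqdev H k)) =
     (12 * Lam ^+ 2 + 4)%:E * eint K (sqdev H k) + (12 * Lam ^+ 2 + 4)%:E * M%:E)%E.
    by rewrite addeC ge0_muleDr// lee_fin ltW.
  apply: leeD; first by apply: lee_wpmul2r => //; rewrite lee_fin lerDr mulr_ge0// sqr_ge0.
  rewrite lee_fin mulrA; apply: ler_wpM2r; first exact: ltW.
  by move: (Lam ^+ 2) (sqr_ge0 Lam) => q q0; lra.
(* Slabs that exhaust the part of D below height T; since [est] is uniform in p, monotone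
   convergence applies. *)
pose p (n : nat) : R := T / n.+1%:R.
have p0 n : 0 < p n by rewrite divr_gt0.
have pT n : p n <= T by rewrite ler_pdivrMr// ler_peMr ?ler1n// ltW.
apply: (@le_trans _ _ (eint (\bigcup_n slab S d (p n) T) (sqdev H k))).
  have sub : D `&` box x t `<=` \bigcup_n slab S d (p n) T.
    move=> y [Dy]; rewrite /box /= !lt_min => /and3P[h1 h2 h3].
    have dy : 0 < d y by exact/chart'.
    have [n hn] : exists n : nat, T / d y < n.+1%:R by exists (Num.truncn (T / d y)); exact: truncnS_gt.
    exists n => //; split.
      by apply: le_trans (xiL _ _) _; move: h1; rewrite ltr_pdivlMr// mulrC => /ltW.
    apply/andP; split.
      by rewrite ler_pdivrMr// mulrC -ler_pdivrMr// ltW.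
    have := dL y x; rewrite dx0 subr0 => h; apply: le_trans (ler_norm _) _; apply: le_trans h _.
    by rewrite mulrC -ler_pdivlMr// ltW.
  have slabsD n : slab S d (p n) T `<=` D.
    move=> y [Sy /andP[h1 h2]]; apply: (slabD (p n) y (p0 n) _).1; split => //; rewrite h1/=.
    by apply: le_trans h2 _; rewrite mulr_natl mulr2n lerDl ltW.
  apply: eint_le => //.
  - by apply: mU; [apply: measurableI; [exact: mble_open|exact: mble_box]|move=> y []].
  - apply: mU; first by apply: bigcup_measurable => n _; exact: mW.
    by move=> y [n _ /slabsD].
  - by move=> y /sub h; split.
apply: eint_bigcup_le => //.
- move=> n m nm y [Sy /andP[h1 h2]]; split => //; rewrite h2 andbT; apply: le_trans h1.
  by rewrite /p ler_pM2l// lef_pV2 ?posrE// ler_nat.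
- move=> n; apply: mU; first exact: mW.
  move=> y [Sy /andP[h1 h2]]; apply: (slabD (p n) y (p0 n) _).1; split => //; rewrite h1/=.
  by apply: le_trans h2 _; rewrite mulr_natl mulr2n lerDl ltW.
- by move=> n; exact: est.
Qed.

End Boundary.

Section BaseSquare.
Set Implicit Arguments.
Unset Strict Implicit.
Context {R : realType}.
Notation pt := (R * R)%type.
Notation T1 := (measurableTypeR R).
Implicit Types (f H d : pt -> R) (D K Q S V W : set pt) (e x y z : pt).

(** A Poincare inequality from an interior zero: Hardy's inequality on both sides of y, each time
    with the weight centred at the far end, so that all boundary terms vanish. *)
Lemma slice_center (p q y : R) (u v : R -> R) : p <= y <= q ->
  (forall t, p <= t <= q -> is_derive t (1 : R) u (v t)) -> cts p q v -> u y = 0 ->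
  (\int[mu1]_(t in `[p, q]) (u t ^+ 2)%:E <= \int[mu1]_(t in `[p, q]) (8 * ((q - p) * v t) ^+ 2)%:E)%E.
Proof.
move=> /andP[py yq] du cv uy; have cu := is_derive_cts du.
have cc (k p' q' : R) : cts p' q' (fun=> k) by move=> t _; exact: cvg_cst.
have sub1 t : p <= t <= y -> p <= t <= q by move=> /andP[-> h]; exact: le_trans yq.
have sub2 t : y <= t <= q -> p <= t <= q by move=> /andP[h ->]; rewrite andbT; exact: le_trans h.
have W1 := slice_weight p py (fun t h => du t (sub1 t h)) (fun t h => cv t (sub1 t h)).
have W2 := slice_weight q yq (fun t h => du t (sub2 t h)) (fun t h => cv t (sub2 t h)).
have Z1 : 2 * (y - p) * u y ^+ 2 - 2 * (p - p) * u p ^+ 2 = 0 by rewrite uy; ring.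
have Z2 : 2 * (q - q) * u q ^+ 2 - 2 * (y - q) * u y ^+ 2 = 0 by rewrite uy; ring.
rewrite Z1 add0e in W1; rewrite Z2 add0e in W2.
pose X t := ((q - p) * v t) ^+ 2.
have mX k (p' q' : R) : cts p' q' v -> measurable_fun (`[p', q'] : set T1) (fun t => (k * X t)%:E).
  by move=> cv'; apply/measurable_EFinP; apply: cts_measurable; apply: ctsM => //; apply: ctsM; exact: ctsM.
have X0 t : 0 <= X t by exact: sqr_ge0.
have le1 (p' q' o : R) : p <= p' -> q' <= q -> p <= o <= q ->
    (\int[mu1]_(t in `[p', q']) (4 * ((t - o) * v t) ^+ 2)%:E <= \int[mu1]_(t in `[p, q]) (4 * X t)%:E)%E.
  move=> pp' qq' /andP[po oq]; have cv' : cts p' q' v.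
    by move=> t /andP[h1 h2]; apply: cv; rewrite (le_trans pp')//= (le_trans h2).
  apply: (@le_trans _ _ (\int[mu1]_(t in `[p', q']) (4 * X t)%:E)%E).
    apply: ge0_le_integral => //=.
    - by move=> t _; rewrite lee_fin mulr_ge0// sqr_ge0.
    - apply/measurable_EFinP; apply: cts_measurable; apply: ctsM => //.
      have cw : cts p' q' (fun t : R => (t - o) * v t).
        by apply: ctsM cv' => t _; apply: cvgB; [exact: cvg_id|exact: cvg_cst].
      exact: (ctsM cw cw).
    - exact: mX.
    move=> t; rewrite in_itv /= => /andP[h1 h2]; rewrite lee_fin ler_wpM2l// /X !exprMn ler_wpM2r ?sqr_ge0//.
    rewrite -(real_normK (num_real (t - o))) lerXn2r ?nnegrE ?subr_ge0 ?(le_trans po)//.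
    by rewrite ler_norml; apply/andP; split; lra.
  apply: ge0_subset_integral => //.
  - exact: mX.
  - by move=> t _; rewrite lee_fin mulr_ge0.
  - by move=> t /=; rewrite !in_itv /= => /andP[h h']; rewrite (le_trans pp' h) (le_trans h' qq').
have pq := le_trans py yq.
have U : (\int[mu1]_(t in `[p, q]) (u t ^+ 2)%:E <=
    \int[mu1]_(t in `[p, y]) (u t ^+ 2)%:E + \int[mu1]_(t in `[y, q]) (u t ^+ 2)%:E)%E.
  have mu2' : measurable_fun (`[p, q] : set T1) (fun t => (u t ^+ 2)%:E).
    by apply/measurable_EFinP; apply: cts_measurable; exact: ctsM.
  have -> : `[p, q]%classic = `[p, y]%classic `|` `]y, q]%classic :> set T1.
    apply/seteqP; split => t /=; rewrite !in_itv /=.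
      by move=> /andP[h1 h2]; have [h|h] := leP t y; [left; rewrite h1|right; rewrite h2].
    by move=> [/sub1//|/andP[/ltW h1 h2]]; apply: sub2; rewrite h1.
  rewrite ge0_integral_setU//=.
  - apply: leeD => //; apply: ge0_subset_integral => //.
    + apply/measurable_EFinP; apply: cts_measurable => t h; apply: cvgM; exact: (cu t (sub2 t h)).
    + by move=> t _; rewrite lee_fin sqr_ge0.
    + by move=> t /=; rewrite !in_itv /= => /andP[/ltW -> ->].
  - rewrite (_ : _ `|` _ = `[p, q]%classic :> set T1)//; apply/seteqP; split => t /=; rewrite !in_itv /=.
      by move=> [/sub1//|/andP[/ltW h1 h2]]; apply: sub2; rewrite h1.
    by move=> /andP[h1 h2]; have [h|h] := leP t y; [left; rewrite h1|right; rewrite h2].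
  - by move=> t _; rewrite lee_fin sqr_ge0.
  - apply/disj_setPLR => t /=; rewrite !in_itv /= => /andP[_ h1] /andP[h2 _].
    by have := le_lt_trans h1 h2; rewrite ltxx.
apply: (le_trans U); apply: (le_trans (leeD (le_trans W1 (le1 _ _ _ _ _ _)) (le_trans W2 (le1 _ _ _ _ _ _)))) => //.
- by rewrite lexx.
- by rewrite lexx andbT.
rewrite -ge0_integralD//=; [|by move=> t _; rewrite lee_fin mulr_ge0|exact: mX|
      by move=> t _; rewrite lee_fin mulr_ge0|exact: mX].
rewrite le_eqVlt; apply/orP; left; apply/eqP/eq_integral => t _; rewrite -EFinD -mulrDl.
by congr (_ * _)%:E; ring.
Qed.

Lemma c1data_slice D H H1 H2 : c1data D H H1 H2 ->
  (forall t s : R, D (t, s) -> is_derive t (1 : R) (fun t => H (t, s)) (H1 (t, s)) /\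
     {for t, continuous (fun t => H1 (t, s))}) /\
  (forall t s : R, D (t, s) -> is_derive s (1 : R) (fun s => H (t, s)) (H2 (t, s)) /\
     {for s, continuous (fun s => H2 (t, s))}).
Proof.
move=> [cH dH].
have E1 (s t : R) : ((0, s) : pt) + t *: ((1, 0) : pt) = (t, s).
  by rewrite -[LHS]/(0 + t * 1, s + t * 0) mulr1 mulr0 add0r addr0.
have E2 (s t : R) : ((t, 0) : pt) + s *: ((0, 1) : pt) = (t, s).
  by rewrite -[LHS]/(t + s * 0, 0 + s * 1) mulr1 mulr0 add0r addr0.
have cl x e : continuous (fun s : R => x + s *: e).
  by move=> s; apply: cvgD; [exact: cvg_cst|apply: cvgZl; exact: cvg_id].
split=> t s Dts.
  split.
    have := dH (0, s) (1, 0) t; rewrite E1 ler_norm_pair /= normr1 normr0 lexx ler01 /= mul1r mul0r addr0.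
    move=> /(_ isT Dts); congr is_derive; by apply/funext => w; rewrite E1.
  have -> : (fun t => H1 (t, s)) = (fun t => H1 ((0, s) + t *: (1, 0))) by apply/funext => w; rewrite E1.
  by apply: continuous_comp; [exact: cl|rewrite E1; have [] := cH _ Dts].
split.
  have := dH (t, 0) (0, 1) s; rewrite E2 ler_norm_pair /= normr1 normr0 lexx ler01 /= mul1r mul0r add0r.
  move=> /(_ isT Dts); congr is_derive; by apply/funext => w; rewrite E2.
have -> : (fun s => H2 (t, s)) = (fun s => H2 ((t, 0) + s *: (0, 1))) by apply/funext => w; rewrite E2.
by apply: continuous_comp; [exact: cl|rewrite E2; have [] := cH _ Dts].
Qed.

End BaseSquare.

Section BaseConstant.
Set Implicit Arguments.
Unset Strict Implicit.
Context {R : realType}.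
Notation pt := (R * R)%type.
Notation T1 := (measurableTypeR R).
Notation T2 := (T1 * T1)%type.
Implicit Types (f H d : pt -> R) (D K Q S V W : set pt) (e x y z : pt).

Lemma eint_iter1 Q f : meas (f \_ Q) -> (forall x, 0 <= f x) ->
  eint Q f = (\int[mu1]_t \int[mu1]_s ((f \_ Q) (t, s))%:E)%E.
Proof.
move=> mf f0; rewrite /eint; have f0' z : (0 <= ((f \_ Q) z)%:E)%E by rewrite lee_fin patchE; case: ifP.
have mf' : measurable_fun setT (fun z : T2 => ((f \_ Q) z)%:E) by exact/measurable_EFinP.
exact: (fubini_tonelli1 (m1 := @mu1 R) (m2 := @mu1 R) _ mf' f0').
Qed.

Lemma eint_iter2 Q f : meas (f \_ Q) -> (forall x, 0 <= f x) ->
  eint Q f = (\int[mu1]_s \int[mu1]_t ((f \_ Q) (t, s))%:E)%E.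
Proof.
move=> mf f0; rewrite /eint; have f0' z : (0 <= ((f \_ Q) z)%:E)%E by rewrite lee_fin patchE; case: ifP.
have mf' : measurable_fun setT (fun z : T2 => ((f \_ Q) z)%:E) by exact/measurable_EFinP.
exact: (fubini_tonelli2 (m1 := @mu1 R) (m2 := @mu1 R) _ mf' f0').
Qed.

Lemma rect_slice1 (p1 q1 p2 q2 : R) f (s : R) : p2 <= s <= q2 ->
  (\int[mu1]_t ((f \_ (rect p1 q1 p2 q2)) (t, s))%:E = \int[mu1]_(t in `[p1, q1]) (f (t, s))%:E)%E.
Proof.
move=> hs; rewrite (integral_itv_support (p := p1) (q := q1)).
  apply: eq_integral => t; rewrite inE /= in_itv /= => ht; rewrite patchE mem_set//.
by move=> t /negP ht; rewrite patchE memNset// => -[].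
Qed.

Lemma rect_slice2 (p1 q1 p2 q2 : R) f (t : R) : p1 <= t <= q1 ->
  (\int[mu1]_s ((f \_ (rect p1 q1 p2 q2)) (t, s))%:E = \int[mu1]_(s in `[p2, q2]) (f (t, s))%:E)%E.
Proof.
move=> ht; rewrite (integral_itv_support (p := p2) (q := q2)).
  apply: eq_integral => s; rewrite inE /= in_itv /= => hs; rewrite patchE mem_set//.
by move=> s /negP hs; rewrite patchE memNset// => -[].
Qed.

(** Otherwise every column would carry more than twice the average, and the total would be at least
    2 M. *)
Lemma exists_good_column (p1 q1 p2 q2 M : R) f : p1 < q1 -> 0 < M ->
  meas (f \_ (rect p1 q1 p2 q2)) -> (forall x, 0 <= f x) ->
  (eint (rect p1 q1 p2 q2) f <= M%:E)%E ->
  exists2 t : R, p1 <= t <= q1 & (\int[mu1]_(s in `[p2, q2]) (f (t, s))%:E <= (2 * M / (q1 - p1))%:E)%E.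
Proof.
move=> pq M0 mf f0 EM; have l0 : 0 < q1 - p1 by rewrite subr_gt0.
apply: contrapT => nex.
have big t : p1 <= t <= q1 ->
    ((2 * M / (q1 - p1))%:E <= \int[mu1]_s ((f \_ (rect p1 q1 p2 q2)) (t, s))%:E)%E.
  move=> ht; rewrite rect_slice2// leNgt; apply/negP => h; apply: nex; exists t => //.
  exact: ltW.
suff : ((2 * M)%:E <= M%:E)%E by rewrite lee_fin; lra.
apply: le_trans EM; rewrite eint_iter1//.
apply: (@le_trans _ _ (\int[mu1]_(t in `[p1, q1]) (2 * M / (q1 - p1))%:E)%E).
  rewrite integral_cst//= [X in (_ * X)%E](@lebesgue_measure_itv R `[p1, q1]) /= lte_fin pq.
  by rewrite -EFinB -EFinM divfK// gt_eqF.
apply: (@le_trans _ _ (\int[mu1]_(t in `[p1, q1]) \int[mu1]_s ((f \_ (rect p1 q1 p2 q2)) (t, s))%:E)%E).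
have mI : measurable_fun setT (fun t : T1 => (\int[mu1]_s ((f \_ (rect p1 q1 p2 q2)) (t, s))%:E)%E).
  have := @measurable_fun_fubini_tonelli_F _ _ T1 T1 R (@mu1 R) (fun z => ((f \_ (rect p1 q1 p2 q2)) z)%:E).
  by apply; [exact/measurable_EFinP|move=> z; rewrite lee_fin patchE; case: ifP].
- apply: ge0_le_integral => //=.
  + by move=> t _; rewrite lee_fin divr_ge0// ?mulr_ge0// ltW.
  + by apply: measurable_funTS.
- apply: ge0_subset_integral => //.
    have := @measurable_fun_fubini_tonelli_F _ _ T1 T1 R (@mu1 R) (fun z => ((f \_ (rect p1 q1 p2 q2)) z)%:E).
    by apply; [exact/measurable_EFinP|move=> z; rewrite lee_fin patchE; case: ifP].
  by move=> t _; apply: integral_ge0 => s _; rewrite lee_fin patchE; case: ifP.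
Qed.

(** The constant is the value of H at one point of a column along which the gradient is small. H is
    compared with it along this column, then along each row with its value on the column. *)
Lemma base_control D x (r t : R) : open D -> (exists z, ~ D z) -> 0 < r -> 0 < t ->
  [set z | `|z - x| <= r + t] `<=` D ->
  exists2 C : R, 0 <= C & forall H H1 H2 (M : R), c1data D H H1 H2 -> 0 < M ->
    (energy D H1 H2 <= M%:E)%E ->
    exists c, (eint [set z | `|z - x| <= r]%R (sqdev H c) <= (C * M)%:E)%E.
Proof.
move=> oD nD r0 t0 xD.
have subD z : [set z | `|z - x| <= r] z -> D z /\ t <= bdist D z.
  move=> zx; split; first by apply: xD => /=; rewrite (le_trans zx)// lerDl ltW.
  exact: (bdist_cbox nD xD zx).
(* 64 r^2 from the rows plus 4 r times 32 r from the column; M / t^2 bounds the unweighted Dirichlet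
   integral on the square. *)
exists (192 * r ^+ 2 / t ^+ 2); first by rewrite divr_ge0 ?sqr_ge0// mulr_ge0// sqr_ge0.
move=> H H1 H2 M dat M0 en; have [sl1 sl2] := c1data_slice dat.
pose M1 := M / t ^+ 2; have M10 : 0 < M1 by rewrite divr_gt0// exprn_gt0.
set Q := [set z | _] in subD *; have mQ : mble Q by exact: mble_cbox.
have QD : Q `<=` D by move=> z /subD[].
have G0 z := sqgrad_ge0 H1 H2 z.
have cG z := @sqgrad_cont R D H H1 H2 z dat.
have mG : meas (sqgrad H1 H2 \_ Q) by exact: (meas_sub_open oD mQ QD cG).
have EG : (eint Q (sqgrad H1 H2) <= M1%:E)%E.
  apply: (@le_trans _ _ (eint D (fun y => ((t ^+ 2)^-1 * (bdist D y ^+ 2 * sqgrad H1 H2 y))%R))).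
    apply: eint_le => //.
    - by rewrite patchZ; apply: measZ; exact: meas_energy dat.
    - by move=> y; rewrite mulr_ge0 ?invr_ge0 ?exprn_ge0 ?(ltW t0)//; apply: mulr_ge0; [exact: sqr_ge0|exact: G0].
    move=> y /subD[Dy ty]; split => //; rewrite mulrA ler_peMl// mulrC ler_pdivlMr ?exprn_gt0// mul1r.
    by rewrite lerXn2r ?nnegrE ?(ltW t0)// (le_trans (ltW t0)).
  rewrite eintZ ?invr_ge0 ?exprn_ge0 ?(ltW t0)//; [|exact: meas_energy dat|by move=> y; apply: mulr_ge0; [exact: sqr_ge0|exact: G0]].
  by rewrite /M1 mulrC EFinM; apply: lee_wpmul2l => //; rewrite lee_fin invr_ge0 exprn_ge0// ltW.
move: EG mG mQ QD subD; rewrite /Q cbox_rect.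
set p1 := x.1 - r; set q1 := x.1 + r; set p2 := x.2 - r; set q2 := x.2 + r => EG mG mQ QD subD.
have l1 : q1 - p1 = 2 * r by rewrite /q1 /p1; ring.
have l2 : q2 - p2 = 2 * r by rewrite /q2 /p2; ring.
have pq1 : p1 < q1 by rewrite -subr_gt0 l1 mulr_gt0.
have [y1 hy1 col] := exists_good_column pq1 M10 mG G0 EG.
have x2I : p2 <= x.2 <= q2 by rewrite /p2 /q2; apply/andP; split; lra.
pose c := H (y1, x.2); exists c.
pose hh s := H (y1, s) - c.
have inQ w s : p1 <= w <= q1 -> p2 <= s <= q2 -> D (w, s) by move=> h1 h2; apply: QD; split.
have ch : cts p2 q2 hh.
  apply: (@is_derive_cts _ _ _ _ (fun s => H2 (y1, s))) => s hs.
  have d := (sl2 y1 s (inQ _ _ hy1 hs)).1; have := is_deriveB d (is_derive_cst c s 1).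
  by rewrite subr0.
have colH : (\int[mu1]_(s in `[p2, q2]) (hh s ^+ 2)%:E <= (32 * r * M1)%:E)%E.
  have CS := slice_center x2I (u := hh) (v := fun s => H2 (y1, s)).
  apply: (le_trans (CS _ _ _)).
  - move=> s hs; have d := (sl2 y1 s (inQ _ _ hy1 hs)).1; have := is_deriveB d (is_derive_cst c s 1).
    by rewrite subr0.
  - by move=> s hs; exact: (sl2 y1 s (inQ _ _ hy1 hs)).2.
  - by rewrite /hh subrr.
  have cH2 : cts p2 q2 (fun s => H2 (y1, s)) by move=> s hs; exact: (sl2 y1 s (inQ _ _ hy1 hs)).2.
  have mc : measurable_fun (`[p2, q2] : set T1) (fun s => (sqgrad H1 H2 (y1, s))%:E).
    apply/measurable_EFinP; apply: cts_measurable => s hs.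
    have cp : {for s, continuous (fun s : R => (y1, s) : pt)}.
      have -> : (fun s : R => (y1, s) : pt) = (fun s : R => (y1, 0) + s *: ((0, 1) : pt)).
        by apply/funext => w; rewrite -[RHS]/(y1 + w * 0, 0 + w * 1) mulr1 mulr0 add0r addr0.
      by apply: cvgD; [exact: cvg_cst|apply: cvgZl; exact: cvg_id].
    by apply: continuous_comp; [exact: cp|exact: cG (inQ _ _ hy1 hs)].
  apply: (@le_trans _ _ ((8 * (2 * r) ^+ 2)%:E * \int[mu1]_(s in `[p2, q2]) (sqgrad H1 H2 (y1, s))%:E)%E).
    rewrite -ge0_integralZl//=; last 2 first.
    - by move=> s _; rewrite lee_fin.
    - by rewrite lee_fin mulr_ge0// sqr_ge0.
    apply: ge0_le_integral => //=.
    - by move=> s _; rewrite lee_fin mulr_ge0// sqr_ge0.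
    - apply/measurable_EFinP; apply: cts_measurable; apply: ctsM; first by move=> ? _; exact: cvg_cst.
      have cc : cts p2 q2 (fun s => (q2 - p2) * H2 (y1, s)) by apply: ctsM => // ? _; exact: cvg_cst.
      exact: (ctsM cc cc).
    - exact: measurable_funeM.
    move=> s _; rewrite lee_fin l2 exprMn mulrA; apply: ler_wpM2l; first by rewrite mulr_ge0// sqr_ge0.
    by rewrite /sqgrad lerDr sqr_ge0.
  apply: (le_trans (lee_wpmul2l _ col)); first by rewrite lee_fin mulr_ge0// sqr_ge0.
  rewrite -!EFinM lee_fin l1 le_eqVlt; apply/orP; left; apply/eqP; field.
  by rewrite gt_eqF.
have cu z := @sqdev_cont R D H H1 H2 c z dat.
have mU : meas (sqdev H c \_ (rect p1 q1 p2 q2)) by exact: (meas_sub_open oD mQ QD cu).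
rewrite (eint_iter2 mU (sqdev_ge0 H c)).
pose J s := (\int[mu1]_w ((sqgrad H1 H2 \_ (rect p1 q1 p2 q2)) (w, s))%:E)%E.
have J0 s : (0 <= J s)%E by apply: integral_ge0 => w _; rewrite lee_fin patchE; case: ifP.
have mJ : measurable_fun setT J.
  have := @measurable_fun_fubini_tonelli_G _ _ T1 T1 R (@mu1 R) (fun z => ((sqgrad H1 H2 \_ (rect p1 q1 p2 q2)) z)%:E).
  by apply; [exact/measurable_EFinP|move=> z; rewrite lee_fin patchE; case: ifP].
have mh : measurable_fun (`[p2, q2] : set T1) (fun s => (hh s ^+ 2)%:E).
  by apply/measurable_EFinP; apply: cts_measurable; exact: (ctsM ch ch).
apply: (@le_trans _ _ (\int[mu1]_(s in `[p2, q2]) ((64 * r ^+ 2)%:E * J s + (4 * r)%:E * (hh s ^+ 2)%:E))%E).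
  have I0 s : ~~ (p2 <= s <= q2) -> (\int[mu1]_w ((sqdev H c \_ (rect p1 q1 p2 q2)) (w, s))%:E = 0)%E.
    by move=> /negP hs; apply: integral0_eq => w _; rewrite patchE memNset// => -[].
  have -> : (\int[mu1]_s \int[mu1]_w ((sqdev H c \_ (rect p1 q1 p2 q2)) (w, s))%:E =
     \int[mu1]_(s in `[p2, q2]) \int[mu1]_w ((sqdev H c \_ (rect p1 q1 p2 q2)) (w, s))%:E)%E.
    rewrite [RHS]integral_mkcond; apply: eq_integral => s _; rewrite patchE; case: ifPn => //.
    by rewrite notin_setE /= in_itv /= => /negP; exact: I0.
  apply: ge0_le_integral => //=.
  - by move=> s _; apply: integral_ge0 => w _; rewrite lee_fin patchE; case: ifP => // _; exact: sqdev_ge0.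
  - apply: measurable_funTS.
    have := @measurable_fun_fubini_tonelli_G _ _ T1 T1 R (@mu1 R) (fun z => ((sqdev H c \_ (rect p1 q1 p2 q2)) z)%:E).
    by apply; [exact/measurable_EFinP|move=> z; rewrite lee_fin patchE; case: ifP => // _; exact: sqdev_ge0].
  - apply: emeasurable_funD; last exact: measurable_funeM.
    by apply: measurable_funeM; exact: measurable_funTS.
  move=> s; rewrite in_itv /= => hs; rewrite rect_slice1// /J rect_slice1//.
  pose u w := H (w, s) - H (y1, s).
  have du w : p1 <= w <= q1 -> is_derive w (1 : R) u (H1 (w, s)).
    move=> hw; have d := (sl1 w s (inQ _ _ hw hs)).1; have := is_deriveB d (is_derive_cst (H (y1, s)) w 1).
    by rewrite subr0.
  have cH1 : cts p1 q1 (fun w => H1 (w, s)) by move=> w hw; exact: (sl1 w s (inQ _ _ hw hs)).2.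
  have CS := slice_center hy1 du cH1 (subrr _).
  have cuu := is_derive_cts du.
  have mc : measurable_fun (`[p1, q1] : set T1) (fun w => (sqgrad H1 H2 (w, s))%:E).
    apply/measurable_EFinP; apply: cts_measurable => w hw.
    have cp : {for w, continuous (fun w : R => (w, s) : pt)}.
      have -> : (fun w : R => (w, s) : pt) = (fun w : R => (0, s) + w *: ((1, 0) : pt)).
        by apply/funext => v; rewrite -[RHS]/(0 + v * 1, s + v * 0) mulr1 mulr0 add0r addr0.
      by apply: cvgD; [exact: cvg_cst|apply: cvgZl; exact: cvg_id].
    by apply: continuous_comp; [exact: cp|exact: cG (inQ _ _ hw hs)].
  have mu_ : measurable_fun (`[p1, q1] : set T1) (fun w => (u w ^+ 2)%:E).
    by apply/measurable_EFinP; apply: cts_measurable; exact: (ctsM cuu cuu).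
  apply: (@le_trans _ _ (\int[mu1]_(w in `[p1, q1]) ((2%:E * (u w ^+ 2)%:E) + (2 * hh s ^+ 2)%:E))%E).
    apply: ge0_le_integral => //=.
    - by move=> w _; rewrite lee_fin; exact: sqdev_ge0.
    - apply/measurable_EFinP; apply: cts_measurable.
      have cw : cts p1 q1 (fun w => H (w, s) - c).
        by move=> w hw; have := cuu w hw; move=> cu'; have -> : (fun w => H (w, s) - c) = (fun w => u w + (H (y1, s) - c));
          [apply/funext => v; rewrite /u addrA subrK|apply: cvgD; [exact: cu'|exact: cvg_cst]].
      exact: (ctsM cw cw).
    - by apply: emeasurable_funD => //; exact: measurable_funeM.
    move=> w _; rewrite -EFinM -EFinD lee_fin /sqdev.
    have -> : H (w, s) - c = u w + hh s by rewrite /u /hh addrA subrK.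
    by have := sqr_ge0 (u w - hh s); move: (u w) (hh s) => a b; rewrite !sqrrD sqrrN mulrN; lra.
  rewrite ge0_integralD//=; last 3 first.
  - by move=> w _; rewrite -EFinM lee_fin mulr_ge0// sqr_ge0.
  - exact: measurable_funeM.
  - by move=> w _; rewrite lee_fin mulr_ge0// sqr_ge0.
  apply: leeD; last first.
    rewrite integral_cst//= [X in (_ * X)%E](@lebesgue_measure_itv R `[p1, q1]) /= lte_fin pq1.
    by rewrite -EFinB l1 -!EFinM lee_fin le_eqVlt; apply/orP; left; apply/eqP; ring.
  rewrite ge0_integralZl//=; [|by move=> w _; rewrite lee_fin sqr_ge0].
  apply: (le_trans (lee_wpmul2l _ CS)) => //.
  rewrite -!ge0_integralZl//=; last 4 first.
  - by move=> w _; rewrite lee_fin.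
  - by rewrite lee_fin mulr_ge0// sqr_ge0.
  - apply/measurable_EFinP; apply: cts_measurable; apply: ctsM; first by move=> ? _; exact: cvg_cst.
    have cc : cts p1 q1 (fun w => (q1 - p1) * H1 (w, s)) by apply: ctsM => // ? _; exact: cvg_cst.
    exact: (ctsM cc cc).
  - by move=> w _; rewrite lee_fin mulr_ge0// sqr_ge0.
  apply: ge0_le_integral => //=.
  - move=> w _; rewrite -EFinM lee_fin; apply: mulr_ge0 => //; apply: mulr_ge0 => //; exact: sqr_ge0.
  - apply: measurable_funeM; apply/measurable_EFinP; apply: cts_measurable; apply: ctsM; first by move=> ? _; exact: cvg_cst.
    have cc : cts p1 q1 (fun w => (q1 - p1) * H1 (w, s)) by apply: ctsM => // ? _; exact: cvg_cst.
    exact: (ctsM cc cc).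
  - exact: measurable_funeM.
  move=> w _; rewrite -!EFinM lee_fin l1 /sqgrad.
  have := sqr_ge0 (H2 (w, s)); move: (H1 _) (H2 _ ^+ 2) => a b b0.
  rewrite (_ : 2 * (8 * (2 * r * a) ^+ 2) = 64 * r ^+ 2 * a ^+ 2); last by ring.
  by apply: ler_wpM2l; [rewrite mulr_ge0// sqr_ge0|rewrite lerDl].
rewrite ge0_integralD//=; last 4 first.
- by move=> s _; rewrite mule_ge0// lee_fin mulr_ge0// sqr_ge0.
- by apply: measurable_funeM; exact: measurable_funTS.
- move=> s _; rewrite -EFinM lee_fin; apply: mulr_ge0; last exact: sqr_ge0.
  by apply: mulr_ge0 => //; exact: ltW.
- exact: measurable_funeM.
rewrite !ge0_integralZl//=; last 4 first.
- by move=> s _; rewrite lee_fin sqr_ge0.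
- by rewrite lee_fin mulr_ge0// ltW.
- exact: measurable_funTS.
- by rewrite lee_fin mulr_ge0// sqr_ge0.
have JE : (\int[mu1]_(s in `[p2, q2]) J s <= M1%:E)%E.
  apply: le_trans EG; rewrite (eint_iter2 mG G0); apply: ge0_subset_integral => //.
apply: (le_trans (leeD (lee_wpmul2l _ JE) (lee_wpmul2l _ colH))).
- by rewrite lee_fin mulr_ge0// sqr_ge0.
- by rewrite lee_fin mulr_ge0// ltW.
rewrite -!EFinM -EFinD lee_fin le_eqVlt; apply/orP; left; apply/eqP; rewrite /M1; field.
by rewrite gt_eqF.
Qed.

End BaseConstant.

Section Gluing.
Set Implicit Arguments.
Unset Strict Implicit.
Context {R : realType}.
Notation pt := (R * R)%type.
Implicit Types (f H d : pt -> R) (A B D K Q S V W : set pt) (e x y z : pt).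

(** Were P K false, the sets V with P (K minus V) would form a proper filter containing K; at a
    cluster point x in K, the complement of some [box x r] would belong to it, which is absurd. *)
Lemma compact_ind K (P : set pt -> Prop) : compact K -> P set0 ->
  (forall A B, P A -> P B -> P (A `|` B)) -> (forall A B, A `<=` B -> P B -> P A) ->
  (forall x, K x -> exists2 r : R, 0 < r & P (box x r)) -> P K.
Proof.
move=> cK P0 PU PS PK; apply: contrapT => nPK.
pose F := [set V | P (K `\` V)].
have FF : ProperFilter F.
  split; first by rewrite /F /= setD0.
  split.
  - by rewrite /F /= setDT.
  - by move=> V W PV PW; rewrite /F /= setDIr; exact: PU.
  - by move=> V W VW; apply: PS; exact: setDS.
have FK : F K by rewrite /F /= setDv.
have [x [Kx clx]] := cK F FF FK; have [r r0 Pr] := PK x Kx.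
have FV : F (~` box x r).
  by apply: PS Pr => z [_ nz]; apply: contrapT.
have [|z [nz Bz]] := clx _ (box x r) FV; last by apply: nz.
apply/open_nbhs_nbhs; split; first exact: open_box.
by rewrite /box /= subrr normr0.
Qed.

Lemma controls_trans D Q A V W : open D -> mble A -> mble V -> A `<=` V -> V `<=` D ->
  controls D Q V -> controls D A W -> controls D Q W.
Proof.
move=> oD mA mV AV VD [C1 C10 h1] [C2 C20 h2]; exists (C2 * (1 + C1)).
  by rewrite mulr_ge0// addr_ge0.
move=> H H1 H2 M c dat M0 en.
have cu z := @sqdev_cont R D H H1 H2 c z dat.
have s1 : (eint A (sqdev H c) <= C1%:E * (M%:E + eint Q (sqdev H c)))%E.
  apply: le_trans (h1 _ _ _ _ c dat M0 en); apply: eint_le => //.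
  - by apply: (meas_sub_open oD mA _ cu) => z /AV /VD.
  - exact: (meas_sub_open oD mV VD cu).
  - by move=> z; exact: sqdev_ge0.
  - by move=> z; exact: sqdev_ge0.
  - by move=> z /AV.
apply: (chain_control C20 C10 M0 _ (h2 _ _ _ _ c dat M0 en) s1).
by apply: eint_ge0 => z; exact: sqdev_ge0.
Qed.

Theorem hardy_poincare D : open D -> bounded_set D -> connected D -> D !=set0 ->
  lipschitz_boundary D ->
  (exists z, ~ D z) /\ exists2 C : R, 0 <= C & forall H H1 H2 (M : R), c1data D H H1 H2 -> 0 < M ->
    (energy D H1 H2 <= M%:E)%E -> exists c, (eint D (sqdev H c) <= (C * M)%:E)%E.
Proof.
move=> oD [B0 [_ hB]] conn [x0 Dx0] lip.
have [B BD] : exists B : R, forall z, D z -> `|z| <= B.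
  exists (B0 + 1) => z Dz; apply: (hB (B0 + 1)) => //; by rewrite ltrDl.
have nD : exists z, ~ D z.
  exists (`|B| + 1, 0) => /BD; rewrite ler_norm_pair /= => /andP[h _].
  by move: h; rewrite ger0_norm ?addr_ge0//; have := ler_norm B; lra.
split => //.
have inner x : D x -> exists2 r : R, 0 < r & [set z | `|z - x| <= r + r] `<=` D.
  move=> Dx; have /openP_box /(_ _ Dx)[r r0 xr] := oD; exists (r / 4); first by rewrite divr_gt0.
  by move=> z /= zx; apply: xr; rewrite /box /=; apply: le_lt_trans zx _; lra.
have [r0 r00 x0D] := inner _ Dx0.
set Q := [set z | `|z - x0| <= r0].
(* The part of V inside D is covered by a measurable set that the base square controls. The covering
   set makes the property monotone in V, as [compact_ind] requires, and meaningful for V that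
   crosses the boundary. *)
pose P V := exists V', [/\ mble V', V `&` D `<=` V', V' `<=` D & controls D Q V'].
have PS A B1 : A `<=` B1 -> P B1 -> P A.
  by move=> AB [V [mV BV VD cV]]; exists V; split => // z [/AB Bz Dz]; apply: BV.
have PU A B1 : P A -> P B1 -> P (A `|` B1).
  move=> [V [mV AV VD [C1 C10 h1]]] [W [mW BW WD [C2 C20 h2]]]; exists (V `|` W); split.
  - exact: measurableU.
  - by move=> z [[Az|Bz] Dz]; [left; apply: AV|right; apply: BW].
  - by move=> z [/VD|/WD].
  exists (C1 + C2); first exact: addr_ge0.
  move=> H H1 H2 M c dat M0 en; have cu z := @sqdev_cont R D H H1 H2 c z dat.
  have mU V' : mble V' -> V' `<=` D -> meas (sqdev H c \_ V') by move=> mV' VD'; exact: (meas_sub_open oD mV' VD' cu).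
  have ge0 : (0 <= M%:E + eint Q (sqdev H c))%E.
    by apply: adde_ge0; [rewrite lee_fin ltW|apply: eint_ge0 => z; exact: sqdev_ge0].
  apply: (@le_trans _ _ (eint V (sqdev H c) + eint W (sqdev H c))%E).
    apply: eint_setU; [exact: mU|exact: mU| |exact: sqdev_ge0].
    by apply: mU; [exact: measurableU|move=> z [/VD|/WD]].
  rewrite EFinD ge0_muleDl ?lee_fin//; apply: leeD; [exact: h1 dat M0 en|exact: h2 dat M0 en].
have P0 : P set0.
  exists set0; split => //; first exact: measurable0.
  exists 0 => // H H1 H2 M c _ _ _; rewrite mul0e /eint.
  by rewrite integral0_eq// => z _; rewrite patchE in_set0.
have PQ : P (box x0 r0).
  exists Q; split; first exact: mble_cbox.
  - by move=> z [/ltW].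
  - by move=> z zx; apply: x0D => /=; rewrite (le_trans zx)// lerDl ltW.
  exists 1 => // H H1 H2 M c _ M0 _; rewrite mul1e leeDr//.
  by rewrite lee_fin ltW.
(* The points with a neighbourhood controlled by the base square: open by construction, closed in D
   by [square_control], hence all of D by connectedness. *)
pose G := [set x | D x /\ exists2 r : R, 0 < r & P (box x r)].
have box_sub x y (r s : R) : s <= r - `|y - x| -> box y s `<=` box x r.
  move=> sr z; rewrite /box /= => zy; have -> : z - x = (z - y) + (y - x) by rewrite addrA subrK.
  by apply: le_lt_trans (ler_normD _ _) _; rewrite -ltrBrDr; exact: lt_le_trans sr.
have GD : G = D.
  apply: conn.
  - by exists x0; split => //; exists r0.
  - exists G; last by apply/seteqP; split => z; [move=> Gz; split => //; case: Gz|case].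
    apply/openP_box => x [Dx [r rp Pr]]; have /openP_box /(_ _ Dx)[s sp xs] := oD.
    exists (Num.min r s); first by rewrite lt_min rp.
    move=> y; rewrite /box /= lt_min => /andP[yr ys]; split; first exact: xs.
    exists (r - `|y - x|); first by rewrite subr_gt0.
    by apply: PS Pr; exact: box_sub.
  - exists (~` (D `\` G)); last first.
      apply/seteqP; split => z; first by move=> Gz; split; [case: Gz|case].
      by move=> [Dz nz]; apply: contrapT => nG; apply: nz.
    apply: open_closedC; apply/openP_box => x [Dx nG]; have [r rp xr] := inner x Dx.
    exists r => // y yx; split.
      by apply: xr; rewrite /= (le_trans (ltW yx))// lerDl ltW.
    move=> [Dy [s sp [V [mV yV VD cV]]]]; apply: nG; split => //; exists r => //.
    pose s' := Num.min s (r - `|y - x|) / 2.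
    have m0 : 0 < Num.min s (r - `|y - x|) by rewrite lt_min sp subr_gt0.
    have s'0 : 0 < s' by rewrite divr_gt0.
    have s's : s' < s by rewrite /s' ltr_pdivrMr// (le_lt_trans (y := s)) ?ge_min ?lexx//; lra.
    have s'r : s' <= r - `|y - x|.
      rewrite /s' ler_pdivrMr// (le_trans (y := r - `|y - x|)) ?ge_min ?lexx ?orbT//.
      have d0 : 0 < r - `|y - x| by rewrite subr_gt0.
      by rewrite mulr_natr mulr2n lerDl; exact: ltW.
    have sub1 : [set z | `|z - y| <= s'] `<=` [set z | `|z - x| <= r].
      move=> z /= zy; have -> : z - x = (z - y) + (y - x) by rewrite addrA subrK.
      by apply: le_trans (ler_normD _ _) _; rewrite -lerBrDr; exact: le_trans s'r.
    have sub2 : [set z | `|z - x| <= r] `<=` D.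
      by move=> z zx; apply: xr => /=; rewrite (le_trans zx)// lerDl ltW.
    exists [set z | `|z - x| <= r]; split => //; first exact: mble_cbox.
      by move=> z [/ltW].
    apply: (controls_trans oD (mble_cbox y s') mV _ VD cV); last exact: square_control sub1 xr.
    move=> z /= zy; apply: yV; split; first exact: le_lt_trans s's.
    exact/sub2/sub1.
have PK K : compact K -> K `<=` D -> P K.
  move=> cK KD; apply: (compact_ind cK P0 PU PS) => x /KD Dx.
  by have : G x by [rewrite GD]; move=> [].
(* Compactness of the closure: inner points are in G, and at a boundary point the strip is
   controlled by a compact subset of D, hence by the base square. *)
have [V [mV DV VD [C1 C10 h1]]] : P (closure D).
  apply: (compact_ind _ P0 PU PS).
    apply: (subclosed_compact (@closed_closure _ D) (@compact_cbox R 0 B)).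
    have cl : closed [set z : pt | `|z - 0| <= B].
      by apply: compact_closed; [exact: norm_hausdorff|exact: compact_cbox].
    have := closure_subset (A := D) (B := [set z : pt | `|z - 0| <= B]).
    move=> h; rewrite [X in _ `<=` X](closure_id _).1//; apply: h => z Dz /=.
    by rewrite subr0; exact: BD.
  move=> x clx; have [Dx|nDx] := pselect (D x).
    by have : G x by [rewrite GD]; move=> [].
  have fx : frontier D x by split => //; rewrite (interior_id _).1.
  have [c [s [r [L [g [cs1 rp gL chart]]]]]] := lip x fx.
  have gL' : forall t u : R, `|g t - g u| <= `|L| * `|t - u|.
    move=> t u; apply: (@le_trans _ _ (L * `|t - u|)); last by rewrite ler_wpM2r// ler_norm.
    exact: (gL (t, u)).
  have [t [K [t0 cK KD cKt]]] := boundary_control oD nD cs1 rp gL' (normr_ge0 L) chart clx nDx.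
  exists t => //; exists (D `&` box x t); split.
  - by apply: measurableI; [exact: mble_open|exact: mble_box].
  - by move=> z [].
  - by move=> z [].
  have [W [mW KW WD cW]] := PK K cK KD.
  have mK : mble K.
    have : mble (~` K) by apply: mble_open; apply: closed_openC; apply: compact_closed => //; exact: norm_hausdorff.
    by move/measurableC; rewrite setCK.
  apply: (controls_trans oD mK mW _ WD cW cKt) => z Kz; apply: KW; split => //; exact: KD.
have {DV} E : V = D.
  by apply/seteqP; split => // z Dz; apply: DV; split => //; exact: subset_closure.
have [C2 C20 h2] := base_control oD nD r00 r00 x0D.
exists (C1 * (1 + C2)); first by rewrite mulr_ge0// addr_ge0.
move=> H H1 H2 M dat M0 en; have [c hc] := h2 H H1 H2 M dat M0 en; exists c.
rewrite -{1}E; apply: (le_trans (h1 H H1 H2 M c dat M0 en)).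
rewrite -mulrA EFinM; apply: lee_wpmul2l; first by rewrite lee_fin.
by rewrite mulrDl mul1r EFinD leeD2l.
Qed.

End Gluing.

(** * The weighted energy of the harmonic part *)

Section EnergyBound.
Set Implicit Arguments.
Unset Strict Implicit.
Context {R : realType}.
Notation pt := (R * R)%type.
Notation T1 := (measurableTypeR R).
Notation T2 := (T1 * T1)%type.
Implicit Types (f H d gam : pt -> R) (A B D K Q S V W : set pt) (e x y z : pt).

Lemma meas_pair_sub : measurable_fun setT (fun z : T2 * T2 => ((z.2 : pt) - z.1 : T2)).
Proof.
have p1 : measurable_fun setT (fun z : T2 * T2 => z.2.1 - z.1.1).
  by apply: measurable_funB; [exact: (measurableT_comp measurable_fst measurable_snd)|
                              exact: (measurableT_comp measurable_fst measurable_fst)].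
have p2 : measurable_fun setT (fun z : T2 * T2 => z.2.2 - z.1.2).
  by apply: measurable_funB; [exact: (measurableT_comp measurable_snd measurable_snd)|
                              exact: (measurableT_comp measurable_snd measurable_fst)].
exact: (measurable_fun_pair p1 p2).
Qed.

(** When y lies in the box of x, bdist y is between 1/2 and 3/2 of bdist x. So the relevant x fill
    at most a box of area 4 bdist(y)^2, on which the weight is at most (9/4) / bdist(y)^2. *)
Lemma inner_weight D y (g : R) : open D -> (exists z, ~ D z) -> 0 <= g ->
  let F := fun x : pt => ((fun x => (bdist D x ^+ 2)^-1) \_ D) x * (g * \1_(box x (bdist D x / 2)) y) in
  meas F -> (\int[mu2]_x (F x)%:E <= (9 * g)%:E)%E.
Proof.
move=> oD nD g0 F mF.
have F0 x : 0 <= F x.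
  rewrite /F patchE; case: ifP => _; last by rewrite mul0r.
  by apply: mulr_ge0; [rewrite invr_ge0 sqr_ge0|apply: mulr_ge0; [exact: g0|rewrite indicE]].
have ND x : D x -> box x (bdist D x / 2) y -> bdist D x / 2 < bdist D y /\ bdist D y < 3 / 2 * bdist D x /\ `|x - y| < bdist D y.
  move=> Dx; rewrite /box /= => yx; have h1 := bdist_lip x y nD; have h2 := bdist_lip y x nD.
  rewrite distrC in yx; rewrite (distrC y) in h2.
  by move: (bdist_ge0 D x) h1 h2 yx; move: (bdist D x) (bdist D y) `|_| => u v w *; split; [|split]; lra.
have Fout x : ~ (D x /\ box x (bdist D x / 2) y) -> F x = 0.
  move=> nDx; rewrite /F patchE; case: ifPn => [|_]; last by rewrite mul0r.
  rewrite inE => Dx; rewrite indicE; case: (boolP (y \in _)) => [|_]; last by rewrite !mulr0.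
  by rewrite inE => yx; case: nDx.
have [dy0|dy0] := eqVneq (bdist D y) 0.
  have -> : (\int[mu2]_x (F x)%:E = 0)%E.
    apply: integral0_eq => x _; congr EFin; apply: Fout => -[Dx /(ND x Dx)[]].
    by rewrite dy0 => h; have := bdist_ge0 D x; lra.
  by rewrite lee_fin; apply: mulr_ge0.
have dyp : 0 < bdist D y by rewrite lt_neqAle eq_sym dy0 bdist_ge0.
pose k := g * (9 / 4 / bdist D y ^+ 2).
have k0 : 0 <= k.
  by apply: mulr_ge0; [exact: g0|apply: divr_ge0 => //; exact: sqr_ge0].
have mb := mble_box y (bdist D y).
have mi : measurable_fun setT (fun x => (\1_(box y (bdist D y)) x)%:E : \bar R).
  by apply/measurable_EFinP; exact: meas_indic.
apply: (@le_trans _ _ (\int[mu2]_x (k * \1_(box y (bdist D y)) x)%:E)%E).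
  apply: ge0_le_integral.
  - exact: measurableT.
  - by move=> x _; rewrite lee_fin.
  - by apply/measurable_EFinP; exact: mF.
  - by apply/measurable_EFinP; apply: measZ; exact: meas_indic.
  move=> x _; rewrite lee_fin.
  have R0 : 0 <= k * \1_(box y (bdist D y)) x by apply: mulr_ge0; [exact: k0|rewrite indicE].
  have [[Dx yx]|nDx] := pselect (D x /\ box x (bdist D x / 2) y); last by rewrite Fout.
  have [h1 [h2 h3]] := ND x Dx yx; rewrite (_ : \1_(box y _) x = 1); last by rewrite indicE mem_set.
  have d0 := bdist_gt0 oD nD Dx.
  rewrite /F patchE mem_set// indicE mem_set// !mulr1 mulrC /k; apply: ler_wpM2l; first exact: g0.
  move: (bdist D x) (bdist D y) d0 dyp h2 {dy0 h1 h3 mF F0 Fout ND R0 k k0 mb mi} => u v u0 v0 uv.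
  rewrite [leRHS](_ : _ = (2 / 3 * v) ^- 2); last by field; rewrite gt_eqF.
  by rewrite lef_pV2 ?posrE ?exprn_gt0// ?mulr_gt0// ?lerXn2r ?nnegrE//; lra.
under eq_integral do rewrite EFinM.
have kE : (0 <= k%:E)%E by rewrite lee_fin.
have i0 (x : pt) : [set: pt] x -> (0 <= (\1_(box y (bdist D y)) x)%:E :> \bar R)%E by move=> _; rewrite lee_fin indicE.
rewrite (ge0_integralZl mu2 measurableT mi i0 kE).
rewrite (integral_indic mu2 measurableT mb) setIT.
apply: (@le_trans _ _ (k%:E * (4 * bdist D y ^+ 2)%:E)%E).
  by apply: lee_wpmul2l; [exact: kE|rewrite le_eqVlt; apply/orP; left; apply/eqP; exact: mu2_box (ltW dyp)].
rewrite -EFinM lee_fin /k le_eqVlt; apply/orP; left; apply/eqP; move: (bdist D y) dy0 => v v0; field; exact: v0.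
Qed.

(* If |y - x| < bdist D x / 2 then bdist D x and bdist D y are comparable, so
   that integrating the local bound over x first gives a constant. *)
Lemma energy_bound D (C0 : R) : open D -> (exists z, ~ D z) -> (exists B : R, forall z, D z -> `|z| <= B) ->
  0 <= C0 ->
  exists2 C : R, 0 <= C & forall H H1 H2 gam, c1data D H H1 H2 -> sqi gam ->
    (forall x (r : R), 0 < r -> [set y | `|y - x| <= r] `<=` D ->
      H1 x ^+ 2 + H2 x ^+ 2 <= C0 * (r + 4) ^+ 2 / r ^+ 4 * Int (fun y => gam y ^+ 2 * \1_(box x r) y)) ->
    (energy D H1 H2 <= (C * Int (fun y => gam y ^+ 2))%:E)%E.
Proof.
move=> oD nD [B BD] C00; have [z0 nz0] := nD.
pose B' := `|z0| + `|B|.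
have B'0 : 0 <= B' by rewrite addr_ge0.
have dB x : D x -> bdist D x <= B'.
  move=> Dx; apply: le_trans (bdist_le x nz0) _; apply: le_trans (ler_normB _ _) _.
  by rewrite lerD2l (le_trans (BD _ Dx))// ler_norm.
(* 16 is the fourth power of the 2 in the radius bdist / 2, and B' bounds this radius on D. *)
pose C1 := 16 * C0 * (B' + 4) ^+ 2.
have C10 : 0 <= C1 by rewrite mulr_ge0 ?sqr_ge0// mulr_ge0.
exists (C1 * 9); first by rewrite mulr_ge0.
move=> H H1 H2 gam dat sgam loc.
pose a := (fun x => (bdist D x ^+ 2)^-1) \_ D.
have a0 x : 0 <= a x by rewrite /a patchE; case: ifP => // _; rewrite invr_ge0 sqr_ge0.
have cd := bdist_continuous nD.
have ma : meas a.
  apply: (meas_open_restrict oD) => x Dx.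
  have d0 := bdist_gt0 oD nD Dx.
  by apply: cvgV; [rewrite gt_eqF// exprn_gt0|apply: cvgM; exact: cd].
(* The indicator of |y - x| < bdist x / 2, written as a function of one real quantity so that its
   joint measurability is immediate. *)
pose N (z : pt * pt) : R := \1_([set t : R | 0 < t]) (bdist D z.1 / 2 - `|z.2 - z.1|).
have N0 (w : pt * pt) : 0 <= N w by rewrite /N indicE.
have NE x y : N (x, y) = \1_(box x (bdist D x / 2)) y.
  by rewrite /N /= !indicE; congr (nat_of_bool _)%:R; apply/idP/idP; rewrite !inE /box /= subr_gt0.
have mN : measurable_fun setT (N : T2 * T2 -> R).
  have m1 : measurable_fun setT (\1_([set t : R | 0 < t]) : T1 -> R).
    apply: measurable_indic; rewrite (_ : [set t : R | 0 < t] = `]0, +oo[%classic).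
      exact: measurable_itv.
    by apply/seteqP; split => t /=; rewrite in_itv /= andbT.
  have m2 : meas (fun x : pt => bdist D x / 2) by apply: measM; [exact: meas_continuous|exact: meas_cst].
  have cn : continuous (fun x : pt => `|x|) by move=> x; exact: norm_continuous.
  have m3 := measurable_funB (measurableT_comp m2 measurable_fst)
    (measurableT_comp (meas_continuous cn) meas_pair_sub).
  exact: (measurableT_comp m1 m3).
pose F (z : T2 * T2) : \bar R := (a z.1 * (gam z.2 ^+ 2 * N z))%:E.
have mF : measurable_fun setT F.
  apply/measurable_EFinP; apply: measurable_funM; first exact: (measurableT_comp ma measurable_fst).
  apply: measurable_funM mN; exact: (measurableT_comp (measX 2 sgam.1) measurable_snd).
have F0 (w : pt * pt) : (0 <= F w)%E.
  by rewrite lee_fin; apply: mulr_ge0 => //; apply: mulr_ge0 => //; exact: sqr_ge0.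
have igb x (r : R) : itg (fun y => gam y ^+ 2 * \1_(box x r) y).
  apply: itg_le sgam.2 _; first by apply: measM; [exact: measX sgam.1|apply: meas_indic; exact: mble_box].
  move=> y; have p0 : 0 <= gam y ^+ 2 * \1_(box x r) y.
    by apply: mulr_ge0; [exact: sqr_ge0|rewrite indicE].
  by rewrite (ger0_norm p0); apply: ler_piMr; [exact: sqr_ge0|rewrite indicE lern1 leq_b1].
have step1 : (energy D H1 H2 <= C1%:E * \int[mu2]_x fubini_F (@mu2 R) F x)%E.
  have mFF : measurable_fun setT (fubini_F (@mu2 R) F).
    exact: (@measurable_fun_fubini_tonelli_F _ _ T2 T2 R (@mu2 R) F mF F0).
  have FF0 x : (0 <= fubini_F (@mu2 R) F x)%E by apply: integral_ge0 => y _; exact: F0.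
  have C1E : (0 <= C1%:E)%E by rewrite lee_fin.
  rewrite -(ge0_integralZl mu2 measurableT mFF (fun x _ => FF0 x) C1E).
  apply: ge0_le_integral => //.
  - by move=> x _; rewrite lee_fin patchE; case: ifP => // _; apply: mulr_ge0; [exact: sqr_ge0|exact: sqgrad_ge0].
  - by apply/measurable_EFinP; exact: meas_energy dat.
  - exact: measurable_funeM.
  move=> x _; rewrite patchE; case: ifPn => [|_]; last by rewrite mule_ge0// lee_fin.
  rewrite inE => Dx; have d0 := bdist_gt0 oD nD Dx; have dn : bdist D x != 0 by rewrite gt_eqF.
  have -> : fubini_F (@mu2 R) F x = ((bdist D x ^+ 2)^-1 * Int (fun y => gam y ^+ 2 * \1_(box x (bdist D x / 2)) y))%:E.
    rewrite -(IntZ _ (igb _ _)) -(Int_EFin (itgZ _ (igb _ _))) /fubini_F; apply: eq_integral => y _.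
    by rewrite /F /= NE /a patchE mem_set.
  rewrite -EFinM lee_fin.
  have sub : [set y | `|y - x| <= bdist D x / 2] `<=` D.
    by move=> y /= yx; apply: (bdist_box nD (x := x)); apply: le_lt_trans yx _; rewrite ltr_pdivrMr//; lra.
  have := loc x (bdist D x / 2) (divr_gt0 d0 (ltr0n R 2)) sub; rewrite /sqgrad.
  set I := Int _ => h; have I0 : 0 <= I.
    by apply: Int_ge0 => y; apply: mulr_ge0; [exact: sqr_ge0|rewrite indicE].
  apply: le_trans (ler_wpM2l (sqr_ge0 _) h) _.
  have -> : bdist D x ^+ 2 * (C0 * (bdist D x / 2 + 4) ^+ 2 / (bdist D x / 2) ^+ 4 * I) =
     16 * C0 * (bdist D x / 2 + 4) ^+ 2 * ((bdist D x ^+ 2)^-1 * I) by field.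
  apply: ler_wpM2r; first by rewrite mulr_ge0// invr_ge0 sqr_ge0.
  apply: ler_wpM2l; first by rewrite mulr_ge0.
  have := dB x Dx; move: d0; move: (bdist D x) => r r0 rB.
  by rewrite lerXn2r ?nnegrE; lra.
apply: (le_trans step1); rewrite -(mulrA C1) (EFinM C1); apply: lee_wpmul2l; first by rewrite lee_fin.
have TT := etrans (esym (fubini_tonelli1 (m1 := @mu2 R) (m2 := @mu2 R) F mF F0)) (fubini_tonelli2 (m1 := @mu2 R) (m2 := @mu2 R) F mF F0).
rewrite TT -(IntZ _ sgam.2) -(Int_EFin (itgZ _ sgam.2)).
apply: ge0_le_integral.
- exact: measurableT.
- by move=> y _; apply: integral_ge0 => x _; exact: F0.
- exact: (@measurable_fun_fubini_tonelli_G _ _ T2 T2 R (@mu2 R) F mF F0).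
- by apply/measurable_EFinP; apply: measZ; exact: measX sgam.1.
move=> y _; rewrite /fubini_G.
have FE x : F (x, y) = (a x * (gam y ^+ 2 * \1_(box x (bdist D x / 2)) y))%:E by rewrite /F NE.
have mFy : measurable_fun setT (fun x => F (x, y)) by exact: (measurableT_comp mF (measurable_pair2 y)).
rewrite (_ : (fun x => F (x, y)) = (fun x => (a x * (gam y ^+ 2 * \1_(box x (bdist D x / 2)) y))%:E)) in mFy *; last first.
  by apply: funext.
move/measurable_EFinP: mFy => mFy.
exact: (inner_weight oD nD (sqr_ge0 (gam y)) mFy).
Qed.

End EnergyBound.

(** * The inequality of Necas *)

Section Necas.
Set Implicit Arguments.
Unset Strict Implicit.
Context {R : realType}.
Notation pt := (R * R)%type.
Implicit Types (f g h p u w phi gam : pt -> R) (A D K : set pt) (e x y z : pt).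

Lemma bounded_setP D : bounded_set D -> exists B : R, forall z, D z -> `|z| <= B.
Proof.
by move=> [M [_ hM]]; exists (M + 1) => z Dz; apply: (hM (M + 1)) => //; rewrite ltrDl.
Qed.

Let dx2_congr f g : f = g -> dx2 f = dx2 g.
Proof. by move=> ->. Qed.

Let sum6 (a b c d i j : R) : - a - b - c + (- d - i - j) = - (a + d + b + c + i + j).
Proof. ring. Qed.

Lemma tst_sqi D phi : tst D phi -> sqi phi.
Proof.
move=> tp; have [B vB] := tst_vanish tp.
exact: (vanish_sqi (sm_continuous (tst_sm tp)) vB).
Qed.

Lemma Int_sqr_ge0 f : 0 <= Int (fun x => f x ^+ 2).
Proof. by apply: Int_ge0 => x; exact: sqr_ge0. Qed.

Lemma Int_sqr_add f g : sqi f -> sqi g -> Int (fun x => (f x + g x) ^+ 2) =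
  Int (fun x => f x ^+ 2) + 2 * Int (fun x => f x * g x) + Int (fun x => g x ^+ 2).
Proof.
move=> sf sg; have ifg := sqi_mul sf sg.
rewrite -(IntZ 2 ifg) -(IntD sf.2 (itgZ 2 ifg)) -(IntD (itgD sf.2 (itgZ 2 ifg)) sg.2).
by congr Int; apply: funext => x; move: (f x) (g x) => a b; ring.
Qed.

Let Int_sqr_congr f g : f = g -> Int (fun x => f x ^+ 2) = Int (fun x => g x ^+ 2).
Proof. by move=> ->. Qed.

Let hess_arith (L a b c d m : R) : L = a + 2 * m + c -> m = b -> d = b -> 0 <= a -> 0 <= b -> 0 <= c ->
  [/\ a <= L, b <= L, d <= L & c <= L].
Proof. by move=> -> -> ->; split; lra. Qed.

(** Two integrations by parts give the product phi_11 phi_22 the same integral as phi_12^2. The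
    integral of the squared Laplacian is then the sum of those of all squared second derivatives. *)
Lemma Int_hessian D phi : tst D phi ->
  let L := Int (fun x => lap phi x ^+ 2) in
  [/\ Int (fun x => dx1 (dx1 phi) x ^+ 2) <= L, Int (fun x => dx2 (dx1 phi) x ^+ 2) <= L,
      Int (fun x => dx1 (dx2 phi) x ^+ 2) <= L & Int (fun x => dx2 (dx2 phi) x ^+ 2) <= L].
Proof.
move=> tp; have sp := tst_sm tp.
have t1 := tst_dx1 tp; have t2 := tst_dx2 tp; have s1 := tst_sm t1.
have [B1 v1] := tst_vanish t1; have [B22 v22] := tst_vanish (tst_dx2 t2).
have [B21 v21] := tst_vanish (tst_dx2 t1).
have ac : Int (fun x => dx1 (dx1 phi) x * dx2 (dx2 phi) x) = Int (fun x => dx2 (dx1 phi) x ^+ 2).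
  have E3 : dx1 (dx2 (dx2 phi)) = dx2 (dx2 (dx1 phi)).
    have E1 := dx12_sm (tst_sm t2); have E0 := dx12_sm sp.
    exact (etrans E1 (dx2_congr E0)).
  apply: (etrans (Int_parts1 (sm_c1 s1) (sm_c1 (tst_sm (tst_dx2 t2))) v22)).
  apply: (etrans (congr1 (fun g : pt -> R => - Int (fun x => dx1 phi x * g x)) E3)).
  have Q := Int_parts2 (sm_c1 (tst_sm (tst_dx2 t1))) (sm_c1 s1) v1.
  have C1 : Int (fun x => dx1 phi x * dx2 (dx2 (dx1 phi)) x) = Int (fun x => dx2 (dx2 (dx1 phi)) x * dx1 phi x).
    by apply: (congr1 Int); apply: funext => x; exact: mulrC.
  apply: (etrans (congr1 (fun t => - t) (etrans C1 Q))).
  apply: (etrans (opprK _)).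
  by apply: (congr1 Int); apply: funext => x; exact: esym (expr2 _).
have qa := tst_sqi (tst_dx1 t1); have qb := tst_sqi (tst_dx2 t1); have qc := tst_sqi (tst_dx2 t2).
have E : Int (fun x => lap phi x ^+ 2) = _ := Int_sqr_add qa qc.
have E0 := Int_sqr_congr (dx12_sm sp).
exact (hess_arith E ac E0 (Int_sqr_ge0 _) (Int_sqr_ge0 _) (Int_sqr_ge0 _)).
Qed.

(** The multiplier is a coordinate: the integral of u^2 is minus that of 2 x_i u d_i u, and |x_i| <=
    B where u does not vanish. Operator and coordinate are parameters so that both directions share
    the proof. *)
Let Int_poincare (d : (pt -> R) -> pt -> R) (c : pt -> R) (B : R) u : sm u -> vanish B u ->
  sm (d u) -> sqi (d u) -> sm c -> (forall x, `|c x| <= `|x|) -> (forall x, d c x = 1) ->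
  (forall x, d (fun y => u y * u y) x = d u x * u x + u x * d u x) ->
  Int (fun x => d c x * (u x * u x)) = - Int (fun x => c x * d (fun y => u y * u y) x) ->
  Int (fun x => u x ^+ 2) <= 4 * B ^+ 2 * Int (fun x => d u x ^+ 2).
Proof.
move=> su uB su1 qu1 sc cle dc dM P; have qu := vanish_sqi (sm_continuous su) uB.
have E1 : (fun x : pt => d c x * (u x * u x)) = (fun x => u x ^+ 2).
  by apply: funext => x; rewrite dc mul1r expr2.
have E2 x : c x * d (fun y => u y * u y) x = 2 * (c x * u x * d u x).
  by rewrite dM; move: (d u x) (u x) => a b; ring.
have Q x : `|c x * u x * d u x| <= 4^-1 * u x ^+ 2 + B ^+ 2 * d u x ^+ 2.
  have [xB|/ltW xB] := leP B `|x|.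
    by rewrite (uB _ xB) mulr0 mul0r normr0 expr0n mulr0 add0r mulr_ge0 ?sqr_ge0.
  have x1 : c x ^+ 2 <= B ^+ 2.
    rewrite -(real_normK (num_real (c x))) lerXn2r ?nnegrE ?(le_trans (cle x))//.
    exact: le_trans (normr_ge0 _) xB.
  move: (u x) (d u x) (c x) x1 => a b e eB.
  have h : (e * b) ^+ 2 <= B ^+ 2 * b ^+ 2 by rewrite exprMn ler_wpM2r ?sqr_ge0.
  have h1 := sqr_ge0 (a / 2 - e * b); have h2 := sqr_ge0 (a / 2 + e * b).
  rewrite mulrAC ler_norml; move: (e * b) h h1 h2 => f h; rewrite !expr2 => h1 h2.
  by move: h; rewrite !expr2 => h; apply/andP; split; nra.
have iq : itg (fun x => c x * u x * d u x).
  apply: itg_le (itgD (itgZ 4^-1 qu.2) (itgZ (B ^+ 2) qu1.2)) Q.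
  by apply: measM qu1.1; apply: measM qu.1; apply: meas_continuous; exact: sm_continuous sc.
have {}P := etrans (etrans (esym (congr1 Int E1)) P) (congr1 (fun g => - Int g) (funext E2)).
move: P; rewrite (IntZ 2 iq).
have := Int_norm iq; have := Int_le (itg_norm iq) (itgD (itgZ 4^-1 qu.2) (itgZ (B ^+ 2) qu1.2)) Q.
rewrite (IntD (itgZ 4^-1 qu.2) (itgZ (B ^+ 2) qu1.2)) (IntZ _ qu.2) (IntZ _ qu1.2).
rewrite -(mulrA 4); move: (Int _) (Int _) (Int (fun x => u x ^+ 2)) (B ^+ 2 * _) => a b e f h1 h2 E.
by move: (ler_norm (- a)); rewrite normrN; lra.
Qed.

Lemma Int_poincare1 (B : R) u : sm u -> vanish B u ->
  Int (fun x => u x ^+ 2) <= 4 * B ^+ 2 * Int (fun x => dx1 u x ^+ 2).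
Proof.
move=> su uB; have su1 := sm_dx1 su; have vuu := vanishM u uB; have su2 := sm_mul su su.
have qu1 := vanish_sqi (sm_continuous su1) (vanish_derive (1, 0) uB).
apply: (Int_poincare (d := @dx1 R) su uB su1 qu1 (sm_fst) ler_norm_fst).
- by move=> x; exact: derive_fst.
- by move=> x; exact: dx1M (sm_derivable su) (sm_derivable su).
exact: (Int_parts1 (sm_c1 sm_fst) (sm_c1 su2) vuu).
Qed.

Lemma Int_poincare2 (B : R) u : sm u -> vanish B u ->
  Int (fun x => u x ^+ 2) <= 4 * B ^+ 2 * Int (fun x => dx2 u x ^+ 2).
Proof.
move=> su uB; have su1 := sm_dx2 su; have vuu := vanishM u uB; have su2 := sm_mul su su.
have qu1 := vanish_sqi (sm_continuous su1) (vanish_derive (0, 1) uB).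
apply: (Int_poincare (d := @dx2 R) su uB su1 qu1 (sm_snd) ler_norm_snd).
- by move=> x; exact: derive_snd.
- by move=> x; exact: dx2M (sm_derivable su) (sm_derivable su).
exact: (Int_parts2 (sm_c1 sm_snd) (sm_c1 su2) vuu).
Qed.

(* p has the weak gradient f - div G. *)
Definition grad_data D p (f1 f2 G11 G12 G21 G22 : pt -> R) : Prop :=
  [/\ sqi p, [/\ sqi f1, sqi G11 & sqi G12], [/\ sqi f2, sqi G21 & sqi G22],
   forall phi, tst D phi -> Int (fun x => p x * dx1 phi x) =
     - Int (fun x => f1 x * phi x) - Int (fun x => G11 x * dx1 phi x) - Int (fun x => G12 x * dx2 phi x) &
   forall phi, tst D phi -> Int (fun x => p x * dx2 phi x) =
     - Int (fun x => f2 x * phi x) - Int (fun x => G21 x * dx1 phi x) - Int (fun x => G22 x * dx2 phi x)].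

Definition data_size (f1 f2 G11 G12 G21 G22 : pt -> R) : R :=
  Int (fun x => f1 x ^+ 2) + Int (fun x => f2 x ^+ 2) + Int (fun x => G11 x ^+ 2) +
  Int (fun x => G12 x ^+ 2) + Int (fun x => G21 x ^+ 2) + Int (fun x => G22 x ^+ 2).

Lemma data_size_ge0 f1 f2 G11 G12 G21 G22 : 0 <= data_size f1 f2 G11 G12 G21 G22.
Proof. by rewrite /data_size !addr_ge0 ?Int_sqr_ge0. Qed.

Lemma Int_CS_le f g (P L : R) : sqi f -> sqi g -> Int (fun x => g x ^+ 2) <= P * L ->
  Int (fun x => f x * g x) ^+ 2 <= Int (fun x => f x ^+ 2) * (P * L).
Proof.
move=> sf sg h; apply: le_trans (Int_CS sf sg) _; apply: ler_wpM2l h; exact: Int_sqr_ge0.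
Qed.

Let sum6_sqr (a b c d i j A1 A2 A3 A4 A5 A6 P L : R) :
  a ^+ 2 <= A1 * (P * L) -> b ^+ 2 <= A2 * (P * L) -> c ^+ 2 <= A3 * (P * L) ->
  d ^+ 2 <= A4 * (P * L) -> i ^+ 2 <= A5 * (P * L) -> j ^+ 2 <= A6 * (P * L) ->
  (a + b + c + d + i + j) ^+ 2 <= 6 * (A1 + A2 + A3 + A4 + A5 + A6) * P * L.
Proof.
move=> h1 h2 h3 h4 h5 h6; rewrite -!(mulrA _ P).
apply: (@le_trans _ _ (6 * (a ^+ 2 + b ^+ 2 + c ^+ 2 + d ^+ 2 + i ^+ 2 + j ^+ 2))).
  rewrite -subr_ge0 [leRHS](_ : _ = (a-b)^+2+(a-c)^+2+(a-d)^+2+(a-i)^+2+(a-j)^+2+(b-c)^+2+(b-d)^+2+(b-i)^+2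
    +(b-j)^+2+(c-d)^+2+(c-i)^+2+(c-j)^+2+(d-i)^+2+(d-j)^+2+(i-j)^+2); last by ring.
  by rewrite !addr_ge0 ?sqr_ge0.
move: (P * L) h1 h2 h3 h4 h5 h6 => Q h1 h2 h3 h4 h5 h6; lra.
Qed.

(** The gradient identities are tested with [dx1 phi] and [dx2 phi] and added. First derivatives are
    bounded by second ones, and those by the Laplacian, so p pairs with Laplacians as a function of
    the size of the data would: the hypothesis of [orthogonal_projection]. *)
Lemma Int_lap_bound D (B : R) p f1 f2 G11 G12 G21 G22 phi : (forall z, D z -> `|z| < B) ->
  grad_data D p f1 f2 G11 G12 G21 G22 -> tst D phi ->
  Int (fun x => p x * lap phi x) ^+ 2 <=
    6 * data_size f1 f2 G11 G12 G21 G22 * (4 * B ^+ 2 + 1) * Int (fun x => lap phi x ^+ 2).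
Proof.
move=> DB [sp [s1 s11 s12] [s2 s21 s22] e1 e2] tp.
have vD psi : tst D psi -> vanish B psi.
  move=> [_ [K [_ KD K0]]] x xB; apply: K0 => /KD /DB; by rewrite ltNge xB.
have t1 := tst_dx1 tp; have t2 := tst_dx2 tp.
have := Int_sqr_ge0 (lap phi); case: (Int_hessian tp).
generalize (Int (fun x => lap phi x ^+ 2)) => L h11 h12 h21 h22 L0.
have PL t : t <= L -> t <= (4 * B ^+ 2 + 1) * L.
  by move=> tL; apply: (le_trans tL); apply: ler_peMl L0 _; rewrite lerDr; apply: mulr_ge0 (sqr_ge0 B).
have PB t s : t <= 4 * B ^+ 2 * s -> s <= L -> t <= (4 * B ^+ 2 + 1) * L.
  move=> ts sL; apply: (le_trans ts); apply: (@le_trans _ _ (4 * B ^+ 2 * L)).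
    by apply: ler_wpM2l sL; apply: mulr_ge0 (sqr_ge0 B).
  by apply: (ler_wpM2r L0); rewrite lerDl.
have k1 := PB _ _ (Int_poincare1 (tst_sm t1) (vD _ t1)) h11.
have k2 := PB _ _ (Int_poincare2 (tst_sm t2) (vD _ t2)) h22.
have E : Int (fun x => p x * lap phi x) = - (Int (fun x => f1 x * dx1 phi x) + Int (fun x => f2 x * dx2 phi x) +
  Int (fun x => G11 x * dx1 (dx1 phi) x) + Int (fun x => G12 x * dx2 (dx1 phi) x) +
  Int (fun x => G21 x * dx1 (dx2 phi) x) + Int (fun x => G22 x * dx2 (dx2 phi) x)).
  have -> : (fun x => p x * lap phi x) = (fun x => p x * dx1 (dx1 phi) x + p x * dx2 (dx2 phi) x).
    by apply: funext => x; rewrite /lap mulrDr.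
  apply: (etrans (IntD (sqi_mul sp (tst_sqi (tst_dx1 t1))) (sqi_mul sp (tst_sqi (tst_dx2 t2))))).
  have F1 := e1 _ t1; have F2 := e2 _ t2.
  have AB (a b c d : R) : a = c -> b = d -> a + b = c + d by move=> -> ->.
  apply: (etrans (AB _ _ _ _ F1 F2)).
  exact: sum6.
rewrite E sqrrN /data_size.
have c1 := Int_CS_le s1 (tst_sqi t1) k1; have c2 := Int_CS_le s2 (tst_sqi t2) k2.
have c3 := Int_CS_le s11 (tst_sqi (tst_dx1 t1)) (PL _ h11).
have c4 := Int_CS_le s12 (tst_sqi (tst_dx2 t1)) (PL _ h12).
have c5 := Int_CS_le s21 (tst_sqi (tst_dx1 t2)) (PL _ h21).
have c6 := Int_CS_le s22 (tst_sqi (tst_dx2 t2)) (PL _ h22).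
exact (sum6_sqr c1 c2 c3 c4 c5 c6).
Qed.

Let sum7 (a b c d i j l : R) :
  (`|a| + `|b| + `|c| + `|d| + `|i| + `|j| + `|l|) ^+ 2 <=
  7 * (a ^+ 2 + b ^+ 2 + c ^+ 2 + d ^+ 2 + i ^+ 2 + j ^+ 2 + l ^+ 2).
Proof.
rewrite -(real_normK (num_real a)) -(real_normK (num_real b)) -(real_normK (num_real c))
  -(real_normK (num_real d)) -(real_normK (num_real i)) -(real_normK (num_real j)) -(real_normK (num_real l)).
move: `|a| `|b| `|c| `|d| `|i| `|j| `|l| => {}a {}b {}c {}d {}i {}j {}l.
rewrite -subr_ge0 [leRHS](_ : _ = (a-b)^+2+(a-c)^+2+(a-d)^+2+(a-i)^+2+(a-j)^+2+(a-l)^+2+(b-c)^+2+(b-d)^+2+(b-i)^+2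
    +(b-j)^+2+(b-l)^+2+(c-d)^+2+(c-i)^+2+(c-j)^+2+(c-l)^+2+(d-i)^+2+(d-j)^+2+(d-l)^+2+(i-j)^+2+(i-l)^+2+(j-l)^+2); last by ring.
by rewrite !addr_ge0 ?sqr_ge0.
Qed.

(** The function gam of Weyl's lemma: one pointwise majorant for all the terms of the weak gradient
    of p - w, in both components. *)
Definition data_sum (f1 f2 G11 G12 G21 G22 w : pt -> R) : pt -> R := fun x =>
  `|f1 x| + `|f2 x| + `|G11 x| + `|G12 x| + `|G21 x| + `|G22 x| + `|w x|.

Lemma data_sum_sqi f1 f2 G11 G12 G21 G22 w :
  sqi f1 -> sqi f2 -> sqi G11 -> sqi G12 -> sqi G21 -> sqi G22 -> sqi w ->
  sqi (data_sum f1 f2 G11 G12 G21 G22 w) /\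
  Int (fun x => data_sum f1 f2 G11 G12 G21 G22 w x ^+ 2) <=
    7 * (data_size f1 f2 G11 G12 G21 G22 + Int (fun x => w x ^+ 2)).
Proof.
move=> s1 s2 s3 s4 s5 s6 s7.
have sg : sqi (data_sum f1 f2 G11 G12 G21 G22 w) by rewrite /data_sum; do 6 (apply: sqiD; last exact: sqi_norm); exact: sqi_norm.
split; first exact: sg.
have i12 := itgD s1.2 s2.2; have i123 := itgD i12 s3.2; have i4 := itgD i123 s4.2.
have i5 := itgD i4 s5.2; have i6 := itgD i5 s6.2; have i7 := itgD i6 s7.2.
apply: (le_trans (Int_le sg.2 (itgZ 7 i7) (fun x => sum7 (f1 x) (f2 x) (G11 x) (G12 x) (G21 x) (G22 x) (w x)))).
rewrite (IntZ 7 i7) (IntD i6 s7.2) (IntD i5 s6.2) (IntD i4 s5.2) (IntD i123 s4.2) (IntD i12 s3.2) (IntD s1.2 s2.2).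
by rewrite /data_size.
Qed.

Let dot4_le (a b c d x y z t g : R) : `|a| <= g -> `|b| + `|d| <= g -> `|c| + `|d| <= g -> `|t| <= `|y| + `|z| ->
  `|- (a * x) - b * y - c * z - d * t| <= g * (`|x| + `|y| + `|z|).
Proof.
move=> ag bg cg tyz.
have h1 : `|a * x| <= g * `|x| by rewrite normrM; apply: ler_wpM2r.
have h2 : `|b * y| + `|d| * `|y| <= g * `|y| by rewrite normrM -mulrDl; apply: ler_wpM2r.
have h3 : `|c * z| + `|d| * `|z| <= g * `|z| by rewrite normrM -mulrDl; apply: ler_wpM2r.
have h4 : `|d * t| <= `|d| * `|y| + `|d| * `|z| by rewrite normrM -mulrDr; apply: ler_wpM2l.
rewrite !mulrDr; move: h1 h2 h3 h4.
have := ler_normB (- (a * x) - b * y - c * z) (d * t); have := ler_normB (- (a * x) - b * y) (c * z).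
have := ler_normB (- (a * x)) (b * y); rewrite normrN.
move=> a1 a2 a3 a4 a5 a6 a7; lra.
Qed.

Let pairing_bound p w f G1 G2 psi u u1 u2 gam : sqi p -> sqi w -> sqi f -> sqi G1 -> sqi G2 -> sqi psi ->
  sqi u -> sqi u1 -> sqi u2 -> sqi gam ->
  Int (fun x => p x * psi x) = - Int (fun x => f x * u x) - Int (fun x => G1 x * u1 x) - Int (fun x => G2 x * u2 x) ->
  (forall x, `|psi x| <= `|u1 x| + `|u2 x|) -> (forall x, `|f x| <= gam x) ->
  (forall x, `|G1 x| + `|w x| <= gam x) -> (forall x, `|G2 x| + `|w x| <= gam x) ->
  `|Int (fun x => (p x - w x) * psi x)| <= Int (fun x => gam x * (`|u x| + `|u1 x| + `|u2 x|)).
Proof.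
move=> sp sw sf s1 s2 sps su su1 su2 sg eq psu fg g1 g2.
have ip := sqi_mul sp sps; have iw := sqi_mul sw sps.
have i1 := sqi_mul sf su; have i2 := sqi_mul s1 su1; have i3 := sqi_mul s2 su2.
have ii := itgB (itgB (itgB (itgN i1) i2) i3) iw.
have iJ := sqi_mul sg (sqiD (sqiD (sqi_norm su) (sqi_norm su1)) (sqi_norm su2)).
have -> : Int (fun x => (p x - w x) * psi x) =
    Int (fun x => - (f x * u x) - G1 x * u1 x - G2 x * u2 x - w x * psi x).
  rewrite (IntB (itgB (itgB (itgN i1) i2) i3) iw) (IntB (itgB (itgN i1) i2) i3) (IntB (itgN i1) i2) (IntN i1) -eq.
  rewrite -(IntB ip iw); apply: (congr1 Int); apply: funext => x; exact: mulrBl.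
apply: (le_trans (Int_norm ii)); apply: Int_le (itg_norm ii) iJ _ => x.
exact: dot4_le.
Qed.

Let data_sum_le f1 f2 G11 G12 G21 G22 w x :
  let g := data_sum f1 f2 G11 G12 G21 G22 w x in
  [/\ `|f1 x| <= g, `|G11 x| + `|w x| <= g & `|G12 x| + `|w x| <= g] /\
  [/\ `|f2 x| <= g, `|G21 x| + `|w x| <= g & `|G22 x| + `|w x| <= g].
Proof.
rewrite /data_sum /=; move: (normr_ge0 (f1 x)) (normr_ge0 (f2 x)) (normr_ge0 (G11 x)) (normr_ge0 (G12 x))
  (normr_ge0 (G21 x)) (normr_ge0 (G22 x)) (normr_ge0 (w x)).
move: `|f1 x| `|f2 x| `|G11 x| `|G12 x| `|G21 x| `|G22 x| `|w x| => a b c d i j l *.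
by split; split; lra.
Qed.

(* With w the projection of p on the closure of the Laplacians of test functions, p - w is harmonic. *)
Lemma weak_gradient_split D (B : R) p f1 f2 G11 G12 G21 G22 : (forall z, D z -> `|z| < B) ->
  grad_data D p f1 f2 G11 G12 G21 G22 ->
  let E := data_size f1 f2 G11 G12 G21 G22 in
  exists w gam, [/\ sqi w /\ Int (fun x => w x ^+ 2) <= 6 * E * (4 * B ^+ 2 + 1),
    sqi gam /\ Int (fun x => gam x ^+ 2) <= 7 * (E + 6 * E * (4 * B ^+ 2 + 1)),
    (forall y, 0 <= gam y), forall phi, tst D phi -> Int (fun x => (p x - w x) * lap phi x) = 0 &
    forall phi, tst D phi -> let J := Int (fun y => gam y * (`|phi y| + `|dx1 phi y| + `|dx2 phi y|)) in
    `|Int (fun y => (p y - w y) * dx1 phi y)| <= J /\ `|Int (fun y => (p y - w y) * dx2 phi y)| <= J].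
Proof.
move=> DB data E; have [sp [s1 s11 s12] [s2 s21 s22] e1 e2] := data.
have E0 : 0 <= E by exact: data_size_ge0.
have P0 : 0 <= 4 * B ^+ 2 + 1 by apply: addr_ge0 => //; apply: mulr_ge0 => //; exact: sqr_ge0.
pose V : set (pt -> R) := [set v | exists2 phi, tst D phi & v = lap phi].
have [w [sw wK wV]] : exists w, [/\ sqi w, Int (fun x => w x ^+ 2) <= 6 * E * (4 * B ^+ 2 + 1) &
    forall v, V v -> Int (fun x => (p x - w x) * v x) = 0].
  apply: orthogonal_projection sp _ _ _ _ _ _.
  - by apply: mulr_ge0 => //; apply: mulr_ge0.
  - exists (fun=> 0); last by rewrite lap_cst.
    by split; [exact: sm_cst|exists set0; split => //; exact: compact0].
  - by move=> v [phi tp ->]; exact: tst_sqi (tst_lap tp).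
  - move=> v v' [phi tp ->] [psi ts ->]; exists (fun x => phi x + psi x); first exact: tst_add.
    by rewrite (lap_add (tst_sm tp) (tst_sm ts)).
  - move=> c v [phi tp ->]; exists (fun x => c * phi x); first exact: tst_scale.
    by rewrite (lap_scale c (tst_sm tp)).
  by move=> v [phi tp ->]; exact: Int_lap_bound DB data tp.
have [sg gK] := data_sum_sqi s1 s2 s11 s12 s21 s22 sw.
exists w, (data_sum f1 f2 G11 G12 G21 G22 w); split.
- by split.
- split; first exact: sg.
  by apply: (le_trans gK); rewrite ler_pM2l// lerD2l.
- by move=> y; rewrite /data_sum !addr_ge0.
- by move=> phi tp; apply: wV; exists phi.
move=> phi tp; have qp := tst_sqi tp; have qp1 := tst_sqi (tst_dx1 tp); have qp2 := tst_sqi (tst_dx2 tp).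
have bd x := data_sum_le f1 f2 G11 G12 G21 G22 w x.
split.
- apply: (pairing_bound sp sw s1 s11 s12 qp1 qp qp1 qp2 sg (e1 _ tp)) => x; first by rewrite lerDl.
  + by have [[]] := bd x.
  + by have [[]] := bd x.
  + by have [[]] := bd x.
apply: (pairing_bound sp sw s2 s21 s22 qp2 qp qp1 qp2 sg (e2 _ tp)) => x; first by rewrite lerDr.
- by have [_ []] := bd x.
- by have [_ []] := bd x.
- by have [_ []] := bd x.
Qed.

Let sqr_split (a b c : R) : (a - c) ^+ 2 <= 2 * (a - b) ^+ 2 + 2 * (b - c) ^+ 2.
Proof. by have := sqr_ge0 (a - b - (b - c)); rewrite !expr2; lra. Qed.

(** p - c is the sum of w, bounded by the projection, and of a function equal to H - c almost
    everywhere, bounded by Hardy-Poincare. The term eps keeps the energy bound M positive when the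
    data vanish. *)
Theorem necas D : open D -> bounded_set D -> connected D -> D !=set0 -> lipschitz_boundary D ->
  exists2 C : R, 0 <= C & forall p f1 f2 G11 G12 G21 G22 (eps : R),
    grad_data D p f1 f2 G11 G12 G21 G22 -> 0 < eps ->
    exists c, (eint D (fun x => (p x - c) ^+ 2)%R <= (C * (data_size f1 f2 G11 G12 G21 G22 + eps))%:E)%E.
Proof.
move=> oD bD cD D0 lD; have [nD [C3 C30 HP]] := hardy_poincare oD bD cD D0 lD.
have [C0 C00 W] := @weyl R.
have [B DB] := bounded_setP bD.
have DB1 z : D z -> `|z| < B + 1 by move=> /DB; lra.
have [C2 C20 EB] := energy_bound oD nD (ex_intro _ B DB) (ltW C00).
set P := 4 * (B + 1) ^+ 2 + 1.
have P0 : 0 <= P by apply: addr_ge0 => //; apply: mulr_ge0 => //; exact: sqr_ge0.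
pose c1 := C2 * (7 * (1 + 6 * P)) + 1.
have c10 : 0 <= c1 by rewrite addr_ge0// mulr_ge0// mulr_ge0// addr_ge0// mulr_ge0.
exists (2 * (6 * P) + 2 * (C3 * c1)); first by rewrite addr_ge0// mulr_ge0// mulr_ge0.
move=> p f1 f2 G11 G12 G21 G22 eps data eps0.
have E0 := data_size_ge0 f1 f2 G11 G12 G21 G22.
have sp : sqi p by case: data.
have := weak_gradient_split DB1 data; rewrite -/P /=.
move: (data_size _ _ _ _ _ _) E0 => E E0 [w [gam [[sw wK] [sg gK] g0 harm grd]]].
have [H [H1 [H2 [Hh ctH dH loc]]]] := W D _ gam oD (sqiB sp sw) sg g0 harm grd.
have dat : c1data D H H1 H2 by split.
have M0 : 0 < c1 * (E + eps).
  apply: mulr_gt0; last exact: ltr_wpDl.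
  by rewrite /c1; apply: ltr_wpDl => //; apply: mulr_ge0 => //; apply: mulr_ge0 => //; apply: addr_ge0 => //; apply: mulr_ge0.

have eM : (energy D H1 H2 <= (c1 * (E + eps))%:E)%E.
  apply: (le_trans (EB _ _ _ _ dat sg loc)); rewrite lee_fin.
  apply: (@le_trans _ _ (C2 * (7 * (E + 6 * E * P)))); first exact: ler_wpM2l.
  rewrite (_ : C2 * _ = (C2 * (7 * (1 + 6 * P))) * E); last by ring.
  have : 0 <= C2 * (7 * (1 + 6 * P)) by rewrite mulr_ge0// mulr_ge0// addr_ge0// mulr_ge0.
  by rewrite /c1; move: (C2 * _) => k k0; rewrite mulrDl mul1r mulrDr -addrA lerDl addr_ge0// ?mulr_ge0// ?addr_ge0// ltW.
have [c hc] := HP H H1 H2 _ dat M0 eM; exists c.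
have mp : meas ((fun x => (p x - c) ^+ 2) \_ D).
  by apply: meas_patch (mble_open oD) _; apply: measX; apply: measB sp.1 (meas_cst c).
have mw : meas ((fun x => 2 * w x ^+ 2) \_ D).
  by apply: meas_patch (mble_open oD) _; apply: measZ; exact: measX sw.1.
have mH1 : meas (sqdev H c \_ D).
  have cu z := @sqdev_cont R D H H1 H2 c z dat.
  by apply: (meas_open_restrict oD) => x Dx; have := cu x Dx; exact.
have mH : meas ((fun x => 2 * sqdev H c x) \_ D) by rewrite patchZ; exact: measZ.
have n1 x : 0 <= (p x - c) ^+ 2 by exact: sqr_ge0.
have n2 x : 0 <= 2 * w x ^+ 2 by apply: mulr_ge0 => //; exact: sqr_ge0.
have n3 x : 0 <= 2 * sqdev H c x by apply: mulr_ge0 => //; exact: sqr_ge0.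
apply: (@le_trans _ _ (eint D (fun x => 2 * w x ^+ 2 + 2 * sqdev H c x)%R)).
  rewrite /eint; apply: ae_ge0_le_integral.
  - exact: measurableT.
  - by move=> x _; rewrite lee_fin patchE; case: ifP.
  - by apply/measurable_EFinP; exact: mp.
  - by move=> x _; rewrite lee_fin patchE; case: ifP => // _; rewrite addr_ge0.
  - by apply/measurable_EFinP; rewrite patchD; exact: measD.
  apply: filterS Hh => x hx _; rewrite lee_fin !patchE; case: ifPn => //; rewrite inE => /hx HE.
  rewrite /sqdev HE; have := sqr_split (p x) (p x - w x) c.
  by rewrite (_ : p x - (p x - w x) = w x)//; ring.
rewrite (eintD mw mH n2 n3) mulrDl EFinD; apply: leeD.
  apply: (@le_trans _ _ (\int[mu2]_x (2 * w x ^+ 2)%:E)%E).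
    rewrite /eint; apply: ge0_le_integral.
    - exact: measurableT.
    - by move=> x _; rewrite lee_fin patchE; case: ifP.
    - by apply/measurable_EFinP; exact: mw.
    - by apply/measurable_EFinP; apply: measZ; exact: measX sw.1.
    by move=> x _; rewrite lee_fin patchE; case: ifP.
  rewrite (Int_EFin (itgZ 2 sw.2)) lee_fin (IntZ 2 sw.2) -!(mulrA 2) ler_pM2l//.
  apply: (le_trans wK); rewrite -(mulrA 6 P) (mulrC P) mulrA -(mulrA 6 E) -(mulrA 6) ler_pM2l//.
  by apply: ler_wpM2r => //; rewrite lerDl ltW.
rewrite (eintZ (ler0n _ 2) mH1 (fun x => sqr_ge0 _)) -!(mulrA 2) (EFinM 2).
by apply: lee_wpmul2l; [rewrite lee_fin|rewrite -mulrA].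
Qed.

End Necas.

(** * From the fields of the definitions to square integrable functions *)

Section Interface.
Set Implicit Arguments.
Unset Strict Implicit.
Context {R : realType}.
Notation pt := (R * R)%type.
Implicit Types (f g h p u w phi : pt -> R) (D : set pt) (x y z : pt).
Implicit Types (sigma tau : pt -> 'M[R]_2) (v : pt -> 'rV[R]_2).

Lemma L2P D f : L2 D f <-> sqi (f \_ D).
Proof.
rewrite /L2; split => [h|[mf fi]].
  split; last exact: (Lfun2_integrable_sqr h).
  by move: h; rewrite inE => /andP[]; rewrite inE.
rewrite inE; apply/andP; split; first by rewrite inE.
rewrite inE /= /finite_norm unlock; apply: poweR_lty.
have /integrableP[_ hf] := fi; apply: le_lt_trans hf; rewrite le_eqVlt; apply/orP; left; apply/eqP.
apply: eq_integral => x _.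
rewrite -[LHS]/(`|(f \_ D) x|%:E `^ 2)%E -[RHS](_ : (`|((f \_ D) x ^+ 2)|%:E) = _)//.
by rewrite poweR_EFin powR_mulrn// real_normK ?num_real// ger0_norm// sqr_ge0.
Qed.

Lemma RintE D g : mble D -> \int[leb2]_(x in D) g x = Int (g \_ D).
Proof. by move=> mD; rewrite Rintegral_mkcond. Qed.

Lemma patchM D f g : (fun x => (f \_ D) x * g x) = (fun x => f x * g x) \_ D.
Proof. by apply: funext => x; rewrite !patchE; case: ifP => // _; rewrite mul0r. Qed.

Lemma patchMM D f g : (fun x => (f \_ D) x * (g \_ D) x) = (fun x => f x * g x) \_ D.
Proof. by apply: funext => x; rewrite !patchE; case: ifP => // _; rewrite mul0r. Qed.

Lemma dotvE (a b : 'rV[R]_2) : dotv a b = a 0 0 * b 0 0 + a 0 1 * b 0 1.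
Proof.
rewrite /dotv !big_ord_recl big_ord0 addr0.
by congr (_ + _ * _); congr (_ _ _); apply: val_inj.
Qed.

Lemma sum2E (F : 'I_2 -> R) : \sum_i F i = F 0 + F 1.
Proof. by rewrite !big_ord_recl big_ord0 addr0; congr (_ + F _); apply: val_inj. Qed.

Lemma frobE (a b : 'M[R]_2) : frob a b = a 0 0 * b 0 0 + a 0 1 * b 0 1 + (a 1 0 * b 1 0 + a 1 1 * b 1 1).
Proof. by rewrite /frob !sum2E. Qed.

Lemma devE (a : 'M[R]_2) : [/\ dev a 0 0 = (a 0 0 - a 1 1) / 2, dev a 0 1 = a 0 1,
  dev a 1 0 = a 1 0 & dev a 1 1 = (a 1 1 - a 0 0) / 2].
Proof.
by rewrite /dev /mxtrace sum2E; split; rewrite !mxE /= ?mulr1n ?mulr0n ?subr0//; field.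
Qed.

Lemma bounded_mu2_lty D : bounded_set D -> mble D -> (mu2 D < +oo)%E.
Proof.
move=> [M [_ hM]] mD; apply: (@le_lt_trans _ _ (mu2 (box 0 (`|M| + 2)))); last exact: mu2_box_lty.
apply: le_measure; rewrite ?inE//; first exact: mble_box.
move=> x Dx; apply/box0P; apply: le_lt_trans (hM (`|M| + 1) _ _ Dx) _; last by rewrite ltrD2l; lra.
by apply: le_lt_trans (ler_norm _) _; rewrite ltrDl.
Qed.

Lemma bounded_sqi1 D : bounded_set D -> mble D -> sqi (\1_D : pt -> R).
Proof.
move=> bD mD; split; first exact: meas_indic.
rewrite (_ : (fun x => _) = \1_D); first exact: itg_indic (bounded_mu2_lty bD mD).
by apply: funext => x; rewrite indicE; case: (_ \in _); rewrite ?expr1n ?expr0n.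
Qed.

(** For mean zero the cross term disappears, so replacing p by p - c only increases the integral of
    the square, whatever c is; then eps tends to 0. The condition [p \_ D = p] lets integrals over D
    be taken over the plane. *)
Theorem mean_zero_bound D : open D -> bounded_set D -> connected D -> D !=set0 -> lipschitz_boundary D ->
  exists2 C : R, 0 <= C & forall p f1 f2 G11 G12 G21 G22,
    grad_data D p f1 f2 G11 G12 G21 G22 -> p \_ D = p -> Int p = 0 ->
    Int (fun x => p x ^+ 2) <= C * data_size f1 f2 G11 G12 G21 G22.
Proof.
move=> oD bD cD D0 lD; have [C C0 hC] := necas oD bD cD D0 lD.
exists C => // p f1 f2 G11 G12 G21 G22 data pD p0.
have mD := mble_open oD; have s1 := bounded_sqi1 bD mD.
have sp : sqi p by case: data.
have ip : itg p.
  have := sqi_mul sp s1; rewrite (_ : (fun x => _) = p)//; apply: funext => x.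
  by rewrite -[in LHS]pD -[in RHS]pD patchE indicE; case: ifP; rewrite ?mulr1 ?mulr0.
have i1 : itg (\1_D : pt -> R) by exact: itg_indic (bounded_mu2_lty bD mD).
apply/ler_addgt0Pr => e e0; pose e' := e / (C + 1).
have e'0 : 0 < e' by rewrite divr_gt0// ltr_wpDl.
have [c hc] := hC _ _ _ _ _ _ _ _ data e'0.
have E : (fun x => (p x - c) ^+ 2) \_ D = (fun x => p x ^+ 2 - 2 * c * p x + c ^+ 2 * \1_D x).
  apply: funext => x; rewrite patchE indicE -[in RHS]pD patchE; case: ifP => _ /=; first ring.
  by rewrite expr0n !mulr0 subr0 addr0.
have ii := itgD (itgB sp.2 (itgZ (2 * c) ip)) (itgZ (c ^+ 2) i1).
move: hc; rewrite /eint E (Int_EFin ii) lee_fin (IntD (itgB sp.2 (itgZ (2 * c) ip)) (itgZ (c ^+ 2) i1)).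
rewrite (IntB sp.2 (itgZ (2 * c) ip)) (IntZ _ ip) (IntZ _ i1) p0 mulr0 subr0 => hc.
have h : 0 <= c ^+ 2 * Int (\1_D : pt -> R).
  by apply: mulr_ge0; [exact: sqr_ge0|apply: Int_ge0 => x; rewrite indicE].
have h2 : C * e' <= e.
  by rewrite /e' mulrA ler_pdivrMr ?ltr_wpDl// mulrC ler_pM2l// lerDl.
by move: hc; rewrite mulrDr; lra.
Qed.

Lemma wdivP D v : Hdiv D v -> L2 D (wdiv D v) /\ is_weak_div D v (wdiv D v).
Proof. by move=> [_ [g hg]]; rewrite /wdiv; case: xgetP => [y _ //|/(_ g)]. Qed.

Lemma gradE phi x : grad phi x 0 0 = dx1 phi x /\ grad phi x 0 1 = dx2 phi x.
Proof. by rewrite /grad !mxE. Qed.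

Lemma weak_div_Int D v g phi : open D -> L2v D v -> L2 D g -> is_weak_div D v g -> tst D phi ->
  Int (fun x => ((fun x => v x 0 0) \_ D) x * dx1 phi x) + Int (fun x => ((fun x => v x 0 1) \_ D) x * dx2 phi x)
  = - Int (fun x => (g \_ D) x * phi x).
Proof.
move=> oD Lv /L2P sg wd tp; have mD := mble_open oD.
have s0 := (L2P D _).1 (Lv 0); have s1 := (L2P D _).1 (Lv 1).
have := wd _ (tst_test_fun tp); rewrite !(RintE _ mD).
rewrite -(IntD (sqi_mul s0 (tst_sqi (tst_dx1 tp))) (sqi_mul s1 (tst_sqi (tst_dx2 tp)))).
rewrite -(patchM D g phi) => <-; apply: (congr1 Int); apply: funext => x; rewrite !patchE.
case: ifP => _; last by rewrite !mul0r addr0.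
by rewrite dotvE; have [-> ->] := gradE phi x.
Qed.

End Interface.

(** * Green's formula on star-shaped polygons *)

(* The sign of cr a b x tells on which side of the line through a and b the point x lies. *)
Definition cr {R : realType} (a b x : R * R) : R :=
  (x.1 - a.1) * (b.2 - a.2) - (x.2 - a.2) * (b.1 - a.1).

Section OneSided.
Set Implicit Arguments.
Unset Strict Implicit.
Context {R : realType}.
Notation pt := (R * R)%type.
Implicit Types (D : set pt) (a b x y z : pt) (t : R).

Lemma eq_pt x y : x.1 = y.1 -> x.2 = y.2 -> x = y.
Proof. by case: x y => [x1 x2] [y1 y2] /= -> ->. Qed.

Lemma cr_lerp a b x y t : cr a b (lerp x y t) = (1 - t) * cr a b x + t * cr a b y.
Proof.
rewrite /cr /lerp -[(x + t *: (y - x)).1]/(x.1 + t * (y.1 - x.1)) -[(x + t *: (y - x)).2]/(x.2 + t * (y.2 - x.2)).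
ring.
Qed.

Lemma lerp_continuous a b : continuous (lerp a b).
Proof.
apply: (lipschitz_cont (L := `|b - a|)) => s t; rewrite /lerp.
by rewrite opprD addrACA subrr add0r -scalerBl normrZ mulrC.
Qed.

Lemma seg_connected x y : connected (seg x y).
Proof.
apply: connected_continuous_connected; first exact: segment_connected.
by apply: continuous_subspaceT; exact: lerp_continuous.
Qed.

Lemma seg_closed x y : closed (seg x y).
Proof.
apply: compact_closed; first exact: norm_hausdorff.
apply: continuous_compact; last exact: segment_compact.
by apply: continuous_subspaceT; exact: lerp_continuous.
Qed.

Lemma frontier_notin D z : open D -> frontier D z -> ~ D z.
Proof. by move=> /interior_id oD [_]; rewrite oD. Qed.

(** Otherwise D would meet the connected segment in a set both open and closed in it, containing x
    but not y. *)
Lemma seg_crosses_frontier D x y : open D -> D x -> ~ D y -> exists2 t : R, 0 <= t <= 1 & frontier D (lerp x y t).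
Proof.
move=> oD Dx nDy; apply: contrapT => h.
have sx : seg x y x by exists 0; [rewrite /= in_itv /= lexx ler01|rewrite /lerp scale0r addr0].
have sy : seg x y y by exists 1; [rewrite /= in_itv /= lexx ler01|rewrite /lerp scale1r addrC subrK].
have E : seg x y `&` D = seg x y `&` closure D.
  apply/seteqP; split => z [sz Dz]; split => //; first exact: subset_closure.
  apply: contrapT => nDz; case: sz => t; rewrite /= in_itv /= => t01 tz; apply: h; exists t => //.
  by rewrite tz; split => //; rewrite (interior_id _).1.
have F : seg x y `&` D = seg x y.
  apply: (@seg_connected x y); [by exists x|by exists D|].
  by exists (closure D) => //; exact: closed_closure.
by move: sy; rewrite -F => -[].
Qed.

Lemma box_lerp z x y (r t : R) : 0 <= t <= 1 -> box z r x -> box z r y -> box z r (lerp x y t).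
Proof.
move=> /andP[t0 t1]; rewrite /box /= => xr yr.
have -> : lerp x y t - z = (1 - t) *: (x - z) + t *: (y - z).
  rewrite /lerp scalerBl scale1r !scalerBr opprB addrA -addrA.
  by apply: eq_pt => /=; ring.
apply: le_lt_trans (ler_normD _ _) _; rewrite !normrZ ger0_norm ?subr_ge0// (ger0_norm t0).
have [t_|t_] := leP t (1/2); nra.
Qed.

(** Off the line the box contains no frontier point, so each of its sides is inside or outside D.
    The far side is outside: a point of D slightly behind z would see y through z, which is not in
    D. A point of D on the line would have points of D behind it. One side is inside, as z is a
    frontier point. *)
Lemma one_sided D a b y z (r k : R) : open D -> frontier D z -> cr a b z = 0 -> 0 < r ->
  (forall x, box z r x -> frontier D x -> cr a b x = 0) ->
  (forall x, D x -> seg x y `<=` D) -> 0 < k * cr a b y ->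
  forall x, box z r x -> (D x <-> 0 < k * cr a b x).
Proof.
move=> oD fz cz r0 hf star ky.
have nDz := frontier_notin oD fz.
have bzz : box z r z by rewrite /box /= subrr normr0.
have same (s : R) x x' : box z r x -> box z r x' -> 0 < s * cr a b x -> 0 < s * cr a b x' -> D x -> D x'.
  move=> bx bx' sx sx' Dx; apply: contrapT => nDx'.
  have [t t01 /(hf _ (box_lerp t01 bx bx')) c0] := seg_crosses_frontier oD Dx nDx'.
  have := congr1 (fun w => s * w) c0; rewrite /= cr_lerp mulr0.
  move: t01 => /andP[t0 t1]; move: (cr a b x) (cr a b x') sx sx' => u v su sv.
  rewrite mulrDr !(mulrCA s); have [t2|t2] := leP t (1/2); nra.
(* [lerp x y (- s)] is a point just behind x as seen from y. *)
have back x (e : R) : 0 < e -> exists2 s : R, 0 < s & `|lerp x y (- s) - x| < e.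
  move=> e0; exists (e / (2 * (`|y - x| + 1))); first by rewrite divr_gt0// mulr_gt0// ltr_wpDl.
  rewrite /lerp addrAC subrr add0r normrZ normrN ger0_norm; last first.
    by rewrite divr_ge0 ?ltW// mulr_gt0// ltr_wpDl.
  rewrite mulrAC ltr_pdivrMr ?mulr_gt0 ?ltr_wpDl// ltr_pM2l//.
  by move: (normr_ge0 (y - x)); lra.
have neg x : box z r x -> k * cr a b x < 0 -> ~ D x.
  move=> bx kx Dx; have [s s0 bs] := back z r r0.
  have Dz' : D (lerp z y (- s)).
    apply: (same (- k) x) => //; first by rewrite mulNr oppr_gt0.
    by rewrite cr_lerp cz mulr0 add0r mulrA mulrNN -mulrA mulrCA mulr_gt0.
  apply: nDz; apply: (star _ Dz'); exists (s / (1 + s)).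
    by rewrite /= in_itv /= divr_ge0 ?addr_ge0 ?(ltW s0)//= ler_pdivrMr ?addr_gt0// mul1r lerDr.
  have sn : 1 + s != 0 by rewrite gt_eqF// addr_gt0.
  have comp (u v : R) : u + - s * (v - u) + s / (1 + s) * (v - (u + - s * (v - u))) = u by field; exact: sn.
  by apply: eq_pt; [exact: (comp z.1 y.1)|exact: (comp z.2 y.2)].
have zer x : box z r x -> cr a b x = 0 -> ~ D x.
  move=> bx c0 Dx.
  have [e1 e10 D1] := (openP_box _).1 oD _ Dx.
  have [e2 e20 D2] := (openP_box _).1 (@open_box R z r) _ bx.
  have e0 : 0 < Num.min e1 e2 by rewrite lt_min e10 e20.
  have [s s0] := back x _ e0; rewrite lt_min => /andP[b1 b2].
  apply: (neg (lerp x y (- s))); [exact: D2| |exact: D1].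
  by rewrite cr_lerp c0 mulr0 add0r mulNr mulrN oppr_lt0 mulrCA mulr_gt0.
have [x0 [Dx0 bx0]] : D `&` box z r !=set0.
  case: fz => cz' _; apply: cz'; exact: (open_nbhs_nbhs (conj (@open_box R z r) bzz)).
have k0 : k != 0 by apply: contraTneq ky => ->; rewrite mul0r ltxx.
have px0 : 0 < k * cr a b x0.
  have [//|h|h] := ltgtP; first by case: (neg x0 bx0 h).
  by case: (zer x0 bx0) => //; move/esym/eqP: h; rewrite mulf_eq0 (negPf k0) => /eqP.
move=> x bx; split=> [Dx|kx]; last exact: (same k x0).
have [//|h|h] := ltgtP; first by case: (neg x bx h).
by case: (zer x bx) => //; move/esym/eqP: h; rewrite mulf_eq0 (negPf k0) => /eqP.
Qed.

Lemma cr_ends a b : cr a b a = 0 /\ cr a b b = 0.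
Proof. by rewrite /cr; split; ring. Qed.

(** Half-open edges being disjoint, only the end point of edge j is left to exclude. It is the
    source of the next edge, which would have to be i, but an inner point of edge i is not its
    source. *)
Lemma edge_interior (E : polygon R) (i j : 'I_(nvert E)) t : is_polygon E -> edge_src i != edge_dst i ->
  0 < t < 1 -> edge j (lerp (edge_src i) (edge_dst i) t) -> j = i.
Proof.
move=> [_ _ tri _] ab /andP[t0 t1] [s]; rewrite /= in_itv /= => /andP[s0 s1] sz.
have hi : [set lerp (edge_src i) (edge_dst i) t | t in `[0, 1[] (lerp (edge_src i) (edge_dst i) t).
  by exists t => //; rewrite /= in_itv /= (ltW t0) t1.
have [s1'|s1'] := ltP s 1.
  apply: tri => //; exists (lerp (edge_src i) (edge_dst i) t); split => //.
  by rewrite -sz; exists s => //; rewrite /= in_itv /= s0 s1'.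
have se : s = 1 by apply/eqP; rewrite eq_le s1 s1'.
have zE : lerp (edge_src i) (edge_dst i) t = edge_src (ordS j).
  by rewrite -sz se /lerp scale1r addrC subrK.
have ji : ordS j = i.
  apply: tri => //; exists (lerp (edge_src i) (edge_dst i) t); split => //.
  by exists 0; [rewrite /= in_itv /= lexx ltr01|rewrite zE /lerp scale0r addr0].
case/eqP: ab; move: zE; rewrite ji /lerp -[RHS]addr0 => /addrI/eqP.
by rewrite scaler_eq0 gt_eqF//= subr_eq0 => /eqP.
Qed.

(** The sign k records the side on which the polygon lies, the same along the whole edge because it
    is that of a fixed point y of the ball, off the line. Inner points of the edge are handled by
    [one_sided]; compactness of [d, 1 - d] makes the radius uniform. *)
Lemma polygon_one_sided (E : polygon R) (i : 'I_(nvert E)) (r : R) : is_polygon E ->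
  star_shaped_ball (Defs.pset E) r -> 0 < r -> edge_src i != edge_dst i ->
  exists2 k : R, k ^+ 2 = 1 & forall d, 0 < d -> exists2 e : R, 0 < e &
    forall t x, d <= t <= 1 - d -> box (lerp (edge_src i) (edge_dst i) t) e x ->
      (Defs.pset E x <-> 0 < k * cr (edge_src i) (edge_dst i) x).
Proof.
move=> pE [c [cD star]] r0 ab; have [_ [oD _ _ _] _ fr] := pE.
set a := edge_src i in ab *; set b := edge_dst i in ab *.
have [y [yc cy]] : exists y, Defs.edist y c < r /\ cr a b y != 0.
  have [c0|c0] := eqVneq (cr a b c) 0; last first.
    by exists c; split => //; apply: edist_lt; rewrite subrr normr0 divr_gt0.
  (* If the centre of the ball lies on the line, it is moved a little along the normal v. *)
  pose v : pt := (b.2 - a.2, - (b.1 - a.1)).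
  pose e := r / (4 * (`|v| + 1)).
  have e0 : 0 < e by rewrite divr_gt0// mulr_gt0// ltr_wpDl.
  exists (c + e *: v); split.
    apply: edist_lt; rewrite addrC addKr normrZ gtr0_norm// /e mulrAC ltr_pdivrMr ?mulr_gt0 ?ltr_wpDl//.
    by move: (normr_ge0 v); nra.
  have -> : cr a b (c + e *: v) = cr a b c + e * ((b.1 - a.1) ^+ 2 + (b.2 - a.2) ^+ 2).
    by rewrite /cr -[(c + e *: v).1]/(c.1 + e * (b.2 - a.2)) -[(c + e *: v).2]/(c.2 + e * - (b.1 - a.1)); ring.
  rewrite c0 add0r mulf_neq0 ?(gt_eqF e0)// paddr_eq0 ?sqr_ge0// !sqrf_eq0 !subr_eq0.
  by apply: contra ab => /andP[/eqP h1 /eqP h2]; apply/eqP; apply: eq_pt; rewrite ?h1 ?h2.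
pose k : R := if 0 < cr a b y then 1 else -1.
have ky : 0 < k * cr a b y.
  rewrite /k; case: ifPn => [h|]; first by rewrite mul1r.
  by rewrite -leNgt mulN1r oppr_gt0 lt_neqAle cy.
exists k; first by rewrite /k; case: ifP => _; rewrite ?expr1n// sqrrN expr1n.
have loc t : 0 < t < 1 -> exists2 e : R, 0 < e & forall x, box (lerp a b t) e x -> (Defs.pset E x <-> 0 < k * cr a b x).
  move=> t01; set z := lerp a b t.
  have : \forall x \near z, forall j, j != i -> ~ edge j x.
    apply: (filter_forall (f := fun j x => j != i -> ~ edge j x) (F := nbhs z)) => j; have [->|ji] := eqVneq j i; first by apply: nearW.
    have : nbhs z (~` edge j).
      apply: open_nbhs_nbhs; split; first by rewrite openC; exact: seg_closed.
      by move=> /(edge_interior pE ab t01)/eqP; rewrite (negPf ji).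
    by apply: filterS => x h _.
  move=> /nbhs_ballP[e /= e0 he]; exists e => // x bx.
  apply: (one_sided oD _ _ e0 _ _ ky bx).
  - by rewrite fr; exists i => //; exists t => //; rewrite /= in_itv /=; case/andP: t01 => /ltW -> /ltW ->.
  - by rewrite /z cr_lerp; have [-> ->] := cr_ends a b; rewrite !mulr0 addr0.
  - move=> w bw; rewrite fr => -[j _ jw].
    have [ji|ji] := eqVneq j i.
      by move: jw; rewrite ji => -[s _ <-]; rewrite cr_lerp; have [-> ->] := cr_ends a b; rewrite !mulr0 addr0.
    by case: (he w _ j ji jw); rewrite -ball_normE /= distrC.
  - by move=> w Dw; apply: star.
move=> d d0.
have := (compact_near_coveringP `[d, 1 - d]%classic).1 (@segment_compact R d (1 - d)).
move=> /(_ R 0^'+ (fun e t => forall x, box (lerp a b t) e x -> (Defs.pset E x <-> 0 < k * cr a b x))).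
case.
  move=> t; rewrite /= in_itv /= => /andP[dt td].
  have t01 : 0 < t < 1 by rewrite (lt_le_trans d0 dt) (le_lt_trans td)// ltrBlDr ltrDl.
  have [e e0 he] := loc t t01.
  have /cvgrPdist_lt/(_ _ (divr_gt0 e0 (ltr0n R 2))) C := @lerp_continuous a b t.
  near=> t' e'.
  have h1 : e' < e / 2 by near: e'; apply: nbhs_right_lt; rewrite divr_gt0.
  have h2 : `|lerp a b t' - lerp a b t| < e / 2.
    by rewrite distrC; near: t'; exact: C.
  move=> x bx; apply: he; rewrite /box /=.
  rewrite (_ : x - _ = (x - lerp a b t') + (lerp a b t' - lerp a b t)); last by rewrite addrA subrK.
  apply: le_lt_trans (ler_normD _ _) _; rewrite (splitr e); apply: ltrD h2.
  exact: (lt_trans bx h1).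
move=> e /= e0 he; exists (e / 2); first by rewrite divr_gt0.
move=> t x dt; apply: (he (e / 2)) => //=; last by rewrite divr_gt0.
by rewrite sub0r normrN gtr0_norm ?divr_gt0// ltr_pdivrMr// ltr_pMr//; lra.
Unshelve. all: by end_near.
Qed.

End OneSided.

(** * The divergence theorem in a half-plane *)

Section Green.
Set Implicit Arguments.
Unset Strict Implicit.
Context {R : realType}.
Notation pt := (R * R)%type.
Notation T1 := (measurableTypeR R).
Implicit Types (f g h u : pt -> R) (D H : set pt) (a b e x y z : pt).

Lemma line_is_derive f x e (d : R) : is_derive (0 : R) 1 (fun s : R => f (x + s *: e)) d -> is_derive x e f d.
Proof.
move=> [du dE].
have E (h : R) : f (h *: e + x) = f (x + (h *: 1 + 0) *: e).
  by rewrite addrC addr0 [h *: 1]mulr1.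
have E0 : f (x + (0 : R) *: e) = f x by rewrite scale0r addr0.
have EE : (fun h : R => h^-1 *: ((f \o shift x) (h *: e) - f x)) =
    (fun h : R => h^-1 *: (((fun s : R => f (x + s *: e)) \o shift 0) (h *: 1) - f (x + (0 : R) *: e))).
  by apply/funext => h /=; rewrite E E0.
by split; rewrite ?/derivable ?/derive EE.
Qed.

(** The chain rule is wanted for functions with directional derivatives only, so it is reduced to
    one variable on the line through x. *)
Lemma is_derive_comp_line (F : R -> R) (F' : R) f x e : derivable f x e -> is_derive (f x) 1 F F' ->
  is_derive x e (fun y => F (f y)) (F' * 'D_e f x).
Proof.
move=> df dF; apply: line_is_derive.
have x0 : x + (0 : R) *: e = x by rewrite scale0r addr0.
have df0 : derivable f (x + (0 : R) *: e) e by rewrite x0.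
have := is_derive_line df0; rewrite x0 => dl.
have dF0 : is_derive (f (x + (0 : R) *: e)) 1 F F' by rewrite x0.
exact: (is_derive1_comp (g := fun s : R => f (x + s *: e)) dF0 dl).
Qed.

Lemma c1_comp (F F' : R -> R) f : c1 f -> (forall t : R, is_derive t 1 F (F' t)) -> continuous F' ->
  [/\ c1 (fun x => F (f x)), dx1 (fun x => F (f x)) = (fun x => F' (f x) * dx1 f x) &
      dx2 (fun x => F (f x)) = (fun x => F' (f x) * dx2 f x)].
Proof.
move=> [cf d1 c1f d2 c2f] dF cF'.
have i1 x := is_derive_comp_line (d1 x) (dF (f x)).
have i2 x := is_derive_comp_line (d2 x) (dF (f x)).
have E1 : dx1 (fun x => F (f x)) = (fun x => F' (f x) * dx1 f x).
  by apply: funext => x; have [_ h] := i1 x; exact: h.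
have E2 : dx2 (fun x => F (f x)) = (fun x => F' (f x) * dx2 f x).
  by apply: funext => x; have [_ h] := i2 x; exact: h.
have cF : continuous F.
  move=> t; apply: differentiable_continuous; apply/derivable1_diffP; by have [] := dF t.
split; [split|exact: E1|exact: E2].
- by move=> x; apply: continuous_comp; [exact: cf|exact: cF].
- by move=> x; have [] := i1 x.
- by rewrite E1 => x; apply: cvgM; [apply: continuous_comp; [exact: cf|exact: cF']|exact: c1f].
- by move=> x; have [] := i2 x.
- by rewrite E2 => x; apply: cvgM; [apply: continuous_comp; [exact: cf|exact: cF']|exact: c2f].
Qed.

(** Vanishing near the frontier makes the cut-off at D invisible: the extension by zero is still
    C^1, and its derivatives will have integral zero. *)
Lemma zero_extension D h : open D -> c1 h -> (forall x, frontier D x -> \forall y \near x, h y = 0) ->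
  [/\ c1 (h \_ D), dx1 (h \_ D) = (dx1 h) \_ D & dx2 (h \_ D) = (dx2 h) \_ D].
Proof.
move=> oD [ch d1 c1h d2 c2h] fr.
have loc (g : pt -> R) : (forall x, frontier D x -> \forall y \near x, g y = 0) ->
    forall x, (\forall y \near x, (g \_ D) y = g y) /\ D x \/ (\forall y \near x, (g \_ D) y = 0) /\ ~ D x.
  move=> g0 x; have [Dx|nDx] := pselect (D x).
    left; split => //; have : nbhs x D by apply: open_nbhs_nbhs.
    by apply: filterS => y Dy; rewrite patchE mem_set.
  right; split => //; have [cx|ncx] := pselect (closure D x).
    have : frontier D x by split => //; rewrite (interior_id _).1.
    by move/g0; apply: filterS => y gy; rewrite patchE; case: ifP.
  have : nbhs x (~` closure D) by apply: open_nbhs_nbhs; split => //; rewrite openC; exact: closed_closure.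
  by apply: filterS => y ncy; rewrite patchE memNset// => /subset_closure.
have cont (g : pt -> R) : continuous g -> (forall x, frontier D x -> \forall y \near x, g y = 0) -> continuous (g \_ D).
  move=> cg g0 x; have [[E Dx]|[E nDx]] := loc g g0 x.
    rewrite /continuous_at (nbhs_singleton E).
    apply: cvg_trans (cg x); apply: near_eq_cvg; by apply: filterS E => y ->.
  rewrite /continuous_at (nbhs_singleton E).
  apply: (@cvg_trans _ ((fun=> 0 : R) @ nbhs x)); last exact: cvg_cst.
  by apply: near_eq_cvg; apply: filterS E => y ->.
have dfr (v : pt) x : frontier D x -> \forall y \near x, 'D_v h y = 0.
  move=> /fr/near_join; apply: filterS => y; exact: derive_zero_near.
have der (v : pt) : (forall x, derivable h x v) ->
    (forall x, derivable (h \_ D) x v) /\ 'D_v (h \_ D) = ('D_v h) \_ D.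
  move=> dh; have dl x : is_derive x v (h \_ D) ((('D_v h) \_ D) x).
    have [[E Dx]|[E nDx]] := loc h fr x.
      rewrite patchE mem_set//; apply: (@near_eq_is_derive _ _ _ h); last by apply: DeriveDef.
      by apply: filterS E => y ->.
    have -> : (('D_v h) \_ D) x = 0 by rewrite patchE memNset.
    have d0 := @is_derive_cst R _ _ (0 : R) x v.
    by apply: (near_eq_is_derive _ d0); apply: filterS E => y ->.
  by split => [x|]; [have [] := dl x|apply: funext => x; have [_ ->] := dl x].
have [e1 E1] := der (1, 0) d1; have [e2 E2] := der (0, 1) d2.
split; [split|exact: E1|exact: E2].
- exact: cont.
- exact: e1.
- by rewrite (E1 : dx1 (h \_ D) = _); exact: (cont _ c1h (dfr (1, 0))).
- exact: e2.
- by rewrite (E2 : dx2 (h \_ D) = _); exact: (cont _ c2h (dfr (0, 1))).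
Qed.

(** Substitution is used on a segment, for a monotone map: P is so large that c + m t leaves the
    support of phi for |t| > P, and the two signs of m are treated apart. *)
Lemma integral_affine (phi : R -> R) (c m B : R) : continuous phi -> m != 0 ->
  (forall s, B <= `|s| -> phi s = 0) ->
  (\int[mu1]_s (phi s)%:E = \int[mu1]_t (phi (c + m * t) * `|m|)%:E)%E.
Proof.
move=> cphi m0 phi0; pose F (t : R) := c + m * t.
pose P := (`|B| + 1 + `|c|) / `|m|.
have mp : 0 < `|m| by rewrite normr_gt0.
have P0 : 0 < P by rewrite divr_gt0// ltr_wpDr// ltr_wpDl.
have mP : `|m| * P = `|B| + 1 + `|c| by rewrite /P mulrC divfK// gt_eqF.
have dF (t : R) : is_derive t (1 : R) F m.
  have h : is_derive t (1 : R) (fun t : R => c + m *: t) (0 + m *: 1) by exact: is_deriveD.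
  by apply: is_derive_eq h _; rewrite add0r [m *: 1]mulr1.
have F1 : (F^`())%classic = cst m by apply: funext => t; rewrite derive1E; have [_ ->] := dF t.
have cF : continuous F.
  by move=> t; apply: differentiable_continuous; apply/derivable1_diffP; have [] := dF t.
have doo : derivable_oo_LRcontinuous F (- P) P.
  split; first by move=> t _; have [] := dF t.
    by apply: cvg_at_right_filter; exact: cF.
  by apply: cvg_at_left_filter; exact: cF.
have PP : - P <= P by rewrite ge0_cp ?ltW.
have cst1 (t : R) (S : set_system R) (FS : Filter S) : cvg ((F^`())%classic x @[x --> S]) by rewrite F1; exact: is_cvg_cst.
have sup t : ~~ (- P <= t <= P) -> phi (c + m * t) * `|m| = 0.
  rewrite -ler_norml -ltNge => tP; rewrite phi0 ?mul0r//.
  have : `|m * t| <= `|c + m * t| + `|c|.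
    by rewrite -{1}(addKr c (m * t)) addrC (le_trans (ler_normB _ _))// addrC.
  have : `|m| * P < `|m * t| by rewrite normrM ltr_pM2l.
  by rewrite mP; have := ler_norm B; lra.
rewrite [RHS](integral_itv_support (p := - P) (q := P))//.
have := ler_norm c; have := ler_norm (- c); rewrite normrN => c1 c2.
have := ler_norm B => B1.
have [mgt|mlt] := ltP 0 m.
- have mE : `|m| = m by rewrite gtr0_norm.
  rewrite (integral_itv_support (p := F (- P)) (q := F P)); last first.
    move=> s; rewrite /F mulrN -mE mP negb_and -!ltNge => /orP[h|h]; apply: phi0.
      by have := ler_norm (- s); rewrite normrN; lra.
    by have := ler_norm s; lra.
  rewrite [LHS](@integration_by_substitution_increasing R F phi (- P) P PP).
  + by apply: eq_integral => t _; rewrite /= F1 /= mE.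
  + by move=> s t _ _ st; rewrite /F ltrD2l ltr_pM2l.
  + by move=> t _; rewrite F1; exact: cst_continuous.
  + exact: cst1.
  + exact: cst1.
  + exact: doo.
  + by apply: continuous_subspaceT.
have mlt' : m < 0 by rewrite lt_neqAle m0.
have mE : `|m| = - m by rewrite ltr0_norm.
rewrite (integral_itv_support (p := F P) (q := F (- P))); last first.
  move=> s; rewrite /F mulrN -(opprK (m * P)) -mulNr -mE mP negb_and -!ltNge opprK => /orP[h|h]; apply: phi0.
    by have := ler_norm (- s); rewrite normrN; lra.
  by have := ler_norm s; lra.
rewrite [LHS](@integration_by_substitution_decreasing R F phi (- P) P PP).
- by apply: eq_integral => t _; rewrite /= F1 /= mE.
- by move=> s t _ _ st; rewrite /F ltrD2l ltr_nM2l.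
- by move=> t _; rewrite F1; exact: cst_continuous.
- exact: cst1.
- exact: cst1.
- exact: doo.
- by apply: continuous_subspaceT.
Qed.

Lemma cr_continuous a b : continuous (cr a b).
Proof.
move=> x; apply: cvgB; apply: cvgM; try exact: cvg_cst; apply: cvgB; try exact: cvg_cst.
- exact: cvg_fst.
- exact: cvg_snd.
Qed.

Lemma open_side a b (k : R) : open [set x | 0 < k * cr a b x].
Proof.
rewrite (_ : [set _ | _] = (fun x => k * cr a b x) @^-1` [set t | 0 < t]); last by [].
apply: open_comp; last exact: open_gt.
by move=> x _; apply: cvgM; [exact: cvg_cst|exact: cr_continuous].
Qed.

(** The row at height s meets the half-plane in a half-line that ends at X on the edge line; the
    sign of k (b.2 - a.2) tells to which side it extends, and g vanishes far out. *)
Lemma slice1_halfplane (B : R) g a b (k s : R) : c1 g -> vanish B g -> b.2 - a.2 != 0 -> k ^+ 2 = 1 ->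
  let X := a.1 + (s - a.2) * (b.1 - a.1) / (b.2 - a.2) in
  (\int[mu1]_t (((dx1 g) \_ [set x | 0 < k * cr a b x]) (t, s))%:E =
   (- (k * (b.2 - a.2) / `|b.2 - a.2|) * g (X, s))%:E)%E.
Proof.
move=> [cg d1 c1g _ _] gB m0 k1 X; set m := b.2 - a.2 in m0 *.
have crE t : cr a b (t, s) = m * (t - X) by rewrite /cr /X /= -/m; field.
have vB := vanish_derive (1, 0) gB.
pose M := `|X| + `|B| + 1.
have MB : B + 1 <= M by rewrite /M; have := ler_norm B; have := normr_ge0 X; lra.
have XM : X <= M by rewrite /M; have := ler_norm X; have := normr_ge0 B; lra.
have XN : - M <= X by rewrite /M; have := ler_norm (- X); rewrite normrN; have := normr_ge0 B; lra.
have big t : M <= `|t| -> M <= `|(t, s) : pt| by move=> h; rewrite prod_normE /= le_max h.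
have d0 t : M <= `|t| -> dx1 g (t, s) = 0.
  by move=> /big h; apply: vB; apply: le_trans h.
have g0 t : M <= `|t| -> g (t, s) = 0.
  by move=> /big h; apply: gB; apply: le_trans h; move: MB; lra.
have M0 : 0 <= M by rewrite /M !addr_ge0.
have gM : g (M, s) = 0 by apply: g0; rewrite ger0_norm.
have gN : g (- M, s) = 0 by apply: g0; rewrite normrN ger0_norm.
have msl : measurable_fun setT (fun t : T1 => dx1 g (t, s)).
  by apply: continuous_measurable_fun; exact: continuous_slice1.
have mE A : measurable_fun A (fun t : T1 => (dx1 g (t, s))%:E).
  by apply/measurable_EFinP; apply: measurable_funTS.
have k2 : k = 1 \/ k = -1.
  have /eqP : (k - 1) * (k + 1) = 0 by rewrite -subr_sqr k1 expr1n subrr.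
  by rewrite mulf_eq0 subr_eq0 addr_eq0 => /orP[/eqP|/eqP]; [left|right].
have [km|km] : 0 < k * m \/ k * m < 0.
  have : k * m != 0 by rewrite mulf_neq0//; case: k2 => ->; rewrite ?oppr_eq0 oner_neq0.
  by case: (ltgtP (k * m) 0) => // h _; [right|left].
- have -> : k * m / `|m| = 1.
    have : `|k * m| = `|m| by rewrite normrM; case: k2 => ->; rewrite ?normrN normr1 mul1r.
    by rewrite (gtr0_norm km) => ->; rewrite divff// normr_eq0.
  transitivity (\int[mu1]_(t in `]X, M]) (dx1 g (t, s))%:E)%E.
    rewrite [RHS]integral_mkcond; apply: eq_integral => t _.
    have tX : (0 < k * cr a b (t, s)) = (X < t) by rewrite crE mulrA pmulr_rgt0// subr_gt0.
    rewrite !patchE; have [Xt|Xt] := ltP X t; last first.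
      rewrite memNset; last by rewrite /= tX ltNge Xt.
      by rewrite memNset//= in_itv /= ltNge Xt.
    rewrite mem_set; last by rewrite /= tX.
    have [tM|tM] := leP t M; first by rewrite mem_set//= in_itv /= Xt tM.
    rewrite memNset; last by rewrite /= in_itv /= leNgt tM andbF.
    by rewrite d0//; apply: le_trans (ltW tM) (ler_norm _).
  rewrite (integral_itv_obnd_cbnd (mE _)) (slice1_FTC s XM d1 c1g) gM sub0r.
  by rewrite mulN1r.
have -> : k * m / `|m| = - 1.
  have : `|k * m| = `|m| by rewrite normrM; case: k2 => ->; rewrite ?normrN normr1 mul1r.
  by rewrite (ltr0_norm km) => <-; rewrite invrN mulrN divff// (lt_eqF km).
transitivity (\int[mu1]_(t in `[(- M)%R, X[) (dx1 g (t, s))%:E)%E.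
  rewrite [RHS]integral_mkcond; apply: eq_integral => t _.
  have tX : (0 < k * cr a b (t, s)) = (t < X) by rewrite crE mulrA nmulr_rgt0// subr_lt0.
  rewrite !patchE; have [Xt|Xt] := ltP t X; last first.
    rewrite memNset; last by rewrite /= tX ltNge Xt.
    by rewrite memNset//= in_itv /= (ltNge t) Xt andbF.
  rewrite mem_set; last by rewrite /= tX.
  have [tM|tM] := leP (- M) t; first by rewrite mem_set//= in_itv /= Xt tM.
  rewrite memNset; last by rewrite /= in_itv /= leNgt tM.
  by rewrite d0//; rewrite -normrN; apply: le_trans (ler_norm _); lra.
rewrite (integral_itv_bndo_bndc (mE _)) (slice1_FTC s XN d1 c1g) gN subr0.
by rewrite opprK mul1r.
Qed.

Lemma side_continuous_line a b (c d : R) : continuous (fun s : R => (a.1 + (s - c) * d, s) : pt).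
Proof.
apply: (lipschitz_cont (L := `|d| + 1)) => s t.
rewrite prod_normE /= ge_max; apply/andP; split.
  rewrite (_ : a.1 + (s - c) * d - (a.1 + (t - c) * d) = d * (s - t)); last by ring.
  by rewrite normrM ler_wpM2r// lerDl.
by rewrite -[leLHS]mul1r ler_wpM2r// lerDr.
Qed.

(** The row integrals are summed over s, which is then parametrised by the height of [lerp a b t].
    For a horizontal edge the normal has no first component, and both sides are zero. *)
Theorem halfplane1 (B : R) g a b (k : R) : c1 g -> vanish B g -> k ^+ 2 = 1 ->
  ((Int ((dx1 g) \_ [set x | 0 < k * cr a b x]))%:E =
   \int[mu1]_t (- (k * (b.2 - a.2)) * g (lerp a b t))%:E)%E.
Proof.
move=> cg gB k1; have [cg0 d1 c1g _ _] := cg.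
have vB := vanish_derive (1, 0) gB.
have mH := mble_open (@open_side a b k).
rewrite (Int_fubini1 (itg_patch mH (vanish_itg c1g vB))).
have [m0|m0] := eqVneq (b.2 - a.2) 0.
  rewrite [LHS]integral0_eq; last first.
    move=> s _; have crE t : cr a b (t, s) = - ((s - a.2) * (b.1 - a.1)) by rewrite /cr /= m0; ring.
    have [h|h] := boolP (0 < k * - ((s - a.2) * (b.1 - a.1))); last first.
      by apply: integral0_eq => t _; rewrite patchE memNset//= crE; exact/negP.
    transitivity (\int[mu1]_t (dx1 g (t, s))%:E)%E.
      by apply: eq_integral => t _; rewrite patchE mem_set//= crE.
    pose M := `|B| + 1; have MB : B + 1 <= M by rewrite /M lerD2r ler_norm.
    have M0 : 0 <= M by rewrite addr_ge0.
    have big t : M <= `|t| -> B + 1 <= `|(t, s) : pt| by move=> tM; rewrite prod_normE /= le_max (le_trans MB tM).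
    rewrite (integral_itv_support (p := - M) (q := M)); last first.
      by move=> t; rewrite -ler_norml -ltNge => /ltW/big; exact: vB.
    rewrite (slice1_FTC s _ d1 c1g); last by rewrite ge0_cp.
    have BB t : M <= `|t| -> g (t, s) = 0 by move=> /big h'; apply: gB; apply: le_trans h'; rewrite lerDl.
    by rewrite !BB ?subrr// ?normrN ger0_norm.
  rewrite m0; rewrite integral0_eq// => t _; by rewrite mulr0 oppr0 mul0r.
pose X (s : R) := a.1 + (s - a.2) * ((b.1 - a.1) / (b.2 - a.2)).
transitivity (\int[mu1]_s (- (k * (b.2 - a.2) / `|b.2 - a.2|) * g (X s, s))%:E)%E.
  by apply: eq_integral => s _; rewrite (slice1_halfplane s cg gB m0 k1) /X mulrA.
rewrite (@integral_affine (fun s => - (k * (b.2 - a.2) / `|b.2 - a.2|) * g (X s, s)) a.2 (b.2 - a.2) B)//.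
- apply: eq_integral => t _; congr EFin; rewrite mulrAC mulNr divfK ?normr_eq0//.
  rewrite -mulNr; congr (_ * g _); apply: eq_pt; last by rewrite (mulrC _ t).
  by rewrite /X /= -[RHS]/(a.1 + t * (b.1 - a.1)); field.
- move=> s; apply: cvgM; first exact: cvg_cst.
  by apply: (@continuous_comp _ _ _ (fun s : R => (X s, s)) g); [exact: side_continuous_line|exact: cg0].
- by move=> s Bs; rewrite gB ?mulr0// prod_normE /= le_max Bs orbT.
Qed.

Definition swap x : pt := (x.2, x.1).

Lemma c1_swap g : c1 g -> c1 (fun x => g (swap x)) /\
  dx1 (fun x => g (swap x)) = (fun x => dx2 g (swap x)).
Proof.
move=> [cg d1 c1g d2 c2g].
have cs : continuous swap.
  apply: (lipschitz_cont (L := 1)) => x y; rewrite mul1r [leLHS]prod_normE [leRHS]prod_normE /= ge_max.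
  by rewrite !le_max !lexx orbT.
have E1 : dx1 (fun x => g (swap x)) = (fun x => dx2 g (swap x)) by [].
have E2 : dx2 (fun x => g (swap x)) = (fun x => dx1 g (swap x)) by [].
split; [split|exact: E1].
- by move=> x; apply: continuous_comp; [exact: cs|exact: cg].
- by move=> x; exact: (d2 (swap x)).
- by rewrite E1 => x; apply: continuous_comp; [exact: cs|exact: c2g].
- by move=> x; exact: (d1 (swap x)).
- by rewrite E2 => x; apply: continuous_comp; [exact: cs|exact: c1g].
Qed.

Lemma Int_swap_vars f : itg f -> itg (fun x => f (swap x)) -> Int (fun x => f (swap x)) = Int f.
Proof. by move=> i1 i2; apply: EFin_inj; rewrite (Int_fubini2 i2) (Int_fubini1 i1). Qed.

(** Exchanging the coordinates reduces it to the other component; the exchange reverses orientation,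
    hence - k. *)
Theorem halfplane2 (B : R) g a b (k : R) : c1 g -> vanish B g -> k ^+ 2 = 1 ->
  ((Int ((dx2 g) \_ [set x | 0 < k * cr a b x]))%:E =
   \int[mu1]_t (k * (b.1 - a.1) * g (lerp a b t))%:E)%E.
Proof.
move=> cg gB k1; have [cg' E1] := c1_swap cg.
have gB' : vanish B (fun x => g (swap x)).
  move=> x; rewrite prod_normE => xB; apply: gB; rewrite prod_normE /=; by rewrite maxC.
have k1' : (- k) ^+ 2 = 1 by rewrite sqrrN.
have hp := halfplane1 (swap a) (swap b) cg' gB' k1'.
have E : (fun x => ((dx2 g) \_ [set x | 0 < k * cr a b x]) (swap x)) =
   (dx1 (fun x => g (swap x))) \_ [set x | 0 < - k * cr (swap a) (swap b) x].
  apply: funext => x; rewrite !patchE E1.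
  have -> : (x \in [set x | 0 < - k * cr (swap a) (swap b) x]) = (swap x \in [set x | 0 < k * cr a b x]).
    apply/idP/idP; rewrite !inE /= /cr /=;
    by rewrite (_ : - k * _ = k * ((x.2 - a.1) * (b.2 - a.2) - (x.1 - a.2) * (b.1 - a.1)))//; ring.
  by [].
have [_ _ c1g _ c2g] := cg; have [_ _ c1g' _ _] := cg'.
have i1 := itg_patch (mble_open (@open_side a b k)) (vanish_itg c2g (vanish_derive (0, 1) gB)).
have i2 := itg_patch (mble_open (@open_side (swap a) (swap b) (- k))) (vanish_itg c1g' (vanish_derive (1, 0) gB')).
rewrite -(Int_swap_vars i1); last by rewrite E.
rewrite E hp; apply: eq_integral => t _; congr EFin.
by rewrite -mulNr opprK.
Qed.

End Green.

(* trunc n s tends to s and vanishes for n.+1 * s^2 <= 1; dtrunc n is its derivative, which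
   tends to the indicator of s != 0. *)
Definition trunc {R : realType} (n : nat) (s : R) : R := s * flat 0 (n.+1%:R * s ^+ 2 - 1).
Definition dtrunc {R : realType} (n : nat) (s : R) : R :=
  flat 0 (n.+1%:R * s ^+ 2 - 1) + 2 * (n.+1%:R * s ^+ 2) * flat 2 (n.+1%:R * s ^+ 2 - 1).

Section Truncation.
Set Implicit Arguments.
Unset Strict Implicit.
Context {R : realType}.
Notation pt := (R * R)%type.
Implicit Types (f g h u : pt -> R) (x y z : pt).

Lemma is_derive_trunc n (s : R) : is_derive s 1 (trunc n) (dtrunc n s).
Proof.
pose q (s : R) := n.+1%:R * s ^+ 2 - 1.
have dq : is_derive s (1 : R) q (2 * n.+1%:R * s).
  have h : is_derive s (1 : R) (fun s : R => n.+1%:R *: (s * s) - 1) (n.+1%:R *: (s *: 1 + s *: 1) - 0).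
    apply: is_deriveB; apply: is_deriveZ; exact: is_deriveM.
  rewrite (_ : q = (fun s : R => n.+1%:R *: (s * s) - 1)); last by apply: funext => t; rewrite /q expr2.
  apply: is_derive_eq h _; rewrite -[LHS]/(n.+1%:R * (s * 1 + s * 1) - 0); ring.
have df : is_derive s (1 : R) (fun t => flat 0 (q t)) ((flat 2 (q s) - 0%:R * flat 1 (q s)) * (2 * n.+1%:R * s)).
  exact: (is_derive1_comp (is_derive_flat 0 (q s)) dq).
have h : is_derive s (1 : R) (fun t : R => t * flat 0 (q t))
    (s *: ((flat 2 (q s) - 0%:R * flat 1 (q s)) * (2 * n.+1%:R * s)) + flat 0 (q s) *: 1).
  exact: is_deriveM.
apply: is_derive_eq h _; rewrite -[LHS]/(s * ((flat 2 (q s) - 0 * flat 1 (q s)) * (2 * n.+1%:R * s)) + flat 0 (q s) * 1).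
by rewrite /dtrunc -/(q s); move: (flat 2 _) (flat 1 _) (flat 0 _) => u v w; ring.
Qed.

Lemma flat_continuous n : continuous (flat n : R -> R).
Proof.
by move=> t; apply: differentiable_continuous; apply/derivable1_diffP; have [] := is_derive_flat n t.
Qed.

Lemma dtrunc_continuous n : continuous (dtrunc n : R -> R).
Proof.
move=> s; have cq : (fun s : R => n.+1%:R * s ^+ 2) t @[t --> s] --> n.+1%:R * s ^+ 2.
  by apply: cvgM; [exact: cvg_cst|apply: cvgM; exact: cvg_id].
have cq1 : (fun s : R => n.+1%:R * s ^+ 2 - 1) t @[t --> s] --> n.+1%:R * s ^+ 2 - 1.
  by apply: cvgB => //; exact: cvg_cst.
have cf m : (fun s : R => flat m (n.+1%:R * s ^+ 2 - 1)) t @[t --> s] --> flat m (n.+1%:R * s ^+ 2 - 1).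
  exact: (@continuous_comp _ _ _ (fun s : R => n.+1%:R * s ^+ 2 - 1) (flat m) s cq1 (@flat_continuous m _)).
apply: cvgD; first exact: cf.
by apply: cvgM; last exact: cf; apply: cvgM; [exact: cvg_cst|exact: cq].
Qed.

Lemma flat0_le1 (t : R) : flat 0 t <= 1.
Proof.
rewrite /flat; case: ifP => // t0; rewrite expr0 mul1r -expR0 ler_expR oppr_le0 invr_ge0; exact: ltW.
Qed.

Lemma flat0_ge (t : R) : 0 < t -> 1 - t^-1 <= flat 0 t.
Proof. by move=> t0; rewrite /flat t0 expr0 mul1r; exact: expR_ge1Dx. Qed.

(** With w = 1 / t the claim is (w + w^2) e^-w <= 4, a consequence of e^w >= (1 + w / 2)^2. It
    bounds [dtrunc] uniformly in n. *)
Lemma flat2_le (t : R) : 0 < t -> (t + 1) * flat 2 t <= 4.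
Proof.
move=> t0; rewrite /flat t0; set w := t^-1.
have w0 : 0 < w by rewrite invr_gt0.
have -> : (t + 1) * (w ^+ 2 * expR (- w)) = (w + w ^+ 2) * expR (- w).
  by rewrite mulrA; congr (_ * _); rewrite /w; field; rewrite gt_eqF.
rewrite expRN ler_pdivrMr ?expR_gt0//.
have h : (1 + w / 2) ^+ 2 <= expR w.
  rewrite (_ : expR w = expR (w / 2) ^+ 2); last by rewrite expr2 -expRD -splitr.
  rewrite lerXn2r ?nnegrE ?expR_ge0 ?addr_ge0 ?divr_ge0 ?(ltW w0)//; exact: expR_ge1Dx.
by move: h; rewrite !expr2; nra.
Qed.

Lemma flat2_le' (t : R) : 1 <= t -> (t + 1) * flat 2 t <= 2 / t.
Proof.
move=> t1; have t0 : 0 < t by apply: lt_le_trans t1.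
rewrite /flat t0 mulrA; have e1 : expR (- t^-1) <= 1 by rewrite -expR0 ler_expR oppr_le0 invr_ge0 ltW.
have A0 : 0 <= (t + 1) * t^-1 ^+ 2 by rewrite mulr_ge0 ?sqr_ge0// addr_ge0 ?(ltW t0).
apply: le_trans (ler_wpM2l A0 e1) _; rewrite mulr1 expr2 mulrA ler_wpM2r ?invr_ge0 ?(ltW t0)//.
by rewrite ler_pdivrMr//; lra.
Qed.

Lemma trunc_norm n (s : R) : `|trunc n s| <= `|s|.
Proof.
by rewrite normrM ler_piMr// ger0_norm ?flat_ge0// flat0_le1.
Qed.

Lemma trunc_eq0 n (s : R) : n.+1%:R * s ^+ 2 <= 1 -> trunc n s = 0.
Proof. by move=> h; rewrite /trunc flat_le0 ?mulr0// subr_le0. Qed.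

Lemma dtrunc_bound n (s : R) : `|dtrunc n s| <= 9.
Proof.
rewrite /dtrunc; set Q := n.+1%:R * s ^+ 2; have Q0 : 0 <= Q by rewrite mulr_ge0 ?sqr_ge0.
have f2 := flat_ge0 2 (Q - 1); have f0 := flat_ge0 0 (Q - 1); have f1 := flat0_le1 (Q - 1).
rewrite ger0_norm; last by rewrite addr_ge0// mulr_ge0// mulr_ge0.
have [h|h] := leP (Q - 1) 0; first by rewrite !flat_le0// mulr0 addr0.
by have := flat2_le h; rewrite subrK -(mulrA 2); lra.
Qed.

(** With Q = (n + 1) s^2 the errors are of order 1 / Q: for Q <= 2 the uniform bounds are enough
    since 1 <= 2 / Q, and beyond that the behaviour of [flat] at infinity decides. *)
Lemma trunc_near n (s : R) : s != 0 -> `|trunc n s - s| <= 2 / `|s| / n.+1%:R /\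
  `|dtrunc n s - 1| <= 20 / s ^+ 2 / n.+1%:R.
Proof.
move=> s0; set N : R := n.+1%:R; have N0 : 0 < N by rewrite ltr0n.
have s2 : 0 < s ^+ 2 by rewrite exprn_even_gt0.
have sp : 0 < `|s| by rewrite normr_gt0.
have E1 : `|trunc n s - s| = `|s| * (1 - flat 0 (N * s ^+ 2 - 1)).
  rewrite /trunc (_ : _ - s = - (s * (1 - flat 0 (N * s ^+ 2 - 1)))); last by rewrite /N; ring.
  by rewrite normrN normrM; congr (_ * _); rewrite ger0_norm// subr_ge0 flat0_le1.
have Q0 : 0 < N * s ^+ 2 by rewrite mulr_gt0.
have main : 1 - flat 0 (N * s ^+ 2 - 1) <= 2 / (N * s ^+ 2) /\ `|dtrunc n s - 1| <= 20 / (N * s ^+ 2).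
  rewrite /dtrunc -/N; set Q := N * s ^+ 2 in Q0 *.
  have f2 := flat_ge0 2 (Q - 1); have f0 := flat_ge0 0 (Q - 1); have f1 := flat0_le1 (Q - 1).
  have [Q2|Q2] := leP Q 2.
    have h : 1 <= 2 / Q by rewrite ler_pdivlMr// mul1r.
    have b := dtrunc_bound n s; rewrite /dtrunc -/N -/Q in b.
    have E20 : 20 / Q = 10 * (2 / Q) by ring.
    split; first by lra.
    by rewrite E20; apply: le_trans (ler_normB _ _) _; rewrite normr1; lra.
  have t1 : 1 <= Q - 1 by lra.
  have t0 : 0 < Q - 1 by lra.
  have h1 := flat0_ge t0; have h2 := flat2_le' t1; rewrite subrK in h2.
  have h3 : (Q - 1)^-1 <= 2 / Q by rewrite -[leLHS]mul1r ler_pdivrMr// mulrAC ler_pdivlMr//; lra.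
  have E20 : 20 / Q = 10 * (2 / Q) by ring.
  split; first by lra.
  rewrite E20 -(mulrA 2); have := mulr_ge0 (ltW Q0) f2; rewrite mulrC in h3 *.
  by rewrite ler_norml => h4; apply/andP; split; lra.
split; last by rewrite -mulrA -invfM mulrC [s ^+ 2 * _]mulrC; case: main => _; rewrite mulrC.
rewrite E1; apply: le_trans (ler_wpM2l (normr_ge0 s) main.1) _.
rewrite le_eqVlt; apply/orP; left; apply/eqP; rewrite -(real_normK (num_real s)); field.
by rewrite !gt_eqF.
Qed.

Lemma cvg_inv_nat (u : nat -> R) (l K : R) : (forall n, `|u n - l| <= K / n.+1%:R) -> u n @[n --> \oo] --> l.
Proof.
move=> h; apply/cvgrPdist_le => e e0.
have c0 : K / n.+1%:R @[n --> \oo] --> (0 : R).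
  by rewrite -(mulr0 K); apply: cvgM; [exact: cvg_cst|exact: cvg_harmonic].
have /cvgrPdist_le/(_ e e0) := c0; apply: filterS => n hn.
by rewrite distrC; apply: le_trans (h n) _; move: hn; rewrite sub0r normrN; apply: le_trans; exact: ler_norm.
Qed.

Lemma trunc_cvg (s : R) : trunc n s @[n --> \oo] --> s.
Proof.
have [->|s0] := eqVneq s 0.
  rewrite (_ : (fun n => trunc n 0) = (fun=> 0)); first exact: cvg_cst.
  by apply: funext => n; rewrite /trunc mul0r.
by apply: (@cvg_inv_nat _ _ (2 / `|s|)) => n; have [] := trunc_near n s0.
Qed.

Lemma dtrunc_cvg (s : R) : dtrunc n s @[n --> \oo] --> ((s != 0)%:R : R).
Proof.
have [->|s0] := eqVneq s 0.
  rewrite (_ : (fun n => dtrunc n 0) = (fun=> 0)); first exact: cvg_cst.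
  by apply: funext => n; rewrite /dtrunc expr0n mulr0 sub0r flat_le0 ?mulr0 ?mul0r ?addr0// oppr_le0.
by apply: (@cvg_inv_nat _ _ (20 / s ^+ 2)) => n; have [] := trunc_near n s0.
Qed.

Lemma trunc_c1 n g : c1 g -> [/\ c1 (fun x => trunc n (g x)),
  dx1 (fun x => trunc n (g x)) = (fun x => dtrunc n (g x) * dx1 g x) &
  dx2 (fun x => trunc n (g x)) = (fun x => dtrunc n (g x) * dx2 g x)].
Proof. by move=> cg; apply: c1_comp cg _ _; [exact: is_derive_trunc|exact: dtrunc_continuous]. Qed.

Lemma trunc_vanish n (B : R) g : vanish B g -> vanish B (fun x => trunc n (g x)).
Proof. by move=> gB x xB; rewrite gB// /trunc mul0r. Qed.

End Truncation.

(** * Green's formula for functions that vanish on the other edges *)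

Section GreenPolygon.
Set Implicit Arguments.
Unset Strict Implicit.
Context {R : realType}.
Notation pt := (R * R)%type.
Notation T1 := (measurableTypeR R).
Implicit Types (f g h u G : pt -> R) (D H : set pt) (a b e x y z : pt).

(** The parameter of the orthogonal projection of x onto the line through a and b. *)
Definition along a b x : R :=
  ((x.1 - a.1) * (b.1 - a.1) + (x.2 - a.2) * (b.2 - a.2)) / ((b.1 - a.1) ^+ 2 + (b.2 - a.2) ^+ 2).

Lemma edge_sqr_gt0 a b : a != b -> 0 < (b.1 - a.1) ^+ 2 + (b.2 - a.2) ^+ 2.
Proof.
move=> ab; rewrite lt_neqAle eq_sym addr_ge0 ?sqr_ge0// andbT paddr_eq0 ?sqr_ge0// !sqrf_eq0 !subr_eq0.
by apply: contra ab => /andP[/eqP h1 /eqP h2]; apply/eqP; apply: eq_pt; rewrite ?h1 ?h2.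
Qed.

Lemma along_lerp a b t : a != b -> along a b (lerp a b t) = t /\ cr a b (lerp a b t) = 0.
Proof.
move=> ab; have L0 := edge_sqr_gt0 ab; split; last first.
  by rewrite cr_lerp; have [-> ->] := cr_ends a b; rewrite !mulr0 addr0.
rewrite /along -[(lerp a b t).1]/(a.1 + t * (b.1 - a.1)) -[(lerp a b t).2]/(a.2 + t * (b.2 - a.2)).
by field; rewrite gt_eqF.
Qed.

Lemma along_dist a b x : a != b ->
  `|x - lerp a b (along a b x)| <= `|cr a b x| * `|b - a| / ((b.1 - a.1) ^+ 2 + (b.2 - a.2) ^+ 2).
Proof.
move=> ab; have L0 := edge_sqr_gt0 ab; set L := _ + _ in L0 *.
have E1 : (x - lerp a b (along a b x)).1 = cr a b x * (b - a).2 / L.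
  rewrite -[LHS]/(x.1 - (a.1 + along a b x * (b.1 - a.1))) -[(b - a).2]/(b.2 - a.2) /along /cr -/L /L.
  by field; rewrite gt_eqF.
have E2 : (x - lerp a b (along a b x)).2 = - (cr a b x * (b - a).1 / L).
  rewrite -[LHS]/(x.2 - (a.2 + along a b x * (b.2 - a.2))) -[(b - a).1]/(b.1 - a.1) /along /cr -/L /L.
  by field; rewrite gt_eqF.
have LV : `|L^-1| = L^-1 by rewrite gtr0_norm// invr_gt0.
rewrite ler_norm_pair E1 E2 normrN !normrM LV; apply/andP; split; apply: ler_wpM2r;
  by rewrite ?invr_ge0 ?(ltW L0)// ler_wpM2l// ?ler_norm_snd ?ler_norm_fst.
Qed.

Lemma sm_along a b : sm (along a b).
Proof.
have E : along a b = (fun x => ((x.1 + - a.1) * (b.1 - a.1) + (x.2 + - a.2) * (b.2 - a.2)) *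
  ((b.1 - a.1) ^+ 2 + (b.2 - a.2) ^+ 2)^-1) by [].
rewrite E; apply: sm_mul (sm_cst _); apply: sm_add; apply: sm_mul (sm_cst _).
  exact: sm_add sm_fst (sm_cst _).
exact: sm_add sm_snd (sm_cst _).
Qed.

Lemma sm_cr a b : sm (cr a b).
Proof.
apply: sm_sub; apply: sm_mul (sm_cst _).
  exact: sm_add sm_fst (sm_cst _).
exact: sm_add sm_snd (sm_cst _).
Qed.

Lemma near_lt (f : pt -> R) x (c : R) : continuous f -> f x < c -> \forall y \near x, f y < c.
Proof. move=> cf fx; have h : nbhs (f x) [set t | t < c] by exact: (open_nbhs_nbhs (conj (@open_lt R c) fx)).
exact: (cf x _ h). Qed.

Lemma near_gt (f : pt -> R) x (c : R) : continuous f -> c < f x -> \forall y \near x, c < f y.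
Proof. move=> cf fx; have h : nbhs (f x) [set t | c < t] by exact: (open_nbhs_nbhs (conj (@open_gt R c) fx)).
exact: (cf x _ h). Qed.

(* theta = 1 near the middle part of the segment, and theta vanishes near every point
   outside a neighbourhood of thickness r of a slightly larger part. *)
Lemma edge_cutoff a b (d r : R) : a != b -> 0 < d -> 0 < r -> exists theta, [/\ sm theta,
  forall t, d <= t <= 1 - d -> \forall y \near lerp a b t, theta y = 1,
  forall t, ~~ (0 < t < 1) -> theta (lerp a b t) = 0 &
  forall x, (exists2 t, d / 2 <= t <= 1 - d / 2 & box (lerp a b t) r x) \/ \forall y \near x, theta y = 0].
Proof.
move=> ab d0 r0; have L0 := edge_sqr_gt0 ab; set L := _ + _ in L0.
(* The width of the strip, measured by [cr]: by [along_dist], |cr| <= 2 rho keeps x within r of its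
   projection. *)
pose rho := r * L / (4 * (`|b - a| + 1)).
have rho0 : 0 < rho by rewrite divr_gt0 ?mulr_gt0// ltr_wpDl.
(* S1 and S2 cut off along the segment, between the parameters d / 2 and 3 d / 4 from each end; S3
   cuts off across it, where cr^2 runs from rho^2 to 2 rho^2. *)
pose S1 x : R := step ((along a b x + - (d / 2)) * (4 / d)).
pose S2 x : R := step (((1 - d / 2) + - along a b x) * (4 / d)).
pose S3 x : R := step (2 + - (cr a b x * cr a b x * rho ^- 2)).
have s1 : sm S1.
  by apply: sm_step; apply: sm_mul (sm_cst _); apply: sm_add (sm_cst _); exact: sm_along.
have s2 : sm S2.
  by apply: sm_step; apply: sm_mul (sm_cst _); apply: sm_add; [exact: sm_cst|apply: sm_opp; exact: sm_along].
have s3 : sm S3.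
  apply: sm_step; apply: sm_add; first exact: sm_cst.
  by apply: sm_opp; apply: sm_mul (sm_cst _); apply: sm_mul; exact: sm_cr.
have ca := sm_continuous (sm_along a b); have cc := sm_continuous (sm_mul (sm_cr a b) (sm_cr a b)).
exists (fun x => S1 x * S2 x * S3 x); split.
- by apply: sm_mul s3; apply: sm_mul.
- move=> t /andP[t0 t1]; have [aE cE] := along_lerp t ab.
  have n1 : \forall y \near lerp a b t, d / 2 + d / 4 < along a b y by apply: near_gt => //; rewrite aE; lra.
  have n2 : \forall y \near lerp a b t, along a b y < 1 - d / 2 - d / 4 by apply: near_lt => //; rewrite aE; lra.
  have n3 : \forall y \near lerp a b t, cr a b y * cr a b y < rho ^+ 2.
    by apply: (near_lt (f := fun y => cr a b y * cr a b y)) => //; rewrite cE mulr0 exprn_gt0.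
  apply: filterS3 n1 n2 n3 => y h1 h2 h3.
  have dd : d / 4 * (4 / d) = 1 by field; rewrite gt_eqF.
  have d4 : 0 <= 4 / d by rewrite divr_ge0// ltW.
  rewrite /S1 /S2 /S3 !step_ge1 ?mulr1//.
  + by rewrite lerBrDr -lerBrDl (_ : 2 - 1 = 1 :> R); [rewrite ler_pdivrMr ?exprn_gt0// mul1r ltW|ring].
  + by rewrite -[leLHS]dd; apply: ler_wpM2r => //; lra.
  + by rewrite -[leLHS]dd; apply: ler_wpM2r => //; lra.
- move=> t; rewrite negb_and -!leNgt => h; have [aE _] := along_lerp t ab.
  have d4 : 0 <= 4 / d by rewrite divr_ge0// ltW.
  case/orP: h => h.
    by rewrite /S1 step_le0 ?mul0r// aE; apply: mulr_le0_ge0 => //; lra.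
  by rewrite /S2 step_le0 ?(mulr0, mul0r)// aE; apply: mulr_le0_ge0 => //; lra.
move=> x; have d4 : 0 <= 4 / d by rewrite divr_ge0// ltW.
have [h1|h1] := ltP (along a b x) (d / 2).
  right; apply: filterS (near_lt ca h1) => y h; rewrite /S1 step_le0 ?mul0r//.
  by apply: mulr_le0_ge0 => //; lra.
have [h2|h2] := ltP (1 - d / 2) (along a b x).
  right; apply: filterS (near_gt ca h2) => y h; rewrite /S2 step_le0 ?(mulr0, mul0r)//.
  by apply: mulr_le0_ge0 => //; lra.
have [h3|h3] := ltP (2 * rho ^+ 2) (cr a b x * cr a b x).
  right; apply: filterS (near_gt cc h3) => y h; rewrite /S3 [X in _ * X]step_le0 ?mulr0//.
  by rewrite subr_le0 ler_pdivlMr ?exprn_gt0// ltW.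
left; exists (along a b x); first by rewrite h1 h2.
rewrite /box /=; apply: le_lt_trans (along_dist x ab) _; rewrite -/L ltr_pdivrMr//.
have c2 : `|cr a b x| <= 2 * rho.
  move: (cr a b x) h3 => c h3; rewrite leNgt; apply/negP => h.
  have e : `|c| * `|c| = c * c by rewrite -expr2 real_normK ?num_real// expr2.
  by move: h3; rewrite expr2 -e; nra.
apply: (@le_lt_trans _ _ (2 * rho * `|b - a|)); first exact: ler_wpM2r.
have E : rho * (4 * (`|b - a| + 1)) = r * L by rewrite /rho divfK// gt_eqF// mulr_gt0// ltr_wpDl.
by rewrite -E; have := normr_ge0 (b - a); nra.
Qed.

Lemma dx_split f g h x : c1 f -> c1 g -> c1 h -> (forall y, f y = g y + h y) ->
  dx1 f x = dx1 g x + dx1 h x /\ dx2 f x = dx2 g x + dx2 h x.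
Proof.
move=> _ [_ g1 _ g2 _] [_ h1 _ h2 _] E; rewrite (funext E : f = g + h).
by split; [exact: (deriveD (g1 x) (h1 x))|exact: (deriveD (g2 x) (h2 x))].
Qed.

(** G is cut into U = G theta and W = G (1 - theta). W vanishes near the frontier, so the
    derivatives of its zero extension have integral 0. For U, the set D may be replaced by the
    half-plane, because U vanishes near every point where the two differ. *)
Lemma green_truncated D a b (B k d r : R) G : open D -> c1 G -> vanish B G -> k ^+ 2 = 1 -> a != b ->
  0 < d -> 0 < r ->
  (forall t x, d / 2 <= t <= 1 - d / 2 -> box (lerp a b t) r x -> (D x <-> 0 < k * cr a b x)) ->
  (forall x, frontier D x -> (exists2 t, d <= t <= 1 - d & x = lerp a b t) \/ \forall y \near x, G y = 0) ->
  (forall t, 0 <= t <= 1 -> ~~ (d <= t <= 1 - d) -> G (lerp a b t) = 0) ->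
  ((Int ((dx1 G) \_ D))%:E = \int[mu1]_(t in `[0%R, 1%R]) (- (k * (b.2 - a.2)) * G (lerp a b t))%:E)%E /\
  ((Int ((dx2 G) \_ D))%:E = \int[mu1]_(t in `[0%R, 1%R]) (k * (b.1 - a.1) * G (lerp a b t))%:E)%E.
Proof.
move=> oD cG GB k1 ab d0 r0 side fr ends.
have [th [sth th1 th0 thO]] := edge_cutoff ab d0 r0.
have cth := sm_c1 sth; have cth' := sm_c1 (sm_sub (sm_cst 1) sth).
pose U x := G x * th x; pose W x := G x * (1 - th x).
have cU : c1 U := c1M cG cth.
have cW : c1 W := c1M cG cth'.
have UB : vanish B U := vanishM th GB.
have WB : vanish B W := vanishM (fun x => 1 - th x) GB.
have sp y : G y = U y + W y by rewrite /U /W -mulrDr addrC subrK mulr1.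
have Wfr x : frontier D x -> \forall y \near x, W y = 0.
  case/fr => [[t dt ->]|]; first by apply: filterS (th1 t dt) => y ty; rewrite /W ty subrr mulr0.
  by apply: filterS => y Gy; rewrite /W Gy mul0r.
have [[_ w1 cw1 w2 cw2] E1 E2] := zero_extension oD cW Wfr.
have WDB : vanish B (W \_ D) by move=> x xB; rewrite patchE; case: ifP => // _; exact: WB.
have Uout x : ~ (D x <-> 0 < k * cr a b x) -> \forall y \near x, U y = 0.
  move=> nx; case: (thO x) => [[t dt bx]|]; first by case: nx; exact: side dt bx.
  by apply: filterS => y ty; rewrite /U ty mulr0.
have UH (v : pt) : ('D_v U) \_ D = ('D_v U) \_ [set x | 0 < k * cr a b x].
  apply: funext => x; rewrite !patchE; have [Hx|nHx] := pselect (D x <-> 0 < k * cr a b x).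
    by rewrite (_ : (x \in D) = (x \in [set x | 0 < k * cr a b x]))//; apply/idP/idP; rewrite !inE /= => /Hx.
  by rewrite (derive_zero_near v (Uout x nHx)); case: ifP; case: ifP.
have lineU : forall t : R, U (lerp a b t) = ((fun t => G (lerp a b t)) \_ `[0, 1]%classic) t.
  move=> t; rewrite patchE; case: ifPn => [|nt].
    rewrite inE /= in_itv /= => t01; have [dt|ndt] := boolP (d <= t <= 1 - d).
      by rewrite /U (nbhs_singleton (th1 t dt)) mulr1.
    by rewrite /U (ends t t01 ndt) mul0r.
  rewrite /U th0 ?mulr0//; apply: contra nt => /andP[t0 t1].
  by rewrite inE /= in_itv /= !ltW.
have mD := mble_open oD; have [_ u1 cu1 u2 cu2] := cU; have [_ _ cW1 _ cW2] := cW.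
have itU1 := itg_patch mD (vanish_itg cu1 (vanish_derive (1, 0) UB)).
have itU2 := itg_patch mD (vanish_itg cu2 (vanish_derive (0, 1) UB)).
have itW1 := itg_patch mD (vanish_itg cW1 (vanish_derive (1, 0) WB)).
have itW2 := itg_patch mD (vanish_itg cW2 (vanish_derive (0, 1) WB)).
have line (c : R) : (\int[mu1]_t (c * U (lerp a b t))%:E = \int[mu1]_(t in `[0%R, 1%R]) (c * G (lerp a b t))%:E)%E.
  rewrite [RHS]integral_mkcond; apply: eq_integral => t _; rewrite lineU !patchE.
  by case: ifP => // _; rewrite mulr0.
split.
- have I0 : Int ((dx1 W) \_ D) = 0 by rewrite -E1; exact: (Int_dx1 w1 cw1 WDB).
  have -> : Int ((dx1 G) \_ D) = Int ((dx1 U) \_ D).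
    rewrite -[RHS]addr0 -I0 -(IntD itU1 itW1); apply: (congr1 Int); apply: funext => x; rewrite !patchE.
    by case: ifP => _; [have [] := dx_split x cG cU cW sp|rewrite addr0].
  by rewrite (UH (1, 0) : (dx1 U) \_ D = _) -(line (- (k * (b.2 - a.2)))); exact: (halfplane1 a b cU UB k1).
have I0 : Int ((dx2 W) \_ D) = 0 by rewrite -E2; exact: (Int_dx2 w2 cw2 WDB).
have -> : Int ((dx2 G) \_ D) = Int ((dx2 U) \_ D).
  rewrite -[RHS]addr0 -I0 -(IntD itU2 itW2); apply: (congr1 Int); apply: funext => x; rewrite !patchE.
  by case: ifP => _; [have [] := dx_split x cG cU cW sp|rewrite addr0].
by rewrite (UH (0, 1) : (dx2 U) \_ D = _) -(line (k * (b.1 - a.1))); exact: (halfplane2 a b cU UB k1).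
Qed.

Lemma meas_neq0 g : continuous g -> meas (fun x => (g x != 0)%:R : R).
Proof.
move=> cg; rewrite (_ : (fun x => _) = \1_([set x | g x != 0])); last first.
  by apply: funext => x; rewrite indicE; case: (boolP (g x != 0)) => h; [rewrite mem_set|rewrite memNset//; exact/negP].
apply: meas_indic; apply: mble_open.
rewrite (_ : [set _ | _] = g @^-1` [set t | t != 0]); last by [].
by apply: open_comp; [move=> x _; exact: cg|exact: open_neq].
Qed.

(** Pass to the limit in the integration by parts for [trunc n (g x)]: the side with the derivative
    tends to the pairing with the derivative of g restricted to g != 0, the other side to the
    pairing for g itself. The fundamental lemma compares the two. *)
Lemma zero_set_gradient (B : R) g : c1 g -> vanish B g ->
  {ae (@mu2 R), forall x, (g x != 0)%:R * dx1 g x = dx1 g x} /\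
  {ae (@mu2 R), forall x, (g x != 0)%:R * dx2 g x = dx2 g x}.
Proof.
move=> cg gB; have [cg0 g1 cg1 g2 cg2] := cg.
have m0 := meas_neq0 cg0.
have b1 x : `|(g x != 0)%:R : R| <= 1 by case: (g x != 0); rewrite ?normr1 ?normr0.
have ln (u v w : R) : `|u| <= `|v| -> `|u * w| <= `|v * w| by move=> h; rewrite !normrM ler_wpM2r.
have main (dg : pt -> R) (DD : (pt -> R) -> pt -> R) : continuous dg -> vanish (B + 1) dg -> DD g = dg ->
    (forall n, DD (fun x => trunc n (g x)) = (fun x => dtrunc n (g x) * dg x)) ->
    (forall psi, tst setT psi -> tst setT (DD psi)) ->
    (forall f psi, c1 f -> tst setT psi -> Int (fun x => DD f x * psi x) = - Int (fun x => f x * DD psi x)) ->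
    {ae (@mu2 R), forall x, (g x != 0)%:R * dg x = dg x}.
  move=> cdg vdg DE Dn Dsm parts.
  have sdg := vanish_sqi cdg vdg; have sg := vanish_sqi cg0 gB.
  have sz : sqi (fun x => (g x != 0)%:R * dg x) := sqi_bounded_mul sdg m0 b1.
  have fl := @fundamental_lemma R setT (fun x => (g x != 0)%:R * dg x - dg x) openT (sqiB sz sdg).
  suff h : forall psi, tst setT psi -> Int (fun x => ((g x != 0)%:R * dg x - dg x) * psi x) = 0.
    by apply: filterS (fl h) => x /(_ I)/eqP; rewrite subr_eq0 => /eqP.
  move=> psi tp; have sp := tst_sqi tp.
  have [P0 vP] := tst_vanish tp.
  have [M M0 MB] := vanish_bounded (sm_continuous (tst_sm tp)) vP.
  have idp : itg (fun x => dg x * psi x) := sqi_mul sdg sp.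
  have izp : itg (fun x => (g x != 0)%:R * dg x * psi x) := sqi_mul sz sp.
  have -> : (fun x => ((g x != 0)%:R * dg x - dg x) * psi x) = (fun x => (g x != 0)%:R * dg x * psi x - dg x * psi x).
    by apply: funext => x; rewrite mulrBl.
  rewrite (IntB izp idp).
  have mpsi := sp.1.
  have L1 : Int (fun x => dtrunc n (g x) * dg x * psi x) @[n --> \oo] --> Int (fun x => (g x != 0)%:R * dg x * psi x).
    have [] := @Int_dominated R (fun n x => dtrunc n (g x) * dg x * psi x) (fun x => (g x != 0)%:R * dg x * psi x)
      (fun x => 9 * `|dg x * psi x|); [| | | | |by []].
    - move=> n; apply: measM mpsi; apply: measM sdg.1; apply: meas_continuous => x.
      by apply: continuous_comp; [exact: cg0|exact: dtrunc_continuous].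
    - exact: measM sz.1 mpsi.
    - exact: itgZ (itg_norm idp).
    - move=> n x; rewrite -mulrA normrM; apply: ler_wpM2r => //; exact: dtrunc_bound.
    - by move=> x; apply: cvgM; [apply: cvgM; [exact: dtrunc_cvg|exact: cvg_cst]|exact: cvg_cst].
  have igp : itg (fun x => g x * DD psi x).
    exact: sqi_mul sg (tst_sqi (Dsm _ tp)).
  have L2 : Int (fun x => trunc n (g x) * DD psi x) @[n --> \oo] --> Int (fun x => g x * DD psi x).
    have [] := @Int_dominated R (fun n x => trunc n (g x) * DD psi x) (fun x => g x * DD psi x)
      (fun x => `|g x * DD psi x|); [| | | | |by []].
    - move=> n; have [[ct _ _ _ _] _ _] := trunc_c1 n cg.
      by apply: measM; [exact: meas_continuous|apply: meas_continuous; exact: sm_continuous (tst_sm (Dsm _ tp))].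
    - exact: itg_meas igp.
    - exact: itg_norm igp.
    - by move=> n x; exact: (ln _ _ _ (trunc_norm n (g x))).
    - by move=> x; apply: cvgM; [exact: trunc_cvg|exact: cvg_cst].
  have E n : Int (fun x => dtrunc n (g x) * dg x * psi x) = - Int (fun x => trunc n (g x) * DD psi x).
    by have [ct _ _] := trunc_c1 n cg; rewrite -(parts _ _ ct tp) Dn.
  have L1' : Int (fun x => dtrunc n (g x) * dg x * psi x) @[n --> \oo] --> - Int (fun x => g x * DD psi x).
    by rewrite (funext E); exact: cvgN.
  by rewrite (cvg_unique (@norm_hausdorff _ _) L1 L1') -(parts _ _ cg tp) DE subrr.
split.
- apply: (main (dx1 g) (@dx1 R)) => //.
  + exact: vanish_derive.
  + by move=> n; have [] := trunc_c1 n cg.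
  + by move=> psi tp; exact: tst_dx1 tp.
  + by move=> f psi cf tp; have [P0 vP] := tst_vanish tp; exact: Int_parts1 cf (sm_c1 (tst_sm tp)) vP.
apply: (main (dx2 g) (@dx2 R)) => //.
- exact: vanish_derive.
- by move=> n; have [] := trunc_c1 n cg.
- by move=> psi tp; exact: tst_dx2 tp.
- by move=> f psi cf tp; have [P0 vP] := tst_vanish tp; exact: Int_parts2 cf (sm_c1 (tst_sm tp)) vP.
Qed.

Lemma trunc_line_cvg (c : R) g a b : continuous g ->
  (\int[mu1]_(t in `[0%R, 1%R]) (c * trunc n (g (lerp a b t)))%:E)%E @[n --> \oo] -->
  (\int[mu1]_(t in `[0%R, 1%R]) (c * g (lerp a b t))%:E)%E.
Proof.
move=> cg; have cl : continuous (fun t : R => g (lerp a b t)).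
  by move=> t; apply: continuous_comp; [exact: lerp_continuous|exact: cg].
have ct n : continuous (fun t : R => c * trunc n (g (lerp a b t))).
  move=> t; apply: cvgM; first exact: cvg_cst.
  apply: (@continuous_comp _ _ _ (fun t : R => g (lerp a b t)) (trunc n)); first exact: cl.
  by apply: differentiable_continuous; apply/derivable1_diffP; have [] := is_derive_trunc n (g (lerp a b t)).
have cb : continuous (fun t : R => `|c| * `|g (lerp a b t)|).
  by move=> t; apply: cvgM; [exact: cvg_cst|apply: cvg_norm; exact: cl].
have cc : continuous (fun t : R => c * g (lerp a b t)).
  by move=> t; apply: cvgM; [exact: cvg_cst|exact: cl].
have ms (f : R -> R) : continuous f -> measurable_fun (`[0, 1]%classic : set T1) (fun t : T1 => (f t)%:E).
  by move=> cf; apply/measurable_EFinP; apply: measurable_funTS; exact: continuous_measurable_fun.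
have ib : (@mu1 R).-integrable `[0, 1]%classic (fun t : T1 => (`|c| * `|g (lerp a b t)|)%:E).
  apply: continuous_compact_integrable; first exact: segment_compact.
  by apply: continuous_subspaceT.
have [] := @dominated_convergence _ T1 R (@mu1 R) `[0, 1]%classic (measurable_itv _)
  (fun n (t : T1) => (c * trunc n (g (lerp a b t)))%:E) (fun t : T1 => (c * g (lerp a b t))%:E)
  (fun t : T1 => (`|c| * `|g (lerp a b t)|)%:E); [| | | | |by []].
- by move=> n; exact: ms.
- exact: ms.
- apply: aeW => t _; apply: cvg_EFin; first by apply: nearW.
  by apply: cvgM; [exact: cvg_cst|exact: trunc_cvg].
- exact: ib.
- apply: aeW => t n _; rewrite abse_EFin lee_fin normrM; apply: ler_wpM2l => //.
  exact: (trunc_norm n (g (lerp a b t))).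
Qed.

(** [trunc n (g x)] vanishes near every point where g is small, thus near the other edges and the
    two ends, and [green_truncated] applies. In the limit [dtrunc] leaves the indicator of g != 0,
    which [zero_set_gradient] removes. *)
Theorem green_edge D a b (B k : R) g : open D -> c1 g -> vanish B g -> k ^+ 2 = 1 -> a != b ->
  (forall d, 0 < d -> exists2 r : R, 0 < r & forall t x, d <= t <= 1 - d -> box (lerp a b t) r x ->
     (D x <-> 0 < k * cr a b x)) ->
  (forall x, frontier D x -> ~ seg a b x -> g x = 0) -> g a = 0 -> g b = 0 ->
  ((Int ((dx1 g) \_ D))%:E = \int[mu1]_(t in `[0%R, 1%R]) (- (k * (b.2 - a.2)) * g (lerp a b t))%:E)%E /\
  ((Int ((dx2 g) \_ D))%:E = \int[mu1]_(t in `[0%R, 1%R]) (k * (b.1 - a.1) * g (lerp a b t))%:E)%E.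
Proof.
move=> oD cg gB k1 ab side fr ga gb; have [cg0 g1 cg1 g2 cg2] := cg.
have mD := mble_open oD.
have qn (n : nat) : continuous (fun x => n.+1%:R * g x ^+ 2).
  by move=> x; apply: cvgM; [exact: cvg_cst|apply: cvgM; exact: cg0].
have small (n : nat) x : n.+1%:R * g x ^+ 2 < 1 -> \forall y \near x, trunc n (g y) = 0.
  by move=> h; apply: filterS (near_lt (qn n) h) => y hy; apply: trunc_eq0; exact: ltW.
have step (n : nat) :
  ((Int ((dx1 (fun x => trunc n (g x))) \_ D))%:E =
     \int[mu1]_(t in `[0%R, 1%R]) (- (k * (b.2 - a.2)) * trunc n (g (lerp a b t)))%:E)%E /\
  ((Int ((dx2 (fun x => trunc n (g x))) \_ D))%:E =
     \int[mu1]_(t in `[0%R, 1%R]) (k * (b.1 - a.1) * trunc n (g (lerp a b t)))%:E)%E.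
  have cq : continuous (fun t : R => n.+1%:R * g (lerp a b t) ^+ 2).
    by move=> t; apply: (@continuous_comp _ _ _ (lerp a b) (fun x => n.+1%:R * g x ^+ 2)); [exact: lerp_continuous|exact: qn].
  have nb (t0 : R) : n.+1%:R * g (lerp a b t0) ^+ 2 < 1 -> exists2 d : R, 0 < d &
      forall t : R, `|t0 - t| < d -> n.+1%:R * g (lerp a b t) ^+ 2 < 1.
    move=> h; have h1 : nbhs (n.+1%:R * g (lerp a b t0) ^+ 2) [set t | t < 1] by exact: (open_nbhs_nbhs (conj (@open_lt R 1) h)).
    by have /nbhs_ballP[d /= d0 hd] := cq t0 _ h1; exists d => // t td; exact: (hd t td).
  have l0 : lerp a b 0 = a by rewrite /lerp scale0r addr0.
  have l1 : lerp a b 1 = b by rewrite /lerp scale1r addrC subrK.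
  have [d1 d10 hd1] : exists2 d : R, 0 < d & forall t : R, `|0 - t| < d -> n.+1%:R * g (lerp a b t) ^+ 2 < 1.
    by apply: nb; rewrite l0 ga expr0n mulr0.
  have [d2 d20 hd2] : exists2 d : R, 0 < d & forall t : R, `|1 - t| < d -> n.+1%:R * g (lerp a b t) ^+ 2 < 1.
    by apply: nb; rewrite l1 gb expr0n mulr0.
  (* Within d of the ends of the edge, continuity keeps (n + 1) g^2 below 1, so the truncation
     vanishes there. That d depends on n is harmless, as [side] covers every d. *)
  pose d := Num.min d1 d2; have d0 : 0 < d by rewrite lt_min d10 d20.
  have ends t : 0 <= t <= 1 -> ~~ (d <= t <= 1 - d) -> n.+1%:R * g (lerp a b t) ^+ 2 < 1.
    move=> /andP[t0 t1]; rewrite negb_and -!ltNge => /orP[h|h].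
      by apply: hd1; rewrite sub0r normrN ger0_norm//; move: h; rewrite lt_min => /andP[].
    apply: hd2; rewrite ger0_norm ?subr_ge0//.
    have : 1 - t < d by lra.
    by rewrite lt_min => /andP[].
  have [r r0 hr] := side (d / 2) (divr_gt0 d0 (ltr0n R 2)).
  have [ct _ _] := trunc_c1 n cg.
  apply: (green_truncated oD ct (trunc_vanish n gB) k1 ab d0 r0 hr).
  - move=> x frx; have [h|h] := ltP (n.+1%:R * g x ^+ 2) 1; first by right; exact: small.
    left; have : seg a b x.
      by apply: contrapT => /(fr x frx) gx; move: h; rewrite gx expr0n mulr0 ler10.
    case=> t; rewrite /= in_itv /= => t01 tx; exists t => //; apply: contraT => /(ends t t01).
    by rewrite tx ltNge h.
  - by move=> t t01 nd; apply: trunc_eq0; apply: ltW; exact: ends.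
have [ae1 ae2] := zero_set_gradient cg gB.
have limit (dg : pt -> R) (F : nat -> pt -> R) : continuous dg -> vanish (B + 1) dg ->
    (forall n, F n = (fun x => dtrunc n (g x) * dg x)) ->
    {ae (@mu2 R), forall x, (g x != 0)%:R * dg x = dg x} ->
    Int ((F n) \_ D) @[n --> \oo] --> Int (dg \_ D).
  move=> cdg vdg FE ae; have idg := vanish_itg cdg vdg.
  have mF n : meas (F n).
    rewrite FE; apply: meas_continuous => x; apply: cvgM; last exact: cdg.
    by apply: continuous_comp; [exact: cg0|exact: dtrunc_continuous].
  have pw x : F n x @[n --> \oo] --> (g x != 0)%:R * dg x.
    rewrite (_ : (fun n => F n x) = (fun n => dtrunc n (g x) * dg x)); last by apply: funext => n; rewrite FE.
    by apply: cvgM; [exact: dtrunc_cvg|exact: cvg_cst].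
  have mz := measM (meas_neq0 cg0) (meas_continuous cdg).
  have -> : Int (dg \_ D) = Int ((fun x => (g x != 0)%:R * dg x) \_ D).
    apply: esym; apply: eq_Int_ae; [exact: meas_patch|exact: meas_patch (meas_continuous cdg)|].
    by apply: filterS ae => x hx; rewrite !patchE; case: ifP.
  have [] := @Int_dominated R (fun n => (F n) \_ D) ((fun x => (g x != 0)%:R * dg x) \_ D)
      (fun x => 9 * `|dg x|); [| | | | |by []].
  - by move=> n; exact: meas_patch.
  - exact: meas_patch.
  - exact: itgZ (itg_norm idg).
  - move=> n x; rewrite patchE; case: ifP => _; last by rewrite normr0 mulr_ge0.
    by rewrite FE normrM; apply: ler_wpM2r => //; exact: dtrunc_bound.
  - move=> x; have [Dx|nDx] := pselect (D x).
      rewrite (_ : (fun n => ((F n) \_ D) x) = (fun n => F n x)); last by apply: funext => n; rewrite patchE mem_set.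
      by rewrite patchE mem_set//; exact: pw.
    rewrite (_ : (fun n => ((F n) \_ D) x) = (fun n => 0)); last by apply: funext => n; rewrite patchE memNset.
    by rewrite patchE memNset//; exact: cvg_cst.
have conclude (dg : pt -> R) (F : nat -> pt -> R) (c : R) :
    Int ((F n) \_ D) @[n --> \oo] --> Int (dg \_ D) ->
    (forall n, (Int ((F n) \_ D))%:E = \int[mu1]_(t in `[0%R, 1%R]) (c * trunc n (g (lerp a b t)))%:E)%E ->
    ((Int (dg \_ D))%:E = \int[mu1]_(t in `[0%R, 1%R]) (c * g (lerp a b t))%:E)%E.
  move=> h E; have L1 : (Int ((F n) \_ D))%:E @[n --> \oo] --> (Int (dg \_ D))%:E.
    by apply: cvg_EFin => //; apply: nearW.
  have L2 := @trunc_line_cvg c g a b cg0.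
  rewrite -(funext E) in L2.
  exact: (cvg_unique (@ereal_hausdorff R) L1 L2).
split.
- apply: (conclude _ (fun n => dx1 (fun x => trunc n (g x)))) => [|n]; last by have [] := step n.
  by apply: limit => // [|n]; [exact: vanish_derive|have [] := trunc_c1 n cg].
apply: (conclude _ (fun n => dx2 (fun x => trunc n (g x)))) => [|n]; last by have [] := step n.
by apply: limit => // [|n]; [exact: vanish_derive|have [] := trunc_c1 n cg].
Qed.

End GreenPolygon.

(** * The virtual element space *)

Section Polynomials.
Set Implicit Arguments.
Unset Strict Implicit.
Context {R : realType}.
Notation pt := (R * R)%type.
Implicit Types (f g p : pt -> R) (D : set pt) (a b x y z : pt) (m n : nat).

Lemma sm_exp f n : sm f -> sm (fun x => f x ^+ n).
Proof.
move=> sf; elim: n => [|n IH]; first by rewrite (_ : (fun x => _) = (fun=> 1)); [exact: sm_cst|apply: funext => x; rewrite expr0].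
by rewrite (_ : (fun x => _) = (fun x => f x * f x ^+ n)); [exact: sm_mul|apply: funext => x; rewrite exprS].
Qed.

Lemma sm_dx_sum (I : Type) (r : seq I) (P : pred I) (F : I -> pt -> R) : (forall i, sm (F i)) ->
  [/\ sm (fun x => \sum_(i <- r | P i) F i x),
      dx1 (fun x => \sum_(i <- r | P i) F i x) = (fun x => \sum_(i <- r | P i) dx1 (F i) x) &
      dx2 (fun x => \sum_(i <- r | P i) F i x) = (fun x => \sum_(i <- r | P i) dx2 (F i) x)].
Proof.
move=> sF; elim: r => [|i r [IH1 IH2 IH3]].
  rewrite (_ : (fun x => _) = (fun=> 0)); last by apply: funext => x; rewrite big_nil.
  rewrite dx1_cst dx2_cst; split; first exact: sm_cst.
  - by apply: funext => x; rewrite big_nil.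
  - by apply: funext => x; rewrite big_nil.
have [Pi|nPi] := boolP (P i).
  rewrite (_ : (fun x => \sum_(i <- i :: r | P i) F i x) = (fun x => F i x + \sum_(i <- r | P i) F i x)); last first.
    by apply: funext => x; rewrite big_cons Pi.
  split; first exact: sm_add.
  - by rewrite (dx1_add (sF i) IH1); apply: funext => x; rewrite big_cons Pi; congr (_ + _); exact: (congr1 (fun h => h x) IH2).
  - by rewrite (dx2_add (sF i) IH1); apply: funext => x; rewrite big_cons Pi; congr (_ + _); exact: (congr1 (fun h => h x) IH3).
rewrite (_ : (fun x => \sum_(i <- i :: r | P i) F i x) = (fun x => \sum_(i <- r | P i) F i x)); last first.
  by apply: funext => x; rewrite big_cons (negPf nPi).
by split; [exact: IH1|rewrite IH2|rewrite IH3]; apply: funext => x; rewrite big_cons (negPf nPi).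
Qed.

Let mon (c : R) (i j : nat) : pt -> R := fun x => c * x.1 ^+ i * x.2 ^+ j.

Let sm_mon c i j : sm (mon c i j).
Proof. by apply: sm_mul; [apply: sm_mul; [exact: sm_cst|exact: sm_exp sm_fst]|exact: sm_exp sm_snd]. Qed.

Let dx_mon c i j x : dx1 (mon c i j) x = c * i%:R * x.1 ^+ i.-1 * x.2 ^+ j /\
  dx2 (mon c i j) x = c * j%:R * x.1 ^+ i * x.2 ^+ j.-1.
Proof.
have ex (f : pt -> R) n : sm f -> dx1 (fun y => f y ^+ n) x = n%:R * f x ^+ n.-1 * dx1 f x /\
    dx2 (fun y => f y ^+ n) x = n%:R * f x ^+ n.-1 * dx2 f x.
  move=> sf; elim: n => [|n [IH1 IH2]].
    rewrite (_ : (fun y => f y ^+ 0) = (fun=> 1)); last by apply: funext => y; rewrite expr0.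
    by rewrite dx1_cst dx2_cst !mul0r.
  rewrite (_ : (fun y => f y ^+ n.+1) = (fun y => f y * f y ^+ n)); last by apply: funext => y; rewrite exprS.
  have sn := sm_exp n sf.
  rewrite (dx1M (sm_derivable sf) (sm_derivable sn)) (dx2M (sm_derivable sf) (sm_derivable sn)) IH1 IH2.
  by case: n {IH1 IH2 sn} => [|n] /=; rewrite ?expr0 ?exprS -?natr1; split; move: (dx1 f x) (dx2 f x) => u v; ring.
have s1 := @sm_exp _ i (@sm_fst R); have s2 := @sm_exp _ j (@sm_snd R).
have sc : sm (fun x : pt => c * x.1 ^+ i) by apply: sm_mul s1; exact: sm_cst.
have [e1 e1'] := ex _ i (@sm_fst R); have [e2 e2'] := ex _ j (@sm_snd R).
rewrite /mon (dx1M (sm_derivable sc) (sm_derivable s2)) (dx2M (sm_derivable sc) (sm_derivable s2)).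
rewrite (dx1_scale c s1) (dx2_scale c s1) e1 e1' e2 e2' /dx1 /dx2 !derive_fst !derive_snd /=.
by split; ring.
Qed.

Lemma poly2_sm m p : poly2 m p -> sm p.
Proof.
move=> [c pE]; rewrite (funext pE).
have [h _ _] := @sm_dx_sum 'I_m (index_enum _) xpredT
  (fun i x => \sum_(j < m | (i + j < m)%N) mon (c i j) i j x) (fun i =>
    let: And3 h _ _ := @sm_dx_sum 'I_m (index_enum _) (fun j : 'I_m => (i + j < m)%N) (fun j => mon (c i j) i j) (fun j => sm_mon _ _ _) in h).
exact: h.
Qed.

(** The index m is 1 + degree, so one derivative lowers it by one: terms of exponent 0 disappear and
    the others shift. *)
Lemma poly2_dx m p : poly2 m.+1 p -> poly2 m (dx1 p) /\ poly2 m (dx2 p).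
Proof.
move=> [c pE]; have pE' : p = fun x => \sum_(i < m.+1) \sum_(j < m.+1 | (i + j < m.+1)%N) mon (c i j) i j x by exact: funext.
have inner (i : 'I_m.+1) := @sm_dx_sum 'I_m.+1 (index_enum _) (fun j : 'I_m.+1 => (i + j < m.+1)%N) (fun j => mon (c i j) i j) (fun j => sm_mon _ _ _).
have [_ D1 D2] := @sm_dx_sum 'I_m.+1 (index_enum _) xpredT
  (fun i x => \sum_(j < m.+1 | (i + j < m.+1)%N) mon (c i j) i j x) (fun i => let: And3 h _ _ := inner i in h).
split.
- exists (fun i j => c i.+1 j * i.+1%:R) => x.
  rewrite pE' D1 big_ord_recl /= [X in X + _](_ : _ = 0) ?add0r; last first.
    have [_ -> _] := inner ord0; apply: big1 => j _; by rewrite (dx_mon _ _ _ _).1 !(mulr0, mul0r).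
  apply: eq_bigr => i _; have [_ -> _] := inner (lift ord0 i).
  rewrite big_mkcond big_ord_recr /= [X in _ + X](_ : _ = 0) ?addr0; last first.
    by rewrite ifF// /bump /= add1n addSn ltnS ltnNge leq_addl.
  rewrite [RHS]big_mkcond; apply: eq_bigr => j _; rewrite /bump /= add1n addSn ltnS.
  by case: ifP => // _; rewrite (dx_mon _ _ _ _).1.
exists (fun i j => c i j.+1 * j.+1%:R) => x.
rewrite pE' D2 big_ord_recr /= [X in _ + X](_ : _ = 0) ?addr0; last first.
  have [_ _ ->] := inner ord_max; apply: big1 => j /=; rewrite -[X in (_ < X)%N]addn1 ltn_add2l ltnS leqn0 => /eqP j0.
  by rewrite (dx_mon _ _ _ _).2 j0 !(mulr0, mul0r).
apply: eq_bigr => i _; have [_ _ ->] := inner (widen_ord (leqnSn m) i).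
rewrite big_mkcond big_ord_recl /= [X in X + _](_ : _ = 0) ?add0r; last first.
  by case: ifP => // _; rewrite (dx_mon _ _ _ _).2 !(mulr0, mul0r).
rewrite [RHS]big_mkcond; apply: eq_bigr => j _; rewrite /= /bump /= add1n addnS ltnS.
by case: ifP => // _; rewrite (dx_mon _ _ _ _).2.
Qed.

Lemma poly2_widen m p : poly2 m p -> poly2 m.+1 p.
Proof.
move=> [c pE]; exists (fun i j => if (i + j < m)%N then c i j else 0) => x.
rewrite pE [RHS]big_ord_recr /= [X in _ = _ + X](_ : _ = 0) ?addr0; last first.
  by apply: big1 => j _; rewrite ltnNge leq_addr /= !mul0r.
apply: eq_bigr => i _; rewrite [RHS]big_mkcond [RHS]big_ord_recr /=.
rewrite [X in _ = _ + X](_ : _ = 0) ?addr0; last first.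
  by case: ifP => // _; rewrite ltnNge leq_addl /= !mul0r.
rewrite big_mkcond; apply: eq_bigr => j _; case: ifP => h; first by rewrite ifT// ltnS ltnW.
by rewrite !mul0r; case: ifP.
Qed.

Lemma poly2_lin m (u v : R) p q : poly2 m p -> poly2 m q -> poly2 m (fun x => u * p x + v * q x).
Proof.
move=> [c pE] [d qE]; exists (fun i j => u * c i j + v * d i j) => x.
rewrite pE qE !mulr_sumr -big_split; apply: eq_bigr => i _.
by rewrite !mulr_sumr -big_split; apply: eq_bigr => j _; rewrite /=; ring.
Qed.

Lemma poly2_sub m p q : poly2 m p -> poly2 m q -> poly2 m (fun x => p x - q x).
Proof.
move=> hp hq; rewrite (_ : (fun x => _) = (fun x => 1 * p x + (-1) * q x)); first exact: poly2_lin.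
by apply: funext => x; rewrite mul1r mulN1r.
Qed.

Lemma poly2_zero m : poly2 m (fun=> 0 : R).
Proof. by exists (fun _ _ => 0) => x; rewrite big1// => i _; rewrite big1// => j _; rewrite !mul0r. Qed.

(** Both coordinates are affine in t, so the bound on the total degree i + j becomes a bound on the
    degree in t. *)
Lemma poly2_line k p a b : poly2 k.+1 p -> exists2 q : {poly R}, (size q <= k.+1)%N &
  forall t, q.[t] = p (lerp a b t).
Proof.
move=> [c pE]; pose l1 : {poly R} := (a.1)%:P + (b.1 - a.1) *: 'X; pose l2 : {poly R} := (a.2)%:P + (b.2 - a.2) *: 'X.
have sl (u v : R) : (size (u%:P + v *: 'X : {poly R})%R <= 2)%N.
  apply: leq_trans (size_polyD _ _) _; rewrite geq_max (leq_trans (size_polyC_leq1 _))//=.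
  by apply: leq_trans (size_scale_leq _ _) _; rewrite size_polyX.
have sx (l : {poly R}) n : (size l <= 2)%N -> (size (l ^+ n)%R <= n.+1)%N.
  move=> l2'; apply: leq_trans (size_poly_exp_leq _ _) _; rewrite ltnS -[leqRHS]mul1n leq_mul2r.
  by case: (size l) l2' => [|[|[|?]]] //= _; rewrite orbT.
exists (\sum_(i < k.+1) \sum_(j < k.+1 | (i + j < k.+1)%N) (c i j)%:P * l1 ^+ i * l2 ^+ j).
  apply: (leq_trans (size_sum _ _ _)); apply/bigmax_leqP => i _.
  apply: (leq_trans (size_sum _ _ _)); apply/bigmax_leqP => j ij.
  rewrite -mulrA mul_polyC; apply: leq_trans (size_scale_leq _ _) _.
  apply: leq_trans (size_polyMleq _ _) _.
  apply: leq_trans ij; rewrite -ltnS; apply: (@leq_trans (i.+1 + j.+1)); last by rewrite addSn addnS.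
  have := leq_add (sx l1 i (sl _ _)) (sx l2 j (sl _ _)); by case: (_ + _)%N => [|n] //=.
move=> t; rewrite horner_sum pE; apply: eq_bigr => i _; rewrite horner_sum; apply: eq_bigr => j _.
rewrite !hornerM hornerC !horner_exp /l1 /l2 !hornerD !hornerC !hornerZ !hornerX.
by rewrite (mulrC (b.1 - a.1)) (mulrC (b.2 - a.2)).
Qed.

End Polynomials.

Section TestFunctionFacts.
Set Implicit Arguments.
Unset Strict Implicit.
Context {R : realType}.
Notation pt := (R * R)%type.
Implicit Types (f g p phi : pt -> R) (D : set pt) (x y z : pt).

Lemma test_fun_c1 D phi : test_fun D phi -> c1 phi.
Proof.
move=> [h _]; have [d [c1' c2']] := h 1%N; have c0 := h 0%N.
by split; [exact: c0|move=> x; have [] := d x|exact: c1'|move=> x; have [] := d x|exact: c2'].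
Qed.

Lemma test_fun_vanish D phi : test_fun D phi -> exists B, vanish B phi.
Proof.
move=> [_ [cK _]]; have [M [_ hM]] := compact_bounded cK.
exists (`|M| + 2) => x xB; apply: contrapT => /eqP nx.
have := hM (`|M| + 1) _ x (@subset_closure _ [set x | phi x != 0] x nx); rewrite (le_lt_trans (ler_norm _)) ?ltrDl// => /(_ isT).
by move=> /= h; move: xB h; lra.
Qed.

Lemma test_fun_zero_near D phi x : test_fun D phi -> ~ D x -> \forall y \near x, phi y = 0.
Proof.
move=> [_ [_ KD]] nDx; have : nbhs x (~` closure [set x | phi x != 0]).
  apply: open_nbhs_nbhs; split; first by rewrite openC; exact: closed_closure.
  by move/KD.
by apply: filterS => y ny; apply: contrapT => /eqP h; apply: ny; exact: subset_closure.
Qed.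

End TestFunctionFacts.

(** A quarter turn, chosen so that the divergence of the turned field is the rotational of v; the
    claims on [Hrot] and [wrot] are thus deduced from those on [Hdiv] and [wdiv]. *)
Definition rotv {R : realType} (v : R * R -> 'rV[R]_2) : R * R -> 'rV[R]_2 :=
  fun x => \row_j (if j == 0 then v x 0 1 else - v x 0 0).

Section VirtualSpace.
Set Implicit Arguments.
Unset Strict Implicit.
Context {R : realType}.
Notation pt := (R * R)%type.
Notation T1 := (measurableTypeR R).
Implicit Types (f g h phi : pt -> R) (D : set pt) (a b x y z : pt) (tau p v : pt -> 'rV[R]_2).

Lemma weak_div_unique D v g h : open D -> L2v D v -> L2 D g -> L2 D h ->
  is_weak_div D v g -> is_weak_div D v h -> {ae (@mu2 R), forall x, D x -> g x = h x}.
Proof.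
move=> oD Lv Lg Lh wg wh; have /L2P sg := Lg; have /L2P sh := Lh.
have fl := @fundamental_lemma R D (fun x => (g \_ D) x - (h \_ D) x) oD (sqiB sg sh).
suff H : forall phi, tst D phi -> Int (fun x => ((g \_ D) x - (h \_ D) x) * phi x) = 0.
  by apply: filterS (fl H) => x hx Dx; have /eqP := hx Dx; rewrite !patchE mem_set// subr_eq0 => /eqP.
move=> phi tp; have ig := sqi_mul sg (tst_sqi tp); have ih := sqi_mul sh (tst_sqi tp).
rewrite (_ : (fun x => _) = (fun x => (g \_ D) x * phi x - (h \_ D) x * phi x)); last first.
  by apply: funext => x; rewrite mulrBl.
rewrite (IntB ig ih); apply/eqP; rewrite subr_eq0 -eqr_opp.
by rewrite -(weak_div_Int oD Lv Lg wg tp) -(weak_div_Int oD Lv Lh wh tp).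
Qed.

Lemma continuous_L2 D f : open D -> bounded_set D -> continuous f -> L2 D f.
Proof.
move=> oD bD cf; apply/L2P; have mD := mble_open oD.
have [B DB] := bounded_setP bD.
have [C C0 hC] := continuous_compact_bounded (compact_sqbox (B := B)) cf.
have s1 := bounded_sqi1 bD mD.
have -> : f \_ D = (fun x => (f \_ D) x * \1_D x).
  by apply: funext => x; rewrite patchE indicE; case: ifP => _; rewrite ?mulr1 ?mul0r.
apply: (sqi_bounded_mul (C := C) s1); first exact: meas_patch (meas_continuous cf).
move=> x; rewrite patchE; case: ifPn => [|_]; last by rewrite normr0.
by rewrite inE => /DB; exact: hC.
Qed.

Lemma dotv_grad v phi x : dotv (v x) (grad phi x) = v x 0 0 * dx1 phi x + v x 0 1 * dx2 phi x.
Proof. by rewrite dotvE; have [-> ->] := gradE phi x. Qed.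

Lemma test_fun_sqi D phi : test_fun D phi -> [/\ sqi phi, sqi (dx1 phi) & sqi (dx2 phi)].
Proof.
move=> tp; have [cp p1 cp1 p2 cp2] := test_fun_c1 tp; have [B vB] := test_fun_vanish tp.
by split; [exact: vanish_sqi cp vB|exact: vanish_sqi cp1 (vanish_derive (1, 0) vB)|exact: vanish_sqi cp2 (vanish_derive (0, 1) vB)].
Qed.

Definition smv p := sm (fun x => p x 0 0) /\ sm (fun x => p x 0 1).
Definition pdiv p : pt -> R := fun x => dx1 (fun y => p y 0 0) x + dx2 (fun y => p y 0 1) x.

Lemma pdiv_weak D p : open D -> smv p -> is_weak_div D p (pdiv p).
Proof.
move=> oD [s0 s1] phi tp; have mD := mble_open oD; rewrite !(RintE _ mD).
have [B vB] := test_fun_vanish tp; have cp := test_fun_c1 tp; have [c0 _ c1' _ c2'] := cp.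
have out (g : pt -> R) : (forall x, (\forall y \near x, phi y = 0) -> g x = 0) -> g \_ D = g.
  move=> h; apply: funext => x; rewrite patchE; case: ifPn => // nDx.
  by rewrite h//; apply: test_fun_zero_near tp _ => Dx; move: nDx; rewrite mem_set.
rewrite !out; last 2 first.
- by move=> x h; rewrite (nbhs_singleton h) mulr0.
- by move=> x h; rewrite dotv_grad (derive_zero_near _ h : dx1 phi x = 0) (derive_zero_near _ h : dx2 phi x = 0) !mulr0 addr0.
have P1 := Int_parts1 (sm_c1 s0) cp vB; have P2 := Int_parts2 (sm_c1 s1) cp vB.
have it f g : continuous f -> continuous g -> (exists B', vanish B' g) -> itg (fun x => f x * g x).
  move=> cf cg [B' vg]; apply: (@vanish_itg _ B'); first by move=> x; apply: cvgM; [exact: cf|exact: cg].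
  by move=> x /vg ->; rewrite mulr0.
have v1 : exists B', vanish B' (dx1 phi) by exists (B + 1); exact: vanish_derive.
have v2 : exists B', vanish B' (dx2 phi) by exists (B + 1); exact: vanish_derive.
have v0 : exists B', vanish B' phi by exists B.
have i1 := it _ _ (sm_continuous s0) c1' v1; have i2 := it _ _ (sm_continuous s1) c2' v2.
have i3 := it _ _ (sm_continuous (sm_dx1 s0)) c0 v0; have i4 := it _ _ (sm_continuous (sm_dx2 s1)) c0 v0.
rewrite (_ : (fun x => dotv _ _) = (fun x => p x 0 0 * dx1 phi x + p x 0 1 * dx2 phi x)); last first.
  by apply: funext => x; rewrite dotv_grad.
rewrite (_ : (fun x => pdiv p x * phi x) = (fun x => dx1 (fun y => p y 0 0) x * phi x + dx2 (fun y => p y 0 1) x * phi x)); last first.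
  by apply: funext => x; exact: mulrDl.
have arith (u1 u2 u3 u4 : R) : u3 = - u1 -> u4 = - u2 -> u1 + u2 = - (u3 + u4) by move=> -> ->; rewrite opprD !opprK.
apply: (etrans (IntD i1 i2)); apply: (etrans _ (congr1 (fun t => - t) (esym (IntD i3 i4)))).
exact: (arith _ _ _ _ P1 P2).
Qed.

Lemma ord2 (j : 'I_2) : j = 0 \/ j = 1.
Proof. by case: j => [[|[|]]] // ?; [left|right]; exact: val_inj. Qed.

Lemma smv_L2 D p : open D -> bounded_set D -> smv p -> L2v D p /\ L2 D (pdiv p).
Proof.
move=> oD bD [s0 s1]; split.
  by move=> j; have [->|->] := ord2 j; apply: continuous_L2 => //; exact: sm_continuous.
by apply: continuous_L2 => //; apply: sm_continuous; apply: sm_add; [exact: sm_dx1|exact: sm_dx2].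
Qed.

Lemma L2_sub D f g : L2 D f -> L2 D g -> L2 D (fun x => f x - g x).
Proof.
move=> /L2P sf /L2P sg; apply/L2P; have := sqiB sf sg.
rewrite (_ : (fun x => (f \_ D) x - (g \_ D) x) = (fun x => f x - g x) \_ D)//.
by apply: funext => x; rewrite !patchE; case: ifP => // _; rewrite subr0.
Qed.

(** Both values of [wdiv] are arbitrary representatives, so they are related almost everywhere only;
    integrals and [in_poly] do not see the difference. *)
Lemma Hdiv_sub D tau p : open D -> bounded_set D -> Hdiv D tau -> smv p ->
  [/\ Hdiv D (fun x => tau x - p x), is_weak_div D (fun x => tau x - p x) (fun x => wdiv D tau x - pdiv p x) &
      {ae (@mu2 R), forall x, D x -> wdiv D (fun x => tau x - p x) x = wdiv D tau x - pdiv p x}].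
Proof.
move=> oD bD Ht sp; have mD := mble_open oD; have [Lt _] := Ht; have [Lw wt] := wdivP Ht.
have [Lp Lq] := smv_L2 oD bD sp; have wp := pdiv_weak oD sp.
have Ltp : L2v D (fun x => tau x - p x).
  move=> j; rewrite (_ : (fun x => _) = (fun x => tau x 0 j - p x 0 j)); first exact: L2_sub (Lt j) (Lp j).
  by apply: funext => x; rewrite !mxE.
have Lg := L2_sub Lw Lq.
have wd : is_weak_div D (fun x => tau x - p x) (fun x => wdiv D tau x - pdiv p x).
  move=> phi tp; have [q0 q1 q2] := test_fun_sqi tp.
  have := wt phi tp; have := wp phi tp; rewrite !(RintE _ mD) => e1 e2.
  have split_ v : L2v D v -> itg ((fun x => dotv (v x) (grad phi x)) \_ D).
    move=> Lv; have s0 := (L2P D _).1 (Lv 0); have s1 := (L2P D _).1 (Lv 1).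
    have := itgD (sqi_mul s0 q1) (sqi_mul s1 q2); rewrite (_ : (fun x => _) = (fun x => dotv (v x) (grad phi x)) \_ D)//.
    by apply: funext => x; rewrite !patchE dotv_grad; case: ifP => // _; rewrite !mul0r addr0.
  have iw := sqi_mul ((L2P D _).1 Lw) q0; rewrite patchM in iw.
  have iq := sqi_mul ((L2P D _).1 Lq) q0; rewrite patchM in iq.
  have sub (f g h : pt -> R) : (forall x, f x = g x - h x) -> itg (g \_ D) -> itg (h \_ D) ->
      Int (f \_ D) = Int (g \_ D) - Int (h \_ D).
    move=> E ig ih; rewrite -(IntB ig ih); apply: (congr1 Int); apply: funext => x.
    by rewrite !patchE; case: ifP => // _; rewrite subr0.
  rewrite (sub _ _ _ _ (split_ _ Lt) (split_ _ Lp)); last first.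
    by move=> x; rewrite !dotvE; have [-> ->] := gradE phi x; rewrite !mxE; move: (dx1 phi x) (dx2 phi x) => u w; ring.
  rewrite (sub (fun x => (wdiv D tau x - pdiv p x) * phi x) _ _ _ iw iq); last by move=> x; exact: mulrBl.
  by rewrite e1 e2; ring.
have H : Hdiv D (fun x => tau x - p x) by split => //; exists (fun x => wdiv D tau x - pdiv p x).
split; [exact: H|exact: wd|].
have [L1 w1] := wdivP H.
exact: weak_div_unique oD Ltp L1 Lg w1 wd.
Qed.

Lemma weak_rotE D v g : is_weak_rot D v g <-> is_weak_div D (rotv v) g.
Proof.
have E phi : (fun x => v x 0 1 * dx1 phi x - v x 0 0 * dx2 phi x) = (fun x => dotv (rotv v x) (grad phi x)).
  by apply: funext => x; rewrite dotv_grad !mxE /= mulNr.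
by split=> h phi tp; have := h phi tp; rewrite E.
Qed.

Lemma wrotE D v : wrot D v = wdiv D (rotv v).
Proof.
rewrite /wrot /wdiv; congr xget; apply/seteqP; split => g [Lg wg]; split => //; exact/weak_rotE.
Qed.

Lemma L2v_rotv D v : L2v D v <-> L2v D (rotv v).
Proof.
have N f : L2 D (fun x => - f x) <-> L2 D f.
  have K h : L2 D h -> L2 D (fun x => - h x).
    move=> /L2P sh; apply/L2P; have := sqiN sh; rewrite (_ : (fun x => _) = (fun x => - h x) \_ D)//.
    by apply: funext => x; rewrite !patchE; case: ifP => // _; rewrite oppr0.
  split=> [/K|]; last exact: K.
  by rewrite (_ : (fun x => - - f x) = f)//; apply: funext => x; rewrite opprK.
have E0 : (fun x => rotv v x 0 0) = (fun x => v x 0 1) by apply: funext => x; rewrite mxE.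
have E1 : (fun x => rotv v x 0 1) = (fun x => - v x 0 0) by apply: funext => x; rewrite mxE.
split=> h j; have [->|->] := ord2 j; rewrite ?E0 ?E1.
- exact: h 1.
- exact/N/(h 0).
- by apply/N; rewrite -E1; exact: h 1.
- by rewrite -E0; exact: h 0.
Qed.

Lemma HrotE D v : Hrot D v <-> Hdiv D (rotv v).
Proof.
split=> -[L [g [Lg wg]]].
  by split; [exact: (L2v_rotv D v).1|exists g; split => //; exact: (weak_rotE D v g).1].
by split; [exact: (L2v_rotv D v).2|exists g; split => //; exact: (weak_rotE D v g).2].
Qed.

Lemma rotv_sub tau p : rotv (fun x => tau x - p x) = (fun x => rotv tau x - rotv p x).
Proof.
apply: funext => x; apply/rowP => j; rewrite !mxE; case: ifP => _ //.
by rewrite opprD.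
Qed.

Lemma in_poly_sub D m f g q : mble D -> in_poly D m f -> poly2 m q ->
  {ae (@mu2 R), forall x, D x -> g x = f x - q x} -> in_poly D m g.
Proof.
move=> mD [r pr fr] pq ae; exists (fun x => r x - q x); first exact: poly2_sub.
by apply: filterS2 ae fr => x h1 h2 Dx; rewrite h1// h2.
Qed.

Lemma zero_ends (h : R -> R) : continuous h -> (forall t, 0 < t < 1 -> h t = 0) -> h 0 = 0 /\ h 1 = 0.
Proof.
move=> ch h0; split.
  have L1 : h t @[t --> 0^'+] --> h 0 by apply: cvg_at_right_filter; exact: ch.
  have L2 : h t @[t --> 0^'+] --> (0 : R).
    apply: (@cvg_trans _ ((fun=> 0 : R) @ (0 : R)^'+)); last exact: cvg_cst.
    apply: near_eq_cvg; near=> t; apply: esym; apply: h0.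
    by apply/andP; split; near: t; [exact: nbhs_right_gt|exact: nbhs_right_lt].
  exact: (cvg_unique (@norm_hausdorff _ _) L1 L2).
have L1 : h t @[t --> 1^'-] --> h 1 by apply: cvg_at_left_filter; exact: ch.
have L2 : h t @[t --> 1^'-] --> (0 : R).
  apply: (@cvg_trans _ ((fun=> 0 : R) @ (1 : R)^'-)); last exact: cvg_cst.
  apply: near_eq_cvg; near=> t; apply: esym; apply: h0.
  by apply/andP; split; near: t; [exact: nbhs_left_gt|exact: nbhs_left_lt].
exact: (cvg_unique (@norm_hausdorff _ _) L1 L2).
Unshelve. all: by end_near.
Qed.

(** On any other edge phi vanishes in the interior, hence by continuity at both ends; and each end
    of e is also an end of a neighbouring edge. *)
Lemma trace_ends (E : polygon R) (e : 'I_(nvert E)) phi : is_polygon E ->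
  (forall e : 'I_(nvert E), edge_src e != edge_dst e) -> continuous phi ->
  (forall x, frontier (Defs.pset E) x -> ~ edge e x -> phi x = 0) ->
  phi (edge_src e) = 0 /\ phi (edge_dst e) = 0.
Proof.
move=> pE nd cphi phi0; have [_ _ _ fr] := pE.
have other (j : 'I_(nvert E)) : j != e -> phi (edge_src j) = 0 /\ phi (edge_dst j) = 0.
  move=> je; have cl : continuous (fun t : R => phi (lerp (edge_src j) (edge_dst j) t)).
    by move=> t; apply: continuous_comp; [exact: lerp_continuous|exact: cphi].
  have [t t01|] := zero_ends cl; last by rewrite /lerp scale0r addr0 scale1r addrC subrK.
  apply: phi0; last by move=> /(edge_interior pE (nd j) t01)/eqP; rewrite eq_sym (negPf je).
  by rewrite fr; exists j => //; exists t => //=; rewrite in_itv /=; case/andP: t01 => /ltW -> /ltW ->.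
have nS (j : 'I_(nvert E)) : ordS j != j.
  by apply/eqP => h; have := nd j; rewrite /edge_dst h eqxx.
split.
  have := other (ord_pred e); rewrite /edge_dst ord_predK => h.
  by apply: (h _).2; rewrite -{2}(ord_predK e) eq_sym nS.
by have := other (ordS e) (nS e); case.
Qed.

(** Since phi vanishes on the other edges and at the ends of e, [green_edge] applies to the products
    of phi with the components of p, and the boundary integrand is polynomial along the edge. *)
Lemma normal_trace_sub k (E : polygon R) tau p (r : R) : is_polygon E -> star_shaped_ball (Defs.pset E) r ->
  0 < r -> (forall e : 'I_(nvert E), edge_src e != edge_dst e) ->
  Hdiv (Defs.pset E) tau -> (forall j, poly2 k.+1 (fun x => p x 0 j)) ->
  forall e : 'I_(nvert E), normal_trace_poly k tau e -> normal_trace_poly k (fun x => tau x - p x) e.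
Proof.
move=> pE star r0 ndeg Ht pp e [q sq hq]; have [_ [oD bD _ _] tri fr] := pE; have mD := mble_open oD.
set D := Defs.pset E in star Ht hq oD bD fr mD *.
have p0 := pp 0; have p1 := pp 1; have sp : smv p by split; exact: poly2_sm.
have [H' _ wae] := Hdiv_sub oD bD Ht sp.
set a := edge_src e in hq *; set b := edge_dst e in hq *.
have ab : a != b := ndeg e.
have [kp k1 side] := polygon_one_sided pE star r0 ab.
have len0 : 0 < edge_len e.
  rewrite /edge_len /Defs.edist sqrtr_gt0 -/a -/b; have := edge_sqr_gt0 ab.
  by rewrite -(sqrrN (a.1 - b.1)) -(sqrrN (a.2 - b.2)) !opprB.
have [q0 sq0 q0E] := poly2_line a b p0; have [q1 sq1 q1E] := poly2_line a b p1.
(* The outer normal times the length of the edge is kp (- (b.2 - a.2), b.1 - a.1); the length is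
   divided out because [normal_trace_poly] has it in front of the integral. *)
pose c0 := - (kp * (b.2 - a.2)) / edge_len e; pose c1' := kp * (b.1 - a.1) / edge_len e.
exists (q - (c0 *: q0 + c1' *: q1)).
  apply: leq_trans (size_polyD _ _) _; rewrite geq_max sq size_polyN.
  apply: leq_trans (size_polyD _ _) _; rewrite geq_max.
  by rewrite (leq_trans (size_scale_leq _ _) sq0) (leq_trans (size_scale_leq _ _) sq1).
move=> phi tp phi0; rewrite -/D -/a -/b.
have [B vB] := test_fun_vanish tp; have cp := test_fun_c1 tp; have [cphi _ _ _ _] := cp.
have [t0 t1 t2] := test_fun_sqi tp.
have [pa pb] := trace_ends pE ndeg cphi phi0.
have grn (g : pt -> R) : sm g ->
    Int ((dx1 (fun x => g x * phi x)) \_ D) =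
      \int[lebesgue_measure]_(t in `[0, 1]) (- (kp * (b.2 - a.2)) * (g (lerp a b t) * phi (lerp a b t))) /\
    Int ((dx2 (fun x => g x * phi x)) \_ D) =
      \int[lebesgue_measure]_(t in `[0, 1]) (kp * (b.1 - a.1) * (g (lerp a b t) * phi (lerp a b t))).
  move=> sg; have cgp := c1M (sm_c1 sg) cp.
  have vgp : vanish B (fun x => g x * phi x) by move=> x /vB ->; rewrite mulr0.
  have [] := green_edge oD cgp vgp k1 ab side.
  - by move=> x fx nx; rewrite phi0 ?mulr0.
  - by rewrite pa mulr0.
  - by rewrite pb mulr0.
  by move=> e1 e2; split; apply: EFin_inj; [rewrite e1|rewrite e2]; rewrite /Rintegral fineK//; [rewrite -e1|rewrite -e2].
have [G0 _] := grn _ sp.1; have [_ G1] := grn _ sp.2.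
have cl : continuous (fun t : R => phi (lerp a b t)).
  by move=> t; apply: continuous_comp; [exact: lerp_continuous|exact: cphi].
have cq (l : {poly R}) : continuous (fun t : R => l.[t] * phi (lerp a b t)).
  by move=> t; apply: cvgM; [exact: continuous_horner|exact: cl].
have iq (l : {poly R}) : (@mu1 R).-integrable `[0, 1]%classic (fun t : T1 => (l.[t] * phi (lerp a b t))%:E).
  apply: continuous_compact_integrable; first exact: segment_compact.
  by apply: continuous_subspaceT.
pose J (l : {poly R}) : R := \int[lebesgue_measure]_(t in `[0, 1]) (l.[t] * phi (lerp a b t)).
have m01 : @measurable _ T1 `[0, 1]%classic by exact: measurable_itv.
have JZ (c : R) l : J (c *: l) = c * J l.
  apply: (etrans _ (@RintegralZl _ T1 R (@mu1 R) _ _ c m01 (iq l))); apply: eq_Rintegral => t _.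
  by rewrite hornerZ mulrA.
have JB l1 l2 : J (l1 - l2) = J l1 - J l2.
  apply: (etrans _ (@RintegralB _ T1 R (@mu1 R) _ _ _ m01 (iq l1) (iq l2))); apply: eq_Rintegral => t _.
  by rewrite hornerD hornerN mulrBl.
have JD l1 l2 : J (l1 + l2) = J l1 + J l2.
  apply: (etrans _ (@RintegralD _ T1 R (@mu1 R) _ _ _ m01 (iq l1) (iq l2))); apply: eq_Rintegral => t _.
  by rewrite hornerD mulrDl.
have E0 : Int ((dx1 (fun x => p x 0 0 * phi x)) \_ D) = - (kp * (b.2 - a.2)) * J q0.
  rewrite G0 -JZ; apply: eq_Rintegral => t _; by rewrite hornerZ q0E mulrA.
have E1 : Int ((dx2 (fun x => p x 0 1 * phi x)) \_ D) = kp * (b.1 - a.1) * J q1.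
  rewrite G1 -JZ; apply: eq_Rintegral => t _; by rewrite hornerZ q1E mulrA.
have hqE := hq phi tp phi0; rewrite (RintE _ mD) -/(J q) in hqE.
rewrite (RintE _ mD) -/(J _) JB JD !JZ.
have [Lt Lw] := (Ht.1, (wdivP Ht).1); have [Lp Lq] := smv_L2 oD bD sp.
have iA (w : pt -> 'rV[R]_2) (g : pt -> R) : L2v D w -> L2 D g ->
    itg ((fun x => dotv (w x) (grad phi x) + g x * phi x) \_ D).
  move=> Lw' Lg; have s0 := (L2P D _).1 (Lw' 0); have s1 := (L2P D _).1 (Lw' 1).
  have := itgD (itgD (sqi_mul s0 t1) (sqi_mul s1 t2)) (sqi_mul ((L2P D _).1 Lg) t0).
  rewrite (_ : (fun x => _) = (fun x => dotv (w x) (grad phi x) + g x * phi x) \_ D)//.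
  by apply: funext => x; rewrite !patchE dotv_grad; case: ifP => // _; rewrite !mul0r !addr0.
have [Ltp _] := H'; have [Lwp _] := wdivP H'.
have i1 := iA _ _ Ltp Lwp; have i2 := iA _ _ Lt Lw; have i3 := iA _ _ Lp Lq.
have -> : Int ((fun x => dotv (tau x - p x) (grad phi x) + wdiv D (fun x => tau x - p x) x * phi x) \_ D) =
    Int ((fun x => dotv (tau x) (grad phi x) + wdiv D tau x * phi x) \_ D) -
    Int ((fun x => dotv (p x) (grad phi x) + pdiv p x * phi x) \_ D).
  rewrite -(IntB i2 i3); apply: eq_Int_ae; first exact: itg_meas i1.
    exact: itg_meas (itgB i2 i3).
  apply: filterS wae => x hx; rewrite !patchE; case: ifPn => [|_]; last by rewrite subr0.
  rewrite inE => /hx ->; rewrite !dotvE; have [-> ->] := gradE phi x; rewrite !mxE.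
  by move: (dx1 phi x) (dx2 phi x) (wdiv D tau x) (pdiv p x) => u1 u2 u3 u4; ring.
have -> : Int ((fun x => dotv (p x) (grad phi x) + pdiv p x * phi x) \_ D) =
    Int ((dx1 (fun x => p x 0 0 * phi x)) \_ D) + Int ((dx2 (fun x => p x 0 1 * phi x)) \_ D).
  have [_ d0 cd0 _ _] := c1M (sm_c1 sp.1) cp; have [_ _ _ d1 cd1] := c1M (sm_c1 sp.2) cp.
  have v0 : vanish B (fun x => p x 0 0 * phi x) by move=> x /vB ->; rewrite mulr0.
  have v1 : vanish B (fun x => p x 0 1 * phi x) by move=> x /vB ->; rewrite mulr0.
  have j0 := itg_patch mD (vanish_itg cd0 (vanish_derive (1, 0) v0)).
  have j1 := itg_patch mD (vanish_itg cd1 (vanish_derive (0, 1) v1)).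
  rewrite -(IntD j0 j1); apply: (congr1 Int); apply: funext => x; rewrite !patchE.
  case: ifP => _; last by rewrite addr0.
  have [_ dp _ dp' _] := cp.
  rewrite (dx1M (sm_derivable sp.1) (dp x)) (dx2M (sm_derivable sp.2) (dp' x)) dotv_grad /pdiv.
  by move: (dx1 _ x) (dx2 _ x) (dx1 phi x) (dx2 phi x) => u1 u2 u3 u4; ring.
rewrite hqE E0 E1 /c0 /c1'; move: (J q) (J q0) (J q1) => u1 u2 u3; field.
by rewrite gt_eqF.
Qed.

(** The entries of p have degree k, so divergence and rotational have degree k - 1: the first is
    widened to P_k, the second has exactly the degree allowed, [poly2 k] standing for P_(k-1). *)
Theorem WhE_sub k (E : polygon R) tau p (r : R) : is_polygon E -> star_shaped_ball (Defs.pset E) r ->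
  0 < r -> (forall e : 'I_(nvert E), edge_src e != edge_dst e) ->
  WhE k E tau -> (forall j, poly2 k.+1 (fun x => p x 0 j)) -> WhE k E (fun x => tau x - p x).
Proof.
move=> pE star r0 nd [Hd Hr tr pd pr] pp; have [_ [oD bD _ _] _ _] := pE; have mD := mble_open oD.
have p0 := pp 0; have p1 := pp 1.
have sp : smv p by split; exact: poly2_sm.
have E0 : (fun x => rotv p x 0 0) = (fun x => p x 0 1) by apply: funext => x; rewrite mxE.
have E1 : (fun x => rotv p x 0 1) = (fun x => - p x 0 0) by apply: funext => x; rewrite mxE.
have sr : smv (rotv p) by split; rewrite ?E0 ?E1; [exact: poly2_sm p1|apply: sm_opp; exact: poly2_sm p0].
have [H1 _ ae1] := Hdiv_sub oD bD Hd sp.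
have [H2 _ ae2] := Hdiv_sub oD bD ((HrotE _ _).1 Hr) sr.
have [d11 d12] := poly2_dx p0; have [d21 d22] := poly2_dx p1.
have lin1 (f g : pt -> R) : poly2 k f -> poly2 k g -> poly2 k (fun x => f x + g x).
  move=> hf hg; rewrite (_ : (fun x => _) = (fun x => 1 * f x + 1 * g x)); first exact: poly2_lin.
  by apply: funext => x; rewrite !mul1r.
split.
- exact: H1.
- by apply/HrotE; rewrite rotv_sub.
- by move=> e; exact: normal_trace_sub pE star r0 nd Hd pp e (tr e).
- by apply: (in_poly_sub mD pd _ ae1); apply: poly2_widen; exact: lin1.
rewrite wrotE rotv_sub; rewrite wrotE in pr; apply: (in_poly_sub mD pr _ ae2).
rewrite /pdiv E0 E1 (_ : (fun x => _) = (fun x => 1 * dx1 (fun y => p y 0 1) x + (-1) * dx2 (fun y => p y 0 0) x)); first exact: poly2_lin.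
apply: funext => x; rewrite mul1r; congr (_ + _).
rewrite (_ : (fun y => - p y 0 0) = (fun y => -1 * p y 0 0)); last by apply: funext => y; rewrite mulN1r.
exact: (congr1 (fun h : pt -> R => h x) (dx2_scale (-1) (poly2_sm p0))).
Qed.

End VirtualSpace.

(** * The cells of the mesh *)

Section Cells.
Set Implicit Arguments.
Unset Strict Implicit.
Context {R : realType}.
Notation pt := (R * R)%type.
Implicit Types (f g h phi : pt -> R) (A D : set pt) (a b x y z : pt).

Lemma integral_point (f : R -> R) (c : R) : (forall t, t != c -> f t = 0) -> (\int[mu1]_t (f t)%:E = 0)%E.
Proof.
move=> f0; transitivity (\int[mu1]_(t in [set c]) (f t)%:E)%E; last exact: integral_set1.
rewrite [RHS]integral_mkcond; apply: eq_integral => t _; rewrite patchE.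
by case: ifPn => // tc; rewrite f0//; apply: contra tc => /eqP ->; rewrite inE.
Qed.

(** Fubini in a coordinate direction for which every line meets the segment in at most one point:
    vertical lines if it is horizontal or degenerate to a point in the second coordinate, horizontal
    lines otherwise. For a horizontal segment the slice at t is contained in the single height
    a.2. *)
Lemma seg_null a b : {ae (@mu2 R), forall x, ~ seg a b x}.
Proof.
have mA : mble (seg a b).
  by have := mble_open (closed_openC (@seg_closed R a b)); move=> /measurableC; rewrite setCK.
have [M AM] : exists M : R, seg a b `<=` box 0 M.
  exists (`|a| + `|b - a| + 1) => x [t]; rewrite /= in_itv /= => /andP[t0 t1] <-; apply/box0P.
  rewrite /lerp; apply: le_lt_trans (ler_normD _ _) _; rewrite -addrA ltrD2l normrZ ger0_norm//.
  by have := normr_ge0 (b - a); nra.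
have fin : (mu2 (seg a b) < +oo)%E.
  apply: le_lt_trans (mu2_box_lty 0 M); apply: le_measure; rewrite ?inE//; exact: mble_box.
have iA := itg_indic mA fin.
have out x : ~ seg a b x -> (\1_(seg a b) x : R) = 0 by move=> nx; rewrite indicE memNset.
have I0 : Int (\1_(seg a b) : pt -> R) = 0.
  apply: EFin_inj; have [m0|m0] := eqVneq (b.2 - a.2) 0.
    rewrite (Int_fubini2 iA); apply: integral0_eq => t _; apply: (@integral_point _ a.2) => s sa.
    apply: out => -[r _ rE]; case/eqP: sa; rewrite -[s]/((t, s) : pt).2 -rE.
    by rewrite -[LHS]/(a.2 + r * (b.2 - a.2)) m0 mulr0 addr0.
  rewrite (Int_fubini1 iA); apply: integral0_eq => s _.
  apply: (@integral_point _ (a.1 + (s - a.2) / (b.2 - a.2) * (b.1 - a.1))) => t ta.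
  apply: out => -[r _ rE]; case/eqP: ta; have e1 := congr1 fst rE; have e2 := congr1 snd rE.
  rewrite -[LHS]/(a.1 + r * (b.1 - a.1)) /= in e1; rewrite -[LHS]/(a.2 + r * (b.2 - a.2)) /= in e2.
  by rewrite -e1 -e2; field.
exists (seg a b); split => //; last by move=> x /= /contrapT.
have := Int_EFin iA; rewrite I0 => E0.
by have := integral_indic (@mu2 R) measurableT mA; rewrite setIT E0.
Qed.

Lemma polygon_frontier_null (E : polygon R) : is_polygon E -> {ae (@mu2 R), forall x, ~ frontier (Defs.pset E) x}.
Proof.
move=> [_ _ _ ->].
have : {ae (@mu2 R), forall x, forall i : 'I_(nvert E), ~ edge i x}.
  by apply: (filter_forall (f := fun i x => ~ edge i x) (F := almost_everywhere (@mu2 R))) => i; exact: seg_null.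
by apply: filterS => x h [i _ ix]; exact: h i ix.
Qed.

(** A point of Omega outside all cells lies in the closure of some cell, thus on its frontier, a
    finite union of segments. *)
Lemma regular_cover (Omega : set pt) (chat eta : R) (T : mesh R) : regular_mesh Omega chat eta T ->
  {ae (@mu2 R), forall x, Omega x -> exists i : 'I_(ncell T), Defs.pset (cell i) x}.
Proof.
move=> [pc _ clo _ _].
have : {ae (@mu2 R), forall x, forall i : 'I_(ncell T), ~ frontier (Defs.pset (cell i)) x}.
  apply: (filter_forall (f := fun i x => ~ frontier (Defs.pset (cell i)) x) (F := almost_everywhere (@mu2 R))) => i.
  by apply: polygon_frontier_null; have [] := pc i.
apply: filterS => x h Ox; have : closure Omega x by exact: subset_closure.
rewrite clo => -[i _ ci]; exists i; apply: contrapT => nx; apply: (h i); split => //.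
by have [[_ [oD _ _ _] _ _] _] := pc i; rewrite (interior_id _).1.
Qed.

Lemma Int_sum n (F : 'I_n -> pt -> R) : (forall i, itg (F i)) ->
  itg (fun x => \sum_(i < n) F i x) /\ Int (fun x => \sum_(i < n) F i x) = \sum_(i < n) Int (F i).
Proof.
elim: n F => [|n IH] F iF.
  rewrite (_ : (fun x => _) = (fun=> 0)); last by apply: funext => x; rewrite big_ord0.
  by rewrite big_ord0 Int0; split => //; exact: itg0.
have [i1 E1] := IH (fun i => F (lift ord0 i)) (fun i => iF _).
rewrite (_ : (fun x => _) = (fun x => F ord0 x + \sum_(i < n) F (lift ord0 i) x)); last first.
  by apply: funext => x; rewrite big_ord_recl.
split; first exact: itgD (iF _) i1.
by rewrite (IntD (iF _) i1) E1 big_ord_recl.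
Qed.

Lemma Int_cells (Omega : set pt) (chat eta : R) (T : mesh R) f : open Omega -> regular_mesh Omega chat eta T ->
  (forall x, 0 <= f x) -> itg (f \_ Omega) ->
  Int (f \_ Omega) <= \sum_(i < ncell T) Int (f \_ (Defs.pset (cell i))).
Proof.
move=> oO reg f0 fi; have [pc _ _ _ _] := reg.
have oD (i : 'I_(ncell T)) : open (Defs.pset (cell i)) by have [[_ [? _ _ _] _ _] _] := pc i.
have sub (i : 'I_(ncell T)) : Defs.pset (cell i) `<=` Omega by have [] := pc i.
have iF (i : 'I_(ncell T)) : itg (f \_ (Defs.pset (cell i))).
  have := itg_patch (mble_open (oD i)) fi; rewrite (_ : (f \_ Omega) \_ _ = f \_ (Defs.pset (cell i)))//.
  by apply: funext => x; rewrite !patchE; case: ifPn => //; rewrite inE => /sub ?; rewrite mem_set.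
have [iS <-] := Int_sum iF.
pose U := \bigcup_(i : 'I_(ncell T)) Defs.pset (cell i).
have oU : open U by apply: bigcup_open => i _; exact: oD.
have iU := itg_patch (mble_open oU) fi.
have -> : Int (f \_ Omega) = Int ((f \_ Omega) \_ U).
  apply: eq_Int_ae; [exact: itg_meas fi|exact: itg_meas iU|].
  apply: filterS (regular_cover reg) => x h; rewrite [RHS]patchE; case: ifPn => // nU.
  rewrite patchE; case: ifPn => //; rewrite inE => /h[i Di]; case/negP: nU; rewrite inE; by exists i.
apply: Int_le iU iS _ => x; rewrite patchE; case: ifPn => [|_].
  rewrite inE => -[i _ Di]; rewrite patchE mem_set; last exact: sub Di.
  rewrite (bigD1 i)//= patchE mem_set// lerDl; apply: sumr_ge0 => j _; rewrite patchE; by case: ifP.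
by apply: sumr_ge0 => j _; rewrite patchE; case: ifP.
Qed.

Lemma diam_gt0 D : open D -> bounded_set D -> D !=set0 -> 0 < diam D.
Proof.
move=> oD bD [x Dx]; have [r r0 xr] := (openP_box _).1 oD _ Dx.
have [B DB] := bounded_setP bD.
pose y : pt := (x.1 + r / 2, x.2).
have xy : y - x = (r / 2, 0) :> pt by apply: eq_pt => /=; ring.
have Dy : D y.
  apply: xr; rewrite /box /= xy prod_normE /= normr0 gtr0_norm ?divr_gt0//.
  by rewrite gt_max r0 andbT ltr_pdivrMr// ltr_pMr//; lra.
have e0 : 0 < Defs.edist x y.
  rewrite /Defs.edist sqrtr_gt0 /= subrr expr0n addr0 opprD addrA subrr add0r sqrrN exprn_gt0//.
  by rewrite divr_gt0.
apply: (lt_le_trans e0); apply: ub_le_sup; last by exists x, y.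
exists (4 * (`|B| + 1)) => _ [z [w [Dz Dw ->]]]; apply: ltW; apply: edist_lt.
apply: le_lt_trans (ler_normB _ _) _; have := DB z Dz; have := DB w Dw; have := ler_norm B; lra.
Qed.

(** A nonempty open cell has positive diameter; this gives the star-shapedness ball a positive
    radius and, through the edge condition, excludes degenerate edges. *)
Lemma cell_facts (Omega : set pt) (chat eta : R) (T : mesh R) (i : 'I_(ncell T)) : 0 < chat -> 0 < eta ->
  regular_mesh Omega chat eta T -> let E := cell i in
  [/\ is_polygon E, Defs.pset E `<=` Omega, (exists2 r : R, 0 < r & star_shaped_ball (Defs.pset E) r) &
      forall e : 'I_(nvert E), edge_src e != edge_dst e].
Proof.
move=> c0 e0 [pc _ _ len star] E; have [pE sub] := pc i; have [_ [oD bD _ D0] _ _] := pE.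
have d0 := diam_gt0 oD bD D0; split => //.
  by exists (eta * diam (Defs.pset E)); [exact: mulr_gt0|exact: star].
move=> e; apply/eqP => h; have := len i e; rewrite /edge_len h /Defs.edist !subrr expr0n addr0 sqrtr0.
by rewrite leNgt mulr_gt0.
Qed.

Lemma weak_div_restrict D D' (v : pt -> 'rV[R]_2) g : open D -> open D' -> D' `<=` D ->
  is_weak_div D v g -> is_weak_div D' v g.
Proof.
move=> oD oD' sub wd phi tp; have mD := mble_open oD; have mD' := mble_open oD'.
have tp' : test_fun D phi by case: tp => h [cK KD]; split => //; split => // x /KD /sub.
have := wd phi tp'; rewrite !(RintE _ mD) !(RintE _ mD').
have E (f : pt -> R) : (forall x, (\forall y \near x, phi y = 0) -> f x = 0) -> f \_ D = f \_ D'.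
  move=> f0; apply: funext => x; rewrite !patchE; have [D'x|nD'x] := pselect (D' x).
    by rewrite !mem_set//; exact: sub.
  by rewrite (f0 x (test_fun_zero_near tp nD'x)); case: ifP; case: ifP.
rewrite !E//.
- by move=> x h; rewrite (nbhs_singleton h) mulr0.
- by move=> x h; rewrite dotv_grad (derive_zero_near _ h : dx1 phi x = 0) (derive_zero_near _ h : dx2 phi x = 0) !mulr0 addr0.
Qed.

Lemma L2_restrict D D' f : open D' -> D' `<=` D -> L2 D f -> L2 D' f.
Proof.
move=> oD' sub /L2P sf; apply/L2P; have := sqi_patch (mble_open oD') sf.
rewrite (_ : (f \_ D) \_ D' = f \_ D')//.
by apply: funext => x; rewrite !patchE; case: ifPn => //; rewrite inE => /sub ?; rewrite mem_set.
Qed.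

(** A test function of the cell is one of the whole domain, so the global weak divergence is a weak
    divergence on the cell as well, and uniqueness identifies the two choices of [wdiv] up to a null
    set. *)
Lemma wdiv_cell D D' (v : pt -> 'rV[R]_2) : open D -> open D' -> D' `<=` D -> Hdiv D v -> Hdiv D' v ->
  {ae (@mu2 R), forall x, D' x -> wdiv D v x = wdiv D' v x}.
Proof.
move=> oD oD' sub Hv Hv'; have [L w] := wdivP Hv; have [L' w'] := wdivP Hv'.
exact: weak_div_unique oD' Hv'.1 (L2_restrict oD' sub L) L' (weak_div_restrict oD oD' sub w) w'.
Qed.

(** Both branches of [xget] are polynomial, its default value being 0. *)
Lemma poly2m_proj D k (sigma : pt -> 'M[R]_2) : poly2m k.+1 (Defs.proj D k sigma).
Proof.
rewrite /Defs.proj; case: xgetP => [P _ [] //|_] i j.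
by rewrite (_ : (fun x => _) = (fun=> 0)); [exact: poly2_zero|apply: funext => x; rewrite mxE].
Qed.

Lemma HhE_sub k (E : polygon R) (sigma P : pt -> 'M[R]_2) (r : R) : is_polygon E ->
  star_shaped_ball (Defs.pset E) r -> 0 < r -> (forall e : 'I_(nvert E), edge_src e != edge_dst e) ->
  HhE k E sigma -> poly2m k.+1 P -> HhE k E (sigma - P).
Proof.
move=> pE star r0 nd Hs pP i.
have -> : mrow (sigma - P) i = (fun x => mrow sigma i x - mrow P i x).
  by apply: funext => x; apply/rowP => j; rewrite !mxE.
apply: (WhE_sub pE star r0 nd (Hs i)) => j.
by rewrite (_ : (fun x => _) = (fun x => P x i j)); [exact: pP|apply: funext => x; rewrite mxE].
Qed.

End Cells.

(** * Coercivity and the bound of a tensor by its deviator and divergence *)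

Section Coercivity.
Set Implicit Arguments.
Unset Strict Implicit.
Context {R : realType}.
Notation pt := (R * R)%type.
Implicit Types (f g : pt -> R) (D : set pt) (x : pt) (sigma tau P : pt -> 'M[R]_2) (v w : pt -> 'rV[R]_2).

Lemma L2_lin D (a b : R) f g : L2 D f -> L2 D g -> L2 D (fun x => a * f x + b * g x).
Proof.
move=> /L2P sf /L2P sg; apply/L2P; have := sqiD (sqiZ a sf) (sqiZ b sg).
rewrite (_ : (fun x => _) = (fun x => a * f x + b * g x) \_ D)//.
by apply: funext => x; rewrite !patchE; case: ifP => // _; rewrite !mulr0 addr0.
Qed.

Lemma L2_mul D f g : L2 D f -> L2 D g -> itg ((fun x => f x * g x) \_ D).
Proof. by move=> /L2P sf /L2P sg; have := sqi_mul sf sg; rewrite patchMM. Qed.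

Lemma itg_patchD D f g : itg (f \_ D) -> itg (g \_ D) -> itg ((fun x => f x + g x) \_ D).
Proof. by move=> i j; rewrite patchD; exact: itgD. Qed.

Lemma L2v_dot D v w : L2v D v -> L2v D w -> itg ((fun x => dotv (v x) (w x)) \_ D).
Proof.
move=> Lv Lw; have := itg_patchD (L2_mul (Lv 0) (Lw 0)) (L2_mul (Lv 1) (Lw 1)).
by rewrite (_ : (fun x => dotv (v x) (w x)) = (fun x => v x 0 0 * w x 0 0 + v x 0 1 * w x 0 1))//; apply: funext => x; rewrite dotvE.
Qed.

Lemma L2m_frob D sigma tau : L2m D sigma -> L2m D tau -> itg ((fun x => frob (sigma x) (tau x)) \_ D).
Proof.
move=> Ls Lt; have h := itg_patchD (itg_patchD (L2_mul (Ls 0 0) (Lt 0 0)) (L2_mul (Ls 0 1) (Lt 0 1)))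
  (itg_patchD (L2_mul (Ls 1 0) (Lt 1 0)) (L2_mul (Ls 1 1) (Lt 1 1))).
rewrite (_ : (fun x => frob (sigma x) (tau x)) = (fun x => sigma x 0 0 * tau x 0 0 + sigma x 0 1 * tau x 0 1 +
  (sigma x 1 0 * tau x 1 0 + sigma x 1 1 * tau x 1 1))); first exact: h.
by apply: funext => x; rewrite frobE.
Qed.

Lemma L2m_dev D sigma : L2m D sigma -> L2m D (fun x => dev (sigma x)).
Proof.
move=> Ls i j; have l01 := L2_lin (1 / 2) (- (1 / 2)) (Ls 0 0) (Ls 1 1).
have l10 := L2_lin (1 / 2) (- (1 / 2)) (Ls 1 1) (Ls 0 0).
have [->|->] := ord2 i; have [->|->] := ord2 j.
- by rewrite (_ : (fun x => dev (sigma x) 0 0) = (fun x => 1 / 2 * sigma x 0 0 + - (1 / 2) * sigma x 1 1))//;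
    apply: funext => x; have [-> _ _ _] := devE (sigma x); ring.
- by rewrite (_ : (fun x => dev (sigma x) 0 1) = (fun x => sigma x 0 1))//;
    apply: funext => x; have [_ -> _ _] := devE (sigma x).
- by rewrite (_ : (fun x => dev (sigma x) 1 0) = (fun x => sigma x 1 0))//;
    apply: funext => x; have [_ _ -> _] := devE (sigma x).
- by rewrite (_ : (fun x => dev (sigma x) 1 1) = (fun x => 1 / 2 * sigma x 1 1 + - (1 / 2) * sigma x 0 0))//;
    apply: funext => x; have [_ _ _ ->] := devE (sigma x); ring.
Qed.

Lemma frob_ge0 (a : 'M[R]_2) : 0 <= frob a a.
Proof. by rewrite frobE -!expr2 !addr_ge0 ?sqr_ge0. Qed.

Lemma dotv_ge0 (a : 'rV[R]_2) : 0 <= dotv a a.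
Proof. by rewrite dotvE -!expr2 !addr_ge0 ?sqr_ge0. Qed.

Lemma Int_patch_ge0 D f : (forall x, 0 <= f x) -> 0 <= Int (f \_ D).
Proof. by move=> f0; apply: Int_ge0 => x; rewrite patchE; case: ifP. Qed.

Lemma normm_sqr D sigma : open D -> normm D sigma ^+ 2 = Int ((fun x => frob (sigma x) (sigma x)) \_ D).
Proof.
move=> oD; rewrite /normm (RintE _ (mble_open oD)) sqr_sqrtr//; apply: Int_patch_ge0 => x; exact: frob_ge0.
Qed.

Lemma normv_sqr D v : open D -> normv D v ^+ 2 = Int ((fun x => dotv (v x) (v x)) \_ D).
Proof.
move=> oD; rewrite /normv (RintE _ (mble_open oD)) sqr_sqrtr//; apply: Int_patch_ge0 => x; exact: dotv_ge0.
Qed.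

(** The triangle inequality together with |dev (a - b)| <= |a - b|; the difference of the two sides
    is written as a sum of squares. *)
Lemma frob_dev_le (a b : 'M[R]_2) :
  frob (dev a) (dev a) <= 2 * frob (dev b) (dev b) + 2 * frob (a - b) (a - b).
Proof.
rewrite !frobE; have [-> -> -> ->] := devE a; have [-> -> -> ->] := devE b; rewrite !mxE.
move: (a 0 0) (a 0 1) (a 1 0) (a 1 1) (b 0 0) (b 0 1) (b 1 0) (b 1 1) => a1 a2 a3 a4 b1 b2 b3 b4.
rewrite -subr_ge0 [leRHS](_ : _ = ((a1 - a4) / 2 - (b1 - b4)) ^+ 2 * 2 + (a1 - b1 + (a4 - b4)) ^+ 2 +
  (a2 - 2 * b2) ^+ 2 + (a3 - 2 * b3) ^+ 2 + 0); last by field.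
rewrite addr0; do 3 (apply: addr_ge0; last exact: sqr_ge0).
by apply: mulr_ge0 => //; exact: sqr_ge0.
Qed.

Lemma cell_dev_bound D sigma P : open D -> L2m D sigma -> L2m D P ->
  Int ((fun x => frob (dev (sigma x)) (dev (sigma x))) \_ D) <=
  2 * Int ((fun x => frob (dev (P x)) (dev (P x))) \_ D) + 2 * normm D (sigma - P) ^+ 2.
Proof.
move=> oD Ls LP; rewrite (normm_sqr _ oD).
have LsP : L2m D (sigma - P).
  move=> i j; rewrite (_ : (fun x => _) = (fun x => sigma x i j - P x i j)); first exact: L2_sub (Ls i j) (LP i j).
  by apply: funext => x; rewrite !mxE.
have i1 := L2m_frob (L2m_dev Ls) (L2m_dev Ls); have i2 := L2m_frob (L2m_dev LP) (L2m_dev LP).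
have i3 := L2m_frob LsP LsP.
rewrite -(IntZ 2 i2) -(IntZ 2 i3) -(IntD (itgZ 2 i2) (itgZ 2 i3)).
apply: Int_le i1 (itgD (itgZ 2 i2) (itgZ 2 i3)) _ => x; rewrite !patchE; case: ifP => _.
  exact: frob_dev_le.
by rewrite !mulr0 addr0.
Qed.

Lemma HhE_L2m k (E : polygon R) sigma : HhE k E sigma -> L2m (Defs.pset E) sigma.
Proof.
move=> H i j; have [[L _] _ _ _ _] := H i; have := L j.
by rewrite (_ : (fun x => mrow sigma i x 0 j) = (fun x => sigma x i j))//; apply: funext => x; rewrite mxE.
Qed.

(** On each cell dev sigma is split into the deviator of Pi sigma, which [aE] controls, and a part
    bounded by sigma - Pi sigma, which the stabilization controls once it is known to lie in the
    virtual element space. The costs are 2 nu and 2 nu / c0; their sum serves for both. *)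
Lemma a_h_coercive (Omega : set pt) (chat eta nu c0 c1 : R) k (T : mesh R) (S : 'I_(ncell T) -> tform R) sigma :
  0 < chat -> 0 < eta -> 0 < nu -> 0 < c0 -> open Omega -> regular_mesh Omega chat eta T ->
  (forall i, stabilization nu c0 c1 k (cell i) (S i)) -> L2m Omega sigma ->
  (forall i : 'I_(ncell T), HhE k (cell i) sigma) ->
  Int ((fun x => frob (dev (sigma x)) (dev (sigma x))) \_ Omega) <=
    2 * nu * (1 + c0^-1) * a_h nu k S sigma sigma.
Proof.
move=> ch0 et0 nu0 c00 oO reg stab Ls Hs.
have i1 := L2m_frob (L2m_dev Ls) (L2m_dev Ls).
apply: (le_trans (Int_cells oO reg (fun x => frob_ge0 _) i1)); rewrite /a_h mulr_sumr; apply: ler_sum => i _.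
have [pE sub [r r0 star] nd] := cell_facts i ch0 et0 reg; have [_ [oD bD _ _] _ _] := pE.
set P := Defs.proj _ _ _; have pP : poly2m k.+1 P by exact: poly2m_proj.
have LP : L2m (Defs.pset (cell i)) P.
  by move=> j l; apply: continuous_L2 => //; exact: sm_continuous (poly2_sm (pP j l)).
apply: (le_trans (cell_dev_bound oD (HhE_L2m (Hs i)) LP)).
have [_ _ _ bnd] := stab i; have [lo _] := bnd _ (HhE_sub pE star r0 nd (Hs i) pP).
rewrite /aE (RintE _ (mble_open oD)); set A := Int _.
have A0 : 0 <= A by apply: Int_patch_ge0 => x; exact: frob_ge0.
set N := normm _ _ ^+ 2 in lo *; have N0 : 0 <= N by exact: sqr_ge0.
have K0 : 0 < 2 * nu * (1 + c0^-1) by rewrite !mulr_gt0// addr_gt0// invr_gt0.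
apply: (@le_trans _ _ (2 * nu * (1 + c0^-1) * (nu^-1 * A + c0 / nu * N))); last first.
  by rewrite ler_pM2l// lerD2l.
have -> : 2 * nu * (1 + c0^-1) * (nu^-1 * A + c0 / nu * N) = 2 * A + 2 * N + (2 * c0^-1 * A + 2 * c0 * N).
  by field; rewrite !gt_eqF.
rewrite lerDl; have c0' := ltW c00; apply: addr_ge0; apply: mulr_ge0 => //; first exact: divr_ge0.
exact: mulr_ge0.
Qed.

(** Pythagoras: the identity matrix is orthogonal to deviators and has squared norm 2. *)
Lemma frob_split (a : 'M[R]_2) : frob a a = 2 * (\tr a / 2) ^+ 2 + frob (dev a) (dev a).
Proof.
rewrite !frobE; have [-> -> -> ->] := devE a; rewrite /mxtrace sum2E.
by field.
Qed.

Let row_arith1 (a b c d : R) : a + b + c = - d -> a = - d - b - c.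
Proof. by move=> h; lra. Qed.

Let row_arith2 (a b c d : R) : c + (a + b) = - d -> a = - d - c - b.
Proof. by move=> h; lra. Qed.

Let korn_arith (C a b c : R) : c <= C * (a + b) -> 0 <= b -> 2 * c + a <= (2 * C + 1) * (a + b).
Proof. by rewrite (mulrDl (2 * C)) -(mulrA 2) mul1r => h1 h2; lra. Qed.

Let sum6_arith (a b c d e f : R) : a + b + c + d + e + f = c + d + (e + f) + (a + b).
Proof. by ring. Qed.

Lemma data_size_sum (f1 f2 G11 G12 G21 G22 : pt -> R) : sqi f1 -> sqi f2 -> sqi G11 -> sqi G12 -> sqi G21 -> sqi G22 ->
  data_size f1 f2 G11 G12 G21 G22 = Int (fun x => G11 x ^+ 2 + G12 x ^+ 2 + (G21 x ^+ 2 + G22 x ^+ 2)) +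
    Int (fun x => f1 x ^+ 2 + f2 x ^+ 2).
Proof.
move=> s1 s2 s3 s4 s5 s6.
rewrite (IntD (itgD s3.2 s4.2) (itgD s5.2 s6.2)) (IntD s3.2 s4.2) (IntD s5.2 s6.2) (IntD s1.2 s2.2) /data_size.
exact: sum6_arith.
Qed.

(** Row i of sigma is tr sigma / 2 times the i-th unit vector plus row i of dev sigma. The weak
    divergence of the rows thus reads as [grad_data] for p = tr sigma / 2, with f = div sigma and G
    = dev sigma. *)
Theorem korn (Omega : set pt) : polygonal_domain Omega -> exists2 C : R, 0 <= C & forall sigma,
  HHdiv Omega sigma -> \int[leb2]_(x in Omega) \tr (sigma x) = 0 ->
  normm Omega sigma ^+ 2 <= C * (Int ((fun x => frob (dev (sigma x)) (dev (sigma x))) \_ Omega) +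
    normv Omega (mdiv Omega sigma) ^+ 2).
Proof.
move=> [oD bD cD D0 [lD _]]; have mD := mble_open oD.
have [C C0 hC] := mean_zero_bound oD bD cD D0 lD.
exists (2 * C + 1); first by rewrite addr_ge0// mulr_ge0.
move=> sigma Hs tr0; rewrite (normm_sqr _ oD) (normv_sqr _ oD).
set D := Omega in oD bD cD D0 lD mD hC Hs tr0 *.
have Ls : L2m D sigma.
  move=> i j; have [L _] := Hs i; have := L j.
  by rewrite (_ : (fun x => mrow sigma i x 0 j) = (fun x => sigma x i j))//; apply: funext => x; rewrite mxE.
have Ld := L2m_dev Ls.
pose tr x : R := \tr (sigma x) / 2.
have Lp : L2 D tr.
  rewrite (_ : tr = (fun x => 1 / 2 * sigma x 0 0 + 1 / 2 * sigma x 1 1)); first exact: L2_lin.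
  by apply: funext => x; rewrite /tr /mxtrace sum2E; ring.
pose G i j : pt -> R := (fun x => dev (sigma x) i j) \_ D.
pose f i : pt -> R := (wdiv D (mrow sigma i)) \_ D.
have sG i j : sqi (G i j) by exact/L2P.
have sf i : sqi (f i) by apply/L2P; exact: (wdivP (Hs i)).1.
have sp : sqi (tr \_ D) by exact/L2P.
have wk i phi : tst D phi ->
    Int (fun x => ((fun x => sigma x i 0) \_ D) x * dx1 phi x) +
    Int (fun x => ((fun x => sigma x i 1) \_ D) x * dx2 phi x) = - Int (fun x => f i x * phi x).
  move=> tp; have [Lw w] := wdivP (Hs i); have := weak_div_Int oD (Hs i).1 Lw w tp.
  have E j : (fun x => mrow sigma i x 0 j) = (fun x => sigma x i j) by apply: funext => x; rewrite mxE.
  by rewrite !E.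
have data : grad_data D (tr \_ D) (f 0) (f 1) (G 0 0) (G 0 1) (G 1 0) (G 1 1).
  split=> // phi tp; have q1 := tst_sqi (tst_dx1 tp); have q2 := tst_sqi (tst_dx2 tp).
    have E : (fun x => ((fun x => sigma x 0 0) \_ D) x * dx1 phi x) =
        (fun x => (tr \_ D) x * dx1 phi x + G 0 0 x * dx1 phi x).
      apply: funext => x; rewrite -mulrDl; congr (_ * _); rewrite /G !patchE; case: ifP => _; last by rewrite addr0.
      by have [-> _ _ _] := devE (sigma x); rewrite /tr /mxtrace sum2E; field.
    have E' : (fun x => sigma x 0 1) = (fun x => dev (sigma x) 0 1).
      by apply: funext => x; have [_ -> _ _] := devE (sigma x).
    have := wk 0 phi tp; rewrite E E' (IntD (sqi_mul sp q1) (sqi_mul (sG 0 0) q1)) -/(G 0 1).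
    exact: row_arith1.
  have E : (fun x => ((fun x => sigma x 1 1) \_ D) x * dx2 phi x) =
      (fun x => (tr \_ D) x * dx2 phi x + G 1 1 x * dx2 phi x).
    apply: funext => x; rewrite -mulrDl; congr (_ * _); rewrite /G !patchE; case: ifP => _; last by rewrite addr0.
    by have [_ _ _ ->] := devE (sigma x); rewrite /tr /mxtrace sum2E; field.
  have E' : (fun x => sigma x 1 0) = (fun x => dev (sigma x) 1 0).
    by apply: funext => x; have [_ _ -> _] := devE (sigma x).
  have := wk 1 phi tp; rewrite E E' (IntD (sqi_mul sp q2) (sqi_mul (sG 1 1) q2)) -/(G 1 0).
  exact: row_arith2.
have pD : (tr \_ D) \_ D = tr \_ D by rewrite patch_patch setIid.
have ip : itg (tr \_ D).
  have := sqi_mul sp (bounded_sqi1 bD mD); rewrite (_ : (fun x => _) = tr \_ D)//.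
  by apply: funext => x; rewrite patchE indicE; case: ifP; rewrite ?mulr1 ?mulr0.
have p0 : Int (tr \_ D) = 0.
  have h : 2 * Int (tr \_ D) = 0.
    rewrite -(IntZ 2 ip) -tr0 (RintE _ mD); apply: (congr1 Int); apply: funext => x.
    by rewrite !patchE; case: ifP => _; rewrite ?mulr0// /tr mulrC divfK.
  by apply/eqP; have /eqP := h; rewrite mulf_eq0 pnatr_eq0.
have := hC _ _ _ _ _ _ _ data pD p0.
have Lm : L2v D (mdiv D sigma).
  move=> j; rewrite (_ : (fun x => _) = wdiv D (mrow sigma j)); last by apply: funext => x; rewrite mxE.
  exact: (wdivP (Hs j)).1.
have -> : data_size (f 0) (f 1) (G 0 0) (G 0 1) (G 1 0) (G 1 1) =
    Int ((fun x => frob (dev (sigma x)) (dev (sigma x))) \_ D) +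
    Int ((fun x => dotv (mdiv D sigma x) (mdiv D sigma x)) \_ D).
  have -> : (fun x => frob (dev (sigma x)) (dev (sigma x))) \_ D =
      (fun x => G 0 0 x ^+ 2 + G 0 1 x ^+ 2 + (G 1 0 x ^+ 2 + G 1 1 x ^+ 2)).
    apply: funext => x; rewrite /G !patchE; case: ifP => _; first by rewrite frobE.
    by rewrite expr0n !addr0.
  have -> : (fun x => dotv (mdiv D sigma x) (mdiv D sigma x)) \_ D = (fun x => f 0 x ^+ 2 + f 1 x ^+ 2).
    apply: funext => x; rewrite /f !patchE; case: ifP => _; first by rewrite dotvE !mxE.
    by rewrite expr0n addr0.
  exact: data_size_sum.
have -> : Int ((fun x => frob (sigma x) (sigma x)) \_ D) =
    2 * Int (fun x => (tr \_ D) x ^+ 2) + Int ((fun x => frob (dev (sigma x)) (dev (sigma x))) \_ D).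
  rewrite -(IntZ 2 sp.2) -(IntD (itgZ 2 sp.2) (L2m_frob Ld Ld)); apply: (congr1 Int); apply: funext => x.
  by rewrite !patchE; case: ifP => _; [exact: frob_split|rewrite expr0n mulr0 addr0].
have V0 : 0 <= Int ((fun x => dotv (mdiv D sigma x) (mdiv D sigma x)) \_ D).
  by apply: Int_patch_ge0 => x; exact: dotv_ge0.
by move=> h; exact: (korn_arith h V0).
Qed.

(** Once X is absorbed, AH is at least ah + kappa^-1 V / 2 + kappa U / 2. The three terms of the
    constant turn these summands into (CK + 1) A, (CK + 1) V and U, whose sum dominates N + V +
    U. *)
Lemma energy_arith (CK K kappa ah A V U N X AH : R) : 0 <= CK -> 0 < K -> 0 < kappa ->
  0 <= A -> 0 <= V -> 0 <= U -> N <= CK * (A + V) -> A <= K * ah -> 2 * X <= kappa^-1 * V + kappa * U ->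
  AH = ah + kappa^-1 * V + kappa * U - X ->
  N + V + U <= ((CK + 1) * K + (CK + 1) * (2 * kappa) + 2 / kappa) * AH.
Proof.
move=> CK0 K0 k0 A0 V0 U0 hN hA hX E.
have ki : 0 < kappa^-1 by rewrite invr_gt0.
have w0 : 0 <= kappa^-1 * V by rewrite mulr_ge0// ltW.
have z0 : 0 <= kappa * U by rewrite mulr_ge0// ltW.
have ah0 : 0 <= ah by rewrite -(pmulr_rge0 _ K0); exact: le_trans A0 hA.
have h1 : (CK + 1) * K * ah <= (CK + 1) * K * AH.
  by apply: ler_wpM2l; [rewrite mulr_ge0 ?(ltW K0)// addr_ge0|lra].
have h2 : (CK + 1) * (2 * kappa) * (kappa^-1 * V / 2) <= (CK + 1) * (2 * kappa) * AH.
  by apply: ler_wpM2l; [rewrite mulr_ge0 ?mulr_ge0 ?(ltW k0)// addr_ge0|lra].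
have h3 : 2 / kappa * (kappa * U / 2) <= 2 / kappa * AH.
  by apply: ler_wpM2l; [rewrite divr_ge0// ltW|lra].
have e2 : (CK + 1) * (2 * kappa) * (kappa^-1 * V / 2) = (CK + 1) * V by field; rewrite gt_eqF.
have e3 : 2 / kappa * (kappa * U / 2) = U by field; rewrite gt_eqF.
have h4 : (CK + 1) * A <= (CK + 1) * K * ah by rewrite -mulrA; apply: ler_wpM2l => //; rewrite addr_ge0.
rewrite e2 in h2; rewrite e3 in h3; rewrite !mulrDl in h1 h2 h4 *; rewrite mulrDr in hN.
by lra.
Qed.

Lemma norm3_sqr (D : set pt) sigma v : norm3 D sigma v ^+ 2 =
  normm D sigma ^+ 2 + normv D (mdiv D sigma) ^+ 2 + normv D v ^+ 2.
Proof.
rewrite /norm3 sqr_sqrtr ?addr_ge0 ?sqr_ge0// /norm_div sqr_sqrtr// addr_ge0 ?sqr_ge0//.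
Qed.

Lemma L2v_mdiv (D : set pt) sigma : HHdiv D sigma -> L2v D (mdiv D sigma).
Proof.
move=> Hs j; rewrite (_ : (fun x => _) = wdiv D (mrow sigma j)); last by apply: funext => x; rewrite mxE.
exact: (wdivP (Hs j)).1.
Qed.

(** It makes kappa^-1 div sigma a discrete test function, although [mdiv] uses the divergence on
    Omega and [HhE] the one on the cell. *)
Lemma mdiv_in_poly (Omega : set pt) k (T : mesh R) sigma (i : 'I_(ncell T)) j : open Omega -> open (Defs.pset (cell i)) ->
  Defs.pset (cell i) `<=` Omega -> HHdiv Omega sigma -> HhE k (cell i) sigma ->
  in_poly (Defs.pset (cell i)) k.+1 (fun x => mdiv Omega sigma x 0 j).
Proof.
move=> oO oD sub Hs Hi; have [Hd _ _ [p pp pE] _] := Hi j; exists p => //.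
apply: filterS2 pE (wdiv_cell oO oD sub (Hs j) Hd) => x h1 h2 Dx.
by rewrite mxE h2// h1.
Qed.

End Coercivity.

Theorem lemma3p1 (R : realType) (Omega : set (R * R)) (k : nat)
    (nu kappa chat eta c0 c1 gammahat : R) :
  polygonal_domain Omega ->
  0 < nu -> 0 < kappa -> 0 < chat -> 0 < eta -> 0 < c0 -> 0 < c1 ->
  0 < gammahat ->
  exists C CJ : R, 0 < C /\ 0 < CJ /\
    forall (T : R -> mesh R) (S : forall h : R, 'I_(ncell (T h)) -> tform R),
      (forall h, 0 < h -> regular_mesh Omega chat eta (T h)) ->
      (forall h, 0 < h -> forall i : 'I_(ncell (T h)),
         stabilization nu c0 c1 k (cell i) (S h i)) ->
      (forall h, 0 < h -> discrete_inf_sup gammahat Omega k (T h)) ->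
      forall h, 0 < h ->
      forall (sigma : R * R -> 'M[R]_2) (u : R * R -> 'rV[R]_2),
        H0h Omega k (T h) sigma -> Qh Omega k (T h) u ->
        exists (tau : R * R -> 'M[R]_2) (v : R * R -> 'rV[R]_2),
          H0h Omega k (T h) tau /\ Qh Omega k (T h) v /\
          norm3 Omega tau v <= C * norm3 Omega sigma u /\
          norm3 Omega sigma u ^+ 2
            <= CJ * A_h nu kappa Omega k (S h) sigma u tau v.
Proof.
move=> pO nu0 k0 ch0 et0 c00 c10 _.
have [CK CK0 hK] := korn pO; have [oO _ _ _ _] := pO; have mO := mble_open oO.
have ki : 0 < kappa^-1 by rewrite invr_gt0.
have kn : kappa != 0 by rewrite gt_eqF.
have K0 : 0 < 2 * nu * (1 + c0^-1) by rewrite !mulr_gt0// addr_gt0// invr_gt0.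
(* The square of the first constant exceeds 1 + 2 kappa^-2 and 2, the factors of |div sigma|^2 and
   |u|^2 in the bound for the test pair; the second constant is that of [energy_arith]. *)
exists (2 + 2 * kappa^-1), ((CK + 1) * (2 * nu * (1 + c0^-1)) + (CK + 1) * (2 * kappa) + 2 / kappa).
split; first by rewrite addr_gt0// mulr_gt0.
have CK1 : 0 < CK + 1 by rewrite ltr_wpDl.
split; first by rewrite !addr_gt0// mulr_gt0// mulr_gt0.
move=> T S reg stab _ h h0 sigma u Hs Hu.
have [[Hd Hc] tr0] := Hs; have [Lu pu] := Hu.
pose m := mdiv Omega sigma; have Lm : L2v Omega m := L2v_mdiv Hd.
(* With X = b(sigma, u), b(sigma, v) is kappa^-1 |div sigma|^2 - X and -d(u, v) is kappa |u|^2 - X.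
   Together with b(sigma, u) a single - X remains, absorbed by Young's inequality with the weights
   kappa^-1 and kappa. *)
pose v x : 'rV[R]_2 := kappa^-1 *: m x - u x.
have vE x j : v x 0 j = kappa^-1 * m x 0 j + (-1) * u x 0 j by rewrite !mxE mulN1r.
have imm := L2v_dot Lm Lm; have imu := L2v_dot Lm Lu; have iuu := L2v_dot Lu Lu.
have Lv : L2v Omega v.
  by move=> j; rewrite (funext (vE ^~ j)); exact: L2_lin (Lm j) (Lu j).
have ivv := L2v_dot Lv Lv.
exists sigma, v; split; first exact: Hs.
split.
  split=> // i j; have [pE sub _ _] := cell_facts i ch0 et0 (reg h h0); have [_ [oD _ _ _] _ _] := pE.
  have [p pp pE1] := mdiv_in_poly j oO oD sub Hd (Hc i); have [q pq qE] := pu i j.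
  exists (fun x => kappa^-1 * p x + (-1) * q x); first exact: poly2_lin.
  by apply: filterS2 pE1 qE => x e1 e2 Dx; rewrite vE e1// e2.
have V0 : 0 <= normv Omega m ^+ 2 := sqr_ge0 _.
have U0 : 0 <= normv Omega u ^+ 2 := sqr_ge0 _.
have N0 : 0 <= normm Omega sigma ^+ 2 := sqr_ge0 _.
pose X := Int ((fun x => dotv (m x) (u x)) \_ Omega).
have lin (a b c d : R) (f1 f2 f3 g : R * R -> R) : (forall x, g x = a * f1 x + b * f2 x + c * f3 x) ->
    itg (f1 \_ Omega) -> itg (f2 \_ Omega) -> itg (f3 \_ Omega) ->
    Int (g \_ Omega) = a * Int (f1 \_ Omega) + b * Int (f2 \_ Omega) + c * Int (f3 \_ Omega).
  move=> E i1 i2 i3; rewrite -(IntZ a i1) -(IntZ b i2) -(IntZ c i3).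
  rewrite -(IntD (itgZ a i1) (itgZ b i2)) -(IntD (itgD (itgZ a i1) (itgZ b i2)) (itgZ c i3)).
  by apply: (congr1 Int); apply: funext => x; rewrite !patchE; case: ifP => // _; rewrite !mulr0 !addr0.
have XN : 2 * X <= kappa^-1 * normv Omega m ^+ 2 + kappa * normv Omega u ^+ 2.
  rewrite !normv_sqr// -(IntZ 2 imu) -(IntZ _ imm) -(IntZ _ iuu) -(IntD (itgZ _ imm) (itgZ _ iuu)).
  apply: Int_le (itgZ 2 imu) (itgD (itgZ _ imm) (itgZ _ iuu)) _ => x; rewrite !patchE.
  case: ifP => _; last by rewrite !mulr0 addr0.
  rewrite !dotvE; move: (m x 0 0) (m x 0 1) (u x 0 0) (u x 0 1) => m1 m2 u1 u2.
  rewrite -subr_ge0 (_ : _ - _ = kappa^-1 * ((m1 - kappa * u1) ^+ 2 + (m2 - kappa * u2) ^+ 2)); last by field.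
  by apply: mulr_ge0; [exact: ltW|apply: addr_ge0; exact: sqr_ge0].
have vv : normv Omega v ^+ 2 <= 2 * kappa^-1 ^+ 2 * normv Omega m ^+ 2 + 2 * normv Omega u ^+ 2.
  rewrite !normv_sqr// -(IntZ _ imm) -(IntZ 2 iuu) -(IntD (itgZ _ imm) (itgZ 2 iuu)).
  apply: Int_le ivv (itgD (itgZ _ imm) (itgZ 2 iuu)) _ => x; rewrite !patchE.
  case: ifP => _; last by rewrite !mulr0 addr0.
  rewrite !dotvE !vE; move: (m x 0 0) (m x 0 1) (u x 0 0) (u x 0 1) => m1 m2 u1 u2.
  rewrite -subr_ge0 (_ : _ - _ = (kappa^-1 * m1 + u1) ^+ 2 + (kappa^-1 * m2 + u2) ^+ 2); last by field.
  by apply: addr_ge0; exact: sqr_ge0.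
split.
  have n0 : 0 <= norm3 Omega sigma u by exact: sqrtr_ge0.
  have C0 : 0 <= 2 + 2 * kappa^-1 by rewrite addr_ge0// mulr_ge0// ltW.
  rewrite -(@ler_pXn2r _ 2) ?nnegrE ?sqrtr_ge0// ?mulr_ge0// exprMn !norm3_sqr -/m.
  move: vv V0 U0 N0; move: (normv Omega v ^+ 2) (normv Omega m ^+ 2) (normv Omega u ^+ 2) (normm Omega sigma ^+ 2).
  move=> vv mm uu nn hv mm0 uu0 nn0.
  have Csq : (2 + 2 * kappa^-1) ^+ 2 = 4 + 8 * kappa^-1 + 4 * kappa^-1 ^+ 2 by ring.
  have q0 : 0 <= kappa^-1 ^+ 2 * mm by apply: mulr_ge0 => //; exact: sqr_ge0.
  have q1 : 0 <= kappa^-1 ^+ 2 * (nn + uu) by apply: mulr_ge0; [exact: sqr_ge0|exact: addr_ge0].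
  have q2 : 0 <= kappa^-1 * (nn + mm + uu) by apply: mulr_ge0; [exact: ltW|rewrite !addr_ge0].
  rewrite Csq; move: q0 q1 q2 hv; move: (kappa^-1 ^+ 2) (kappa^-1) => a b.
  rewrite !mulrDr !mulrDl; lra.
rewrite norm3_sqr.
have A0 : 0 <= Int ((fun x => frob (dev (sigma x)) (dev (sigma x))) \_ Omega).
  by apply: Int_patch_ge0 => x; exact: frob_ge0.
have Ls : L2m Omega sigma.
  move=> i j; have [L _] := Hd i; have := L j.
  by rewrite (_ : (fun x => mrow sigma i x 0 j) = (fun x => sigma x i j))//; apply: funext => x; rewrite mxE.
apply: (energy_arith CK0 K0 k0 A0 V0 U0 (hK _ Hd tr0)
  (a_h_coercive ch0 et0 nu0 c00 oO (reg h h0) (stab h h0) Ls Hc) XN).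
have bv : b_form Omega sigma v = kappa^-1 * normv Omega m ^+ 2 - X.
  rewrite /b_form (RintE _ mO) normv_sqr// (lin kappa^-1 (-1) 0 0 _ _ _ _ _ imm imu imu); first by rewrite mul0r addr0 mulN1r.
  by move=> x; rewrite -/m !dotvE !vE; ring.
have dv : d_form kappa Omega u v = X - kappa * normv Omega u ^+ 2.
  rewrite /d_form (RintE _ mO) normv_sqr// (lin 1 (- kappa) 0 0 _ _ _ _ _ imu iuu iuu); first by rewrite mul0r addr0 mul1r mulNr.
  by move=> x; rewrite !dotvE !vE; field.
have bu : b_form Omega sigma u = X by rewrite /b_form (RintE _ mO).
by rewrite /A_h bv dv bu; ring.
Qed.
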